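(* Assume $\beta\gamma<0$ and that condition $C_{2a}$ or condition $C_3$ holds. Then for every pair of nonnegative $\mathcal F_0$-measurable initial values $(X_0,Y_0)$ with $\mathbb P((X_0,Y_0)=(0,0))=0$, there exists a strong O2BP with these initial values, taking values in $S\setminus\{(0,0)\}$ at all times, and it is pathwise unique.
   Context: On a complete filtered probability space with usual conditions, $(B,C)$ is an adapted planar Brownian motion started at $0$ with $\langle B\rangle_t=\langle C\rangle_t=t$, $\langle B,C\rangle_t=\rho t$, $\rho\in[-1,1]$. $S=[0,\infty)^2$. With $\alpha>0,\delta>0,\beta,\gamma\in\mathbb R$, an O2BP is an adapted continuous $S$-valued process $(X,Y)$ with $X_t=X_0+B_t+\alpha\int_0^t\frac{ds}{X_s}+\beta\int_0^t\frac{ds}{Y_s}$, $Y_t=Y_0+C_t+\gamma\int_0^t\frac{ds}{X_s}+\delta\int_0^t\frac{ds}{Y_s}$ for all $t\ge0$, nonnegative $\mathcal F_0$-measurable $X_0,Y_0$, $\int_0^t\mathbf 1_{\{X_s=0\}}ds=\int_0^t\mathbf 1_{\{Y_s=0\}}ds=0$ and $\int_0^t\mathbf 1_{\{X_s>0\}}\frac{ds}{X_s}<\infty$, $\int_0^t\mathbf 1_{\{Y_s>0\}}\frac{ds}{Y_s}<\infty$ for all $t$. Conditions: $C_{2a}$: $\alpha\geq\frac12$ and $\beta\geq0$. $C_3$: there exist $\lambda>0,\mu>0$ with $\lambda\alpha+\mu\gamma\geq0$, $\lambda\beta+\mu\delta\geq0$ and $\big(\sqrt{\lambda(\lambda\alpha+\mu\gamma)}+\sqrt{\mu(\lambda\beta+\mu\delta)}\big)^2\geq\frac12(\lambda^2+\mu^2+2\rho\lambda\mu)$.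 *)

(* Defs.v *)
From HB Require Import structures.
From mathcomp Require Import all_boot all_order all_algebra.
From mathcomp Require Import all_classical all_reals all_analysis.
Import Order.TTheory GRing.Theory Num.Theory.
Import numFieldNormedType.Exports.
Set Implicit Arguments. Unset Strict Implicit. Unset Printing Implicit Defensive.
Local Open Scope classical_set_scope.
Local Open Scope ring_scope.

Definition sub_meas {d} {T : measurableType d} {R : realType}
  (G : set (set T)) (f : T -> R) : Prop :=
  forall A : set R, measurable A -> G (f @^-1` A).

Definition complete_space {d} {T : measurableType d} {R : realType}
  (P : probability T R) : Prop :=
  forall N : set T, P.-negligible N -> measurable N.

Definition usual_filtration {d} {T : measurableType d} {R : realType}
  (P : probability T R) (F : R -> set (set T)) : Prop :=
  [/\ (forall t : R, 0 <= t -> sigma_algebra setT (F t)),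
      (forall t : R, 0 <= t -> F t `<=` measurable),
      (forall s t : R, 0 <= s -> s <= t -> F s `<=` F t),
      (forall t : R, 0 <= t -> forall A, (forall s, t < s -> F s A) -> F t A)
    & (forall N : set T, P.-negligible N -> F 0 N)].

(* (B,C) is an (F_t)-adapted planar Brownian motion started at 0 with
   <B>_t = <C>_t = t and <B,C>_t = rho t: continuous paths, B_0 = C_0 = 0,
   adapted, and for 0 <= s <= t the increment (B_t-B_s, C_t-C_s) is
   independent of F_s with centered Gaussian law of covariance
   (t-s) [[1,rho],[rho,1]] (expressed through its characteristic function
   against indicators of events of F_s). *)
Definition corr_BM {d} {T : measurableType d} {R : realType}
  (P : probability T R) (F : R -> set (set T)) (rho : R)
  (B C : R -> T -> R) : Prop :=
  [/\ (forall w, B 0 w = 0 /\ C 0 w = 0),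
      (forall w, {within `[0, +oo[%classic, continuous (fun t => B t w)} /\
                 {within `[0, +oo[%classic, continuous (fun t => C t w)}),
      (forall t : R, 0 <= t -> sub_meas (F t) (B t) /\ sub_meas (F t) (C t))
    & (forall s t : R, 0 <= s -> s <= t -> forall A : set T, F s A ->
        forall u v : R,
        (\int[P]_(w in A) (cos (u * (B t w - B s w) + v * (C t w - C s w)))%:E
          = P A * (expR (- ((t - s) * (u ^+ 2 + 2 * rho * u * v + v ^+ 2)) / 2))%:E)%E
        /\
        (\int[P]_(w in A) (sin (u * (B t w - B s w) + v * (C t w - C s w)))%:E
          = 0)%E)].

(* Lebesgue integral of s |-> 1/f(s) over [0,t]; with the convention 0^-1 = 0
   this is \int_0^t 1_{f(s)>0} ds / f(s). *)
Definition inv_int {R : realType} (f : R -> R) (t : R) : \bar R :=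
  let D := `[0, t]%classic in
  (\int[(@lebesgue_measure R)]_(s in D) ((f s)^-1)%:E)%E.

Definition O2BP {d} {T : measurableType d} {R : realType}
  (P : probability T R) (F : R -> set (set T)) (B C : R -> T -> R)
  (alpha beta gamma delta : R) (X Y : R -> T -> R) : Prop :=
  [/\ (forall t w, 0 <= t -> 0 <= X t w /\ 0 <= Y t w),
      (forall w, {within `[0, +oo[%classic, continuous (fun t => X t w)} /\
                 {within `[0, +oo[%classic, continuous (fun t => Y t w)}),
      (forall t : R, 0 <= t -> sub_meas (F t) (X t) /\ sub_meas (F t) (Y t))
    & {ae P, forall w, forall t : R, 0 <= t ->
        [/\ (@lebesgue_measure R) ((`[0, t]%classic) `&` [set s | X s w = 0]) = 0%E,
            (@lebesgue_measure R) ((`[0, t]%classic) `&` [set s | Y s w = 0]) = 0%E,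
            ((inv_int (X ^~ w) t < +oo)%E /\ (inv_int (Y ^~ w) t < +oo)%E),
            X t w = X 0 w + B t w + alpha * fine (inv_int (X ^~ w) t)
                    + beta * fine (inv_int (Y ^~ w) t)
          & Y t w = Y 0 w + C t w + gamma * fine (inv_int (X ^~ w) t)
                    + delta * fine (inv_int (Y ^~ w) t)]}].

Definition strong_filtration {d} {T : measurableType d} {R : realType}
  (P : probability T R) (X0 Y0 : T -> R) (B C : R -> T -> R) (t : R)
  : set (set T) :=
  smallest (sigma_algebra setT)
    ([set E | exists A : set R, measurable A /\
       (E = X0 @^-1` A \/ E = Y0 @^-1` A \/
        exists s, 0 <= s <= t /\ (E = B s @^-1` A \/ E = C s @^-1` A))]
     `|` [set N | P.-negligible N]).

Definition cond_C2a {R : realType} (alpha beta : R) : Prop :=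
  1 / 2 <= alpha /\ 0 <= beta.

Definition cond_C3 {R : realType} (rho alpha beta gamma delta : R) : Prop :=
  exists lambda mu : R, [/\ 0 < lambda, 0 < mu,
    0 <= lambda * alpha + mu * gamma,
    0 <= lambda * beta + mu * delta
  & (Num.sqrt (lambda * (lambda * alpha + mu * gamma))
     + Num.sqrt (mu * (lambda * beta + mu * delta))) ^+ 2
    >= (lambda ^+ 2 + mu ^+ 2 + 2 * rho * lambda * mu) / 2].

(* Main.v *)
(** Replace 1/x by phi N x = 1/max(x, 1/N) and run the Euler scheme along each Brownian path,
    with N = n_k = 2^(2^k) and mesh n_k^-8, on nested grids.

    Some positive combination Z = la X + mu Y has drift a/X + b/Y with a, b > 0 and
    Z (a/X + b/Y) >= <Z>'/2; the boundary cases of the hypotheses are reached by perturbing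
    (la, mu), which gains a square root and loses only linearly.  Hence ln (1 + Z^-2) has bounded
    drift, so with probability close to 1 the schemes keep Z >= eta on [0, T] for small eta.
    While Z >= eta at most one coordinate is small, and testing the scheme against
    x ln (1/x) bounds the expected time integral of phi X |ln X|.  As ln n_k = 2^k ln 2, the
    truncation and discretisation errors of consecutive levels have summable expectations.

    Two schemes driven by the same path are compared deterministically: in the equation for X the
    map x |-> x + al h phi x contracts, and al Y - ga X does not see 1/X, so a Gronwall argument
    works as long as Y stays away from 0, and symmetrically; as be and ga are not both negative,
    only finitely many exchanges of roles occur on [0, T].  So the levels converge, 1/X_k converges
    in L^1, and the limit solves the equation without ever meeting the corner.  The same two
    observations give pathwise uniqueness.

    Only the Gaussian moments of the increments are needed on the probabilistic side; they are
    read off the characteristic function at 0. *)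

Require Import Defs.
From HB Require Import structures.
From mathcomp Require Import all_boot all_order all_algebra.
From mathcomp Require Import all_classical all_reals all_analysis.
From mathcomp Require Import measurable_realfun ring lra zify.
Import Order.TTheory GRing.Theory Num.Theory.
Import numFieldNormedType.Exports.
Local Open Scope classical_set_scope.
Local Open Scope ring_scope.

(** * Comparison of two Euler schemes *)

(** The estimate that keeps a scheme off the corner holds for each level separately and says nothing
    about all levels at once. What helps is the direction of the comparison: if the finer of two
    consecutive schemes stays off the corner, so does the coarser one, up to a summable loss. So it
    suffices that almost every path has infinitely many good levels, which the probability bound
    gives by continuity of measure; goodness then spreads downwards to all large levels. The
    comparison constants depend on the modulus of continuity of the path, so they must not come
    under an expectation. Only [ErrW], which is free of them and whose singular part is switched off
    once the fine scheme comes near the corner, is averaged. A logarithmic test function gains only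
    a factor 1 / ln n_k, hence doubly exponential levels. With s = n_k^-4 and mesh s^2, the cubic
    Taylor remainder, of order n_k^2 s^3, stays below the mesh. All the rest is done path by path,
    so one and the same limit is adapted both to [F] and to the filtration generated by the data:
    the solution is strong. *)

Definition cmp_cE {R : realType} (al ga : R) : R := (1 + `|ga|) / al.
(** The terms collect the coefficients of h |v - v'| in one step: [be] acts on X,
    [al * de - ga * be] on the combination al Y - ga X, and 1 on the accumulated sum. *)
Definition cmp_c0 {R : realType} (al be ga de : R) : R :=
  `|be| + `|al * de - ga * be| + 1.
(** Three factors: the return from the Gronwall quantity Q to the distance, the Gronwall exponential
    over [0, T], and the coefficients of the initial distance and of the error. *)
Definition phase_const {R : realType} (al be ga de L T : R) : R :=
  (1 + cmp_cE al ga + al^-1)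
  * expR (cmp_c0 al be ga de * L * cmp_cE al ga * T)
  * ((1 + al + `|ga|) + (2 * al + cmp_c0 al be ga de)).

Section compare.
Variables (R : realType) (al be ga de h K L kap T : R) (phi : R -> R).
Hypotheses (al0 : 0 < al) (h0 : 0 < h) (kap0 : 0 < kap) (L0 : 0 <= L).
Hypothesis phi_dec : forall x y, x <= y -> phi y <= phi x.
Hypothesis phi_lip : forall x y, x <= y -> phi x - phi y <= K * (y - x).
Hypothesis phi_lipL : forall x y, kap / 2 <= x -> x <= y ->
  phi x - phi y <= L * (y - x).
Hypothesis noover : al * h * K <= 1.

Local Ltac ctx := have pal := al0; have ph := h0; have pk := kap0; have pL := L0; have pn := noover.

(** Since [phi] decreases and [al * h * K <= 1], the added term opposes x - x' without reversing its
    sign. The equality keeps the amount lost: summed over the steps, it controls the distance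
    between the singular drifts. *)
Lemma contract_step x x' :
  `|x - x' + al * h * (phi x - phi x')| = `|x - x'| - al * h * `|phi x - phi x'|.
Proof.
ctx.
have ah0 : 0 <= al * h by rewrite mulr_ge0 ?ltW.
wlog le : x x' / x <= x'.
  move=> H; case: (leP x x') => [/H//|/ltW/H].
  rewrite distrC (distrC (phi x)) => <-; rewrite -[LHS]normrN.
  by congr `| _ |; ring.
have l1 := phi_dec _ _ le; have l2 := phi_lip _ _ le.
have l3 : al * h * (phi x - phi x') <= x' - x.
  apply: (@le_trans _ _ (al * h * (K * (x' - x)))); first exact: ler_wpM2l.
  rewrite mulrA -[leRHS]mul1r; apply: ler_wpM2r => //; lra.
rewrite ler0_norm; last lra.
by rewrite ler0_norm ?subr_le0// ger0_norm ?subr_ge0//; ring.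
Qed.

Lemma phi_lip_norm x x' : kap / 2 <= x -> kap / 2 <= x' ->
  `|phi x - phi x'| <= L * `|x - x'|.
Proof.
ctx.
move=> hx hx'; wlog le : x x' hx hx' / x <= x'.
  move=> H; case: (leP x x') => [/H|/ltW/H]; first exact.
  by rewrite distrC (distrC x); apply.
rewrite ger0_norm ?subr_ge0 ?phi_dec// distrC ger0_norm ?subr_ge0//.
exact: phi_lipL.
Qed.

Variables (X Y X' Y' u v u' v' e : nat -> R) (I : nat).
Hypothesis stepX : forall i, (i < I)%N -> X i.+1 - X' i.+1 =
  X i - X' i + h * (al * (u i - u' i) + be * (v i - v' i)).
Hypothesis stepY : forall i, (i < I)%N -> Y i.+1 - Y' i.+1 =
  Y i - Y' i + h * (ga * (u i - u' i) + de * (v i - v' i)).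
Hypothesis eu : forall i, (i < I)%N -> `|u i - phi (X i)| + `|u' i - phi (X' i)| <= e i.
Hypothesis ev : forall i, (i < I)%N -> `|v i - phi (Y i)| + `|v' i - phi (Y' i)| <= e i.
Hypothesis IT : I%:R * h <= T.

Local Notation cmp_dist i := (`|X i - X' i| + `|Y i - Y' i|
  + \sum_(j < i) h * (`|u j - u' j| + `|v j - v' j|)).
Local Notation Er := (\sum_(j < I) h * e j).

Local Notation cE := (cmp_cE al ga).
Local Notation c0 := (cmp_c0 al be ga de).
Local Notation phase_const := (phase_const al be ga de L T).
Local Notation c := (c0 * L * cE).
Local Notation G i := (al * (Y i - Y' i) - ga * (X i - X' i)).

Lemma cE_ge0 : 0 <= cE. Proof. by rewrite divr_ge0 ?addr_ge0// ltW. Qed.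
Lemma c0_ge1 : 1 <= c0. Proof. by rewrite lerDr addr_ge0. Qed.

Lemma T_ge0 : 0 <= T. Proof. by apply: le_trans IT; rewrite mulr_ge0// ltW. Qed.

Lemma c_ge0 : 0 <= c.
Proof.
ctx.
apply: mulr_ge0 cE_ge0; apply: mulr_ge0 => //.
exact: le_trans ler01 c0_ge1.
Qed.

Lemma phase_const_ge1 : 1 <= phase_const.
Proof.
ctx.
have h1 := cE_ge0; have h2 := c0_ge1.
have h3 : 1 <= expR (c * T) by rewrite -expR0 ler_expR mulr_ge0 ?c_ge0 ?T_ge0.
have h4 : 0 <= al^-1 by rewrite invr_ge0 ltW.
have h5 := normr_ge0 ga.
rewrite /phase_const .
set A := 1 + cE + al^-1; set B := expR _; set D := _ + _ + _.
have hA : 1 <= A by rewrite /A; lra.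
have hD : 1 <= D by rewrite /D; lra.
have hAB : 1 <= A * B by rewrite -[1]mul1r ler_pM.
by rewrite -[1]mul1r ler_pM.
Qed.

Lemma e_ge0 i : (i < I)%N -> 0 <= e i.
Proof. by move=> /eu; apply: le_trans; rewrite addr_ge0. Qed.

(** Y - Y' is recovered from X - X' and from the combination G, whose evolution does not contain
    1/X. *)
Lemma E_le i : `|Y i - Y' i| <= cE * (`|X i - X' i| + `|G i|).
Proof.
ctx.
rewrite /cmp_cE mulrAC ler_pdivlMr//.
have -> : `|Y i - Y' i| * al = `|G i + ga * (X i - X' i)|.
  by rewrite subrK normrM (gtr0_norm al0) mulrC.
apply: le_trans (ler_normD _ _) _; rewrite normrM.
have := normr_ge0 (X i - X' i); have := normr_ge0 (G i); have := normr_ge0 ga.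
nra.
Qed.

Local Notation Q i0 i := (`|X i - X' i| + `|G i|
  + \sum_(i0 <= j < i) h * (al * `|u j - u' j| + `|v j - v' j|)).

(** The sum in Q grows by [al * h * |u - u'|], which, up to the error [e], is what [contract_step]
    removes from |X - X'|. Only terms in v - v' remain, and there [phi] is Lipschitz with constant L
    because both Y and Y' are at least kap / 2. *)
Lemma Q_step i0 i : (i0 <= i)%N -> (i < I)%N -> kap / 2 <= Y i -> kap / 2 <= Y' i ->
  Q i0 i.+1 <= (1 + c * h) * Q i0 i + (2 * al + c0) * (h * e i).
Proof.
ctx.
move=> i0i iI hY hY'; rewrite big_nat_recr//=.
set p := u i - u' i; set q := v i - v' i.
set S := \sum_(i0 <= j < i) _.
have S0 : 0 <= S.
  by apply: sumr_ge0 => j _; rewrite mulr_ge0 ?addr_ge0 ?mulr_ge0// ltW.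
have hq : `|q| <= e i + L * (cE * (`|X i - X' i| + `|G i|)).
  have -> : q = (v i - phi (Y i)) - (v' i - phi (Y' i)) + (phi (Y i) - phi (Y' i)).
    by rewrite /q; ring.
  apply: le_trans (ler_normD _ _) _; apply: lerD.
    by apply: le_trans (ler_normB _ _) _; exact: ev.
  apply: le_trans (phi_lip_norm _ _ hY hY') _.
  by apply: ler_wpM2l => //; exact: E_le.
(* The factor 2 before [al * h * e i]: once for [r], once for replacing [phi (X i) - phi (X' i)] by
   [p] in the contracted amount. *)
have hD : `|X i.+1 - X' i.+1| <= `|X i - X' i| - al * h * `|p| + 2 * (al * h) * e i
    + `|be| * h * `|q|.
  set r := p - (phi (X i) - phi (X' i)).
  have hr : `|r| <= e i.
    have -> : r = (u i - phi (X i)) - (u' i - phi (X' i)) by rewrite /r /p; ring.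
    by apply: le_trans (ler_normB _ _) _; exact: eu.
  have -> : X i.+1 - X' i.+1 = (X i - X' i + al * h * (phi (X i) - phi (X' i)))
     + (al * h * r + be * h * q) by rewrite stepX// /r -/p -/q; ring.
  apply: le_trans (ler_normD _ _) _; rewrite contract_step.
  have h1 : `|al * h * r + be * h * q| <= al * h * e i + `|be| * h * `|q|.
    apply: le_trans (ler_normD _ _) _; rewrite !normrM (gtr0_norm al0) (gtr0_norm h0).
    by rewrite lerD2r ler_wpM2l// mulr_ge0 ?ltW.
  have h2 : `|p| <= `|phi (X i) - phi (X' i)| + e i.
    have -> : p = (phi (X i) - phi (X' i)) + r by rewrite /r; ring.
    by apply: le_trans (ler_normD _ _) _; rewrite lerD2l.
  have ah0 : 0 < al * h by rewrite mulr_gt0.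
  have : al * h * `|p| <= al * h * (`|phi (X i) - phi (X' i)| + e i).
    by rewrite ler_wpM2l// ltW.
  lra.
have hG : `|G i.+1| <= `|G i| + `|al * de - ga * be| * h * `|q|.
  have -> : G i.+1 = G i + (al * de - ga * be) * h * q.
    by rewrite stepX// stepY// -/p -/q; ring.
  by apply: le_trans (ler_normD _ _) _; rewrite !normrM (gtr0_norm h0).
have hc : c0 * h * `|q| <= c0 * h * (e i + L * (cE * (`|X i - X' i| + `|G i|))).
  by rewrite ler_wpM2l// mulr_ge0 ?(ltW h0)//; have := c0_ge1; lra.
have hS : 0 <= c * h * S by exact: mulr_ge0 (mulr_ge0 c_ge0 (ltW h0)) S0.
have hc0 : c0 * h * `|q| = `|be| * h * `|q| + `|al * de - ga * be| * h * `|q| + h * `|q|.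
  by rewrite /cmp_c0; ring.
lra.
Qed.

(** The lower bound is assumed for Y' alone. As long as the estimate lasts, the smallness hypothesis
    keeps |Y - Y'| below kap / 2, so Y >= kap / 2 and the next step is covered. The added 1 in the
    factor pays for [Er] and for the sum accumulated before i0. *)
Lemma phase_bound i0 i1 : (i0 <= i1)%N -> (i1 <= I)%N ->
  (forall i, (i0 <= i < i1)%N -> kap <= Y' i) ->
  phase_const * (cmp_dist i0 + Er) <= kap / 2 ->
  forall i, (i0 <= i <= i1)%N -> cmp_dist i + Er <= (phase_const + 1) * (cmp_dist i0 + Er).
Proof.
ctx.
move=> i01 i1I hY' small.
have h1 := cE_ge0; have h2 := c0_ge1; have hal : 0 < al^-1 by rewrite invr_gt0.
set N := fun i => `|X i - X' i| + `|Y i - Y' i|.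
pose S0 i := \sum_(i0 <= j < i) h * (`|u j - u' j| + `|v j - v' j|).
have Er0 a b : (b <= I)%N -> 0 <= \sum_(a <= j < b) h * e j.
  move=> bI; rewrite big_nat_cond; apply: sumr_ge0 => j /andP[/andP[_ jb] _].
  by rewrite mulr_ge0 ?(ltW h0)// e_ge0// (leq_trans jb).
have ErE a b : (a <= b)%N -> (b <= I)%N -> \sum_(a <= j < b) h * e j <= Er.
  move=> ab bI; rewrite -(big_mkord xpredT (fun j => h * e j)).
  rewrite (@big_cat_nat _ _ _ a 0%N I)//= ?(leq_trans ab)//.
  rewrite (@big_cat_nat _ _ _ b a I)//=.
  have := Er0 0%N a (leq_trans ab bI); have := Er0 b I (leqnn _); lra.
have CQ i : N i + S0 i <= (1 + cE + al^-1) * Q i0 i.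
  rewrite /N.
  have : S0 i <= (1 + al^-1) * \sum_(i0 <= j < i) h * (al * `|u j - u' j| + `|v j - v' j|).
    rewrite /S0 mulr_sumr; apply: ler_sum => j _.
    have -> : (1 + al^-1) * (h * (al * `|u j - u' j| + `|v j - v' j|)) =
      h * ((al^-1 * al) * `|u j - u' j| + `|v j - v' j|) +
      h * (al * `|u j - u' j| + al^-1 * `|v j - v' j|) by ring.
    rewrite mulVf ?gt_eqF// mul1r lerDl mulr_ge0 ?(ltW h0)//.
    by rewrite addr_ge0 ?mulr_ge0// ltW.
  set S1 := \sum_(_ <= j < _) h * (al * _ + _).
  have : 0 <= S1.
    by apply: sumr_ge0 => j _; rewrite mulr_ge0 ?addr_ge0 ?mulr_ge0// ltW.
  have := E_le i; have := normr_ge0 (X i - X' i); have := normr_ge0 (G i).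
  nra.
have Qi0 : Q i0 i0 <= (1 + al + `|ga|) * N i0.
  rewrite big_geq// addr0.
  have : `|G i0| <= al * `|Y i0 - Y' i0| + `|ga| * `|X i0 - X' i0|.
    by apply: le_trans (ler_normB _ _) _; rewrite !normrM (gtr0_norm al0).
  rewrite /N; have := normr_ge0 (X i0 - X' i0); have := normr_ge0 (Y i0 - Y' i0).
  have := normr_ge0 ga; nra.
have Sp i : 0 <= \sum_(j < i) h * (`|u j - u' j| + `|v j - v' j|).
  by apply: sumr_ge0 => j _; rewrite mulr_ge0 ?addr_ge0// ltW.
have Nc i : (i0 <= i)%N -> cmp_dist i = N i + S0 i +
    \sum_(j < i0) h * (`|u j - u' j| + `|v j - v' j|).
  move=> ii; rewrite /N /S0.
  rewrite -!(big_mkord xpredT (fun j => h * (`|u j - u' j| + `|v j - v' j|))).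
  by rewrite (@big_cat_nat _ _ _ i0 0%N i)//=; ring.
have Nle : N i0 <= cmp_dist i0 by rewrite lerDl.
have N0 i : 0 <= N i by rewrite addr_ge0.
have Er1 : 0 <= Er by rewrite -(big_mkord xpredT (fun j => h * e j)) Er0.
(* Discrete Gronwall. The bound after d steps yields [kap / 2 <= Y] there, which is the hypothesis
   of [Q_step] for the next one. *)
have key d : (i0 + d <= i1)%N ->
  Q i0 (i0 + d)%N <= expR (c * (d%:R * h)) *
    ((1 + al + `|ga|) * N i0 + (2 * al + c0) * \sum_(i0 <= j < i0 + d) h * e j).
  elim: d => [_|d IH dd].
    by rewrite addn0 mul0r mulr0 expR0 mul1r [X in _ + _ * X]big_geq// mulr0 addr0.
  have dl : (i0 + d < i1)%N by rewrite addnS in dd.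
  have {}IH := IH (ltnW dl).
  have dI := leq_trans dl i1I.
  have QN : N (i0 + d)%N + S0 (i0 + d)%N <= phase_const * (cmp_dist i0 + Er).
    apply: (le_trans (CQ _)).
    rewrite /phase_const -!(mulrA (1 + cE + al^-1)) ler_wpM2l//; first lra.
    rewrite -mulrA.
    apply: (le_trans IH); apply: ler_pM.
    - exact: expR_ge0.
    - have g0 := normr_ge0 ga.
      by apply: addr_ge0; apply: mulr_ge0 => //; [lra|lra|exact: Er0 (ltnW dI)].
    - rewrite ler_expR ler_wpM2l ?c_ge0//.
      apply: le_trans IT; rewrite ler_wpM2r ?(ltW h0)// ler_nat.
      exact: leq_trans (leq_addl _ _) (ltnW dI).
    - have := ErE i0 (i0 + d)%N (leq_addr _ _) (ltnW dI).
      have := Er0 i0 (i0 + d)%N (ltnW dI); have := normr_ge0 ga.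
      have := N0 i0.
      set s := \sum_(_ <= _ < _) _; move=> k1 k2 k3 k4.
      have : (1 + al + `|ga|) * N i0 <= (1 + al + `|ga|) * cmp_dist i0.
        by apply: ler_wpM2l => //; lra.
      have : (2 * al + c0) * s <= (2 * al + c0) * Er.
        by apply: ler_wpM2l => //; lra.
      have : 0 <= (2 * al + c0) * cmp_dist i0 by rewrite mulr_ge0//; lra.
      have : 0 <= (1 + al + `|ga|) * Er by rewrite mulr_ge0//; lra.
      lra.
  have hE : `|Y (i0 + d)%N - Y' (i0 + d)%N| <= kap / 2.
    apply: le_trans small; apply: le_trans QN.
    have : 0 <= S0 (i0 + d)%N.
      by apply: sumr_ge0 => j _; rewrite mulr_ge0 ?addr_ge0// ltW.
    rewrite /N; have := normr_ge0 (X (i0 + d)%N - X' (i0 + d)%N); lra.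
  have hY1 : kap <= Y' (i0 + d)%N by apply: hY'; rewrite leq_addr.
  have hY2 : kap / 2 <= Y (i0 + d)%N by move: hE; rewrite ler_norml; lra.
  rewrite addnS; apply: (le_trans (Q_step _ _ (leq_addr _ _) dI hY2 _)); first lra.
  rewrite big_nat_recr ?leq_addr//=.
  set s := \sum_(i0 <= j < i0 + d) h * e j in IH *; set ee := h * e _.
  have ee0 : 0 <= ee by rewrite mulr_ge0 ?(ltW h0)// e_ge0.
  have -> : expR (c * (d.+1%:R * h)) = expR (c * h) * expR (c * (d%:R * h)).
    by rewrite -expRD -natr1; congr expR; ring.
  have x1 : 1 + c * h <= expR (c * h) by exact: expR_ge1Dx.
  have ch : 0 <= c * h by rewrite mulr_ge0 ?c_ge0 ?ltW.
  have x2 : 1 <= expR (c * h) * expR (c * (d%:R * h)).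
    rewrite -expRD -expR0 ler_expR addr_ge0// mulr_ge0 ?c_ge0// mulr_ge0// ltW//.
  have B0 : 0 <= 2 * al + c0 by lra.
  set Bc := 2 * al + c0 in IH B0 *; set Ac := (1 + al + `|ga|) * N i0 in IH *.
  set E1 := expR (c * h) in x1 x2 *; set E2 := expR (c * (d%:R * h)) in x2 IH *.
  have -> : E1 * E2 * (Ac + Bc * (s + ee)) = E1 * (E2 * (Ac + Bc * s)) + E1 * E2 * (Bc * ee) by ring.
  apply: lerD.
    apply: ler_pM => //; first lra.
    apply: addr_ge0; first exact: addr_ge0.
    by apply: sumr_ge0 => l _; rewrite mulr_ge0 ?addr_ge0 ?mulr_ge0// ltW.
  by apply: ler_peMl => //; exact: mulr_ge0.
move=> i /andP[ii0 ii1]; rewrite -(subnKC ii0).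
set d := (i - i0)%N; have dd : (i0 + d <= i1)%N by rewrite subnKC.
have QN : N (i0 + d)%N + S0 (i0 + d)%N <= phase_const * (N i0 + Er).
  apply: (le_trans (CQ _)).
  rewrite /phase_const -!(mulrA (1 + cE + al^-1)) ler_wpM2l//; first lra.
    rewrite -mulrA.
  apply: (le_trans (key _ dd)); apply: ler_pM.
  - exact: expR_ge0.
  - have g0 := normr_ge0 ga.
    by apply: addr_ge0; apply: mulr_ge0 => //; [lra|lra|exact: Er0 (leq_trans dd i1I)].
  - rewrite ler_expR ler_wpM2l ?c_ge0//.
    apply: le_trans IT; rewrite ler_wpM2r ?(ltW h0)// ler_nat.
    exact: leq_trans (leq_addl _ _) (leq_trans dd i1I).
  - have := ErE i0 (i0 + d)%N (leq_addr _ _) (leq_trans dd i1I).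
    have := Er0 i0 (i0 + d)%N (leq_trans dd i1I); have := normr_ge0 ga.
    have := N0 i0.
    set s := \sum_(_ <= _ < _) _; move=> k1 k2 k3 k4.
    have : (2 * al + c0) * s <= (2 * al + c0) * Er by apply: ler_wpM2l => //; lra.
    have : 0 <= (2 * al + c0) * N i0 by rewrite mulr_ge0//; lra.
    have : 0 <= (1 + al + `|ga|) * Er by rewrite mulr_ge0//; lra.
    lra.
rewrite Nc ?leq_addr// -/(N i0).
have := Sp i0; set s := \sum_(_ < _) _ => s0.
have := phase_const_ge1; have := N0 i0; nra.
Qed.

End compare.

(** Greedy alternation: X' leads while it stays above kap; when it falls below, Y' is at least 2 kap
    and leads in turn. A fall of X' from 2 kap to kap lasts at least r, so a full round costs a
    factor C^2 and at least the time r. Timing one coordinate is enough to bound the number of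
    rounds by T / r. *)
Lemma phases_bound (R : realType) (X' Y' M : nat -> R) (I : nat) (C kap r h T : R) :
  1 <= C -> 0 < r -> 0 <= h -> I%:R * h <= T -> (forall i, 0 <= M i) ->
  (forall i0 i1, (i0 <= i1)%N -> (i1 <= I)%N ->
     (forall i, (i0 <= i < i1)%N -> kap <= Y' i) -> C * M i0 <= kap / 2 ->
     forall i, (i0 <= i <= i1)%N -> M i <= C * M i0) ->
  (forall i0 i1, (i0 <= i1)%N -> (i1 <= I)%N ->
     (forall i, (i0 <= i < i1)%N -> kap <= X' i) -> C * M i0 <= kap / 2 ->
     forall i, (i0 <= i <= i1)%N -> M i <= C * M i0) ->
  (forall i j, (i <= j <= I)%N -> 2 * kap <= X' i -> X' j < kap -> r <= (j - i)%:R * h) ->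
  (forall i, (i <= I)%N -> 2 * kap <= X' i \/ 2 * kap <= Y' i) ->
  0 < kap ->
  forall J, T <= J%:R * r -> C ^+ (2 * J + 4) * M 0%N <= kap / 2 ->
  forall i, (i <= I)%N -> M i <= C ^+ (2 * J + 4) * M 0%N.
Proof.
move=> C1 r0 h0 IT M0 phA phB drop sep kap0.
have C0 : 0 <= C by apply: le_trans C1.
have Cle m n : (m <= n)%N -> C ^+ m <= C ^+ n by move=> mn; exact: ler_weXn2l.
have Cge1 m : 1 <= C ^+ m by exact: exprn_ege1.
have exitP (Z : nat -> R) i0 : (i0 <= I)%N ->
   (forall i, (i0 <= i < I)%N -> kap <= Z i) \/
   exists j, [/\ (i0 <= j)%N, (j < I)%N, Z j < kap & forall i, (i0 <= i < j)%N -> kap <= Z i].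
  move=> i0I.
  have [/existsP[j]|no] := boolP [exists j : 'I_I, (i0 <= j)%N && (Z j < kap)].
    move=> hj; right.
    have ex : exists j, (fun j => [&& (i0 <= j)%N, (j < I)%N & Z j < kap]) j.
      by exists (nat_of_ord j); case/andP: hj => -> ->; rewrite ltn_ord.
    case: (ex_minnP ex) => m /and3P[m1 m2 m3] mmin; exists m; split => // i /andP[i1 i2].
    rewrite leNgt; apply/negP => zi.
    have : (m <= i)%N by apply: mmin; rewrite i1 zi (ltn_trans i2 m2).
    by rewrite leqNgt i2.
  left => i /andP[i1 i2]; rewrite leNgt; apply/negP => zi.
  by move/existsP: no; apply; exists (Ordinal i2); rewrite /= i1.
have mainA J : forall i0, (i0 <= I)%N -> 2 * kap <= X' i0 ->
    (I - i0)%:R * h <= J%:R * r -> C ^+ (2 * J + 2) * M i0 <= kap / 2 ->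
    forall i, (i0 <= i <= I)%N -> M i <= C ^+ (2 * J + 2) * M i0.
  elim: J => [|J IH] i0 i0I x0 time small i iI.
    (* No time is left for a fall, which would last at least r > 0. *)
    have nodrop i' : (i0 <= i' < I)%N -> kap <= X' i'.
      move=> /andP[a b]; rewrite leNgt; apply/negP => zi.
      have dd : (i0 <= i' <= I)%N by rewrite a ltnW.
      have := drop _ _ dd x0 zi.
      have : (i' - i0)%:R * h <= (I - i0)%:R * h.
        by rewrite ler_wpM2r// ler_nat leq_sub2r// ltnW.
      lra.
    have s1 : C * M i0 <= kap / 2.
      by apply: le_trans small; rewrite ler_wpM2r// -[leLHS]expr1 Cle.
    apply: (le_trans (phB _ _ i0I (leqnn _) nodrop s1 _ iI)).
    by rewrite ler_wpM2r// -[leLHS]expr1 Cle.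
  have s1 : C * M i0 <= kap / 2.
    by apply: le_trans small; rewrite ler_wpM2r// -[leLHS]expr1 Cle.
  case: (exitP X' i0 i0I) => [nod|[j [j1 j2 j3 j4]]].
    apply: (le_trans (phB _ _ i0I (leqnn _) nod s1 _ iI)).
    by rewrite ler_wpM2r// -[leLHS]expr1 Cle// addn2.
  have B1 := phB _ _ j1 (ltnW j2) j4 s1.
  case/andP: iI => i0i iI.
  have [ij|ji] := leqP i j.
    apply: (le_trans (B1 _ _)); first by rewrite i0i.
    by rewrite ler_wpM2r// -[leLHS]expr1 Cle// addn2.
  have Mj : M j <= C * M i0 by apply: B1; rewrite j1 leqnn.
  have yj : 2 * kap <= Y' j by case: (sep j (ltnW j2)) => //; lra.
  have s2 : C * M j <= kap / 2.
    apply: le_trans small; apply: le_trans (ler_wpM2l C0 Mj) _.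
    by rewrite mulrA ler_wpM2r// -expr2 Cle// addn2.
  have MM : forall z, z <= C * M j -> z <= C ^+ 2 * M i0.
    move=> z /le_trans; apply; rewrite expr2 -mulrA; exact: ler_wpM2l.
  case: (exitP Y' j (ltnW j2)) => [nod|[m [m1 m2 m3 m4]]].
    have iI' : (j <= i <= I)%N by rewrite (ltnW ji).
    apply: (le_trans (MM _ (phA _ _ (ltnW j2) (leqnn _) nod s2 _ iI'))).
    by rewrite ler_wpM2r// Cle// addn2.
  have B2 := phA _ _ m1 (ltnW m2) m4 s2.
  have [im|mi] := leqP i m.
    have iI' : (j <= i <= m)%N by rewrite (ltnW ji).
    by apply: (le_trans (MM _ (B2 _ iI'))); rewrite ler_wpM2r// Cle// addn2.
  have Mm : M m <= C ^+ 2 * M i0 by apply: MM; apply: B2; rewrite m1 leqnn.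
  have xm : 2 * kap <= X' m by case: (sep m (ltnW m2)) => //; lra.
  have e1 : (2 * J.+1 + 2 = (2 * J + 2) + 2)%N by rewrite mulnS; ring.
  have bd : C ^+ (2 * J + 2) * M m <= C ^+ (2 * J.+1 + 2) * M i0.
    by rewrite e1 [in leRHS]exprD -mulrA ler_wpM2l// exprn_ge0.
  have tm : (I - m)%:R * h <= J%:R * r.
    have jd : (i0 <= j <= I)%N by rewrite j1 ltnW.
    have := drop _ _ jd x0 j3.
    have : ((I - m)%:R + (j - i0)%:R) * h <= (I - i0)%:R * h.
      rewrite -natrD ler_wpM2r// ler_nat.
      by move: (ltnW m2) m1 j1; clear; lia.
    move: time; rewrite -natr1; lra.
  apply: (le_trans _ bd); apply: IH => //; first exact: ltnW.
  - exact: le_trans bd small.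
  - by rewrite iI (ltnW mi).
move=> J TJ small i iI.
have IJ m : (I - m)%:R * h <= J%:R * r.
  by apply: le_trans TJ; apply: le_trans IT; rewrite ler_wpM2r// ler_nat leq_subr.
have le2 : C ^+ (2 * J + 2) * M 0%N <= C ^+ (2 * J + 4) * M 0%N.
  by rewrite ler_wpM2r// Cle// leq_add2l.
(* If only Y' is known to be large at the start, one phase led by Y' precedes the rounds and costs
   one more factor C. *)
case: (sep 0%N (leq0n _)) => [x0|y0].
  apply: (le_trans _ le2); apply: mainA => //.
  exact: le_trans le2 small.
have s1 : C * M 0%N <= kap / 2.
  by apply: le_trans small; rewrite ler_wpM2r// -[leLHS]expr1 Cle// addn4.
have le1 : C * M 0%N <= C ^+ (2 * J + 4) * M 0%N.
  by rewrite ler_wpM2r// -[leLHS]expr1 Cle// addn4.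
case: (exitP Y' 0%N (leq0n _)) => [nod|[m [m1 m2 m3 m4]]].
  by apply: (le_trans (phA _ _ (leq0n _) (leqnn _) nod s1 _ _)); rewrite ?iI.
have B2 := phA _ _ m1 (ltnW m2) m4 s1.
have [im|mi] := leqP i m; first by apply: (le_trans (B2 _ _)).
have Mm : M m <= C * M 0%N by apply: B2; rewrite leqnn.
have xm : 2 * kap <= X' m by case: (sep m (ltnW m2)) => //; lra.
have bd : C ^+ (2 * J + 2) * M m <= C ^+ (2 * J + 4) * M 0%N.
  apply: (@le_trans _ _ (C ^+ (2 * J + 2) * (C * M 0%N))).
    by apply: ler_wpM2l => //; rewrite exprn_ge0.
  by rewrite mulrA -exprSr ler_wpM2r// Cle// -addnS leq_add2l.
apply: (le_trans _ bd); apply: (mainA J m) => //; first exact: ltnW.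
- exact: le_trans bd small.
- by rewrite iI (ltnW mi).
Qed.

Definition phi {R : realType} (N x : R) : R := (Num.max x N^-1)^-1.

(** * The truncated reciprocal *)

Section phi.
Variable R : realType.
Implicit Types N x y : R.

Lemma phi_gt0 N x : 0 < N -> 0 < phi N x.
Proof. by move=> N0; rewrite invr_gt0 lt_max invr_gt0 N0 orbT. Qed.

Lemma phi_le N x : 0 < N -> phi N x <= N.
Proof.
move=> N0; rewrite /phi -[leRHS]invrK lef_pV2 ?posrE ?invr_gt0//.
  by rewrite le_max lexx orbT.
by rewrite lt_max invr_gt0 N0 orbT.
Qed.

Lemma phi_dec N x y : 0 < N -> x <= y -> phi N y <= phi N x.
Proof.
move=> N0 xy; rewrite lef_pV2 ?posrE ?lt_max ?invr_gt0 ?N0 ?orbT//.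
by rewrite ge_max !le_max xy lexx !orbT.
Qed.

Lemma phi_eq N x : 0 < N -> N^-1 <= x -> phi N x = x^-1.
Proof. by move=> N0 Nx; rewrite /phi max_l. Qed.

Lemma phi_eqN N x : x <= N^-1 -> phi N x = N.
Proof. by move=> Nx; rewrite /phi max_r// invrK. Qed.

Lemma phi_le_inv N x : 0 < N -> 0 < x -> phi N x <= x^-1.
Proof.
move=> N0 x0; rewrite lef_pV2 ?posrE//; first by rewrite le_max lexx.
by rewrite lt_max x0.
Qed.

(** Here c is any lower bound of the clamped argument. The choice 1 / N gives the global constant
    N^2; the choice kap / 2 gives a constant independent of N, which makes the comparison uniform in
    the level. *)
Lemma phi_lip_gen N (c : R) x y : 0 < N -> 0 < c -> c <= Num.max x N^-1 -> x <= y ->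
  phi N x - phi N y <= c ^- 2 * (y - x).
Proof.
move=> N0 c0 cx xy; rewrite /phi.
set a := Num.max x _ in cx *; set d := Num.max y _.
have ad : a <= d by rewrite ge_max !le_max xy lexx !orbT.
have a0 : 0 < a by exact: lt_le_trans cx.
have d0 : 0 < d by exact: lt_le_trans ad.
have dxy : d - a <= y - x.
  rewrite /a /d; case: (leP x N^-1) => h1; case: (leP y N^-1) => h2; lra.
have -> : a^-1 - d^-1 = (a * d)^-1 * (d - a) by field; rewrite !gt_eqF.
apply: ler_pM => //.
- by rewrite invr_ge0 mulr_ge0// ltW.
- by rewrite subr_ge0.
- rewrite lef_pV2 ?posrE ?exprn_gt0 ?mulr_gt0// expr2 ler_pM// ?(ltW c0)//.
  exact: le_trans ad.
Qed.

Lemma phi_lip N x y : 0 < N -> x <= y -> phi N x - phi N y <= N ^+ 2 * (y - x).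
Proof.
move=> N0 xy; have := @phi_lip_gen N N^-1 x y N0.
by rewrite -exprVn invrK invr_gt0 => /(_ N0); apply => //; rewrite le_max lexx orbT.
Qed.

Lemma phi_norm_lip N x y : 0 < N -> `|phi N x - phi N y| <= N ^+ 2 * `|x - y|.
Proof.
move=> N0; wlog le : x y / x <= y.
  move=> H; case: (leP x y) => [/H//|/ltW/H].
  by rewrite distrC (distrC y).
rewrite ger0_norm ?subr_ge0 ?phi_dec// distrC ger0_norm ?subr_ge0//.
exact: phi_lip.
Qed.

(** The two truncations agree from 1 / N on. Below, [phi N x] equals N and lies under [phi N' x], so
    the difference is at most [phi N' x] itself. *)
Lemma phi_level N N' x : 0 < N -> N <= N' ->
  `|phi N' x - phi N x| <= phi N' x * (x < N^-1)%R%:R.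
Proof.
move=> N0 NN; have N'0 : 0 < N' by exact: lt_le_trans NN.
have [xN|xN] := ltP x N^-1; last first.
  rewrite !phi_eq// ?subrr ?normr0 ?mulr0//.
  by apply: le_trans xN; rewrite lef_pV2 ?posrE.
rewrite mulr1 (phi_eqN N _ (ltW xN)).
have h : N <= phi N' x.
  rewrite /phi -[leLHS]invrK lef_pV2 ?posrE ?invr_gt0 ?lt_max ?invr_gt0 ?N'0 ?orbT//.
  by rewrite ge_max ltW//= lef_pV2 ?posrE.
by rewrite ger0_norm ?subr_ge0// lerBlDr lerDl ltW.
Qed.

End phi.

(** Used for a drift frozen on coarse cells and summed over fine indices: complete cells give the
    coarse sum, the remainder is the part of the last cell. *)
Lemma sum_div (R : realType) (q : nat) (g : nat -> R) (i : nat) : (0 < q)%N ->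
  \sum_(j < i) g (j %/ q)%N = q%:R * \sum_(J < i %/ q) g J + (i %% q)%:R * g (i %/ q)%N.
Proof.
move=> q0; elim: i => [|i IH].
  by rewrite div0n mod0n !big_ord0 mulr0 mul0r addr0.
rewrite big_ord_recr/= IH.
have [lt|ge] := ltnP (i %% q).+1 q.
  have e : (i.+1 = (i %/ q) * q + (i %% q).+1)%N by rewrite {1}(divn_eq i q) addnS.
  have e1 : (i.+1 %/ q = i %/ q)%N by rewrite e divnMDl// (divn_small lt) addn0.
  have e2 : (i.+1 %% q = (i %% q).+1)%N by rewrite e modnMDl (modn_small lt).
  by rewrite e1 e2 -natr1; ring.
have e0 : ((i %% q).+1 = q)%N by apply/eqP; rewrite eqn_leq ge ltn_pmod.
have e : (i.+1 = (i %/ q).+1 * q)%N by rewrite {1}(divn_eq i q) -addnS e0 mulSn addnC.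
have e1 : (i.+1 %/ q = (i %/ q).+1)%N by rewrite {1}e mulnK.
have e2 : (i.+1 %% q = 0)%N by rewrite {1}e modnMl.
rewrite e1 e2 big_ord_recr/= mul0r addr0.
have : (i %% q)%:R + 1 = q%:R :> R by rewrite natr1 e0.
by move=> <-; ring.
Qed.

(** * The Euler scheme and its comparison on two nested grids *)

Section euler.
Variable R : realType.

Fixpoint euler (al be ga de N h : R) (b c : R -> R) (x0 y0 : R) (i : nat) : R * R :=
  if i is j.+1 then
    let p := euler al be ga de N h b c x0 y0 j in
    (p.1 + (b (j.+1%:R * h) - b (j%:R * h)) + h * (al * phi N p.1 + be * phi N p.2),
     p.2 + (c (j.+1%:R * h) - c (j%:R * h)) + h * (ga * phi N p.1 + de * phi N p.2))
  else (x0, y0).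

Lemma euler_swap al be ga de N h b c x0 y0 i :
  euler de ga be al N h c b y0 x0 i =
  ((euler al be ga de N h b c x0 y0 i).2, (euler al be ga de N h b c x0 y0 i).1).
Proof.
elim: i => [//|i IH] /=; rewrite IH/=; congr pair; congr (_ + _ + _ * _); exact: addrC.
Qed.

Lemma euler_sum1 al be ga de N h b c x0 y0 i :
  let E := euler al be ga de N h b c x0 y0 in
  (E i).1 = x0 + (b (i%:R * h) - b 0)
    + h * \sum_(j < i) (al * phi N (E j).1 + be * phi N (E j).2).
Proof.
move=> E; elim: i => [|i IH]; first by rewrite big_ord0 mul0r /= /E/=; ring.
by rewrite big_ord_recr/= -/E IH; ring.
Qed.

Lemma euler_sum2 al be ga de N h b c x0 y0 i :
  let E := euler al be ga de N h b c x0 y0 in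
  (E i).2 = y0 + (c (i%:R * h) - c 0)
    + h * \sum_(j < i) (ga * phi N (E j).1 + de * phi N (E j).2).
Proof.
move=> E; elim: i => [|i IH]; first by rewrite big_ord0 mul0r /= /E/=; ring.
by rewrite big_ord_recr/= -/E IH; ring.
Qed.

(* [errB] pays for freezing the coarse scheme (level [N], mesh [q h]) between its grid points,
   [errS] for replacing [phi N'] by [phi N] along the fine scheme. *)
Definition errB (Ka N h : R) (q : nat) (b c : R -> R) (i : nat) : R :=
  N ^+ 2 * (`|b (i%:R * h) - b ((i %/ q)%:R * (q%:R * h))|
    + `|c (i%:R * h) - c ((i %/ q)%:R * (q%:R * h))| + 2 * (q%:R * h * (Ka * N))).

Definition errS (N N' : R) (p : R * R) : R :=
  phi N' p.1 * (p.1 < N^-1)%R%:R + phi N' p.2 * (p.2 < N^-1)%R%:R.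

(** The coarse scheme read at fine times, with its drift frozen at the last coarse point, has moved
    away from its last coarse value only by the noise since then and by at most one coarse mesh of
    drift. *)
Lemma euler_frozen (f1 f2 N h x0 b0 : R) (q : nat) (b : R -> R) (w : nat -> R) (M : R) i :
  (0 < q)%N -> 0 < h -> (forall j, `|w j| <= M) ->
  `| (x0 + (b (i%:R * h) - b0) + h * \sum_(j < i) w (j %/ q)%N)
    - (x0 + (b ((i %/ q)%:R * (q%:R * h)) - b0) + q%:R * h * \sum_(J < i %/ q) w J) |
  <= `|b (i%:R * h) - b ((i %/ q)%:R * (q%:R * h))| + q%:R * h * M.
Proof.
move=> q0 h0 wM; rewrite sum_div//.
set b1 := b _; set b2 := b _; set S := \sum_(_ < _) _.
have -> : x0 + (b1 - b0) + h * (q%:R * S + (i %% q)%:R * w (i %/ q)%N)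
   - (x0 + (b2 - b0) + q%:R * h * S) = (b1 - b2) + h * (i %% q)%:R * w (i %/ q)%N by ring.
apply: le_trans (ler_normD _ _) _; rewrite lerD2l normrM.
rewrite ger0_norm ?mulr_ge0 ?(ltW h0)//; apply: ler_pM => //.
  by rewrite mulr_ge0// ltW.
by rewrite mulrC ler_wpM2r ?(ltW h0)// ler_nat ltnW// ltn_pmod.
Qed.

(** [(kap / 2) ^- 2] is a Lipschitz constant of [phi N] on [kap / 2, oo), uniform in N. The bracket
    dominates the factor of a phase led by either coordinate; the exponent is that of [phases_bound]
    for J rounds. *)
Definition cmp_const (al be ga de kap T : R) (J : nat) : R :=
  (phase_const al be ga de ((kap / 2) ^- 2) T
   + phase_const de ga be al ((kap / 2) ^- 2) T + 1) ^+ (2 * J + 4).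

(** The coarse scheme is extended to the fine grid with frozen drift; both paths then receive the
    same increments of b and c, which cancel in the differences. The value of kap is such that both
    coordinates below 2 kap would contradict [eta <= la X + mu Y], so one of them is always
    large. *)
Lemma euler_compare (al be ga de N N' h kap T r la mu eta : R) (q I J : nat)
    (b c : R -> R) (x0 y0 : R) :
  0 < al -> 0 < de -> 0 <= be -> 0 < N -> N <= N' -> 0 < h -> (0 < q)%N ->
  al * h * N ^+ 2 <= 1 -> de * h * N ^+ 2 <= 1 ->
  0 < la -> 0 < mu -> 0 < eta -> kap = eta / (2 * (la + mu)) ->
  I%:R * h <= T -> 0 < r -> T <= J%:R * r ->
  (forall s t, 0 <= s -> s <= t -> t <= T -> t - s < r -> `|b t - b s| < kap) ->
  let E := euler al be ga de N (q%:R * h) b c x0 y0 in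
  let E' := euler al be ga de N' h b c x0 y0 in
  let Err := \sum_(i < I) h *
    (errB (`|al| + `|be| + `|ga| + `|de|) N h q b c i + errS N N' (E' i)) in
  let C := cmp_const al be ga de kap T J in
  (forall i, (i <= I)%N -> eta <= la * (E' i).1 + mu * (E' i).2) ->
  C * Err <= kap / 2 ->
  (forall i, (i <= I)%N ->
   `|(E (i %/ q)%N).1 - (E' i).1| <= C * Err + (`|b (i%:R * h) - b ((i %/ q)%:R * (q%:R * h))| + q%:R * h * ((`|al| + `|be| + `|ga| + `|de|) * N)) /\
   `|(E (i %/ q)%N).2 - (E' i).2| <= C * Err + (`|c (i%:R * h) - c ((i %/ q)%:R * (q%:R * h))| + q%:R * h * ((`|al| + `|be| + `|ga| + `|de|) * N))) /\
   \sum_(i < I) h * (`|phi N (E (i %/ q)%N).1 - phi N' (E' i).1|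
                + `|phi N (E (i %/ q)%N).2 - phi N' (E' i).2|) <= C * Err.
Proof.
move=> al0 de0 be0 N0 NN h0 q0 ova ovd la0 mu0 eta0 kapE IT r0 TJ modb E E' Err C good small.
have kap0 : 0 < kap by rewrite kapE divr_gt0// mulr_gt0// addr_gt0.
pose Ka := `|al| + `|be| + `|ga| + `|de|.
have Ka0 : 0 <= Ka by rewrite !addr_ge0.
pose u i := phi N (E (i %/ q)%N).1; pose v i := phi N (E (i %/ q)%N).2.
pose u' i := phi N' (E' i).1; pose v' i := phi N' (E' i).2.
pose w1 J := al * phi N (E J).1 + be * phi N (E J).2.
pose w2 J := ga * phi N (E J).1 + de * phi N (E J).2.
pose X i := x0 + (b (i%:R * h) - b 0) + h * \sum_(j < i) w1 (j %/ q)%N.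
pose Y i := y0 + (c (i%:R * h) - c 0) + h * \sum_(j < i) w2 (j %/ q)%N.
pose X' i := (E' i).1; pose Y' i := (E' i).2.
pose e i := errB Ka N h q b c i + errS N N' (E' i).
have N'0 : 0 < N' by exact: lt_le_trans NN.
have wM (a1 a2 z1 z2 : R) : `|a1| + `|a2| <= Ka -> `|a1 * phi N z1 + a2 * phi N z2| <= Ka * N.
  move=> aK; apply: (@le_trans _ _ ((`|a1| + `|a2|) * N)); last first.
    by rewrite ler_wpM2r// ltW.
  apply: le_trans (ler_normD _ _) _; rewrite !normrM mulrDl.
  by rewrite !(ger0_norm (ltW (phi_gt0 _ _ _ N0))) lerD// ler_wpM2l// phi_le.
have Ka1 : `|al| + `|be| <= Ka.
  by rewrite /Ka -!addrA lerD2l lerDl addr_ge0.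
have Ka2 : `|ga| + `|de| <= Ka.
  by rewrite /Ka -!addrA addrA lerDr addr_ge0.
have frX i : `|X i - (E (i %/ q)%N).1| <=
    `|b (i%:R * h) - b ((i %/ q)%:R * (q%:R * h))| + q%:R * h * (Ka * N).
  rewrite /X /E euler_sum1; apply: (@euler_frozen 0 0 0) => // j; exact: wM.
have frY i : `|Y i - (E (i %/ q)%N).2| <=
    `|c (i%:R * h) - c ((i %/ q)%:R * (q%:R * h))| + q%:R * h * (Ka * N).
  rewrite /Y /E euler_sum2; apply: (@euler_frozen 0 0 0) => // j; exact: wM.
have qh0 : 0 <= q%:R * h * (Ka * N) by rewrite !mulr_ge0// ltW.
have N20 : 0 <= N ^+ 2 by rewrite exprn_ge0// ltW.
have ph0 z : 0 <= phi N' z by rewrite ltW// phi_gt0.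
have eu i : (i < I)%N -> `|u i - phi N (X i)| + `|u' i - phi N (X' i)| <= e i.
  move=> _; rewrite /e; apply: lerD.
    apply: le_trans (phi_norm_lip _ _ _ _ N0) _; rewrite /errB ler_wpM2l// distrC.
    apply: le_trans (frX i) _; have := normr_ge0 (c (i%:R * h) - c ((i %/ q)%:R * (q%:R * h))).
    lra.
  apply: le_trans (phi_level _ _ _ _ N0 NN) _; rewrite /errS lerDl.
  by rewrite mulr_ge0.
have ev i : (i < I)%N -> `|v i - phi N (Y i)| + `|v' i - phi N (Y' i)| <= e i.
  move=> _; rewrite /e; apply: lerD.
    apply: le_trans (phi_norm_lip _ _ _ _ N0) _; rewrite /errB ler_wpM2l// distrC.
    apply: le_trans (frY i) _; have := normr_ge0 (b (i%:R * h) - b ((i %/ q)%:R * (q%:R * h))).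
    lra.
  apply: le_trans (phi_level _ _ _ _ N0 NN) _; rewrite /errS lerDr.
  by rewrite mulr_ge0.
have sX i : (i < I)%N -> X i.+1 - X' i.+1 = X i - X' i
    + h * (al * (u i - u' i) + be * (v i - v' i)).
  by move=> _; rewrite /X big_ord_recr/= /X' /= -/E' /w1 -/(u i) -/(v i) -/(u' i) -/(v' i); ring.
have sY i : (i < I)%N -> Y i.+1 - Y' i.+1 = Y i - Y' i
    + h * (ga * (u i - u' i) + de * (v i - v' i)).
  by move=> _; rewrite /Y big_ord_recr/= /Y' /= -/E' /w2 -/(u i) -/(v i) -/(u' i) -/(v' i); ring.
have sY2 i : (i < I)%N -> Y i.+1 - Y' i.+1 = Y i - Y' i
    + h * (de * (v i - v' i) + ga * (u i - u' i)).
  by move=> /sY ->; ring.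
have sX2 i : (i < I)%N -> X i.+1 - X' i.+1 = X i - X' i
    + h * (be * (v i - v' i) + al * (u i - u' i)).
  by move=> /sX ->; ring.
pose L := (kap / 2) ^- 2.
have L0 : 0 <= L by rewrite invr_ge0 exprn_ge0// divr_ge0// ltW.
have lip2 z z' : kap / 2 <= z -> z <= z' -> phi N z - phi N z' <= L * (z' - z).
  move=> hz; apply: phi_lip_gen => //; first by rewrite divr_gt0.
  by rewrite le_max hz.
pose M i := `|X i - X' i| + `|Y i - Y' i|
  + \sum_(j < i) h * (`|u j - u' j| + `|v j - v' j|) + Err.
have ee0 i : (i < I)%N -> 0 <= e i.
  by move=> /eu; apply: le_trans; rewrite addr_ge0.
have Err0 : 0 <= Err.
  by apply: sumr_ge0 => i _; rewrite mulr_ge0 ?(ltW h0)//; exact: ee0.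
have M0 i : 0 <= M i.
  rewrite /M !addr_ge0//; apply: sumr_ge0 => j _.
  by rewrite mulr_ge0 ?(ltW h0)// addr_ge0.
pose C1 := phase_const al be ga de L T; pose C2 := phase_const de ga be al L T.
have C11 : 1 <= C1 by apply: (@phase_const_ge1 R al be ga de h (N ^+ 2) L kap T al0 h0 kap0 L0 ova I IT).
have C21 : 1 <= C2 by apply: (@phase_const_ge1 R de ga be al h (N ^+ 2) L kap T de0 h0 kap0 L0 ovd I IT).
have C1le i : C1 * M i <= (C1 + C2 + 1) * M i by rewrite ler_wpM2r//; lra.
have C2le i : C2 * M i <= (C1 + C2 + 1) * M i by rewrite ler_wpM2r//; lra.
have C1le' i : (C1 + 1) * M i <= (C1 + C2 + 1) * M i by rewrite ler_wpM2r//; lra.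
have C2le' i : (C2 + 1) * M i <= (C1 + C2 + 1) * M i by rewrite ler_wpM2r//; lra.
have M00 : M 0%N = Err.
  by rewrite /M /X /Y /X' /Y' /= !big_ord0 !mul0r mulr0 !(subrr, addr0, add0r) !normr0 !add0r.
have key i : (i <= I)%N -> M i <= C * Err.
  rewrite /C /cmp_const -/L -/C1 -/C2 -M00.
  apply: (@phases_bound R X' Y' M I (C1 + C2 + 1) kap r h T) => //.
  - lra.
  - exact: ltW.
  - move=> i0 i1 i01 i1I hY sm i' hi'.
    apply: le_trans (C1le' _).
    apply: (@phase_bound R al be ga de h (N ^+ 2) L kap T (phi N) al0 h0 kap0 L0
      _ _ lip2 ova X Y X' Y' u v u' v' e I sX sY eu ev IT i0 i1) => //.
    + by move=> z z'; exact: phi_dec.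
    + by move=> z z'; exact: phi_lip.
    + exact: le_trans (C1le _) sm.
  - move=> i0 i1 i01 i1I hX sm i' hi'.
    apply: le_trans (C2le' _).
    have MM k : M k = `|Y k - Y' k| + `|X k - X' k|
       + \sum_(j < k) h * (`|v j - v' j| + `|u j - u' j|) + Err.
      rewrite /M [`|X k - _| + _]addrC; congr (_ + _ + _).
      by apply: eq_bigr => j _; rewrite addrC.
    rewrite !MM.
    apply: (@phase_bound R de ga be al h (N ^+ 2) L kap T (phi N) de0 h0 kap0 L0
      _ _ lip2 ovd Y X Y' X' v u v' u' e I sY2 sX2 ev eu IT i0 i1) => //.
    + by move=> z z'; exact: phi_dec.
    + by move=> z z'; exact: phi_lip.
    + by rewrite -MM; exact: le_trans (C2le _) sm.
  - move=> i' j' /andP[ij jI] xi xj; rewrite leNgt; apply/negP => short.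
    (* As [al] and [be] are nonnegative, so is the drift of X'. Hence X' falls by no more than [b]
       does, and [b] needs the time r to move by kap. *)
    have mono : X' i' + (b (j'%:R * h) - b (i'%:R * h)) <= X' j'.
      rewrite -(subnKC ij); elim: (j' - i')%N => [|d IH]; first by rewrite addn0 subrr addr0.
      rewrite addnS /X' /= -/E' -/(X' (i' + d)%N).
      have : 0 <= h * (al * phi N' (X' (i' + d)%N) + be * phi N' (E' (i' + d)%N).2).
        by rewrite mulr_ge0 ?(ltW h0)// addr_ge0// mulr_ge0// ltW.
      move: IH; set t1 := b _; set t2 := b _; set t3 := b _; lra.
    have jT : j'%:R * h <= T by apply: le_trans IT; rewrite ler_wpM2r ?(ltW h0)// ler_nat.
    have ij' : i'%:R * h <= j'%:R * h by rewrite ler_wpM2r ?(ltW h0)// ler_nat.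
    have ds : j'%:R * h - i'%:R * h < r by rewrite -mulrBl -natrB.
    have i0h : 0 <= i'%:R * h by rewrite mulr_ge0// ltW.
    have := modb _ _ i0h ij' jT ds; rewrite ltr_norml; lra.
  - move=> i' iI; have [|x2] := leP (2 * kap) (X' i'); first by left.
    right; rewrite leNgt; apply/negP => y2.
    have := good _ iI; rewrite -/(X' i') -/(Y' i').
    have e1 : eta = la * (2 * kap) + mu * (2 * kap).
      by rewrite kapE; field; rewrite gt_eqF// addr_gt0.
    have : la * X' i' < la * (2 * kap) by rewrite ltr_pM2l.
    have : mu * Y' i' < mu * (2 * kap) by rewrite ltr_pM2l.
    lra.
  - by rewrite M00.
have Sj i : 0 <= \sum_(j < i) h * (`|u j - u' j| + `|v j - v' j|).
  by apply: sumr_ge0 => j _; rewrite mulr_ge0 ?(ltW h0)// addr_ge0.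
split; last first.
  apply: le_trans (key I (leqnn _)); rewrite /M -addrA addrC -addrA lerDl.
  by rewrite addr_ge0 ?addr_ge0.
move=> i iI; have := key _ iI; rewrite /M; have := Sj i.
have := frX i; have := frY i.
set bb := `|b _ - _|; set cc := `|c _ - _|; set qq := q%:R * h * (Ka * N).
move=> f1 f2 s0 kk.
have n1 := normr_ge0 (X i - X' i); have n2 := normr_ge0 (Y i - Y' i).
split.
- have -> : (E (i %/ q)%N).1 - (E' i).1 = (X i - X' i) - (X i - (E (i %/ q)%N).1).
    by rewrite /X'; ring.
  apply: le_trans (ler_normB _ _) _; apply: lerD f2; lra.
- have -> : (E (i %/ q)%N).2 - (E' i).2 = (Y i - Y' i) - (Y i - (E (i %/ q)%N).2).
    by rewrite /Y'; ring.
  apply: le_trans (ler_normB _ _) _; apply: lerD f1; lra.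
Qed.

End euler.

Arguments euler {R}.
Arguments errB {R}.
Arguments errS {R}.
Arguments cmp_const {R}.

(** * Levels and their summable differences *)

(** This is n_k^8. Passing to the next level squares it, so the grids are nested, with [msh k] fine
    steps in each coarse one. *)
Definition msh (k : nat) : nat := (2 ^ (2 ^ (k + 3)))%N.
Definition nlev {R : realType} (k : nat) : R := (2 ^ (2 ^ k))%N%:R.
Definition hlev {R : realType} (k : nat) : R := (msh k)%:R^-1.

Section levels.
Variable R : realType.
Local Notation nlev := (@nlev R).
Local Notation hlev := (@hlev R).

Lemma msh_gt0 k : (0 < msh k)%N. Proof. by rewrite expn_gt0. Qed.

Lemma mshS k : (msh k.+1 = msh k * msh k)%N.
Proof. by rewrite /msh addSn expnS mul2n -addnn expnD. Qed.

Lemma nlev_gt0 k : 0 < nlev k. Proof. by rewrite ltr0n expn_gt0. Qed.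

Lemma nlev_ge k : 2 ^+ k <= nlev k.
Proof. by rewrite -natrX ler_nat leq_exp2l; [apply: ltnW; exact: ltn_expl|]. Qed.

Lemma nlev_ge_nat k : k%:R <= nlev k.
Proof. by apply: le_trans (nlev_ge k); rewrite -natrX ler_nat ltnW; [|exact: ltn_expl]. Qed.

Lemma nlev_ge1 k : 1 <= nlev k.
Proof. by apply: le_trans (nlev_ge k); rewrite exprn_ege1 ?ler1n. Qed.

Lemma nlevS k : nlev k.+1 = nlev k ^+ 2.
Proof. by rewrite /nlev -natrX -expnM expnS mulnC. Qed.

Lemma nlev_le k : nlev k <= nlev k.+1.
Proof. by rewrite nlevS ler_eXnr// nlev_ge1. Qed.

Lemma hlev_gt0 k : 0 < hlev k. Proof. by rewrite invr_gt0 ltr0n msh_gt0. Qed.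

Lemma hlevE k : hlev k = nlev k ^- 8.
Proof.
rewrite /hlev /nlev /msh -natrX -expnM; congr (_%:R^-1); congr (2 ^ _)%N.
by rewrite expnD.
Qed.

Lemma hlevS k : (msh k)%:R * hlev k.+1 = hlev k.
Proof.
by rewrite /hlev mshS natrM invfM mulVKf// pnatr_eq0 -lt0n msh_gt0.
Qed.

Lemma hlev_msh k : (msh k)%:R * hlev k = 1.
Proof. by rewrite mulfV// pnatr_eq0 -lt0n msh_gt0. Qed.

Lemma hlev_leS k : hlev k.+1 <= hlev k.
Proof.
rewrite -(hlevS k); apply: ler_peMl; first exact: ltW (hlev_gt0 _).
by rewrite ler1n msh_gt0.
Qed.

Lemma nlev_big (M : R) : exists k0, forall k, (k0 <= k)%N -> M <= nlev k.
Proof.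
exists (Num.trunc `|M|).+1 => k hk; apply: le_trans (nlev_ge_nat k).
apply: le_trans (ler_norm _) _; apply: le_trans (ltW (truncnS_gt _)) _.
by rewrite ler_nat.
Qed.

(** The mesh n_k^-8 absorbs up to seven powers of n_k and still leaves the summable quantity 1 /
    n_k. *)
Lemma hlev_pow k m : (m <= 7)%N -> hlev k * nlev k ^+ m <= (nlev k)^-1.
Proof.
move=> m7; have n1 := nlev_ge1 k; have n0 := nlev_gt0 k.
rewrite hlevE mulrC ler_pdivrMr ?exprn_gt0//.
have -> : nlev k ^+ 8 = nlev k * nlev k ^+ 7 by rewrite -exprS.
by rewrite mulKf ?gt_eqF// ler_weXn2l.
Qed.

Lemma nlev_inv_geo k : (nlev k)^-1 <= 2^-1 ^+ k.
Proof. by rewrite exprVn lef_pV2 ?posrE ?exprn_gt0 ?nlev_gt0 ?nlev_ge. Qed.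

Lemma sum_geo_le m n : \sum_(m <= k < n) 2^-1 ^+ k <= 2 * 2^-1 ^+ m :> R.
Proof.
have pos j : 0 <= 2 * 2^-1 ^+ j :> R.
  by apply: mulr_ge0; [lra|apply: exprn_ge0; lra].
have [mn|nm] := leqP m n; last by rewrite big_geq; [exact: pos|exact: ltnW].
suff -> : \sum_(m <= k < n) 2^-1 ^+ k = 2 * 2^-1 ^+ m - 2 * 2^-1 ^+ n :> R.
  by have := pos n; lra.
rewrite -(subnKC mn); elim: (n - m)%N => [|d IH].
  by rewrite addn0 big_geq// subrr.
rewrite addnS big_nat_recr ?leq_addr//= IH.
rewrite [X in _ = _ - _ * X]exprS; set z := 2^-1 ^+ (m + d); lra.
Qed.

End levels.

Section levels_compare.
Variable R : realType.

Definition lev (al be ga de : R) (b c : R -> R) (x0 y0 : R) (k : nat) : nat -> R * R :=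
  euler al be ga de (nlev k) (hlev k) b c x0 y0.

(** A boolean, so that it can serve as an indicator inside expectations. It records the whole past
    up to i; hence it is adapted and decreases in i, like the indicator of not being stopped yet. *)
Definition goodl (la mu eta : R) (E : nat -> R * R) (i : nat) : bool :=
  all (fun j => eta <= la * (E j).1 + mu * (E j).2) (iota 0 i.+1).

Lemma goodlP la mu eta E i :
  reflect (forall j, (j <= i)%N -> eta <= la * (E j).1 + mu * (E j).2) (goodl la mu eta E i).
Proof.
apply: (iffP allP) => [H j ji|H j]; first by apply: H; rewrite mem_iota/= add0n ltnS.
by rewrite mem_iota/= add0n ltnS => /H.
Qed.

Definition coefK (al be ga de : R) : R := `|al| + `|be| + `|ga| + `|de|.

(** The error of [euler_compare] between levels k and k + 1, with its singular part switched off
    once the fine scheme has come below eta. On good paths nothing is changed, and the expectation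
    becomes accessible. *)
Definition ErrW (al be ga de la mu eta : R) (b c : R -> R) (x0 y0 : R) (T k : nat) : R :=
  let E' := lev al be ga de b c x0 y0 k.+1 in
  \sum_(i < T * msh k.+1) hlev k.+1 *
    (errB (coefK al be ga de) (nlev k) (hlev k.+1) (msh k) b c i
     + (goodl la mu eta E' i)%:R * errS (nlev k) (nlev k.+1) (E' i)).

Definition dphi (E E' : nat -> R * R) (k i : nat) : R :=
  `|phi (nlev k) (E (i %/ msh k)%N).1 - phi (nlev k.+1) (E' i).1|
  + `|phi (nlev k) (E (i %/ msh k)%N).2 - phi (nlev k.+1) (E' i).2|.

Definition modulus (T : R) (b : R -> R) := forall e : R, 0 < e -> exists2 r : R, 0 < r &
  forall s t, 0 <= s -> s <= t -> t <= T -> t - s < r -> `|b t - b s| < e.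

Lemma ErrW_ge0 al be ga de la mu eta b c x0 y0 T k :
  0 <= ErrW al be ga de la mu eta b c x0 y0 T k.
Proof.
apply: sumr_ge0 => i _; apply: mulr_ge0; first exact: ltW (hlev_gt0 _ _).
have n0 j := @nlev_gt0 R j; have h0 j := @hlev_gt0 R j.
apply: addr_ge0.
  apply: mulr_ge0; first by apply: exprn_ge0; exact: ltW.
  apply: addr_ge0; first exact: addr_ge0.
  apply: mulr_ge0 => //; apply: mulr_ge0; first by rewrite mulr_ge0// ltW.
  by apply: mulr_ge0; [rewrite /coefK !addr_ge0|exact: ltW].
apply: mulr_ge0 => //.
by rewrite /errS addr_ge0// mulr_ge0// ltW// phi_gt0.
Qed.

(** C is fixed before k: it depends on the path only through the time that [b] (if [be] is
    nonnegative) or [c] (if [ga] is) needs to move by kap, and not on the level. *)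
Lemma level_compare (al be ga de la mu eta : R) (b c : R -> R) (x0 y0 : R) (T : nat) :
  0 < al -> 0 < de -> 0 <= be \/ 0 <= ga -> 0 < la -> 0 < mu -> 0 < eta ->
  modulus T%:R b -> modulus T%:R c ->
  let E := lev al be ga de b c x0 y0 in
  let Er k := ErrW al be ga de la mu eta b c x0 y0 T k in
  exists C : R, [/\ 0 <= C & exists k1 : nat, forall k, (k1 <= k)%N ->
    goodl la mu eta (E k.+1) (T * msh k.+1) ->
    C * Er k <= eta / (2 * (la + mu)) / 2 ->
    (forall j, (j <= T * msh k)%N ->
      `|(E k j).1 - (E k.+1 (j * msh k)%N).1| <= C * Er k + hlev k * (coefK al be ga de * nlev k) /\
      `|(E k j).2 - (E k.+1 (j * msh k)%N).2| <= C * Er k + hlev k * (coefK al be ga de * nlev k)) /\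
    \sum_(i < T * msh k.+1) hlev k.+1 * dphi (E k) (E k.+1) k i <= C * Er k].
Proof.
move=> al0 de0 bega la0 mu0 eta0 mb mc E Er.
pose kap := eta / (2 * (la + mu)).
have kap0 : 0 < kap by rewrite divr_gt0// mulr_gt0// addr_gt0.
have [k1 hk1] := nlev_big R (al + de).
(* The no-overshoot condition of the comparison: the mesh against the Lipschitz constant n_k^2
   leaves at most 1 / n_k, which beats the fixed coefficients from k1 on. *)
have nover a k : 0 < a -> a <= al + de -> (k1 <= k)%N -> a * hlev k.+1 * nlev k ^+ 2 <= 1.
  move=> a0 ad kk; have n0 := @nlev_gt0 R k.
  apply: (@le_trans _ _ (nlev k * (nlev k)^-1)); last by rewrite mulfV ?gt_eqF.
  rewrite -mulrA; apply: ler_pM; first exact: ltW.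
  - by apply: ltW; apply: mulr_gt0; [exact: hlev_gt0|exact: exprn_gt0].
  - exact: le_trans ad (hk1 _ kk).
  - apply: le_trans (@hlev_pow R k 2 isT); apply: ler_wpM2r; last exact: hlev_leS.
    by apply: exprn_ge0; exact: ltW.
have IT k : (T * msh k.+1)%N%:R * hlev k.+1 <= T%:R :> R.
  by rewrite natrM -mulrA hlev_msh mulr1.
have bigJ (r : R) : 0 < r -> exists J : nat, T%:R <= J%:R * r.
  move=> r0; exists (Num.trunc (T%:R / r)).+1.
  by rewrite -ler_pdivrMr// ltW// truncnS_gt.
have ErE k : goodl la mu eta (E k.+1) (T * msh k.+1) -> Er k = \sum_(i < T * msh k.+1) hlev k.+1 *
    (errB (coefK al be ga de) (nlev k) (hlev k.+1) (msh k) b c i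
     + errS (nlev k) (nlev k.+1) (E k.+1 i)).
  move=> /goodlP g; apply: eq_bigr => i _; congr (_ * (_ + _)).
  suff -> : goodl la mu eta (lev al be ga de b c x0 y0 k.+1) i by rewrite mul1r.
  by apply/goodlP => j ji; apply: g; apply: leq_trans ji (ltnW (ltn_ord i)).
case: bega => [be0|ga0].
- have [r r0 hr] := mb _ kap0; have [J TJ] := bigJ r r0.
  pose C := cmp_const al be ga de kap T%:R J.
  have C0 : 0 <= C.
    have c1 := @phase_const_ge1 R al be ga de 1 0 ((kap/2)^-2) kap T%:R al0 ltr01 kap0.
    have c2 := @phase_const_ge1 R de ga be al 1 0 ((kap/2)^-2) kap T%:R de0 ltr01 kap0.
    rewrite /C /cmp_const exprn_ge0//.
    have L0 : 0 <= (kap / 2) ^- 2 by rewrite invr_ge0 exprn_ge0// divr_ge0// ltW.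
    have := c1 L0; rewrite mulr0 => /(_ ler01 T); rewrite mulr1 => /(_ (lexx _)).
    have := c2 L0; rewrite mulr0 => /(_ ler01 T); rewrite mulr1 => /(_ (lexx _)).
    lra.
  exists C; split=> //; exists k1 => k kk g; rewrite -/kap => small.
  have := @euler_compare R al be ga de (nlev k) (nlev k.+1) (hlev k.+1) kap T%:R r la mu eta
    (msh k) (T * msh k.+1)%N J b c x0 y0 al0 de0 be0 (nlev_gt0 _ _) (nlev_le _ _)
    (hlev_gt0 _ _) (msh_gt0 _) (nover _ _ al0 _ kk) (nover _ _ de0 _ kk) la0 mu0 eta0 erefl (IT k)
    r0 TJ hr.
  rewrite lerDl lerDr (ltW al0) (ltW de0) => /(_ isT isT) /=.
  rewrite hlevS -/(E k) -/(E k.+1) -/C -(ErE k g) => /(_ (elimT (goodlP _ _ _ _ _) g) small).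
  case=> H1 H2; split => // j jT.
  (* At multiples of [msh k] the fine time is a coarse grid time, so the noise increments in the
     bound vanish. *)
  have jT' : (j * msh k <= T * msh k.+1)%N by rewrite mshS mulnA leq_mul2r jT orbT.
  have := H1 _ jT'; rewrite (mulnK _ (msh_gt0 k)) natrM -mulrA hlevS !subrr !normr0 !add0r.
  by [].
- have [r r0 hr] := mc _ kap0; have [J TJ] := bigJ r r0.
  pose C := cmp_const de ga be al kap T%:R J.
  have C0 : 0 <= C.
    have c1 := @phase_const_ge1 R al be ga de 1 0 ((kap/2)^-2) kap T%:R al0 ltr01 kap0.
    have c2 := @phase_const_ge1 R de ga be al 1 0 ((kap/2)^-2) kap T%:R de0 ltr01 kap0.
    rewrite /C /cmp_const exprn_ge0//.
    have L0 : 0 <= (kap / 2) ^- 2 by rewrite invr_ge0 exprn_ge0// divr_ge0// ltW.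
    have := c1 L0; rewrite mulr0 => /(_ ler01 T); rewrite mulr1 => /(_ (lexx _)).
    have := c2 L0; rewrite mulr0 => /(_ ler01 T); rewrite mulr1 => /(_ (lexx _)).
    lra.
  have Esw j i : euler de ga be al (nlev j) (hlev j) c b y0 x0 i = ((E j i).2, (E j i).1).
    by rewrite (euler_swap _ al be ga de).
  exists C; split=> //; exists k1 => k kk g; rewrite -/kap => small.
  have kapE : kap = eta / (2 * (mu + la)) by rewrite /kap (addrC mu).
  have := @euler_compare R de ga be al (nlev k) (nlev k.+1) (hlev k.+1) kap T%:R r mu la eta
    (msh k) (T * msh k.+1)%N J c b y0 x0 de0 al0 ga0 (nlev_gt0 _ _) (nlev_le _ _)
    (hlev_gt0 _ _) (msh_gt0 _) (nover _ _ de0 _ kk) (nover _ _ al0 _ kk) mu0 la0 eta0 kapE (IT k)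
    r0 TJ hr.
  rewrite lerDl lerDr (ltW al0) (ltW de0) => /(_ isT isT) /=.
  rewrite hlevS -/C.
  have -> : `|de| + `|ga| + `|be| + `|al| = coefK al be ga de by rewrite /coefK; ring.
  have -> : \sum_(i < T * msh k.+1) hlev k.+1 *
      (errB (coefK al be ga de) (nlev k) (hlev k.+1) (msh k) c b i +
       errS (nlev k) (nlev k.+1) (euler de ga be al (nlev k.+1) (hlev k.+1) c b y0 x0 i)) = Er k.
    rewrite (ErE _ g); apply: eq_bigr => i _; rewrite Esw /errB /errS/=; congr (_ * (_ + _)).
      by congr (_ * (_ + _)); rewrite addrC.
    by rewrite addrC.
  move=> /(_ _ small) [].
    by move=> i iT; rewrite Esw/= addrC; move/goodlP: g; exact.
  move=> H1 H2; split => [j jT|].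
    have jT' : (j * msh k <= T * msh k.+1)%N by rewrite mshS mulnA leq_mul2r jT orbT.
    have [] := H1 _ jT'; rewrite (mulnK _ (msh_gt0 k)) natrM -mulrA hlevS !subrr !normr0 !add0r.
    by rewrite !Esw.
  apply: le_trans H2; rewrite le_eqVlt; apply/orP; left; apply/eqP.
  by apply: eq_bigr => i _; rewrite !Esw/= /dphi addrC.
Qed.

(** A level that is good for some threshold makes the previous one good for a threshold lower by at
    most [t k]. These losses add up to at most eta / 2 beyond k0. So from any of the infinitely many
    levels good for eta one descends to every level from k0 on, always staying good for eta / 2. *)
Lemma levels_summable (al be ga de la mu eta : R) (b c : R -> R) (x0 y0 : R) (T : nat) :
  0 < al -> 0 < de -> 0 <= be \/ 0 <= ga -> 0 < la -> 0 < mu -> 0 < eta ->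
  modulus T%:R b -> modulus T%:R c ->
  let E := lev al be ga de b c x0 y0 in
  let Er k := ErrW al be ga de la mu (eta / 2) b c x0 y0 T k in
  (forall k0, exists2 k, (k0 <= k)%N & goodl la mu eta (E k) (T * msh k)) ->
  (forall e : R, 0 < e -> exists k0, forall n, \sum_(k0 <= k < n) Er k <= e) ->
  exists C : R, [/\ 0 <= C & exists k1 : nat, forall k, (k1 <= k)%N ->
    goodl la mu (eta / 2) (E k) (T * msh k) /\
    \sum_(i < T * msh k.+1) hlev k.+1 * dphi (E k) (E k.+1) k i <= C * Er k].
Proof.
move=> al0 de0 bega la0 mu0 eta0 mb mc E Er Hinf Hsum.
have eta20 : 0 < eta / 2 by rewrite divr_gt0.
have [C [C0 [k1 Hk1]]] := @level_compare al be ga de la mu (eta / 2) b c x0 y0 T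
  al0 de0 bega la0 mu0 eta20 mb mc.
rewrite -/E in Hk1; set kap2 := eta / 2 / _ / 2 in Hk1.
have kap0 : 0 < kap2 by rewrite !divr_gt0// mulr_gt0// addr_gt0.
have lm0 : 0 < la + mu by rewrite addr_gt0.
pose Ka := coefK al be ga de.
have Ka0 : 0 <= Ka by rewrite /Ka /coefK !addr_ge0.
(* Bound on the decrease of la X + mu Y on the coarse grid between level k + 1 and level k. *)
pose t k := (la + mu) * (C * Er k + hlev k * (Ka * nlev k)).
have Er0 k : 0 <= Er k by exact: ErrW_ge0.
have t0 k : 0 <= t k.
  apply: mulr_ge0; first exact: ltW.
  apply: addr_ge0; first exact: mulr_ge0.
  apply: mulr_ge0; first exact: ltW (hlev_gt0 _ _).
  by apply: mulr_ge0 => //; exact: ltW (nlev_gt0 _ _).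
pose M := (la + mu) * (C + 2 * Ka) + C + 1.
have M0 : 0 < M.
  rewrite /M ltr_pwDr// addr_ge0// mulr_ge0 ?(ltW lm0)// addr_ge0// mulr_ge0//.
(* The entry eta / 4 keeps the total loss below eta / 2; the entry [kap2] fulfils the smallness
   hypothesis of [level_compare] at every level. *)
pose ep := Num.min (eta / 4) kap2 / M.
have ep0 : 0 < ep by rewrite divr_gt0// lt_min kap0 divr_gt0.
have [k2 Hk2] := Hsum _ ep0.
have [k3 Hk3] : exists k3 : nat, 2 / ep <= k3%:R.
  by exists (Num.trunc (2 / ep)).+1; rewrite ltW// truncnS_gt.
pose k0 := maxn k1 (maxn k2 k3).
have Er_le k : (k0 <= k)%N -> forall n, \sum_(k <= j < n) Er j <= ep.
  move=> kk n; have [kn|nk] := leqP k n; last by rewrite big_geq ?ltW// ltnW.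
  apply: le_trans (Hk2 n).
  have k2k : (k2 <= k)%N by apply: leq_trans kk; exact: leq_trans (leq_maxl _ _) (leq_maxr _ _).
  rewrite (@big_cat_nat _ _ _ k k2 n)//= lerDr; exact: sumr_ge0.
have small k : (k0 <= k)%N -> C * Er k <= kap2.
  move=> kk; have := Er_le _ kk k.+1; rewrite big_nat1 => h.
  apply: (@le_trans _ _ (C * ep)); first exact: ler_wpM2l.
  apply: (@le_trans _ _ (M * ep)).
    rewrite ler_wpM2r ?(ltW ep0)// /M.
    have : 0 <= (la + mu) * (C + 2 * Ka) by rewrite mulr_ge0 ?(ltW lm0)// addr_ge0// mulr_ge0.
    lra.
  by rewrite /ep mulrCA mulfV ?gt_eqF// mulr1 ge_min lexx orbT.
have tsum k : (k0 <= k)%N -> forall n, \sum_(k <= j < n) t j <= eta / 2.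
  move=> kk n.
  have h1 : \sum_(k <= j < n) t j <= (la + mu) * (C * ep + Ka * ep).
    rewrite /t -mulr_sumr ler_wpM2l ?(ltW lm0)// big_split/= lerD//.
      by rewrite -mulr_sumr ler_wpM2l// Er_le.
    under eq_bigr do rewrite mulrCA.
    rewrite -mulr_sumr ler_wpM2l//.
    apply: (@le_trans _ _ (\sum_(k <= j < n) 2^-1 ^+ j)).
      apply: ler_sum => j _; apply: le_trans (nlev_inv_geo R j).
      by have := @hlev_pow R j 1 isT; rewrite expr1.
    apply: le_trans (sum_geo_le _ _ _) _.
    rewrite exprVn ler_pdivrMr ?exprn_gt0// mulrC -ler_pdivrMr//.
    apply: (le_trans Hk3); rewrite -natrX ler_nat ltnW//.
    apply: leq_ltn_trans (ltn_expl k (isT : (1 < 2)%N)).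
    by apply: leq_trans kk; exact: leq_trans (leq_maxr _ _) (leq_maxr _ _).
  apply: (le_trans h1).
  have : M * ep <= eta / 4.
    by rewrite /ep mulrCA mulfV ?gt_eqF// mulr1 ge_min lexx.
  have h2 : 0 <= ep * ((la + mu) * Ka + C + 1).
    by rewrite mulr_ge0 ?(ltW ep0)// !addr_ge0// mulr_ge0// ltW.
  rewrite /M; nra.
have goodle k e1 e2 : e1 <= e2 -> goodl la mu e2 (E k) (T * msh k) ->
    goodl la mu e1 (E k) (T * msh k).
  by move=> e12 /goodlP g; apply/goodlP => j /g; exact: le_trans.
have k1k k : (k0 <= k)%N -> (k1 <= k)%N by apply: leq_trans; exact: leq_maxl.
have down k' : goodl la mu eta (E k') (T * msh k') -> forall d k, (k + d)%N = k' -> (k0 <= k)%N ->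
    goodl la mu (eta - \sum_(k <= j < k') t j) (E k) (T * msh k).
  move=> gk'; elim => [|d IH] k; first by rewrite addn0 => ->; rewrite big_geq// subr0.
  move=> kd kk; have kd' : (k.+1 + d)%N = k' by rewrite -kd addnS.
  have {}IH := IH _ kd' (leqW kk).
  have lt : (k < k')%N by rewrite -kd' leq_addr.
  have s2 := tsum _ (leqW kk) k'.
  have g2 : goodl la mu (eta / 2) (E k.+1) (T * msh k.+1).
    by apply: goodle IH; move: s2; clear; lra.
  have [H _] := Hk1 _ (k1k _ kk) g2 (small _ kk).
  apply/goodlP => j jT; have [h1 h2] := H _ jT.
  have jT' : (j * msh k <= T * msh k.+1)%N by rewrite mshS mulnA leq_mul2r jT orbT.
  move/goodlP: IH => /(_ _ jT'); rewrite (big_ltn lt).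
  rewrite -/Ka in h1 h2; set q := C * Er k + _ in h1 h2 *.
  have tk : t k = (la + mu) * q by [].
  set S := \sum_(_ <= _ < _) _; move: h1 h2; move: (t k) tk => tk0 tk.
  set a1 := (E k j).1; set a2 := (E k j).2; set a1' := (E k.+1 _).1; set a2' := (E k.+1 _).2.
  rewrite !ler_norml => /andP[h1 _] /andP[h2 _] h3.
  have : la * (a1' - q) <= la * a1 by rewrite ler_wpM2l ?(ltW la0)//; move: h1; clear; lra.
  have : mu * (a2' - q) <= mu * a2 by rewrite ler_wpM2l ?(ltW mu0)//; move: h2; clear; lra.
  move: h3 tk; clear; lra.
have allgood k : (k0 <= k)%N -> goodl la mu (eta / 2) (E k) (T * msh k).
  move=> kk; have [k' kk' gk'] := Hinf k.
  have := down _ gk' (k' - k)%N k (subnKC kk') kk; apply: goodle.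
  by have := tsum _ kk k'; clear; lra.
exists C; split => //; exists k0 => k kk; split; first exact: allgood.
by have [] := Hk1 _ (k1k _ kk) (allgood _ (leqW kk)) (small _ kk).
Qed.

End levels_compare.

Arguments lev {R}.
Arguments goodl {R}.
Arguments coefK {R}.
Arguments ErrW {R}.
Arguments dphi {R}.
Arguments modulus {R}.

(** * Limits of approximate paths *)

Section step_functions.
Variable R : realType.
Local Notation mu := (@lebesgue_measure R).

Lemma measurable_step (a : nat -> R) (m : nat) (D : set R) : (0 < m)%N -> measurable D ->
  measurable_fun D (fun s => a (Num.truncn (s * m%:R))).
Proof.
move=> m0 mD; apply: (@measurable_funS _ _ _ _ setT) => // _ Y mY; rewrite setTI.
have -> : (fun s : R => a (Num.truncn (s * m%:R))) @^-1` Y =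
    \bigcup_(n in [set n | Y (a n)]) [set s : R | Num.truncn (s * m%:R) = n].
  apply/seteqP; split => [s Ys|s [n /= Yn e]]; last by rewrite /preimage/= e.
  by exists (Num.truncn (s * m%:R)).
apply: bigcup_measurable => n _.
have mle j : measurable [set s : R | (Num.truncn (s * m%:R) <= j)%N].
  suff -> : [set s : R | (Num.truncn (s * m%:R) <= j)%N] = `]-oo, (j.+1%:R / m%:R)[%classic.
    exact: measurable_itv.
  apply/seteqP; split => s /=; rewrite truncn_le_nat in_itv/= ltr_pdivlMr ?ltr0n//.
case: n => [|n].
  suff -> : [set s : R | Num.truncn (s * m%:R) = 0%N] =
    [set s : R | (Num.truncn (s * m%:R) <= 0)%N] by exact: mle.
  by apply/seteqP; split => s /=; [move=> ->|rewrite leqn0 => /eqP].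
suff -> : [set s : R | Num.truncn (s * m%:R) = n.+1] =
    [set s : R | (Num.truncn (s * m%:R) <= n.+1)%N] `\`
    [set s : R | (Num.truncn (s * m%:R) <= n)%N] by exact: measurableD.
apply/seteqP; split => s /=; first by move=> ->; rewrite leqnn ltnn; split.
by case=> h1 /negP; rewrite -ltnNge => h2; apply/eqP; rewrite eqn_leq h1.
Qed.

Lemma step_integral (a : nat -> R) (m I : nat) : (0 < m)%N -> (forall i, 0 <= a i) ->
  (\int[mu]_(s in `[0%R, (I%:R / m%:R)%R[) (a (Num.truncn (s * m%:R)))%:E
   = (\sum_(i < I) m%:R^-1 * a i)%:E)%E.
Proof.
move=> m0 a0; have m0' : 0 < m%:R :> R by rewrite ltr0n.
elim: I => [|I IH].
  by rewrite mul0r set_itvco0 integral_set0 big_ord0.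
have le1 : I%:R / m%:R <= I.+1%:R / m%:R :> R.
  by rewrite ler_wpM2r ?invr_ge0 ?ler0n// ler_nat.
rewrite (@itv_bndbnd_setU _ _ _ (BLeft (I%:R / m%:R))) ?bnd_simp ?divr_ge0//.
rewrite ge0_integral_setU//=.
- rewrite IH big_ord_recr/= EFinD; congr (_ + _)%E.
  rewrite (eq_integral (cst (a I)%:E)).
    rewrite integral_cst//= lebesgue_measure_itv/= lte_fin.
    have -> : (I%:R / m%:R < I.+1%:R / m%:R :> R) = true.
      by rewrite ltr_pM2r ?invr_gt0// ltr_nat ltnSn.
    rewrite -EFinB -EFinM; congr (_%:E); rewrite -natr1; field.
    by rewrite gt_eqF.
  move=> s; rewrite inE/= in_itv/= ler_pdivrMr// ltr_pdivlMr// => hs.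
  by rewrite (truncn_def hs).
- apply/measurable_EFinP; apply: measurable_step => //.
  exact: measurableU.
- by move=> s _; rewrite lee_fin.
- apply/disj_setPS => s /= []; rewrite !in_itv/= => /andP[_ h1] /andP[h2 _].
  by move: h1; rewrite ltNge h2.
Qed.

(** The series of absolute differences is integrable, hence finite almost everywhere. This gives the
    convergence, and together with |f_0| it is the dominating function G. *)
Lemma L1_summable_cvg (D : set R) (f_ : nat -> R -> R) (M : R) :
  measurable D -> (forall k, measurable_fun D (f_ k)) ->
  mu.-integrable D (EFin \o f_ 0%N) ->
  (forall n, (\sum_(0 <= k < n) \int[mu]_(x in D) (`|f_ k.+1 x - f_ k x|)%:E <= M%:E)%E) ->
  exists G : R -> \bar R, mu.-integrable D G /\
   {ae mu, forall x, D x -> cvgn (f_ ^~ x) /\ (forall n, (`|(f_ n x)%:E| <= G x)%E)}.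
Proof.
move=> mD mf if0 HM.
pose u k x := (`|f_ k.+1 x - f_ k x|)%:E.
pose S x := (\sum_(k <oo) u k x)%E.
have mu_ k : measurable_fun D (u k).
  apply/measurable_EFinP; apply: measurableT_comp => //; exact: measurable_funB.
have u0 k x : (0 <= u k x)%E by rewrite lee_fin.
have mS : measurable_fun D S by apply: ge0_emeasurable_sum => // k x _ _; exact: u0.
have S0 x : (0 <= S x)%E by apply: nneseries_ge0.
have iS : mu.-integrable D S.
  apply/integrableP; split => //.
  have -> : (\int[mu]_(x in D) `|S x| = \int[mu]_(x in D) S x)%E.
    by apply: eq_integral => x _; rewrite gee0_abs.
  rewrite integral_nneseries//.
  apply: (@le_lt_trans _ _ M%:E); last exact: ltry.
  apply: lime_le; first by apply: is_cvg_nneseries => *; exact: integral_ge0.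
  by apply: nearW => n; exact: HM.
exists (fun x => `|(f_ 0%N x)%:E| + S x)%E; split.
  by apply: integrableD => //; exact: (integrable_abse if0).
apply: (filterS _ (@integrable_ae _ _ _ mu D mD S iS)) => x fin Dx.
have {}fin := fin Dx.
have Sx : S x = (fine (S x))%:E by rewrite fineK.
have part n : \sum_(0 <= k < n) `|f_ k.+1 x - f_ k x| <= fine (S x).
  rewrite -lee_fin -Sx -sumEFin; apply: nneseries_lim_ge => k _ _; exact: u0.
have bnd n : `|f_ n x| <= `|f_ 0%N x| + fine (S x).
  have -> : f_ n x = f_ 0%N x + \sum_(0 <= k < n) (f_ k.+1 x - f_ k x).
    by rewrite telescope_sumr// addrC subrK.
  apply: le_trans (ler_normD _ _) _; rewrite lerD2l.
  by apply: le_trans (ler_norm_sum _ _ _) _; exact: part.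
split; last first.
  by move=> n; rewrite Sx -EFinD lee_fin; exact: bnd.
have cv : cvgn (series (telescope (f_ ^~ x))).
  apply: normed_cvg; apply: nondecreasing_is_cvgn.
    move=> n n' nn'.
    change (\sum_(0 <= k < n) `|telescope (f_ ^~ x) k| <=
            \sum_(0 <= k < n') `|telescope (f_ ^~ x) k|).
    rewrite (@big_cat_nat _ _ _ n 0%N n')//= lerDl.
    by apply: sumr_ge0.
  by exists (fine (S x)) => _ [n _ <-]; exact: part.
have -> : f_ ^~ x = (fun n => f_ 0%N x + series (telescope (f_ ^~ x)) n).
  by apply/funext => n; rewrite -eq_sum_telescope.
by apply: is_cvgD => //; exact: is_cvg_cst.
Qed.

End step_functions.

Lemma ae_imp (d : measure_display) (T : measurableType d) (R : realType)
  (mu : {measure set T -> \bar R}) (P Q : T -> Prop) :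
  {ae mu, forall x, P x} -> (forall x, P x -> Q x) -> {ae mu, forall x, Q x}.
Proof. by move=> aeP PQ; apply: (@filterS _ _ (ae_filter_ringOfSetsType mu) _ _ PQ). Qed.

(** With the convention 0^-1 = 0 inversion is not continuous at 0, so that point is split off. *)
Lemma measurable_inv (R : realType) : measurable_fun setT (@GRing.inv R).
Proof.
have -> : [set: R] = [set~ 0] `|` [set 0] by rewrite setUC setUv.
have o0 : open [set~ (0 : R)] by apply: closed_openC; apply: (compact_closed (@norm_hausdorff R R^o)); exact: compact_set1.
apply/measurable_funU => //; first exact: open_measurable.
split; last exact: measurable_fun_set1.
apply: open_continuous_measurable_fun => // x; rewrite inE/= => /eqP x0.
by apply: cvgV; [exact: x0|exact: cvg_id].
Qed.

Section limits.
Variable R : realType.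
Local Notation mu := (@lebesgue_measure R).

Lemma truncn_div (s : R) (m q : nat) : 0 <= s -> (0 < q)%N ->
  (Num.truncn (s * (m * q)%N%:R) %/ q)%N = Num.truncn (s * m%:R).
Proof.
move=> s0 q0; set i := Num.truncn _.
have q0' : 0 < q%:R :> R by rewrite ltr0n.
have /andP[h1 h2] : i%:R <= s * (m * q)%N%:R < i.+1%:R by rewrite truncn_itv// mulr_ge0.
rewrite natrM mulrA in h1 h2.
apply/esym/truncn_def; apply/andP; split.
  rewrite -(ler_pM2r q0'); apply: le_trans h1; rewrite -natrM ler_nat; exact: leq_trunc_div.
rewrite -(ltr_pM2r q0'); apply: (lt_le_trans h2); rewrite -natrM ler_nat.
by rewrite ltn_ceil.
Qed.

Lemma bounded_itv_integrable (f : R -> R) (i : interval R) (a c M : R) :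
  [set` i] `<=` `[a, c]%classic ->
  measurable_fun [set` i] f -> (forall s, [set` i] s -> `|f s| <= M) ->
  mu.-integrable [set` i] (EFin \o f).
Proof.
move=> sub mf fM.
apply: measurable_bounded_integrable => //.
- apply: (@le_lt_trans _ _ (mu `[a, c]%classic)); first by rewrite le_measure ?inE.
  by rewrite lebesgue_measure_itv/=; case: ifP => _; rewrite ?ltry// -EFinB ltry.
- exists M; split; first exact: num_real.
  by move=> x Mx y /= /fM/le_trans; apply; exact: ltW.
Qed.

Lemma Rint_lip (f : R -> R) (N s t T : R) : 0 <= s -> s <= t -> t <= T ->
  measurable_fun `[0, T]%classic f -> (forall x, 0 <= f x <= N) ->
  `|\int[mu]_(x in `[0, t]) f x - \int[mu]_(x in `[0, s]) f x| <= N * (t - s).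
Proof.
move=> s0 st tT mf fN.
have N0 : 0 <= N by have /andP[] := fN 0; exact: le_trans.
have fN' x : `|f x| <= N by have /andP[h1 h2] := fN x; rewrite ger0_norm.
have sub (i : interval R) : [set` i] `<=` `[0, t]%classic -> [set` i] `<=` `[0, T]%classic.
  move=> si; apply: (subset_trans si); apply: subset_itvl; by rewrite bnd_simp.
have int (i : interval R) : [set` i] `<=` `[0, t]%classic -> mu.-integrable [set` i] (EFin \o f).
  move=> si; apply: (@bounded_itv_integrable f i 0 t N) => //.
  by apply: measurable_funS mf => //; exact: sub.
have i1 : mu.-integrable `[0, t]%classic (EFin \o f) by apply: int.
rewrite Rintegral_itvB//; try by rewrite bnd_simp.
have sst : (`]s, t]%classic : set R) `<=` `[0, t]%classic.
  by apply: subset_itvr; rewrite bnd_simp.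
apply: (le_trans (@le_normr_Rintegral _ _ _ mu _ _ _ (int _ sst))) => //.
apply: (@le_trans _ _ (\int[mu]_(x in `]s, t]) N)).
  apply: le_Rintegral => //.
  - exact: (@integrable_norm _ _ _ mu _ f (int _ sst)).
  - apply: (@bounded_itv_integrable (cst N) _ 0 t N) => // x _.
    by rewrite /= ger0_norm.
rewrite Rintegral_cst//.
have -> : fine (mu (`]s, t]%classic : set R)) = t - s; last by [].
rewrite lebesgue_measure_itv/= lte_fin; case: ltP => [_|ts]; first by rewrite -EFinB.
by have -> : t = s; [apply/eqP; rewrite eq_le st ts|rewrite subrr].
Qed.

(** The Weierstrass test: the tail of the series of the d k bounds the distance to the limit at all
    points of P. *)
Lemma unif_limit (f : nat -> R -> R) (d : nat -> R) (M : R) (P : set R) :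
  (forall n, \sum_(0 <= k < n) d k <= M) ->
  (forall k t, P t -> `|f k.+1 t - f k t| <= d k) -> (forall k, 0 <= d k) ->
  forall e : R, 0 < e -> exists k0, forall k, (k0 <= k)%N -> forall t, P t ->
    cvgn (f ^~ t) /\ `|f k t - limn (f ^~ t)| <= e.
Proof.
move=> dM fd d0.
have cd : cvgn (series d).
  apply: nondecreasing_is_cvgn.
    move=> n n' nn'; rewrite !seriesEnat/= (@big_cat_nat _ _ _ n 0%N n')//= lerDl.
    by apply: sumr_ge0.
  by exists M => _ [n _ <-]; exact: dM.
have cf t : P t -> cvgn (f ^~ t).
  move=> Pt.
  have cv : cvgn (series (telescope (f ^~ t))).
    apply: normed_cvg; apply: nondecreasing_is_cvgn.
      move=> n n' nn'.
      change (\sum_(0 <= k < n) `|telescope (f ^~ t) k| <=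
            \sum_(0 <= k < n') `|telescope (f ^~ t) k|).
      rewrite (@big_cat_nat _ _ _ n 0%N n')//= lerDl.
      by apply: sumr_ge0.
    exists M => _ [n _ <-]; apply: le_trans (dM n); apply: ler_sum => k _; exact: fd.
  have -> : f ^~ t = (fun n => f 0%N t + series (telescope (f ^~ t)) n).
    by apply/funext => n; rewrite -eq_sum_telescope.
  by apply: is_cvgD => //; exact: is_cvg_cst.
move=> e e0.
have /cvgrPdist_le/(_ e e0)[k0 _ Hk0] := cd.
have nd : nondecreasing_seq (series d).
  move=> n n' nn'; rewrite !seriesEnat/= (@big_cat_nat _ _ _ n 0%N n')//= lerDl.
  by apply: sumr_ge0.
exists k0 => k kk t Pt; split; first exact: cf.
have kl l : (k <= l)%N -> `|f k t - f l t| <= e.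
  move=> kl; apply: (@le_trans _ _ (\sum_(k <= j < l) d j)).
    rewrite distrC.
    have -> : f l t - f k t = \sum_(k <= j < l) (f j.+1 t - f j t).
      by rewrite (telescope_sumr (f ^~ t) kl).
    by apply: le_trans (ler_norm_sum _ _ _) _; apply: ler_sum => j _; exact: fd.
  have := Hk0 _ kk; apply: le_trans; apply: le_trans (ler_norm _).
  have := nondecreasing_cvgn_le nd cd l.
  by rewrite {1}seriesEnat/= (@big_cat_nat _ _ _ k 0%N l)//= lerBrDl.
have c1 : (fun l => `|f k t - f l t|) @ \oo --> `|f k t - limn (f ^~ t)|.
  by apply: cvg_norm; apply: cvgB; [exact: cvg_cst|exact: cf].
rewrite -(cvg_lim _ c1)//; apply: limr_le; first by apply/cvg_ex; eexists; exact: c1.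
by exists k => // l /= kl'; exact: kl.
Qed.

(** At almost every s the numbers [psi k s] have a finite limit l, while their product with
    [Num.max (xs k s) (N k)^-1] is 1. In the limit l max(X s, 0) = 1, which forces X s > 0 and l = 1
    / X s: positivity is a by-product of the convergence in L^1. The integrals then converge by
    domination. *)
Lemma inv_limit (T t : R) (psi xs : nat -> R -> R) (X : R -> R) (N : nat -> R) (M : R) :
  0 <= t -> t <= T ->
  (forall k s, 0 <= s -> psi k s = phi (N k) (xs k s)) -> (forall k, 0 < N k) ->
  (N k)^-1 @[k --> \oo] --> 0 ->
  (forall k, measurable_fun `[0, T]%classic (psi k)) ->
  (forall n, (\sum_(0 <= k < n) \int[mu]_(x in `[0%R, T]) (`|psi k.+1 x - psi k x|)%:E <= M%:E)%E) ->
  (forall s, 0 <= s <= T -> xs k s @[k --> \oo] --> X s) ->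
  measurable_fun `[0, T]%classic X ->
  [/\ {ae mu, forall s, 0 <= s <= T -> 0 < X s},
   mu.-integrable `[0, t]%classic (fun s => ((X s)^-1)%:E) &
   \int[mu]_(s in `[0, t]) psi k s @[k --> \oo] --> fine (\int[mu]_(s in `[0%R, t]) ((X s)^-1)%:E)%E].
Proof.
move=> t0 tT psiE N0 Ninf mpsi HM xsX mX.
have T0 : 0 <= T by exact: le_trans tT.
have psi_b k s : 0 <= s -> 0 <= psi k s <= N k.
  by move=> s0; rewrite psiE// phi_le ?ltW ?phi_gt0.
have ip0 : mu.-integrable `[0, T]%classic (EFin \o psi 0%N).
  apply: (@bounded_itv_integrable _ _ 0 T (N 0%N)) => //.
  move=> s; rewrite /= in_itv/= => /andP[s0 _].
  by have /andP[h1 h2] := psi_b 0%N s s0; rewrite ger0_norm.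
have [G [iG Gae]] := @L1_summable_cvg R `[0, T]%classic psi M (measurable_itv _) mpsi ip0 HM.
have conv : {ae mu, forall s, `[0, T]%classic s -> 0 < X s /\
     psi k s @[k --> \oo] --> (X s)^-1 /\ forall n, (`|(psi n s)%:E| <= G s)%E}.
  apply: (ae_imp _ _ _ _ _ _ Gae) => s H Ds; have [cv bd] := H Ds.
  have sT : 0 <= s <= T by move: Ds; rewrite /= in_itv.
  have /andP[s0 _] := sT.
  set l := limn (psi ^~ s).
  have c1 : Num.max (xs k s) (N k)^-1 @[k --> \oo] --> Num.max (X s) 0.
    under eq_fun do rewrite maxr_absE.
    rewrite maxr_absE; apply: cvgMl; apply: cvgD; first by apply: cvgD => //; exact: xsX.
    by apply: cvg_norm; apply: cvgB => //; exact: xsX.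
  have c2 : psi k s * Num.max (xs k s) (N k)^-1 @[k --> \oo] --> l * Num.max (X s) 0.
    by apply: cvgM => //.
  have c3 : psi k s * Num.max (xs k s) (N k)^-1 @[k --> \oo] --> (1:R).
    suff -> : (fun k => psi k s * Num.max (xs k s) (N k)^-1) = (fun=> 1) by exact: cvg_cst.
    apply/funext => k; rewrite psiE// /phi mulVf// gt_eqF//.
    by rewrite lt_max invr_gt0 N0 orbT.
  have e1 : l * Num.max (X s) 0 = 1 by apply: (cvg_unique _ c2 c3).
  have X0 : 0 < X s.
    rewrite ltNge; apply/negP => X0; move: e1; rewrite max_r// mulr0.
    by move/esym/eqP; rewrite oner_eq0.
  split=> //; split => //.
  have -> : (X s)^-1 = l; last exact: cv.
  move: e1; rewrite (max_l (ltW X0)) => /(congr1 (fun z => z / X s)).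
  by rewrite mulfK ?gt_eqF// mul1r.
have subt : (`[0, t]%classic : set R) `<=` `[0, T]%classic.
  by apply: subset_itvl; rewrite bnd_simp.
have mX' : measurable_fun `[0, t]%classic (fun s => ((X s)^-1)%:E).
  apply/measurable_EFinP; apply: (@measurable_funS _ _ _ _ `[0, T]%classic) => //.
  by apply: measurableT_comp mX; exact: measurable_inv.
have mpsi' k : measurable_fun `[0, t]%classic (fun s => (psi k s)%:E).
  apply/measurable_EFinP; by apply: (@measurable_funS _ _ _ _ `[0, T]%classic) => //; exact: mpsi.
have iG' : mu.-integrable `[0, t]%classic G by exact: integrableS iG.
have [] := @dominated_convergence _ _ R mu `[0, t]%classic (measurable_itv _)
  (fun k s => (psi k s)%:E) (fun s => ((X s)^-1)%:E) G mpsi' mX' _ iG' _.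
- apply: (ae_imp _ _ _ _ _ _ conv) => s H Ds; have [_ [cv _]] := H (subt _ Ds).
  by apply: cvg_EFin => //; exact: nearW.
- by apply: (ae_imp _ _ _ _ _ _ conv) => s H n Ds; have [_ [_ ]] := H (subt _ Ds).
move=> iX _ cvi; split => //.
  by apply: (ae_imp _ _ _ _ _ _ conv) => s H sT; have [] := H sT.
have fn := @integrable_fin_num _ _ _ mu _ _ _ iX.
by move: cvi; rewrite -(fineK (fn (measurable_itv _))) => /fine_cvg.
Qed.

End limits.

(** * Continuity on the half-line expressed by moduli of continuity *)

Section continuity.
Variable R : realType.

Lemma within_halfline_epsP (f : R -> R) :
  {within `[0, +oo[%classic, continuous f} <->
  (forall x, 0 <= x -> forall e, 0 < e -> exists2 r : R, 0 < r &
     forall y, 0 <= y -> `|x - y| < r -> `|f x - f y| < e).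
Proof.
split.
  move=> /subspace_continuousP cf x x0 e e0.
  have := cf x; rewrite /= in_itv/= andbT => /(_ x0) /cvgrPdist_lt /(_ e e0).
  rewrite near_withinE => /nbhs_ballP[r /= r0 H]; exists r => // y y0 xy.
  by apply: (H y) => //=; rewrite in_itv/= andbT.
move=> H; apply/subspace_continuousP => x; rewrite /= in_itv/= andbT => x0.
apply/cvgrPdist_lt => e e0; have [r r0 Hr] := H x x0 e e0.
rewrite near_withinE; apply/nbhs_ballP; exists r => //= y xy.
by rewrite in_itv/= andbT => y0; exact: Hr.
Qed.

Lemma within_modulus (f : R -> R) (T : R) :
  {within `[0, +oo[%classic, continuous f} -> modulus T f.
Proof.
move=> /within_halfline_epsP cf e e0.
have /compact_near_coveringP cov : compact `[0, T]%classic by exact: (@segment_compact R 0 T).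
have e20 : 0 < e / 2 by rewrite divr_gt0.
have := cov R (0^'+) (fun r x => 0 <= x -> forall y, 0 <= y -> `|x - y| < r -> `|f x - f y| < e).
case/(_ _ _)/Wrap => [x|].
  rewrite /= in_itv/= => /andP[x0 _]; have [r r0 Hr] := cf x x0 _ e20.
  have r20 : 0 < r / 2 by rewrite divr_gt0.
  exists (ball x (r / 2), [set s | s < r / 2]) => /=.
    by split; [exact: nbhsx_ballx|exact: nbhs_right_lt].
  move=> [x' s] /= [xx' sr] x'0 y y0 x'y.
  have h1 : `|f x - f x'| < e / 2 by apply: Hr => //; apply: lt_trans xx' _; lra.
  have h2 : `|f x - f y| < e / 2.
    apply: Hr => //; have -> : x - y = (x - x') + (x' - y) by ring.
    by apply: le_lt_trans (ler_normD _ _) _; have xx2 : `|x - x'| < r / 2 := xx'; lra.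
  have -> : f x' - f y = (f x - f y) - (f x - f x') by ring.
  by apply: le_lt_trans (ler_normB _ _) _; lra.
move=> H; have [r /andP[r0 Hr]] : exists r : R, (0 < r) && `[< forall x, `[0, T]%classic x -> 0 <= x -> forall y, 0 <= y -> `|x - y| < r -> `|f x - f y| < e >].
  near (0 : R)^'+ => r; exists r; apply/andP; split => //.
  by apply/asboolP => x Tx; move: x Tx; near: r; exact: H.
exists r => // s t s0 st tT ts.
move/asboolP : Hr; apply => //=.
- by rewrite in_itv/= tT (le_trans s0 st).
- exact: le_trans st.
- by rewrite ger0_norm ?subr_ge0.
Unshelve. all: by end_near. Qed.

Lemma modulus_within (f : R -> R) :
  (forall T : nat, modulus T%:R f) -> {within `[0, +oo[%classic, continuous f}.
Proof.
move=> mf; apply/within_halfline_epsP => x x0 e e0.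
have [r r0 Hr] := mf (Num.truncn x).+2 e e0.
have xT : x + 1 <= (Num.truncn x).+2%:R by rewrite -natr1 lerD2r ltW// truncnS_gt.
exists (Num.min r 1); first by rewrite lt_min r0 ltr01.
move=> y y0; rewrite lt_min => /andP[xy xy1].
have [le|/ltW le] := leP x y.
  rewrite distrC; apply: Hr => //; last by move: xy; rewrite distrC ger0_norm ?subr_ge0.
  by move: xy1; rewrite distrC ger0_norm ?subr_ge0//; lra.
apply: Hr => //; last by move: xy; rewrite ger0_norm ?subr_ge0.
lra.
Qed.

Lemma modulus_lin (T x0 b0 al be : R) (b A B : R -> R) :
  modulus T b -> modulus T A -> modulus T B ->
  modulus T (fun t => x0 + (b t - b0) + al * A t + be * B t).
Proof.
move=> mb mA mB e e0; pose K := 1 + `|al| + `|be|.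
have na := normr_ge0 al; have nb := normr_ge0 be.
have K0 : 0 < K by rewrite /K; lra.
have eK : 0 < e / K by rewrite divr_gt0.
have [r1 r10 H1] := mb _ eK; have [r2 r20 H2] := mA _ eK; have [r3 r30 H3] := mB _ eK.
exists (Num.min r1 (Num.min r2 r3)); first by rewrite !lt_min r10 r20.
move=> s t s0 st tT; rewrite !lt_min => /and3P[d1 d2 d3].
have {}H1 := H1 _ _ s0 st tT d1; have {}H2 := H2 _ _ s0 st tT d2; have {}H3 := H3 _ _ s0 st tT d3.
have -> : x0 + (b t - b0) + al * A t + be * B t - (x0 + (b s - b0) + al * A s + be * B s)
  = (b t - b s) + (al * (A t - A s) + be * (B t - B s)) by ring.
have eE : e = e / K + (`|al| * (e / K) + `|be| * (e / K)).
  by rewrite -!mulrDl mulrA -[X in X * _]mulr1 /K; field; rewrite gt_eqF.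
apply: le_lt_trans (ler_normD _ _) _; rewrite [ltRHS]eE; apply: ltr_leD => //.
apply: le_trans (ler_normD _ _) _; rewrite !normrM; apply: lerD; apply: ler_wpM2l => //; exact: ltW.
Qed.

Lemma modulus_measurable (T : R) (f : R -> R) : modulus T f ->
  measurable_fun `[0, T]%classic f.
Proof.
move=> mf; apply: subspace_continuous_measurable_fun => //.
apply/subspace_continuousP => x; rewrite /= in_itv/= => /andP[x0 xT].
apply/cvgrPdist_lt => e e0; have [r r0 Hr] := mf e e0.
rewrite near_withinE; apply/nbhs_ballP; exists r => //= y xy.
rewrite in_itv/= => /andP[y0 yT]; move: xy; rewrite /ball/=.
have [le|/ltW le] := leP x y; first by rewrite !(distrC x) !(distrC (f x)) ger0_norm ?subr_ge0//; exact: Hr.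
by rewrite ger0_norm ?subr_ge0//; exact: Hr.
Qed.

Lemma modulus_dist (T : R) (f : R -> R) : modulus T f -> forall e, 0 < e -> exists2 r : R, 0 < r &
  forall s t, 0 <= s <= T -> 0 <= t <= T -> `|s - t| < r -> `|f s - f t| < e.
Proof.
move=> mf e e0; have [r r0 Hr] := mf e e0; exists r => // s t /andP[s0 sT] /andP[t0 tT].
have [le|/ltW le] := leP s t; first by rewrite !(distrC s) !(distrC (f s)) ger0_norm ?subr_ge0//; exact: Hr.
by rewrite ger0_norm ?subr_ge0//; exact: Hr.
Qed.

End continuity.

(** The drift of the unfinished step is left out. The value at t then depends only on the noise up
    to t, and the missing term, of order h_k n_k, disappears in the limit. *)
Definition app1 {R : realType} (E : nat -> nat -> R * R) (b : R -> R) (k : nat) (t : R) : R :=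
  let i := Num.truncn (t * (msh k)%:R) in (E k i).1 + (b t - b (i%:R * hlev k)).
Definition app2 {R : realType} (E : nat -> nat -> R * R) (c : R -> R) (k : nat) (t : R) : R :=
  let i := Num.truncn (t * (msh k)%:R) in (E k i).2 + (c t - c (i%:R * hlev k)).

Definition psil {R : realType} (E : nat -> nat -> R * R) (p : R * R -> R) (k : nat) (s : R) : R :=
  phi (nlev k) (p (E k (Num.truncn (s * (msh k)%:R)))).

(** * Passage to the limit along one path *)

Section path_limit.
Variable R : realType.
Local Notation mu := (@lebesgue_measure R).

Lemma nlev_inv_cvg0 : (@nlev R k)^-1 @[k --> \oo] --> (0 : R).
Proof.
apply/cvgrPdist_le => e e0; have [k0 Hk0] := nlev_big R e^-1.
exists k0 => // k /= kk; rewrite sub0r normrN ger0_norm; last by rewrite invr_ge0 ltW// nlev_gt0.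
by rewrite -[leRHS]invrK lef_pV2 ?posrE ?invr_gt0 ?nlev_gt0 ?Hk0.
Qed.

Lemma grid_dist (k : nat) (t : R) : 0 <= t ->
  let s := (Num.truncn (t * (msh k)%:R))%:R * hlev k in 0 <= s <= t /\ t - s <= hlev k.
Proof.
move=> t0 s; have m0 : 0 < (msh k)%:R :> R by rewrite ltr0n msh_gt0.
have /andP[h1 h2] := @truncn_itv R (t * (msh k)%:R) (mulr_ge0 t0 (ltW m0)).
have s0 : 0 <= s by rewrite mulr_ge0// ltW// hlev_gt0.
split; first by rewrite s0 /s /hlev ler_pdivrMr.
have : t < (Num.truncn (t * (msh k)%:R)).+1%:R * hlev k by rewrite /hlev ltr_pdivlMr.
by rewrite -natr1 mulrDl mul1r -/s; lra.
Qed.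

Lemma coord_int (E : nat -> nat -> R * R) (p : R * R -> R) (T k : nat) (dk : R) :
  \sum_(i < T * msh k.+1) hlev k.+1 *
     `|phi (nlev k) (p (E k (i %/ msh k)%N)) - phi (nlev k.+1) (p (E k.+1 i))| <= dk ->
  (\int[mu]_(x in `[0%R, T%:R]) (`|psil E p k.+1 x - psil E p k x|)%:E <= dk%:E)%E.
Proof.
move=> H; pose psi := psil E p; rewrite -/psi.
pose a i : R := `|phi (nlev k) (p (E k (i %/ msh k)%N)) - phi (nlev k.+1) (p (E k.+1 i))|.
have m0 : (0 < msh k.+1)%N := msh_gt0 _.
have TE : T%:R = (T * msh k.+1)%N%:R / (msh k.+1)%:R :> R.
  by rewrite natrM mulfK// pnatr_eq0 -lt0n.
have mpsi j (D : set R) : measurable D -> measurable_fun D (psi j).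
  by move=> mD; apply: (@measurable_step R (fun i => phi (nlev j) (p (E j i)))) => //; exact: msh_gt0.
rewrite -integral_itv_bndo_bndc; last first.
  apply/measurable_EFinP; apply: measurableT_comp => //; apply: measurable_funB; exact: mpsi.
have -> : (\int[mu]_(x in `[0%R, T%:R[) (`|psi k.+1 x - psi k x|)%:E
    = \int[mu]_(s in `[0%R, T%:R[) (a (Num.truncn (s * (msh k.+1)%:R)))%:E)%E.
  apply: eq_integral => s; rewrite inE/= in_itv/= => /andP[s0 _]; congr (_%:E).
  by rewrite /a /psi /psil distrC mshS truncn_div// msh_gt0.
rewrite TE (@step_integral R a (msh k.+1) (T * msh k.+1) m0 (fun i => normr_ge0 _)).
by rewrite lee_fin.
Qed.

(** The time integrals A_k of the truncated reciprocals are Lipschitz in time, and consecutive ones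
    differ on [0, T] by summable amounts. They converge uniformly to continuous functions, and X, Y
    are the noise plus linear combinations of these. [inv_limit] identifies the latter with the
    integrals of 1/X and 1/Y. *)
Theorem path_limit (al be ga de : R) (b c : R -> R) (x0 y0 M : R) (T k1 : nat) :
  (0 < T)%N -> modulus T%:R b -> modulus T%:R c ->
  let E := lev al be ga de b c x0 y0 in
  (forall n, \sum_(k1 <= k < n) \sum_(i < T * msh k.+1) hlev k.+1 * dphi (E k) (E k.+1) k i <= M) ->
  let X t := limn (app1 E b ^~ t) in let Y t := limn (app2 E c ^~ t) in
  [/\ (forall t, 0 <= t <= T%:R -> app1 E b k t @[k --> \oo] --> X t /\ app2 E c k t @[k --> \oo] --> Y t),
    (forall t, 0 <= t <= T%:R -> 0 <= X t /\ 0 <= Y t),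
    modulus T%:R X /\ modulus T%:R Y &
    forall t, 0 <= t <= T%:R ->
      [/\ mu (`[0, t]%classic `&` [set s | X s = 0]) = 0%E,
        mu (`[0, t]%classic `&` [set s | Y s = 0]) = 0%E,
        (inv_int X t < +oo)%E /\ (inv_int Y t < +oo)%E,
        X t = x0 + (b t - b 0) + al * fine (inv_int X t) + be * fine (inv_int Y t) &
        Y t = y0 + (c t - c 0) + ga * fine (inv_int X t) + de * fine (inv_int Y t)]].
Proof.
move=> T0 mb mc E HM X Y.
pose psi := psil E.
pose A p k t := \int[mu]_(s in `[0, t]) psi p k s.
pose d k := \sum_(i < T * msh k.+1) hlev k.+1 * dphi (E k) (E k.+1) k i.
have mpsi p j (D : set R) : measurable D -> measurable_fun D (psi p j).
  by move=> mD; apply: (@measurable_step R (fun i => phi (nlev j) (p (E j i)))) => //; exact: msh_gt0.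
have psib p k s : 0 <= psi p k s <= nlev k.
  by rewrite phi_le ?nlev_gt0// ltW// phi_gt0// nlev_gt0.
have d0 k : 0 <= d k.
  by apply: sumr_ge0 => i _; rewrite mulr_ge0 ?(ltW (hlev_gt0 _ _))// addr_ge0.
have dint1 k : (\int[mu]_(x in `[0%R, T%:R]) (`|psi fst k.+1 x - psi fst k x|)%:E <= (d k)%:E)%E.
  apply: coord_int; apply: ler_sum => i _; rewrite ler_wpM2l ?(ltW (hlev_gt0 _ _))//.
  by rewrite /dphi lerDl.
have dint2 k : (\int[mu]_(x in `[0%R, T%:R]) (`|psi snd k.+1 x - psi snd k x|)%:E <= (d k)%:E)%E.
  apply: coord_int; apply: ler_sum => i _; rewrite ler_wpM2l ?(ltW (hlev_gt0 _ _))//.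
  by rewrite /dphi lerDr.
have int p k t : mu.-integrable `[0, t]%classic (EFin \o psi p k).
  apply: (@bounded_itv_integrable R _ _ 0 t (nlev k)) => //; first exact: mpsi.
  by move=> s _; have /andP[h1 h2] := psib p k s; rewrite ger0_norm.
have Ad p : (forall k, (\int[mu]_(x in `[0%R, T%:R]) (`|psi p k.+1 x - psi p k x|)%:E <= (d k)%:E)%E) ->
    forall k t, 0 <= t <= T%:R -> `|A p k.+1 t - A p k t| <= d k.
  move=> di k t /andP[t0 tT].
  rewrite -lee_fin /A -RintegralB//.
  have iB : mu.-integrable `[0, t]%classic (EFin \o (fun s => psi p k.+1 s - psi p k s)).
    apply: (@bounded_itv_integrable R _ _ 0 t (nlev k.+1 + nlev k)) => //.
      by apply: measurable_funB; exact: mpsi.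
    move=> s _; apply: le_trans (ler_normB _ _) _.
    by have /andP[h1 h2] := psib p k s; have /andP[h3 h4] := psib p k.+1 s; rewrite !ger0_norm// lerD.
  rewrite EFin_normr_Rintegral//; apply: le_trans (di k).
  apply: (le_trans (le_abse_integral _ _ _)) => //; first by case/integrableP: iB.
  apply: ge0_subset_integral => //.
    apply/measurable_EFinP; apply: measurableT_comp => //; apply: measurable_funB; exact: mpsi.
  by apply: subset_itvl; rewrite bnd_simp.
have dM n : \sum_(0 <= j < n) d (k1 + j)%N <= M.
  have := HM (k1 + n)%N; rewrite -{1}[k1]add0n big_addn addKn.
  by under eq_bigr do rewrite addnC.
have UL p : (forall k, (\int[mu]_(x in `[0%R, T%:R]) (`|psi p k.+1 x - psi p k x|)%:E <= (d k)%:E)%E) ->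
   exists Ai : R -> R, forall e : R, 0 < e -> exists k0, forall k, (k0 <= k)%N ->
     forall t, 0 <= t <= T%:R -> `|A p k t - Ai t| <= e.
  move=> di; exists (fun t => limn (fun j => A p (k1 + j)%N t)) => e e0.
  have h2 k t : [set t | 0 <= t <= T%:R] t -> `|A p (k1 + k.+1)%N t - A p (k1 + k)%N t| <= d (k1 + k)%N.
    by move=> tT; rewrite addnS; exact: Ad.
  have [k0 Hk0] := @unif_limit R (fun j => A p (k1 + j)%N) (fun j => d (k1 + j)%N) M
    [set t | 0 <= t <= T%:R] dM h2 (fun j => d0 _) e e0.
  exists (k1 + k0)%N => k kk t tT.
  have k1k : (k1 <= k)%N by exact: leq_trans (leq_addr _ _) kk.
  rewrite -(subnKC k1k); have := Hk0 (k - k1)%N; rewrite leq_subRL// => /(_ kk t tT) [_].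
  by [].
have [AX HAX] := UL fst dint1; have [AY HAY] := UL snd dint2.
have Alip p k s t : 0 <= s -> s <= t -> t <= T%:R -> `|A p k t - A p k s| <= nlev k * (t - s).
  move=> s0 st tT; apply: (@Rint_lip R _ _ _ _ T%:R) => //; exact: mpsi.
(* One fixed level k0 supplies the modulus; that its Lipschitz constant [nlev k0] may be huge is
   harmless. *)
have modA p Ai : (forall e : R, 0 < e -> exists k0, forall k, (k0 <= k)%N ->
     forall t, 0 <= t <= T%:R -> `|A p k t - Ai t| <= e) -> modulus T%:R Ai.
  move=> H e e0; have e40 : 0 < e / 4 by rewrite divr_gt0.
  have [k0 Hk0] := H _ e40; have n0 := @nlev_gt0 R k0.
  exists (e / (4 * nlev k0)); first by rewrite divr_gt0// mulr_gt0.
  move=> s t s0 st tT ts.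
  have sT : 0 <= s <= T%:R by rewrite s0 (le_trans st).
  have tT' : 0 <= t <= T%:R by rewrite tT (le_trans s0).
  have h1 := Hk0 k0 (leqnn _) _ sT; have h2 := Hk0 k0 (leqnn _) _ tT'.
  have h3 := Alip p k0 s t s0 st tT.
  have h4 : nlev k0 * (t - s) < e / 4.
    have -> : e / 4 = nlev k0 * (e / (4 * nlev k0)) by field; rewrite gt_eqF.
    by rewrite ltr_pM2l.
  have -> : Ai t - Ai s = (A p k0 t - A p k0 s) - (A p k0 t - Ai t) + (A p k0 s - Ai s) by ring.
  apply: le_lt_trans (ler_normD _ _) _.
  have := ler_normB (A p k0 t - A p k0 s) (A p k0 t - Ai t); lra.
have mAX := modA _ _ HAX; have mAY := modA _ _ HAY.
have stepA p k i : A p k (i%:R * hlev k) = hlev k * \sum_(j < i) phi (nlev k) (p (E k j)).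
  have := @step_integral R (fun j => phi (nlev k) (p (E k j))) (msh k) i (msh_gt0 _).
  move=> /(_ _)/Wrap[j|]; first by rewrite ltW// phi_gt0// nlev_gt0.
  rewrite -mulr_sumr integral_itv_bndo_bndc; last first.
    by apply/measurable_EFinP; exact: mpsi.
  by rewrite /A /Rintegral => ->.
have e1 k i : (E k i).1 = x0 + (b (i%:R * hlev k) - b 0)
    + al * A fst k (i%:R * hlev k) + be * A snd k (i%:R * hlev k).
  rewrite !stepA /E /lev euler_sum1 -/(lev al be ga de b c x0 y0 k) -/E big_split/= -!mulr_sumr; ring.
have e2 k i : (E k i).2 = y0 + (c (i%:R * hlev k) - c 0)
    + ga * A fst k (i%:R * hlev k) + de * A snd k (i%:R * hlev k).
  rewrite !stepA /E /lev euler_sum2 -/(lev al be ga de b c x0 y0 k) -/E big_split/= -!mulr_sumr; ring.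
(* Replacing t by the last grid time costs at most [hlev k * nlev k], hence at most 1 / n_k. *)
have cvgrid p Ai : (forall e : R, 0 < e -> exists k0, forall k, (k0 <= k)%N ->
     forall t, 0 <= t <= T%:R -> `|A p k t - Ai t| <= e) ->
   forall t, 0 <= t <= T%:R ->
   A p k ((Num.truncn (t * (msh k)%:R))%:R * hlev k) @[k --> \oo] --> Ai t.
  move=> H t /andP[t0 tT]; apply/cvgrPdist_le => e e0; have e20 : 0 < e / 2 by rewrite divr_gt0.
  have [k0 Hk0] := H _ e20; have [k2 Hk2] := nlev_big R (2 / e).
  exists (maxn k0 k2) => // k /=; rewrite geq_max => /andP[kk kk2].
  have [/andP[s0 st] ts] := grid_dist k t t0; set s := _ * hlev k in s0 st ts *.
  have h1 := Alip p k s t s0 st tT.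
  have tT' : 0 <= t <= T%:R by rewrite t0.
  have h2 := Hk0 _ kk _ tT'.
  have h3 : nlev k * (t - s) <= e / 2.
    apply: (@le_trans _ _ (hlev k * nlev k ^+ 1)).
      by rewrite expr1 mulrC ler_wpM2r// ltW// nlev_gt0.
    apply: (le_trans (@hlev_pow R k 1 isT)).
    rewrite -[leRHS]invrK lef_pV2 ?posrE ?nlev_gt0 ?invr_gt0//.
    by rewrite invf_div; exact: Hk2.
  have -> : Ai t - A p k s = (A p k t - A p k s) - (A p k t - Ai t) by ring.
  by have := ler_normB (A p k t - A p k s) (A p k t - Ai t); lra.
pose Xi t := x0 + (b t - b 0) + al * AX t + be * AY t.
pose Yi t := y0 + (c t - c 0) + ga * AX t + de * AY t.
have cX t : 0 <= t <= T%:R -> app1 E b k t @[k --> \oo] --> Xi t.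
  move=> tT; pose s k := (Num.truncn (t * (msh k)%:R))%:R * hlev k : R.
  have -> : (fun k => app1 E b k t) = (fun k => x0 + (b t - b 0) + al * A fst k (s k) + be * A snd k (s k)).
    by apply/funext => k; rewrite /app1/= e1 -/(s k); ring.
  apply: cvgD; first apply: cvgD; first exact: cvg_cst.
    by apply: cvgMr; exact: cvgrid.
  by apply: cvgMr; exact: cvgrid.
have cY t : 0 <= t <= T%:R -> app2 E c k t @[k --> \oo] --> Yi t.
  move=> tT; pose s k := (Num.truncn (t * (msh k)%:R))%:R * hlev k : R.
  have -> : (fun k => app2 E c k t) = (fun k => y0 + (c t - c 0) + ga * A fst k (s k) + de * A snd k (s k)).
    by apply/funext => k; rewrite /app2/= e2 -/(s k); ring.
  apply: cvgD; first apply: cvgD; first exact: cvg_cst.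
    by apply: cvgMr; exact: cvgrid.
  by apply: cvgMr; exact: cvgrid.
have XE t : 0 <= t <= T%:R -> X t = Xi t by move=> tT; apply/cvg_lim => //; exact: cX.
have YE t : 0 <= t <= T%:R -> Y t = Yi t by move=> tT; apply/cvg_lim => //; exact: cY.
have modE (f g : R -> R) : (forall t, 0 <= t <= T%:R -> f t = g t) -> modulus T%:R g -> modulus T%:R f.
  move=> fg mg e e0; have [r r0 Hr] := mg e e0; exists r => // s t s0 st tT ts.
  rewrite !fg ?s0 ?tT ?(le_trans st)// ?(le_trans s0)//; exact: Hr.
have mX : modulus T%:R X by apply: (modE _ _ XE); exact: modulus_lin.
have mY : modulus T%:R Y by apply: (modE _ _ YE); exact: modulus_lin.
have bgrid (f : R -> R) t : modulus T%:R f -> 0 <= t <= T%:R ->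
   f ((Num.truncn (t * (msh k)%:R))%:R * hlev k) @[k --> \oo] --> f t.
  move=> mf tT; have /andP[t0 tT'] := tT; apply/cvgrPdist_lt => e e0.
  have [r r0 Hr] := modulus_dist _ _ _ mf e e0.
  have [k0 Hk0] := nlev_big R (r / 2)^-1.
  exists k0 => // k /= kk; have [/andP[s0 st] ts] := grid_dist k t t0.
  apply: Hr => //; first by rewrite s0 (le_trans st).
  rewrite ger0_norm ?subr_ge0//; apply: (le_lt_trans ts).
  apply: (@le_lt_trans _ _ (nlev k)^-1).
    by have := @hlev_pow R k 0 isT; rewrite expr0 mulr1.
  apply: (@le_lt_trans _ _ (r / 2)); last lra.
  by rewrite -[leRHS]invrK lef_pV2 ?posrE ?nlev_gt0 ?invr_gt0 ?divr_gt0// Hk0.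
have xs1 s : 0 <= s <= T%:R -> (E k (Num.truncn (s * (msh k)%:R))).1 @[k --> \oo] --> X s.
  move=> sT; rewrite XE// -[Xi s]subr0 -(subrr (b s)).
  have cb : (fun _ : nat => b s) @ \oo --> b s by exact: cvg_cst.
  have h := cvgB (cX s sT) (cvgB cb (bgrid b s mb sT)).
  have -> : (fun k => (E k (Num.truncn (s * (msh k)%:R))).1) =
    (fun k => app1 E b k s - (b s - b ((Num.truncn (s * (msh k)%:R))%:R * hlev k))).
    by apply/funext => k; rewrite /app1/= addrK.
  exact: h.
have xs2 s : 0 <= s <= T%:R -> (E k (Num.truncn (s * (msh k)%:R))).2 @[k --> \oo] --> Y s.
  move=> sT; rewrite YE// -[Yi s]subr0 -(subrr (c s)).
  have cb : (fun _ : nat => c s) @ \oo --> c s by exact: cvg_cst.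
  have h := cvgB (cY s sT) (cvgB cb (bgrid c s mc sT)).
  have -> : (fun k => (E k (Num.truncn (s * (msh k)%:R))).2) =
    (fun k => app2 E c k s - (c s - c ((Num.truncn (s * (msh k)%:R))%:R * hlev k))).
    by apply/funext => k; rewrite /app2/= addrK.
  exact: h.
have main p (Z Ai : R -> R) t :
    (forall k, (\int[mu]_(x in `[0%R, T%:R]) (`|psi p k.+1 x - psi p k x|)%:E <= (d k)%:E)%E) ->
    (forall s, 0 <= s <= T%:R -> p (E k (Num.truncn (s * (msh k)%:R))) @[k --> \oo] --> Z s) ->
    modulus T%:R Z -> (forall e : R, 0 < e -> exists k0, forall k, (k0 <= k)%N ->
     forall t, 0 <= t <= T%:R -> `|A p k t - Ai t| <= e) ->
    0 <= t <= T%:R ->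
    [/\ {ae mu, forall s, 0 <= s <= T%:R -> 0 < Z s}, (inv_int Z t < +oo)%E,
        Ai t = fine (inv_int Z t) & mu (`[0, t]%classic `&` [set s | Z s = 0]) = 0%E].
  move=> di cz mZ HA tT; have /andP[t0 tT'] := tT.
  have mesZ := modulus_measurable _ _ _ mZ.
  have HM' n : (\sum_(0 <= k < n) \int[mu]_(x in `[0%R, T%:R]) (`|psi p (k1 + k.+1)%N x - psi p (k1 + k)%N x|)%:E <= M%:E)%E.
    apply: (@le_trans _ _ (\sum_(0 <= k < n) (d (k1 + k)%N)%:E)%E).
      by apply: lee_sum => k _; rewrite addnS; exact: di.
    by rewrite sumEFin lee_fin.
  have ninf : (nlev (k1 + k))^-1 @[k --> \oo] --> (0 : R).
    have := nlev_inv_cvg0; rewrite -(cvg_shiftn k1) => h; under eq_fun do rewrite addnC; exact: h.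
  have cz' s : 0 <= s <= T%:R -> p (E (k1 + k)%N (Num.truncn (s * (msh (k1 + k))%:R))) @[k --> \oo] --> Z s.
    move=> sT; have := cz s sT; rewrite -(cvg_shiftn k1) => h; under eq_fun do rewrite addnC; exact: h.
  have [ae1 iZ cvZ] := @inv_limit R T%:R t (fun k => psi p (k1 + k)%N)
     (fun k s => p (E (k1 + k)%N (Num.truncn (s * (msh (k1 + k))%:R)))) Z (fun k => nlev (k1 + k)) M
     t0 tT' (fun _ _ _ => erefl) (fun k => nlev_gt0 _ _) ninf (fun k => mpsi _ _ _ (measurable_itv _)) HM' cz' mesZ.
  split => //.
  - have fn := @integrable_fin_num _ _ _ mu _ _ _ iZ.
    have := fn (measurable_itv _).
    by rewrite fin_numElt => /andP[].
  - have cA : A p (k1 + k)%N t @[k --> \oo] --> Ai t.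
      have h : A p k t @[k --> \oo] --> Ai t.
        apply/cvgrPdist_le => e e0; have [k0 Hk0] := HA _ e0; exists k0 => // k /= kk.
        by rewrite distrC; exact: Hk0.
      by move: h; rewrite -(cvg_shiftn k1) => h; under eq_fun do rewrite addnC; exact: h.
    exact: (cvg_unique _ cA cvZ).
  - have mm : measurable (`[0, t]%classic `&` [set s | Z s = 0]).
      have -> : `[0, t]%classic `&` [set s | Z s = 0] =
          `[0, t]%classic `&` (`[0, T%:R]%classic `&` Z @^-1` [set 0]).
        apply/seteqP; split => s /=; rewrite !in_itv/=; last by case=> ? [].
        by move=> [/andP[s0 st] Zs]; rewrite s0 st (le_trans st).
      by apply: measurableI => //; exact: mesZ.
    have [N [mN N0 sN]] := ae1.
    apply/eqP; rewrite eq_le measure_ge0 andbT -N0; apply: le_measure; rewrite ?inE//.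
    move=> s [/= ]; rewrite in_itv/= => /andP[s0 st] Zs; apply: sN => /= H.
    have : 0 < Z s by apply: H; rewrite s0 (le_trans st).
    by rewrite Zs ltxx.
(* A negative value would, by continuity, spread to an interval of positive length contained in the
   null set where Z is not positive. *)
have pos (Z : R -> R) : {ae mu, forall s, 0 <= s <= T%:R -> 0 < Z s} -> modulus T%:R Z ->
   forall t, 0 <= t <= T%:R -> 0 <= Z t.
  move=> [N [mN N0 sN]] mZ t tT; have /andP[t0 tT'] := tT; rewrite leNgt; apply/negP => Zt.
  have Zt' : 0 < - Z t by rewrite oppr_gt0.
  have [r r0 Hr] := modulus_dist _ _ _ mZ _ Zt'.
  have T0' : 0 < T%:R :> R by rewrite ltr0n.
  pose l := Num.max 0 (t - r / 2); pose u := Num.min T%:R (t + r / 2).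
  have lu : l < u by rewrite /l /u lt_min !gt_max; apply/andP; split; apply/andP; split; lra.
  have sub : `[l, u]%classic `<=` N.
    move=> s /=; rewrite in_itv/= ge_max le_min => /andP[/andP[s0 sl] /andP[sT su]].
    apply: sN => /= H; have sT' : 0 <= s <= T%:R by rewrite s0.
    have ds : `|s - t| < r by rewrite ltr_norml; apply/andP; split; move: sl su r0; clear; lra.
    have h0 := H sT'; have := Hr s t sT' tT ds; rewrite ltr_norml => /andP[h1 h2].
    by move: h0 h2; clear; lra.
  have : (mu `[l, u]%classic <= mu N)%E by apply: le_measure; rewrite ?inE.
  by rewrite N0 lebesgue_measure_itv/= lte_fin lu -EFinB lee_fin subr_le0 leNgt lu.
have m1 t tT := main fst X AX t dint1 xs1 mX HAX tT.
have m2 t tT := main snd Y AY t dint2 xs2 mY HAY tT.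
split => //.
- by move=> t tT; rewrite XE// YE//; split; [exact: cX|exact: cY].
- move=> t tT; have [p1 _ _ _] := m1 t tT; have [p2 _ _ _] := m2 t tT.
  by split; [exact: pos p1 mX _ tT|exact: pos p2 mY _ tT].
- move=> t tT; have [_ i1 E1 z1] := m1 t tT; have [_ i2 E2 z2] := m2 t tT.
  split => //; first by rewrite -E1 -E2 XE.
  by rewrite -E1 -E2 YE.
Qed.

End path_limit.

(** * Pathwise uniqueness *)

Section uniqueness.
Variable R : realType.
Local Notation mu := (@lebesgue_measure R).

(** Let S be the set of times up to which P holds throughout. Its supremum belongs to it by the
    closure hypothesis, and the extension hypothesis leads beyond it, unless S is unbounded. *)
Lemma real_induction (P : R -> Prop) : P 0 ->
  (forall t, 0 <= t -> (forall u, 0 <= u <= t -> P u) ->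
     exists2 r, 0 < r & forall u, t <= u <= t + r -> P u) ->
  (forall t, 0 < t -> (forall u, 0 <= u < t -> P u) -> P t) ->
  forall t, 0 <= t -> P t.
Proof.
move=> P0 step lim t t0; apply: contrapT => nPt.
pose S := [set s | 0 <= s /\ forall u, 0 <= u <= s -> P u].
have S0 : S 0.
  by split=> // u /andP[u0 u0']; have -> : u = 0 by apply/eqP; rewrite eq_le u0 u0'.
have ubS : ubound S t.
  move=> s [s0 Hs]; rewrite leNgt; apply/negP => ts; apply: nPt; apply: Hs.
  by rewrite t0 ltW.
have hS : has_sup S by split; [exists 0|exists t].
have s0 : 0 <= sup S by apply: ub_le_sup => //; exists t.
have Plt u : 0 <= u < sup S -> P u.
  move=> /andP[u0 us]; have e0 : 0 < sup S - u by rewrite subr_gt0.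
  have [s [_ Hs]] := sup_adherent e0 hS; rewrite opprB addrC subrK => us'.
  by apply: Hs; rewrite u0 ltW.
have Ps : forall u, 0 <= u <= sup S -> P u.
  move=> u /andP[u0]; rewrite le_eqVlt => /orP[/eqP us|us]; last by apply: Plt; rewrite u0.
  move: u0; rewrite le_eqVlt => /orP[/eqP <-//|u0]; apply: lim => // v; rewrite us; exact: Plt.
have [r r0 Hr] := step _ s0 Ps.
suff : sup S + r <= sup S by lra.
apply: ub_le_sup; first by exists t.
split; first by rewrite addr_ge0// ltW.
move=> u /andP[u0 ur]; have [us|su] := leP u (sup S); first by apply: Ps; rewrite u0.
by apply: Hr; rewrite ur ltW.
Qed.

Definition inv_real (f : R -> R) (t : R) : R := fine (inv_int f t).

Lemma inv_int_integrable (f : R -> R) (t T : R) : 0 <= t -> t <= T -> modulus T f ->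
  (forall s, 0 <= s -> 0 <= f s) ->
  (inv_int f t < +oo)%E -> mu.-integrable `[0, t]%classic (EFin \o (fun s => (f s)^-1)).
Proof.
move=> t0 tT mf f0 fin; apply/integrableP.
have mi : measurable_fun `[0, t]%classic (EFin \o (fun s => (f s)^-1)).
  apply/measurable_EFinP; apply: (@measurable_funS _ _ _ _ `[0, T]%classic) => //.
    by apply: subset_itvl; rewrite bnd_simp.
  by apply: measurableT_comp (modulus_measurable _ _ _ mf); exact: measurable_inv.
split => //; apply: le_lt_trans fin; rewrite /inv_int.
rewrite le_eqVlt; apply/orP; left; apply/eqP; apply: eq_integral => s.
rewrite inE/= in_itv/= => /andP[s0 _]; rewrite ger0_norm// invr_ge0; exact: f0.
Qed.

Lemma inv_real_sub (f : R -> R) (s t T : R) : 0 <= s -> s <= t -> t <= T -> modulus T f ->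
  (forall s, 0 <= s -> 0 <= f s) -> (inv_int f t < +oo)%E ->
  inv_real f t - inv_real f s = \int[mu]_(x in `]s, t]) (f x)^-1
  /\ mu.-integrable `]s, t]%classic (EFin \o (fun s => (f s)^-1)).
Proof.
move=> s0 st tT mf f0 fin; have t0 := le_trans s0 st.
have i1 := inv_int_integrable _ _ _ t0 tT mf f0 fin.
split.
  rewrite -(@Rintegral_itvB R (fun x => (f x)^-1) (BLeft 0) (BRight t) s)//; rewrite ?bnd_simp//.
apply: (@integrableS _ _ _ mu `[0, t]%classic) => //.
by apply: subset_itvr; rewrite bnd_simp.
Qed.

(** The zeros of g form a null set and have to be discarded: there 0^-1 = 0 could reverse the
    inequality. *)
Lemma inv_real_mono (f g : R -> R) (s t T : R) : 0 <= s -> s <= t -> t <= T ->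
  modulus T f -> modulus T g ->
  (forall s, 0 <= s -> 0 <= f s) -> (forall s, 0 <= s -> 0 <= g s) ->
  (inv_int f t < +oo)%E -> (inv_int g t < +oo)%E ->
  mu (`[0, t]%classic `&` [set s | g s = 0]) = 0%E ->
  (forall u, s < u <= t -> g u <= f u) ->
  inv_real f t - inv_real f s <= inv_real g t - inv_real g s.
Proof.
move=> s0 st tT mf mg f0 g0 ff fg gz gf.
have [-> i1] := inv_real_sub _ _ _ _ s0 st tT mf f0 ff.
have [-> i2] := inv_real_sub _ _ _ _ s0 st tT mg g0 fg.
have m0 : measurable (`]s, t]%classic : set R) by [].
have u0 (u : R) : `]s, t]%classic u -> 0 <= u.
  by rewrite /= in_itv/= => /andP[su _]; rewrite (le_trans s0)// ltW.
apply: fine_le.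
- exact: (@integrable_fin_num _ _ _ mu _ _ _ i1).
- exact: (@integrable_fin_num _ _ _ mu _ _ _ i2).
apply: ae_ge0_le_integral => //.
- by move=> u /u0 hu; rewrite lee_fin invr_ge0 f0.
- by case/integrableP: i1.
- by move=> u /u0 hu; rewrite lee_fin invr_ge0 g0.
- by case/integrableP: i2.
exists (`[0, t]%classic `&` [set s | g s = 0]); split => //.
  have -> : `[0, t]%classic `&` [set s | g s = 0] =
      `[0, t]%classic `&` (`[0, T]%classic `&` g @^-1` [set 0]).
    apply/seteqP; split => u /=; rewrite !in_itv/=; last by case=> ? [].
    by move=> [/andP[u00 ut] Zs]; rewrite u00 ut (le_trans ut).
  by apply: measurableI => //; exact: (modulus_measurable _ _ _ mg).
move=> u /= /not_implyP[/= ust /negP]; rewrite lee_fin -ltNge => h.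
have ust' : s < u <= t by move: ust; rewrite in_itv.
have /andP[su ut] := ust'; have u00 : 0 <= u by rewrite (le_trans s0)// ltW.
rewrite in_itv/= u00 ut; split => //; apply/eqP; apply: contraT => gu.
have gu0 : 0 < g u by rewrite lt_neqAle eq_sym gu g0.
have := gf _ ust' => gfu.
by move: h; rewrite ltNge lef_pV2 ?posrE ?gfu// (lt_le_trans gu0).
Qed.

Lemma inv_real_lip (f g : R -> R) (s t T kap M : R) : 0 <= s -> s <= t -> t <= T ->
  modulus T f -> modulus T g -> 0 < kap ->
  (forall s, 0 <= s -> 0 <= f s) -> (forall s, 0 <= s -> 0 <= g s) ->
  (inv_int f t < +oo)%E -> (inv_int g t < +oo)%E ->
  (forall u, s <= u <= t -> kap <= f u /\ kap <= g u) ->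
  (forall u, s <= u <= t -> `|f u - g u| <= M) ->
  `|(inv_real f t - inv_real f s) - (inv_real g t - inv_real g s)| <= kap ^- 2 * M * (t - s).
Proof.
move=> s0 st tT mf mg kap0 f0 g0 ff fg hk hM.
have [-> i1] := inv_real_sub _ _ _ _ s0 st tT mf f0 ff.
have [-> i2] := inv_real_sub _ _ _ _ s0 st tT mg g0 fg.
have m0 : measurable (`]s, t]%classic : set R) by [].
have M0 : 0 <= M by apply: le_trans (hM s _) => //; rewrite lexx.
rewrite -RintegralB//.
have bd (u : R) : `]s, t]%classic u -> `|(f u)^-1 - (g u)^-1| <= kap ^- 2 * M.
  rewrite /= in_itv/= => /andP[su ut]; have ust : s <= u <= t by rewrite ut ltW.
  have [k1 k2] := hk _ ust; have fu0 := lt_le_trans kap0 k1; have gu0 := lt_le_trans kap0 k2.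
  have -> : (f u)^-1 - (g u)^-1 = (f u * g u)^-1 * (g u - f u) by field; rewrite !gt_eqF.
  rewrite normrM distrC gtr0_norm ?invr_gt0 ?mulr_gt0//; apply: ler_pM => //.
  - by rewrite invr_ge0 mulr_ge0// ltW.
  - rewrite lef_pV2 ?posrE ?exprn_gt0 ?mulr_gt0// expr2; apply: ler_pM => //; exact: ltW.
  - exact: hM.
have iB : mu.-integrable `]s, t]%classic (EFin \o (fun u => (f u)^-1 - (g u)^-1)).
  apply: (@bounded_itv_integrable R _ _ s t (kap ^- 2 * M)) => //.
    by apply: subset_itvr; rewrite bnd_simp.
  apply: measurable_funB; [case/integrableP: i1 => /measurable_EFinP//|case/integrableP: i2 => /measurable_EFinP//].
apply: (le_trans (@le_normr_Rintegral _ _ _ mu _ _ _ iB)) => //.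
have K0 : 0 <= kap ^- 2 * M by rewrite mulr_ge0// invr_ge0 exprn_ge0// ltW.
apply: (@le_trans _ _ (\int[mu]_(x in `]s, t]) (kap ^- 2 * M))).
  apply: le_Rintegral => //; first exact: (@integrable_norm _ _ _ mu _ _ iB).
  apply: (@bounded_itv_integrable R (cst (kap ^- 2 * M)) _ s t (kap ^- 2 * M)) => //.
    by apply: subset_itvr; rewrite bnd_simp.
  by move=> u _; rewrite /= ger0_norm.
rewrite Rintegral_cst//.
have -> : fine (mu (`]s, t]%classic : set R)) = t - s; last by [].
rewrite lebesgue_measure_itv/= lte_fin; case: ltP => [_|ts]; first by rewrite -EFinB.
by have -> : t = s; [apply/eqP; rewrite eq_le st ts|rewrite subrr].
Qed.

End uniqueness.

Section uniqueness2.
Variable R : realType.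
Local Notation mu := (@lebesgue_measure R).
Local Notation hcont f := ({within `[0, +oo[%classic, continuous f}).

Definition path_sol (al be ga de : R) (b c X Y : R -> R) : Prop :=
  forall t : R, 0 <= t ->
    [/\ mu ((`[0, t]%classic) `&` [set s | X s = 0]) = 0%E,
        mu ((`[0, t]%classic) `&` [set s | Y s = 0]) = 0%E,
        (inv_int X t < +oo)%E /\ (inv_int Y t < +oo)%E,
        X t = X 0 + b t + al * fine (inv_int X t) + be * fine (inv_int Y t)
      & Y t = Y 0 + c t + ga * fine (inv_int X t) + de * fine (inv_int Y t)].

Lemma path_sol_swap al be ga de b c X Y :
  path_sol al be ga de b c X Y -> path_sol de ga be al c b Y X.
Proof.
move=> H t t0; have [h1 h2 [h3 h4] h5 h6] := H t t0; split => //.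
  by rewrite {1}h6; ring.
by rewrite {1}h5; ring.
Qed.

(** Applied to the difference of two solutions, it yields an interval ending at u on which they are
    strictly ordered, so that their 1/X integrals can be compared. *)
Lemma last_nonpos (f : R -> R) (s u : R) : hcont f -> 0 <= s -> s <= u -> f s <= 0 -> 0 < f u ->
  exists2 v, s <= v <= u & f v <= 0 /\ forall w, v < w <= u -> 0 < f w.
Proof.
move=> /within_halfline_epsP cf s0 su fs fu.
pose S := [set v | s <= v <= u /\ f v <= 0].
have Ss : S s by split => //; rewrite lexx.
have ubS : ubound S u by move=> v [/andP[]].
have hS : has_sup S by split; [exists s|exists u].
have sS : s <= sup S by apply: ub_le_sup => //; exists u.
have Su : sup S <= u by apply: ge_sup => //; exists s.
have S0 := le_trans s0 sS.
exists (sup S); first by rewrite sS.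
split.
  rewrite leNgt; apply/negP => fS.
  have [r r0 Hr] := cf _ S0 _ fS.
  have [v [/andP[sv vu] fv]] := sup_adherent r0 hS => vS.
  have vs : v <= sup S by apply: ub_le_sup; [exists u|split => //; rewrite sv].
  have := Hr v (le_trans s0 sv); rewrite ger0_norm ?subr_ge0// => /(_ _)/Wrap[|].
    by lra.
  by rewrite ltr_norml; lra.
move=> w /andP[Sw wu]; rewrite ltNge; apply/negP => fw.
suff : w <= sup S by lra.
apply: ub_le_sup; first by exists u.
by split => //; rewrite wu (le_trans sS)// ltW.
Qed.

Lemma hcontB (f g : R -> R) : hcont f -> hcont g -> hcont (fun t => f t - g t).
Proof.
move=> cf cg; apply: modulus_within => T.
have := @modulus_lin R T%:R 0 0 (-1) 0 f g g (within_modulus _ _ _ cf) (within_modulus _ _ _ cg)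
  (within_modulus _ _ _ cg).
move=> H e e0; have [r r0 Hr] := H e e0; exists r => // s t s0 st tT ts.
by have := Hr _ _ s0 st tT ts; rewrite !mulN1r !mul0r !addr0 !add0r !subr0.
Qed.

(** On a short interval where Y and Y' stay above kap, a bound M of |Y - Y'| improves to M / 2. The
    difference D of the first coordinates is controlled although 1/X may be singular, since that
    term always pushes D back to 0. The combination al E - ga D contains only the integral of 1/Y -
    1/Y', which is Lipschitz in E = Y - Y'. *)
Lemma uniq_local (al be ga de : R) (b c X Y X' Y' : R -> R) (s0 : R) :
  0 < al -> hcont X -> hcont Y -> hcont X' -> hcont Y' ->
  (forall s, 0 <= s -> 0 <= X s) -> (forall s, 0 <= s -> 0 <= Y s) ->
  (forall s, 0 <= s -> 0 <= X' s) -> (forall s, 0 <= s -> 0 <= Y' s) ->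
  path_sol al be ga de b c X Y -> path_sol al be ga de b c X' Y' ->
  X 0 = X' 0 -> Y 0 = Y' 0 ->
  0 <= s0 -> X s0 = X' s0 -> Y s0 = Y' s0 -> 0 < Y s0 ->
  exists2 r, 0 < r & forall u, s0 <= u <= s0 + r -> X u = X' u /\ Y u = Y' u.
Proof.
move=> al0 cX cY cX' cY' pX pY pX' pY' sol sol' eX0 eY0 s00 eX eY Ys.
pose kap := Y s0 / 2; have kap0 : 0 < kap by rewrite divr_gt0.
pose L := kap ^- 2; have L0 : 0 < L by rewrite invr_gt0 exprn_gt0.
(* The first summand comes from [al * E - ga * D], the second from the bound of D. The length r
   below makes [W * r] at most al / 2. *)
pose W := (`|al * de - ga * be| + `|ga| * `|be|) * L.
have W0 : 0 <= W by rewrite mulr_ge0 ?(ltW L0)// addr_ge0// mulr_ge0.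
pose e := Num.min kap 2^-1.
have e0 : 0 < e by rewrite lt_min kap0/= invr_gt0.
have [r1 r10 H1] := (within_halfline_epsP _ _).1 cY s0 s00 e e0.
have [r2 r20 H2] := (within_halfline_epsP _ _).1 cY' s0 s00 e e0.
have r30 : 0 < al / (2 * (W + 1)) by rewrite divr_gt0// mulr_gt0//; lra.
pose r := Num.min (Num.min (r1 / 2) (r2 / 2)) (al / (2 * (W + 1))).
have r0 : 0 < r by rewrite !lt_min r30 !divr_gt0.
exists r => //.
have rr1 : r < r1.
  apply: (@le_lt_trans _ _ (r1 / 2)); last by move: r10; clear; lra.
  by rewrite /r !ge_min lexx.
have rr2 : r < r2.
  apply: (@le_lt_trans _ _ (r2 / 2)); last by move: r20; clear; lra.
  by rewrite /r !ge_min lexx !orbT.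
have Wr : W * r <= al / 2.
  have h : r <= al / (2 * (W + 1)) by rewrite /r ge_min lexx orbT.
  apply: (@le_trans _ _ ((W + 1) * (al / (2 * (W + 1))))).
    by apply: ler_pM => //; [exact: ltW|move: W0; clear; lra].
  by rewrite le_eqVlt; apply/orP; left; apply/eqP; field; rewrite gt_eqF//; move: W0; clear; lra.
have rng u : s0 <= u <= s0 + r -> [/\ 0 <= u, kap <= Y u, kap <= Y' u & `|Y u - Y' u| <= 1].
  move=> /andP[su ur]; have u0 := le_trans s00 su.
  have n1 : `|s0 - u| < r1.
    by rewrite distrC ger0_norm ?subr_ge0//; move: ur rr1; clear; lra.
  have n2 : `|s0 - u| < r2.
    by rewrite distrC ger0_norm ?subr_ge0//; move: ur rr2; clear; lra.
  have := H1 u u0 n1; have := H2 u u0 n2; rewrite -eY /e !lt_min.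
  move=> /andP[a1 a2] /andP[a3 a4]; move: a1 a3; rewrite !ltr_norml => a1 a3.
  split => //; rewrite /kap in a1 a3 *; first by move: a3; clear; lra.
    by move: a1; clear; lra.
  have -> : Y u - Y' u = (Y s0 - Y' u) - (Y s0 - Y u) by ring.
  by apply: le_trans (ler_normB _ _) _; move: a2 a4; clear; lra.
pose D u := X u - X' u; pose E u := Y u - Y' u.
have cD : hcont D by exact: hcontB.
have cD' : hcont (fun u => X' u - X u) by exact: hcontB.
pose T := s0 + r.
have mX := within_modulus _ _ T cX; have mY := within_modulus _ _ T cY.
have mX' := within_modulus _ _ T cX'; have mY' := within_modulus _ _ T cY'.
pose IX s u := (inv_real _ X u - inv_real _ X s) - (inv_real _ X' u - inv_real _ X' s).
pose IY s u := (inv_real _ Y u - inv_real _ Y s) - (inv_real _ Y' u - inv_real _ Y' s).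
have dD s u : 0 <= s -> s <= u -> D u - D s = al * IX s u + be * IY s u.
  move=> h1 h2; have u0 := le_trans h1 h2; rewrite /D /IX /IY /inv_real.
  have [_ _ _ -> _] := sol _ u0; have [_ _ _ -> _] := sol _ h1.
  have [_ _ _ -> _] := sol' _ u0; have [_ _ _ -> _] := sol' _ h1; ring.
have dE s u : 0 <= s -> s <= u -> E u - E s = ga * IX s u + de * IY s u.
  move=> h1 h2; have u0 := le_trans h1 h2; rewrite /E /IX /IY /inv_real.
  have [_ _ _ _ ->] := sol _ u0; have [_ _ _ _ ->] := sol _ h1.
  have [_ _ _ _ ->] := sol' _ u0; have [_ _ _ _ ->] := sol' _ h1; ring.
have Ds0 : D s0 = 0 by rewrite /D eX subrr.
have Es0 : E s0 = 0 by rewrite /E eY subrr.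
have IYb M s u : (forall u, s0 <= u <= s0 + r -> `|E u| <= M) -> s0 <= s -> s <= u -> u <= s0 + r ->
    `|IY s u| <= L * M * r.
  move=> HM s0s su uT; have s0' := le_trans s00 s0s; have u0 := le_trans s0' su.
  have M0 : 0 <= M by apply: le_trans (HM s0 _) => //; rewrite lexx lerDl ltW.
  apply: (@le_trans _ _ (L * M * (u - s))).
    have [_ _ [_ f1] _ _] := sol _ u0; have [_ _ [_ f2] _ _] := sol' _ u0.
    apply: (@inv_real_lip R Y Y' s u T kap M) => //.
    - move=> v /andP[v1 v2]; have [|_ ? ? _] := rng v; last by [].
      by rewrite (le_trans s0s v1) (le_trans v2).
    - by move=> v /andP[v1 v2]; apply: HM; rewrite (le_trans s0s v1) (le_trans v2).
  apply: ler_wpM2l; first by rewrite mulr_ge0// ltW.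
  by move: uT s0s; clear; lra.
have Dup M u : (forall u, s0 <= u <= s0 + r -> `|E u| <= M) -> s0 <= u <= s0 + r ->
   `|D u| <= `|be| * (L * M * r).
  move=> HM /andP[su uT]; have u0 := le_trans s00 su.
  have bI s : s0 <= s -> s <= u -> `|be * IY s u| <= `|be| * (L * M * r).
    by move=> h1 h2; rewrite normrM ler_wpM2l//; apply: IYb.
  have [_ _ [fX _] _ _] := sol _ u0; have [_ _ [fX' _] _ _] := sol' _ u0.
  have [zX _ _ _ _] := sol _ u0; have [zX' _ _ _ _] := sol' _ u0.
  have R0 : 0 <= `|be| * (L * M * r) by apply: le_trans (bI s0 _ _).
  (* Since the last time v at which D vanished or had the opposite sign, X and X' are ordered, so
     the 1/X term pushes D towards 0 and only the [be] term can enlarge it. *)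
  have [Du|Du|Du] := ltgtP (D u) 0; last by rewrite Du normr0.
  - have [||v /andP[v1 v2] [v3 v4]] := last_nonpos _ s0 u cD' s00 su.
    + by rewrite eX subrr.
    + by move: Du; rewrite /D; clear; lra.
    have v0 := le_trans s00 v1.
    have mono : inv_real _ X' u - inv_real _ X' v <= inv_real _ X u - inv_real _ X v.
      apply: (@inv_real_mono R X' X v u T) => // w /v4; clear; lra.
    have := dD v u v0 v2; have := bI v v1 v2; rewrite ler_norml => /andP[q1 q2] q3.
    have q4 : 0 <= al * IX v u by rewrite mulr_ge0 ?(ltW al0)// /IX subr_ge0.
    rewrite ltr0_norm//; move: v3 q1 q3 q4; rewrite /D; clear; lra.
  - have [||v /andP[v1 v2] [v3 v4]] := last_nonpos _ s0 u cD s00 su.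
    + by rewrite Ds0.
    + by [].
    have v0 := le_trans s00 v1.
    have mono : inv_real _ X u - inv_real _ X v <= inv_real _ X' u - inv_real _ X' v.
      apply: (@inv_real_mono R X X' v u T) => // w /v4; rewrite /D; clear; lra.
    have := dD v u v0 v2; have := bI v v1 v2; rewrite ler_norml => /andP[q1 q2] q3.
    have q4 : al * IX v u <= 0 by rewrite mulr_ge0_le0 ?(ltW al0)// /IX subr_le0.
    rewrite gtr0_norm//; move: v3 q2 q3 q4; clear; lra.
have Eup M : (forall u, s0 <= u <= s0 + r -> `|E u| <= M) ->
   forall u, s0 <= u <= s0 + r -> `|E u| <= M / 2.
  move=> HM u su; have /andP[su1 su2] := su; have u0 := le_trans s00 su1.
  have M0 : 0 <= M by apply: le_trans (HM u su).
  have h1 := Dup _ _ HM su; have h2 := IYb _ s0 u HM (lexx _) su1 su2.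
  have eqE : al * E u = (al * de - ga * be) * IY s0 u + ga * D u.
    have := dE s0 u s00 su1; have := dD s0 u s00 su1; rewrite Ds0 Es0 !subr0 => -> ->; ring.
  have : al * `|E u| <= W * r * M.
    rewrite -{1}(gtr0_norm al0) -normrM eqE; apply: le_trans (ler_normD _ _) _.
    rewrite !normrM.
    have -> : W * r * M = `|al * de - ga * be| * (L * M * r) + `|ga| * (`|be| * (L * M * r)).
      by rewrite /W; ring.
    by apply: lerD; apply: ler_wpM2l.
  move=> h3; have h4 : W * r * M <= al / 2 * M by apply: ler_wpM2r.
  rewrite -(ler_pM2l al0); move: h3 h4; clear; lra.
have En n : forall u, s0 <= u <= s0 + r -> `|E u| <= 2^-1 ^+ n.
  elim: n => [|n IH] u su; first by rewrite expr0; have [] := rng u su.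
  by rewrite exprS mulrC; exact: Eup.
have Ez u : s0 <= u <= s0 + r -> `|E u| <= 0.
  move=> su; rewrite leNgt; apply/negP => E0.
  have [k Hk] : exists k : nat, `|E u|^-1 < k%:R.
    by exists (Num.truncn `|E u|^-1).+1; rewrite truncnS_gt.
  have := En k u su; apply/negP; rewrite -ltNge exprVn -[ltRHS]invrK ltf_pV2 ?posrE ?invr_gt0 ?exprn_gt0//.
  by apply: (lt_le_trans Hk); rewrite -natrX ler_nat ltnW// ltn_expl.
move=> u su; have := Ez u su; rewrite normr_le0 => /eqP Eu.
have := Dup 0 u Ez su; rewrite mulr0 mul0r mulr0 normr_le0 => /eqP Du.
by split; apply/eqP; rewrite -subr_eq0; apply/eqP.
Qed.

(** Avoidance of the corner passes from (X, Y) to (X', Y'), which coincides with it up to the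
    current time. Some coordinate is then positive, and [uniq_local] extends the coincidence, with
    exchanged roles if that coordinate is X. *)
Theorem path_uniq (al be ga de : R) (b c X Y X' Y' : R -> R) :
  0 < al -> 0 < de -> hcont X -> hcont Y -> hcont X' -> hcont Y' ->
  (forall s, 0 <= s -> 0 <= X s) -> (forall s, 0 <= s -> 0 <= Y s) ->
  (forall s, 0 <= s -> 0 <= X' s) -> (forall s, 0 <= s -> 0 <= Y' s) ->
  path_sol al be ga de b c X Y -> path_sol al be ga de b c X' Y' ->
  X 0 = X' 0 -> Y 0 = Y' 0 ->
  (forall t, 0 <= t -> ~ (X t = 0 /\ Y t = 0)) ->
  forall t, 0 <= t -> X t = X' t /\ Y t = Y' t.
Proof.
move=> al0 de0 cX cY cX' cY' pX pY pX' pY' sol sol' eX0 eY0 nz.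
apply: real_induction => // [t t0 H|t t0 H].
  have [e1 e2] : X t = X' t /\ Y t = Y' t by apply: H; rewrite t0 lexx.
  have [Yt|Yt] := ltP 0 (Y t).
    by apply: (@uniq_local al be ga de b c X Y X' Y' t).
  have Y0 : Y t = 0 by apply/eqP; rewrite eq_le Yt pY.
  have Xt : 0 < X t.
    rewrite lt_neqAle pX// andbT eq_sym; apply/eqP => X0; exact: (nz t t0).
  have [||r r0 Hr] := @uniq_local de ga be al c b Y X Y' X' t de0 cY cX cY' cX' pY pX pY' pX' _ _ eY0 eX0 t0 e2 e1 Xt.
  - exact: path_sol_swap.
  - exact: path_sol_swap.
  by exists r => // u /Hr[].
have lim (f g : R -> R) : hcont f -> hcont g -> (forall u, 0 <= u < t -> f u = g u) -> f t = g t.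
  move=> cf cg fg; have /within_halfline_epsP cfg := hcontB _ _ cf cg.
  apply/eqP; rewrite -subr_eq0; apply: contraT => ne.
  have n0 : 0 < `|f t - g t| by rewrite normr_gt0.
  have [r r0 Hr] := cfg t (ltW t0) _ n0.
  pose u := Num.max 0 (t - r / 2).
  have u0 : 0 <= u by rewrite le_max lexx.
  have ut : u < t by rewrite gt_max t0 /=; move: r0; clear; lra.
  have tu : `|t - u| < r.
    rewrite ger0_norm ?subr_ge0 ?ltW//.
    have : t - r / 2 <= u by rewrite le_max lexx orbT.
    by move: r0; clear; lra.
  have := Hr u u0 tu; rewrite (fg u) ?u0// subrr subr0 ltxx; by [].
by split; apply: lim => // u /H[].
Qed.

End uniqueness2.

(** * The algebraic corner condition *)

(** For Z = la X + mu Y the right side is Z times its drift and the left side is half the rate of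
    its quadratic variation. Strict positivity of both drift coefficients is what makes the drift
    large when a reciprocal is truncated. *)
Definition corner_cond {R : realType} (rho al be ga de la mu : R) : Prop :=
  [/\ 0 < la, 0 < mu, 0 < la * al + mu * ga, 0 < la * be + mu * de &
    forall x y, 0 < x -> 0 < y -> (la ^+ 2 + mu ^+ 2 + 2 * rho * la * mu) / 2 <=
      (la * x + mu * y) * ((la * al + mu * ga) / x + (la * be + mu * de) / y)].

Section corner_cond.
Variable R : realType.

(** Here w stands for any lower bound of the geometric mean, so the perturbation argument can use a
    convenient one. *)
Lemma amgm (P Q z w : R) : 0 <= P -> 0 <= Q -> 0 < z -> 0 <= w -> w ^+ 2 <= P * Q ->
  2 * w <= P * z + Q / z.
Proof.
move=> P0 Q0 z0 w0 wPQ.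
have s0 : 0 <= P * z + Q / z by rewrite addr_ge0// ?divr_ge0// ?mulr_ge0// ltW.
rewrite -(@ler_pXn2r R 2)// ?nnegrE ?mulr_ge0//.
have e : (P * z + Q / z) ^+ 2 = 4 * (P * Q) + (P * z - Q / z) ^+ 2.
  by field; rewrite gt_eqF.
have := sqr_ge0 (P * z - Q / z); rewrite e exprMn; lra.
Qed.

(** Expanding the product, the only part that depends on the point is la b (x / y) + mu a (y / x),
    to which [amgm] applies. *)
Lemma corner_of_amgm (rho al be ga de la mu w : R) :
  let a := la * al + mu * ga in let b := la * be + mu * de in
  0 < la -> 0 < mu -> 0 < a -> 0 < b -> 0 <= w -> w ^+ 2 <= (la * b) * (mu * a) ->
  (la ^+ 2 + mu ^+ 2 + 2 * rho * la * mu) / 2 <= la * a + mu * b + 2 * w ->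
  corner_cond rho al be ga de la mu.
Proof.
move=> a b la0 mu0 a0 b0 w0 wle q; split => // x y x0 y0; rewrite -/a -/b.
apply: (le_trans q).
have -> : (la * x + mu * y) * (a / x + b / y) = la * a + mu * b + ((la * b) * (x / y) + (mu * a) / (x / y)).
  by field; rewrite !gt_eqF.
rewrite lerD2l; apply: amgm => //; rewrite ?divr_gt0// mulr_ge0//; exact: ltW.
Qed.

(** Adding s^2 to mu makes the product of the coefficients in [amgm] at least of order s^2, so the
    bound gains a term of order s, while all losses, collected in K, are of order s^2. The
    hypothesis [0 < b + mu * de] guarantees the order of the gain. *)
Lemma corner_perturb (rho al be ga de la mu : R) :
  let a := la * al + mu * ga in let b := la * be + mu * de in
  -1 <= rho <= 1 -> 0 < de -> 0 < la -> 0 <= mu -> 0 < a -> 0 <= b -> 0 < b + mu * de ->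
  (la ^+ 2 + mu ^+ 2 + 2 * rho * la * mu) / 2 <= la * a + mu * b ->
  exists mu', corner_cond rho al be ga de la mu'.
Proof.
move=> a b /andP[rho1 rho2] de0 la0 mu0 a0 b0 bm q.
have g0 := normr_ge0 ga.
(* s^2 r^2 lies below the perturbed product: the new a is at least a / 2, whence the factor 1 / 2,
   and the new b times the new mu is at least s^2 (b + mu de). *)
pose r := Num.sqrt (la * a * (b + mu * de) / 2).
have r0 : 0 < r by rewrite sqrtr_gt0 divr_gt0// !mulr_gt0.
have r2 : r ^+ 2 = la * a * (b + mu * de) / 2.
  by rewrite sqr_sqrtr// divr_ge0// !mulr_ge0// ltW.
pose K := mu + 1 + la + la * `|ga|.
have lag : 0 <= la * `|ga| by rewrite mulr_ge0// ltW.
have K0 : 0 < K by rewrite /K; move: mu0 la0 lag; clear; lra.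
pose s := Num.min 1 (Num.min (a / (2 * (`|ga| + 1))) (r / K)).
have s0 : 0 < s.
  by rewrite !lt_min ltr01/= !divr_gt0// mulr_gt0//; move: g0; clear; lra.
have s1 : s <= 1 by rewrite ge_min lexx.
have s2 : s * (2 * (`|ga| + 1)) <= a.
  rewrite -ler_pdivlMr; first by rewrite !ge_min lexx orbT.
  by move: g0; clear; lra.
have s3 : s * K <= r by rewrite -ler_pdivlMr// !ge_min lexx !orbT.
have ss : s ^+ 2 <= s by rewrite expr2 ler_piMl// ltW.
have ss0 : 0 < s ^+ 2 by rewrite exprn_gt0.
exists (mu + s ^+ 2).
have sga : `|s ^+ 2 * ga| <= a / 2.
  rewrite normrM gtr0_norm//.
  have : s ^+ 2 * `|ga| <= s * `|ga| by rewrite ler_wpM2r.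
  move: s2 s0; clear; lra.
have aE : la * al + (mu + s ^+ 2) * ga = a + s ^+ 2 * ga by rewrite /a; ring.
have bE : la * be + (mu + s ^+ 2) * de = b + s ^+ 2 * de by rewrite /b; ring.
have sd : 0 < s ^+ 2 * de by rewrite mulr_gt0.
have a' : a / 2 <= a + s ^+ 2 * ga by move: sga; rewrite ler_norml; clear; lra.
apply: (@corner_of_amgm rho al be ga de la (mu + s ^+ 2) (s * r)); rewrite ?aE ?bE//.
- by move: mu0 ss0; clear; lra.
- by move: a' a0; clear; lra.
- by move: b0 sd; clear; lra.
- by rewrite mulr_ge0// ltW.
- rewrite exprMn r2.
  have -> : s ^+ 2 * (la * a * (b + mu * de) / 2) = la * (s ^+ 2 * (b + mu * de)) * (a / 2) by field.
  rewrite [leRHS]mulrA; apply: ler_pM => //.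
  + by rewrite !mulr_ge0// ltW.
  + by rewrite divr_ge0// ltW.
  + rewrite -mulrA ler_wpM2l ?(ltW la0)//.
    have -> : (b + s ^+ 2 * de) * (mu + s ^+ 2) = s ^+ 2 * (b + mu * de) + (b * mu + s ^+ 2 * s ^+ 2 * de) by ring.
    by rewrite lerDl addr_ge0// mulr_ge0// ?mulr_ge0// ltW.
- have p1 : s ^+ 2 * K <= s * r by rewrite expr2 -mulrA ler_wpM2l// ltW.
  have sr0 : 0 <= s * r by rewrite mulr_ge0// ltW.
  have p2 : s ^+ 2 * s ^+ 2 <= s ^+ 2 by rewrite ler_piMl ?(ltW ss0)//; move: ss s1; clear; lra.
  have p3 : rho * (la * s ^+ 2) <= la * s ^+ 2.
    by rewrite ler_piMl// mulr_ge0// ltW.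
  have p4 : - (s ^+ 2 * `|ga|) <= s ^+ 2 * ga.
    rewrite -mulrN ler_wpM2l ?(ltW ss0)//; have := ler_norm (- ga); rewrite normrN; clear; lra.
  have p5 : la * (- (s ^+ 2 * `|ga|)) <= la * (s ^+ 2 * ga) by rewrite ler_wpM2l// ltW.
  have p6 : 0 <= mu * (s ^+ 2 * de) by rewrite mulr_ge0// ltW.
  have p7 : 0 <= s ^+ 2 * b by rewrite mulr_ge0// ltW.
  have p8 : 0 <= s ^+ 2 * (s ^+ 2 * de) by rewrite mulr_ge0// ltW.
  move: p1 q; rewrite /K; set S := s ^+ 2 in p2 p3 p4 p5 p6 p7 p8 ss0 *.
  move: sr0 ss0 p2 p3 p5 p6 p7 p8; clear; move: (s * r) => w.
  rewrite !expr2 => *; lra.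
Qed.

(** C2a is the limiting case la = 1, mu = 0. In C3 the boundary case is that one drift coefficient
    vanishes; it is made positive by moving mu or, after an exchange of coordinates, la. Both cannot
    vanish, since [be] and [ga] would then be negative. *)
Lemma corner_cond_ex (rho al be ga de : R) :
  -1 <= rho <= 1 -> 0 < al -> 0 < de -> be * ga < 0 ->
  cond_C2a al be \/ cond_C3 rho al be ga de ->
  exists la mu, corner_cond rho al be ga de la mu.
Proof.
move=> rho1 al0 de0 bega [[a12 be0]|[la [mu [la0 mu0 a0 b0 q]]]].
  have be1 : 0 < be.
    by rewrite lt_neqAle be0 andbT eq_sym; apply/eqP => e; move: bega; rewrite e mul0r ltxx.
  have [||||mu' H] := @corner_perturb rho al be ga de 1 0 rho1 de0 ltr01 (lexx _).
  - by rewrite mul1r mul0r addr0.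
  - by rewrite mul1r mul0r addr0.
  - by rewrite mul1r mul0r !addr0.
  - by rewrite !mul0r !addr0 !mulr0 !mul1r !expr0n /= addr0 expr1n addr0; move: a12; clear; lra.
  by exists 1, mu'.
move: a0; rewrite le_eqVlt => /orP[/eqP a0|a0]; move: b0; rewrite le_eqVlt => /orP[/eqP b0|b0].
- have ga0 : ga < 0.
    rewrite ltNge; apply/negP => g; have : 0 < la * al by rewrite mulr_gt0.
    have : 0 <= mu * ga by rewrite mulr_ge0// ltW.
    by move: a0; clear; lra.
  have be0 : be < 0.
    rewrite ltNge; apply/negP => g; have : 0 < mu * de by rewrite mulr_gt0.
    have : 0 <= la * be by rewrite mulr_ge0// ltW.
    by move: b0; clear; lra.
  by move: bega; rewrite ltNge ltW// nmulr_rgt0.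
- have q' : (mu ^+ 2 + la ^+ 2 + 2 * rho * mu * la) / 2 <= mu * (mu * de + la * be) + la * (mu * ga + la * al).
    move: q; rewrite -a0 mulr0 sqrtr0 add0r sqr_sqrtr; last by rewrite mulr_ge0// ltW.
    have -> : mu * ga + la * al = 0 by rewrite addrC.
    by rewrite mulr0 addr0 (addrC (mu * de)) (addrC (mu ^+ 2)) (mulrAC (2 * rho) mu).
  have [|||la' [h1 h2 h3 h4 h5]] := @corner_perturb rho de ga be al mu la rho1 al0 mu0 (ltW la0) _ _ _ q'.
  - by rewrite addrC.
  - by rewrite addrC -a0.
  - by rewrite (addrC (mu * ga)) -a0 add0r mulr_gt0.
  exists la', mu; split => //; try by rewrite addrC.
  move=> x y x0 y0; have := h5 y x y0 x0.
  rewrite (addrC (mu * y)) (addrC _ (_ / x)) (addrC (mu * ga)) (addrC (mu * de)).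
  by rewrite (addrC (mu ^+ 2)) (mulrAC (2 * rho) mu).
- have [|||mu' H] := @corner_perturb rho al be ga de la mu rho1 de0 la0 (ltW mu0) a0.
  - by rewrite -b0.
  - by rewrite -b0 add0r mulr_gt0.
  - move: q; rewrite -b0 !mulr0 sqrtr0 !addr0 sqr_sqrtr//; by rewrite mulr_ge0// ltW.
  by exists la, mu'.
- exists la, mu; apply: (@corner_of_amgm rho al be ga de la mu
    (Num.sqrt (la * (la * al + mu * ga)) * Num.sqrt (mu * (la * be + mu * de)))) => //.
  + by rewrite exprMn !sqr_sqrtr ?mulr_ge0 ?(ltW la0) ?(ltW mu0) ?(ltW a0) ?(ltW b0)// le_eqVlt; apply/orP; left; apply/eqP; ring.
  + apply: (le_trans q); rewrite sqrrD !sqr_sqrtr ?mulr_ge0 ?(ltW la0) ?(ltW mu0) ?(ltW a0) ?(ltW b0)//.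
    by rewrite -mulr_natl le_eqVlt; apply/orP; left; apply/eqP; ring.
Qed.

End corner_cond.

(** * Moments of Brownian increments *)

Section trig.
Variable R : realType.

Lemma sin_mvt (x : R) : 0 < x -> exists2 c, 0 <= c <= x & sin x = cos c * x.
Proof.
move=> x0; have [|c] := @MVT_segment R sin cos 0 x (ltW x0) (fun y _ => is_derive_sin y).
  by apply: continuous_subspaceT; exact: continuous_sin.
by rewrite in_itv/= sin0 !subr0 => cx sE; exists c.
Qed.

Lemma sin_le_norm (x : R) : `|sin x| <= `|x|.
Proof.
wlog x0 : x / 0 < x.
  move=> H; have [x0|x0|->] := ltgtP x 0.
  - by have := H (- x); rewrite oppr_gt0 sinN !normrN => /(_ x0).
  - exact: H.
  - by rewrite sin0.
have [c _ ->] := sin_mvt _ x0; rewrite normrM ler_piMl//; exact: cos_max.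
Qed.

Lemma one_sub_cos (x : R) : 1 - cos x = 2 * sin (x / 2) ^+ 2.
Proof.
have -> : cos x = cos ((x / 2) *+ 2) by congr cos; rewrite -mulr_natr; field.
by rewrite cos_mulr2n cos2sin2 -mulr_natr; ring.
Qed.

Lemma sin_approx (x : R) : `|sin x - x| <= `|x| ^+ 3.
Proof.
wlog x0 : x / 0 < x.
  move=> H; have [x0|x0|->] := ltgtP x 0.
  - have := H (- x); rewrite oppr_gt0 sinN opprK normrN => /(_ x0).
    by rewrite addrC distrC.
  - exact: H.
  - by rewrite sin0 subrr normr0 expr0n.
have [c /andP[c0 cx] ->] := sin_mvt _ x0.
have -> : cos c * x - x = - ((1 - cos c) * x) by ring.
rewrite normrN normrM exprSr ler_wpM2r// one_sub_cos normrM normrX.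
have h : `|sin (c / 2)| <= x / 2.
  apply: (le_trans (sin_le_norm _)); rewrite ger0_norm ?divr_ge0//; lra.
have : `|sin (c / 2)| ^+ 2 <= (x / 2) ^+ 2 by rewrite lerXn2r// nnegrE divr_ge0// ltW.
rewrite (gtr0_norm x0) ger0_norm// expr_div_n; have := sqr_ge0 x; lra.
Qed.

Definition theta (n : nat) : R := n.+1%:R^-1.
Lemma theta_gt0 n : 0 < theta n. Proof. by rewrite invr_gt0 ltr0n. Qed.

Lemma theta_cvg : theta n @[n --> \oo] --> (0 : R).
Proof. exact: cvg_harmonic. Qed.

Lemma sin_theta_cvg (a : R) : sin (theta n * a) / theta n @[n --> \oo] --> a.
Proof.
have h : (fun n => `|a| ^+ 3 * theta n ^+ 2) @ \oo --> (0 : R).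
  rewrite -[X in _ --> X](mulr0 (`|a| ^+ 3)) -[X in _ * X](mulr0 (0 : R)).
  by apply: cvgMr; apply: cvgM; exact: theta_cvg.
apply/cvgrPdist_le => e e0; move/cvgrPdist_le : h => /(_ e e0).
apply: filterS => n /=; rewrite sub0r normrN => h; apply: le_trans h.
have t0 := theta_gt0 n.
have -> : a - sin (theta n * a) / theta n = - ((sin (theta n * a) - theta n * a) / theta n).
  by field; rewrite gt_eqF.
rewrite normrN normrM normfV (gtr0_norm t0) ler_pdivrMr//.
apply: (le_trans (sin_approx _)); rewrite normrM (gtr0_norm t0) exprMn.
rewrite [X in _ <= X * _]ger0_norm; last by rewrite mulr_ge0 ?exprn_ge0 ?(ltW t0).
by rewrite le_eqVlt; apply/orP; left; apply/eqP; ring.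
Qed.

(** The second difference quotient at 0. By [cos_theta_bound] it stays between 0 and its limit,
    which suits both Fatou and dominated convergence. *)
Lemma cos_theta_cvg (a : R) : 2 * (1 - cos (theta n * a)) / theta n ^+ 2 @[n --> \oo] --> a ^+ 2.
Proof.
have h := sin_theta_cvg (a / 2); have h2 := cvgM h h.
have -> : (fun n => 2 * (1 - cos (theta n * a)) / theta n ^+ 2) =
   (fun n => 4 * (sin (theta n * (a / 2)) / theta n * (sin (theta n * (a / 2)) / theta n))).
  apply/funext => n; rewrite one_sub_cos -[theta n * a / 2]mulrA.
  by field; rewrite gt_eqF// theta_gt0.
have -> : a ^+ 2 = 4 * (a / 2 * (a / 2)) by field.
by apply: cvgMr; exact: h2.
Qed.

Lemma cos_theta_bound (a : R) n :
  0 <= 2 * (1 - cos (theta n * a)) / theta n ^+ 2 <= a ^+ 2.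
Proof.
have t0 := theta_gt0 n; rewrite one_sub_cos; apply/andP; split.
  apply: divr_ge0; last by apply: exprn_ge0; exact: ltW.
  by apply: mulr_ge0 => //; apply: mulr_ge0 => //; exact: sqr_ge0.
rewrite ler_pdivrMr ?exprn_gt0//.
have h := sin_le_norm (theta n * a / 2).
have : `|sin (theta n * a / 2)| ^+ 2 <= `|theta n * a / 2| ^+ 2 by rewrite lerXn2r// nnegrE.
rewrite !real_normK ?num_real//.
have -> : (theta n * a / 2) ^+ 2 = a ^+ 2 * theta n ^+ 2 / 4 by field.
lra.
Qed.

End trig.
Arguments theta {R}.

Definition itg {d} {T : measurableType d} {R : realType} (P : probability T R) (X : T -> R) : Prop :=
  P.-integrable setT (EFin \o X).
Definition Ex {d} {T : measurableType d} {R : realType} (P : probability T R) (X : T -> R) : R :=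
  \int[P]_w X w.

Section expectation.
Context (d : measure_display) (T : measurableType d) (R : realType) (P : probability T R).
Local Notation itg := (itg P).
Local Notation Ex := (Ex P).
Local Notation meas := (measurable_fun [set: T]).
Implicit Types X Y xi : T -> R.

Lemma itg_meas X : itg X -> meas X.
Proof. by case/integrableP => /measurable_EFinP. Qed.

Lemma itg_bd X (M : R) : meas X -> (forall w, `|X w| <= M) -> itg X.
Proof.
move=> mX XM; apply: measurable_bounded_integrable => //.
  by apply: (le_lt_trans (probability_le1 P measurableT)); exact: ltry.
exists M; split; first exact: num_real.
by move=> x Mx y _; apply: le_trans (XM y) _; exact: ltW.
Qed.

Lemma itg_le X Y : meas X -> itg Y -> (forall w, `|X w| <= Y w) -> itg X.
Proof.
move=> mX iY XY; apply: (@le_integrable _ _ _ P setT _ (EFin \o X) (EFin \o Y)) => //.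
  exact/measurable_EFinP.
by move=> w _ /=; rewrite lee_fin; apply: le_trans (XY w) _; exact: ler_norm.
Qed.

Lemma itgD X Y : itg X -> itg Y -> itg (fun w => X w + Y w).
Proof. by move=> iX iY; have := integrableD measurableT iX iY; apply: eq_integrable. Qed.

Lemma itgZ (k : R) X : itg X -> itg (fun w => k * X w).
Proof. by move=> iX; have := integrableZl measurableT k iX; apply: eq_integrable. Qed.

Lemma itgB X Y : itg X -> itg Y -> itg (fun w => X w - Y w).
Proof. by move=> iX iY; have := integrableB measurableT iX iY; apply: eq_integrable. Qed.

Lemma itg_norm X : itg X -> itg (fun w => `|X w|).
Proof. exact: integrable_norm. Qed.

Lemma itg_cst (k : R) : itg (fun=> k).
Proof. by apply: (itg_bd _ `|k|) => // w. Qed.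

Lemma itgM xi X (M : R) : meas xi -> (forall w, `|xi w| <= M) -> itg X -> itg (fun w => xi w * X w).
Proof.
move=> mxi xiM iX; apply: (itg_le _ (fun w => M * `|X w|)).
- by apply: measurable_funM => //; exact: itg_meas.
- by apply: itgZ; exact: itg_norm.
- by move=> w; rewrite normrM ler_wpM2r.
Qed.

Lemma itg_sum (I : Type) (r : seq I) (F : I -> T -> R) :
  (forall i, itg (F i)) -> itg (fun w => \sum_(i <- r) F i w).
Proof.
move=> iF; elim: r => [|i r IH].
  rewrite (_ : (fun _ => _) = fun=> 0); first exact: itg_cst.
  by apply/funext => w; rewrite big_nil.
rewrite (_ : (fun _ => _) = fun w => F i w + \sum_(j <- r) F j w); first exact: itgD.
by apply/funext => w; rewrite big_cons.
Qed.

Lemma ExD X Y : itg X -> itg Y -> Ex (fun w => X w + Y w) = Ex X + Ex Y.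
Proof. by move=> iX iY; exact: RintegralD. Qed.
Lemma ExB X Y : itg X -> itg Y -> Ex (fun w => X w - Y w) = Ex X - Ex Y.
Proof. by move=> iX iY; exact: RintegralB. Qed.
Lemma ExZ (k : R) X : itg X -> Ex (fun w => k * X w) = k * Ex X.
Proof. by move=> iX; exact: RintegralZl. Qed.
Lemma Ex_le X Y : itg X -> itg Y -> (forall w, X w <= Y w) -> Ex X <= Ex Y.
Proof. by move=> iX iY XY; exact: le_Rintegral. Qed.
Lemma Ex_cst (k : R) : Ex (fun=> k) = k.
Proof.
have := @Rintegral_cst _ _ _ P setT measurableT k; rewrite /Ex => ->.
rewrite (_ : fine _ = 1) ?mulr1//; exact: (congr1 fine (probability_setT P)).
Qed.
Lemma Ex_ge0 X : (forall w, 0 <= X w) -> 0 <= Ex X.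
Proof. by move=> X0; apply: Rintegral_ge0. Qed.
Lemma Ex_norm X : itg X -> `|Ex X| <= Ex (fun w => `|X w|).
Proof. by move=> iX; exact: le_normr_Rintegral. Qed.
Lemma Ex_EFin X : itg X -> (\int[P]_w (X w)%:E = (Ex X)%:E)%E.
Proof. by move=> iX; rewrite /Ex /Rintegral fineK//; exact: integrable_fin_num. Qed.
Lemma eq_Ex X Y : (forall w, X w = Y w) -> Ex X = Ex Y.
Proof. by move=> XY; congr Ex; apply/funext. Qed.

Lemma Ex_sum (I : Type) (r : seq I) (F : I -> T -> R) :
  (forall i, itg (F i)) -> Ex (fun w => \sum_(i <- r) F i w) = \sum_(i <- r) Ex (F i).
Proof.
move=> iF; elim: r => [|i r IH].
  by rewrite big_nil -[RHS](Ex_cst 0); apply: eq_Ex => w; rewrite big_nil.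
rewrite big_cons -IH -ExD//; last exact: itg_sum.
by apply: eq_Ex => w; rewrite big_cons.
Qed.

(** Integrability of the limit is part of the conclusion: this is how moments are first shown to
    exist. *)
Lemma Ex_fatou (f : nat -> T -> R) X (M : R) : (forall n, meas (f n)) ->
  (forall n w, 0 <= f n w) -> (forall n, Ex (f n) <= M) -> (forall n, itg (f n)) ->
  (forall w, f n w @[n --> \oo] --> X w) -> itg X /\ Ex X <= M.
Proof.
move=> mf f0 fM fi fX.
have X0 w : 0 <= X w.
  have -> : X w = limn (f ^~ w) by apply/esym/cvg_lim => //; exact: fX.
  by apply: limr_ge; [apply/cvg_ex; exists (X w); exact: fX|apply: nearW => n; exact: f0].
have mX : meas X.
  by apply: (@measurable_fun_cvg _ T R setT f X) => // w _; exact: fX.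
have fat : (\int[P]_w (X w)%:E <= M%:E)%E.
  have := @fatou _ T R P setT measurableT (fun n w => (f n w)%:E).
  move=> /(_ _ _)/Wrap[||].
  - by move=> n; apply/measurable_EFinP.
  - by move=> n w _; rewrite lee_fin.
  have -> : (\int[P]_w limn_einf ((fun n w => (f n w)%:E) ^~ w) = \int[P]_w (X w)%:E)%E.
    apply: eq_integral => w _.
    suff cv : ((f n w)%:E @[n --> \oo] --> (X w)%:E)%E by rewrite (cvg_limn_einf_sup cv).
    by apply: cvg_EFin; [exact: nearW|exact: fX].
  move=> /le_trans; apply; rewrite limn_einf_lim.
  apply: lime_le; first exact: is_cvg_einfs.
  apply: nearW => n; apply: (@le_trans _ _ (\int[P]_x (f n x)%:E)%E).
    by apply: ereal_inf_lbound; exists n => /=.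
  by rewrite Ex_EFin// lee_fin.
have iX : itg X.
  apply/integrableP; split; first exact/measurable_EFinP.
  rewrite (eq_integral (EFin \o X)); first by apply: le_lt_trans fat _; exact: ltry.
  by move=> w _ /=; rewrite ger0_norm.
by split => //; rewrite -lee_fin -Ex_EFin.
Qed.

Lemma Ex_dominated (f : nat -> T -> R) X G (l : R) : (forall n, meas (f n)) ->
  itg G -> (forall n w, `|f n w| <= G w) ->
  (forall w, f n w @[n --> \oo] --> X w) -> Ex (f n) @[n --> \oo] --> l -> itg X /\ Ex X = l.
Proof.
move=> mf iG fG fX fl.
have mX : meas X by apply: (@measurable_fun_cvg _ T R setT f X) => // w _; exact: fX.
have [] := @dominated_convergence _ T R P setT measurableT (fun n w => (f n w)%:E)
  (EFin \o X) (EFin \o G) _ _ _ iG _.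
- by move=> n; apply/measurable_EFinP.
- exact/measurable_EFinP.
- by apply: aeW => w _; apply: cvg_EFin; [exact: nearW|exact: fX].
- by apply: aeW => w n _; rewrite lee_fin.
move=> iX _ cv; split => //.
move: cv; rewrite Ex_EFin// => /fine_cvg cv; exact: (cvg_unique _ cv fl).
Qed.

End expectation.

Section moments.
Context (d : measure_display) (T : measurableType d) (R : realType) (P : probability T R).
Local Notation itg := (itg P).
Local Notation Ex := (Ex P).
Local Notation meas := (measurable_fun [set: T]).
Implicit Types X Y xi : T -> R.

Lemma sub_meas_meas (G : set (set T)) X : G `<=` measurable -> sub_meas G X -> meas X.
Proof. by move=> Gm GX _ A mA; rewrite setTI; apply: Gm; exact: GX. Qed.

Lemma Ex_indic X (A : set T) : measurable A -> itg X ->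
  (\int[P]_(w in A) (X w)%:E = (Ex (fun w => \1_A w * X w))%:E)%E.
Proof.
move=> mA iX; have i1 : itg (fun w => \1_A w * X w).
  apply: (itgM _ _ _ _ _ _ 1) => // w; rewrite indicE.
  by case: (w \in A); rewrite ?normr1// normr0.
rewrite -Ex_EFin// integral_mkcond; apply: eq_integral => w _.
rewrite patchE indicE; case: ifPn => [wA|wA]; first by rewrite mul1r.
by rewrite mul0r.
Qed.

(** From events to bounded weights: xi + K is rounded down to multiples of 1 / m, which gives a
    finite combination of indicators of events of G and an error of at most Ex |Z| / m. *)
Lemma weighted0 (G : set (set T)) Z xi (K : R) : G `<=` measurable -> G setT -> itg Z ->
  (forall A, G A -> Ex (fun w => \1_A w * Z w) = 0) ->
  sub_meas G xi -> (forall w, `|xi w| <= K) -> Ex (fun w => xi w * Z w) = 0.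
Proof.
move=> Gm GT iZ HZ Gxi xiK.
have mxi := sub_meas_meas _ _ Gm Gxi.
have K0 : 0 <= K by apply: le_trans (xiK point).
have ind A w : `|\1_A w| <= 1 :> R.
  by rewrite indicE; case: (w \in A); rewrite ?normr1// normr0.
have EZ : Ex Z = 0.
  by rewrite -(HZ _ GT); apply: eq_Ex => w; rewrite indicT mul1r.
pose x1 w := xi w + K.
have x10 w : 0 <= x1 w <= 2 * K.
  by have := xiK w; rewrite ler_norml /x1 => /andP[h1 h2]; apply/andP; split; lra.
have mx1 : meas x1 by apply: measurable_funD => //; exact: measurable_cst.
have ix1 : itg (fun w => x1 w * Z w).
  apply: (itgM _ _ _ _ _ _ (2 * K)) => // w.
  by have /andP[h1 h2] := x10 w; rewrite ger0_norm.
have ixi : itg (fun w => xi w * Z w) by apply: (itgM _ _ _ _ _ _ K).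
suff E1 : Ex (fun w => x1 w * Z w) = 0.
  have : Ex (fun w => x1 w * Z w) = Ex (fun w => xi w * Z w) + K * Ex Z.
    rewrite -ExZ// -ExD//; last exact: itgZ.
    by apply: eq_Ex => w; rewrite /x1 mulrDl.
  by rewrite E1 EZ mulr0 addr0 => ->.
have bound (m : nat) : (0 < m)%N -> `|Ex (fun w => x1 w * Z w)| <= Ex (fun w => `|Z w|) / m%:R.
  move=> m0; have m0' : 0 < m%:R :> R by rewrite ltr0n.
  pose A j := [set w | Num.truncn (x1 w * m%:R) = j].
  have GA j : G (A j).
    pose B := [set x : R | Num.truncn ((x + K) * m%:R) = j].
    have mB : measurable B.
      have mf : measurable_fun setT (fun s : R => (Num.truncn (s * m%:R))%:R : R).
        exact: (@measurable_step R (fun n => n%:R)).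
      have mg : measurable_fun setT (fun x : R => x + K).
        by apply: measurable_funD => //; exact: measurable_cst.
      have := measurableT_comp mf mg; move=> /(_ measurableT [set j%:R]).
      rewrite setTI => /(_ (measurable_set1 _)).
      rewrite (_ : _ @^-1` _ = B)//; apply/seteqP; split => x /=.
        by move/eqP; rewrite eqr_nat => /eqP.
      by rewrite /B/= => ->.
    exact: (Gxi _ mB).
  pose J := (Num.truncn (2 * K * m%:R)).+1.
  pose y w : R := (Num.truncn (x1 w * m%:R))%:R / m%:R.
  have yE w : y w = \sum_(j < J) (j%:R / m%:R) * \1_(A j) w.
    have lt : (Num.truncn (x1 w * m%:R) < J)%N.
      rewrite ltnS; apply: le_truncn; rewrite ler_wpM2r ?(ltW m0')//.
      by have /andP[] := x10 w.
    rewrite (bigD1 (Ordinal lt))//= big1 ?addr0; last first.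
      move=> j /negP nj; rewrite indicE; case: (boolP (w \in A j)); last by rewrite mulr0.
      rewrite inE /A/= => e; exfalso; apply: nj; apply/eqP/val_inj => /=; exact: esym.
    by rewrite indicE mem_set//= mulr1.
  have iy : itg (fun w => y w * Z w).
    rewrite (_ : (fun w => y w * Z w) = fun w => \sum_(j < J) (j%:R / m%:R) * (\1_(A j) w * Z w)).
      apply: itg_sum => j; apply: itgZ; apply: (itgM _ _ _ _ _ _ 1) => //.
      by apply: measurable_indic; apply: Gm.
    by apply/funext => w; rewrite yE mulr_suml; apply: eq_bigr => j _; rewrite mulrA.
  have Ey : Ex (fun w => y w * Z w) = 0.
    rewrite (@eq_Ex _ _ _ _ _ (fun w => \sum_(j < J) (j%:R / m%:R) * (\1_(A j) w * Z w))).
      rewrite Ex_sum.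
        rewrite big1// => j _; rewrite ExZ ?HZ ?mulr0//.
        by apply: (itgM _ _ _ _ _ _ 1) => //; apply: measurable_indic; apply: Gm.
      move=> j; apply: itgZ; apply: (itgM _ _ _ _ _ _ 1) => //.
      by apply: measurable_indic; apply: Gm.
    by move=> w; rewrite yE mulr_suml; apply: eq_bigr => j _; rewrite mulrA.
  rewrite -[X in `|X|]subr0 -Ey -ExB//.
  apply: (le_trans (Ex_norm _ _ _ _ _ _)); first exact: itgB.
  rewrite mulrC -ExZ; last exact: itg_norm.
  apply: Ex_le => //; first by apply: itg_norm; exact: itgB.
    by apply: itgZ; exact: itg_norm.
  move=> w; rewrite -mulrBl normrM ler_wpM2r//.
  have /andP[h1 h2] := x10 w.
  have /andP[t1 t2] := @truncn_itv R (x1 w * m%:R) (mulr_ge0 h1 (ltW m0')).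
  have e1 : x1 w - y w = (x1 w * m%:R - (Num.truncn (x1 w * m%:R))%:R) / m%:R.
    by rewrite /y; field; rewrite gt_eqF.
  rewrite e1 ger0_norm; last by rewrite divr_ge0 ?(ltW m0')// subr_ge0.
  rewrite -[leRHS]mul1r ler_wpM2r ?invr_ge0 ?(ltW m0')//.
  by move: t2; rewrite -natr1; lra.
apply/eqP; rewrite -normr_le0 leNgt; apply/negP => n0.
have EZ0 : 0 <= Ex (fun w => `|Z w|) by apply: Ex_ge0.
pose m := (Num.truncn (Ex (fun w => `|Z w|) / `|Ex (fun w => x1 w * Z w)|)).+1.
have := bound m isT; rewrite ler_pdivlMr ?ltr0n// mulrC -ler_pdivlMr// leNgt.
by rewrite truncnS_gt.
Qed.

(** Independence of G and the law N(0, v) in a single condition, by characteristic functions over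
    the events of G. *)
Definition centered_gauss (G : set (set T)) (v : R) (w : T -> R) : Prop :=
  forall A, G A -> forall th : R,
   (\int[P]_(x in A) (cos (th * w x))%:E = P A * (expR (- (v * th ^+ 2) / 2))%:E)%E /\
   (\int[P]_(x in A) (sin (th * w x))%:E = 0)%E.

(** Fatou along the difference quotients gives existence of the moments, dominated convergence their
    values over events of G, and [weighted0] the weighted versions. The fourth moment comes from the
    square of the second difference quotient. *)
Lemma gauss_moments (G : set (set T)) (v : R) (w : T -> R) :
  G `<=` measurable -> G setT -> meas w -> 0 <= v -> centered_gauss G v w ->
  [/\ itg w, itg (fun x => w x ^+ 2), itg (fun x => w x ^+ 4),
   Ex (fun x => w x ^+ 4) <= 3 * v ^+ 2 &
   forall xi K, sub_meas G xi -> (forall x, `|xi x| <= K) ->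
     Ex (fun x => xi x * w x) = 0 /\ Ex (fun x => xi x * w x ^+ 2) = v * Ex xi].
Proof.
move=> Gm GT mw v0 H.
have mcos th : meas (fun x => cos (th * w x)).
  apply: (measurableT_comp (continuous_measurable_fun (@continuous_cos R))).
  by apply: measurable_funM => //; exact: measurable_cst.
have msin th : meas (fun x => sin (th * w x)).
  apply: (measurableT_comp (continuous_measurable_fun (@continuous_sin R))).
  by apply: measurable_funM => //; exact: measurable_cst.
have icos th : itg (fun x => cos (th * w x)) by apply: (itg_bd _ _ _ _ _ 1) => // x; exact: cos_max.
have isin th : itg (fun x => sin (th * w x)) by apply: (itg_bd _ _ _ _ _ 1) => // x; exact: sin_max.
pose ev th := expR (- (v * th ^+ 2) / 2).
have ind A x : `|\1_A x| <= 1 :> R.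
  by rewrite indicE; case: (x \in A); rewrite ?normr1// normr0.
have iind A : G A -> itg (\1_A : T -> R).
  by move=> GA; apply: (itg_bd _ _ _ _ _ 1) => //; apply: measurable_indic; exact: Gm.
have iM A X : G A -> itg X -> itg (fun x => \1_A x * X x).
  by move=> GA iX; apply: (itgM _ _ _ _ _ _ 1) => //; apply: measurable_indic; exact: Gm.
have PA A : G A -> (P A = (Ex (\1_A : T -> R))%:E)%E.
  move=> GA; rewrite -Ex_EFin; last exact: iind.
  by rewrite integral_indic ?setIT//; exact: Gm.
have Ec A th : G A -> Ex (fun x => \1_A x * cos (th * w x)) = Ex (\1_A : T -> R) * ev th.
  move=> GA; have [h _] := H A GA th; apply: EFin_inj.
  rewrite -Ex_indic//; last exact: Gm.
  by rewrite h PA// EFinM.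
have Es A th : G A -> Ex (fun x => \1_A x * sin (th * w x)) = 0.
  move=> GA; have [_ h] := H A GA th; apply: EFin_inj.
  by rewrite -Ex_indic//; exact: Gm.
have E1 : Ex (\1_setT : T -> R) = 1.
  by rewrite -[RHS](Ex_cst _ _ _ P 1); apply: eq_Ex => x; rewrite indicT.
have EcT th : Ex (fun x => cos (th * w x)) = ev th.
  by rewrite -[RHS]mul1r -E1 -Ec//; apply: eq_Ex => x; rewrite indicT mul1r.
pose f n x := 2 * (1 - cos (theta n * w x)) / theta n ^+ 2.
have t0 n : 0 < theta n :> R by exact: theta_gt0.
have fb n x : 0 <= f n x <= w x ^+ 2 by exact: cos_theta_bound.
have mf n : meas (f n).
  apply: measurable_funM; last exact: measurable_cst.
  apply: measurable_funM; first exact: measurable_cst.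
  by apply: measurable_funB => //; exact: measurable_cst.
have i_f n : itg (f n).
  apply: (itg_bd _ _ _ _ _ (4 / theta n ^+ 2)) => // x.
  have /andP[f0 _] := fb n x; rewrite ger0_norm//.
  rewrite /f ler_wpM2r ?invr_ge0 ?exprn_ge0 ?(ltW (t0 n))//.
  by have := cos_geN1 (theta n * w x); lra.
have fE n x : f n x = 2 / theta n ^+ 2 - 2 / theta n ^+ 2 * cos (theta n * w x).
  by rewrite /f; field; rewrite gt_eqF.
pose a n := v * theta n ^+ 2 / 2.
have evE n : ev (theta n) = expR (- a n) by rewrite /ev /a mulNr.
have a0 n : 0 <= a n by rewrite /a divr_ge0// mulr_ge0// exprn_ge0// ltW.
have ev1 n : 1 - a n <= ev (theta n) by rewrite evE; exact: expR_ge1Dx.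
have ev2 n : ev (theta n) <= (1 + a n)^-1.
  rewrite evE expRN lef_pV2 ?posrE ?expR_gt0//; first exact: expR_ge1Dx.
  by have := a0 n; lra.
have ev0 n : 0 < ev (theta n) by exact: expR_gt0.
have ev3 n : ev (theta n) <= 1 by rewrite evE -expR0 ler_expR oppr_le0.
have Ef A n : G A -> Ex (fun x => \1_A x * f n x) = Ex (\1_A : T -> R) * (2 * (1 - ev (theta n)) / theta n ^+ 2).
  move=> GA.
  rewrite (@eq_Ex _ _ _ _ _ (fun x => 2 / theta n ^+ 2 * \1_A x - 2 / theta n ^+ 2 * (\1_A x * cos (theta n * w x)))).
    rewrite ExB; [|by apply: itgZ; exact: iind|by apply: itgZ; exact: iM].
    rewrite !ExZ; [|by exact: iM|exact: iind].
    by rewrite Ec//; field; rewrite gt_eqF.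
  by move=> x; rewrite fE; ring.
have EfT n : Ex (f n) = 2 * (1 - ev (theta n)) / theta n ^+ 2.
  by have := Ef setT n GT; rewrite E1 mul1r => <-; apply: eq_Ex => x; rewrite indicT mul1r.
have Ef_le n : Ex (f n) <= v.
  rewrite EfT ler_pdivrMr ?exprn_gt0//; have := ev1 n; rewrite /a; lra.
have fcv x : f n x @[n --> \oo] --> w x ^+ 2 by exact: cos_theta_cvg.
have [i2 _] : itg (fun x => w x ^+ 2) /\ Ex (fun x => w x ^+ 2) <= v.
  apply: (Ex_fatou _ _ _ _ f) => // n x; by have /andP[] := fb n x.
have i1 : itg w.
  apply: (itg_le _ _ _ _ _ (fun x => 1 + w x ^+ 2)) => //.
    by apply: itgD => //; exact: itg_cst.
  move=> x; rewrite -[w x ^+ 2]real_normK ?num_real//.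
  have := sqr_ge0 (`|w x| - 2^-1); rewrite !expr2; set z := `|w x|; nra.
have iff n : itg (fun x => f n x ^+ 2).
  apply: (itg_bd _ _ _ _ _ ((4 / theta n ^+ 2) ^+ 2)).
    by under eq_fun do rewrite expr2; exact: measurable_funM.
  move=> x; rewrite normrX lerXn2r ?nnegrE ?divr_ge0 ?exprn_ge0 ?(ltW (t0 n))//.
  have /andP[f0 _] := fb n x; rewrite ger0_norm//.
  rewrite /f ler_wpM2r ?invr_ge0 ?exprn_ge0 ?(ltW (t0 n))//.
  by have := cos_geN1 (theta n * w x); lra.
(* By the double angle formula the square is again a combination of cosines, so its expectation is
   explicit. *)
have ffE n x : f n x ^+ 2 = 2 / theta n ^+ 4 * (3 - 4 * cos (theta n * w x) + cos (2 * theta n * w x)).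
  have -> : cos (2 * theta n * w x) = 2 * cos (theta n * w x) ^+ 2 - 1.
    have -> : 2 * theta n * w x = (theta n * w x) *+ 2 by rewrite mulr2n; ring.
    by rewrite cos_mulr2n -mulr_natl.
  by rewrite /f; field; rewrite gt_eqF.
have Eff n : Ex (fun x => f n x ^+ 2) <= 3 * v ^+ 2.
  rewrite (@eq_Ex _ _ _ _ _ (fun x => 2 / theta n ^+ 4 * ((3 - 4 * cos (theta n * w x)) + cos (2 * theta n * w x)))); last first.
    by move=> x; rewrite ffE.
  have ic : itg (fun x => 3 - 4 * cos (theta n * w x)) by apply: itgB; [exact: itg_cst|exact: itgZ].
  rewrite ExZ; last exact: itgD.
  rewrite ExD// ExB; [|exact: itg_cst|exact: itgZ].
  rewrite Ex_cst ExZ// !EcT.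
  have -> : ev (2 * theta n) = ev (theta n) ^+ 4.
    by rewrite evE /ev -expRM_natl; congr expR; rewrite /a; field.
  set y := ev (theta n); have y0 : 0 < y by exact: ev0.
  have y1 : y <= 1 by exact: ev3.
  have ya : 1 - y <= a n by have := ev1 n; rewrite -/y; lra.
  (* As 1 - y <= a and the second factor is at most 6, this is at most 6 a^2; times 2 / theta^4 it
     gives exactly 3 v^2. *)
  have -> : 3 - 4 * y + y ^+ 4 = (1 - y) ^+ 2 * (y ^+ 2 + 2 * y + 3) by ring.
  have h1 : (1 - y) ^+ 2 <= a n ^+ 2 by rewrite lerXn2r ?nnegrE//; lra.
  have h2 : y ^+ 2 + 2 * y + 3 <= 6.
    by have : y ^+ 2 <= 1; [rewrite expr_le1// ltW|lra].
  have h3 : (1 - y) ^+ 2 * (y ^+ 2 + 2 * y + 3) <= a n ^+ 2 * 6.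
    apply: ler_pM => //; first exact: sqr_ge0.
    by have := sqr_ge0 y; lra.
  apply: (@le_trans _ _ (2 / theta n ^+ 4 * (a n ^+ 2 * 6))).
    by apply: ler_wpM2l => //; rewrite divr_ge0// exprn_ge0// ltW.
  by rewrite /a le_eqVlt; apply/orP; left; apply/eqP; field; rewrite gt_eqF.
have [i4 E4] : itg (fun x => w x ^+ 4) /\ Ex (fun x => w x ^+ 4) <= 3 * v ^+ 2.
  apply: (Ex_fatou _ _ _ _ (fun n x => f n x ^+ 2)) => //.
  - by move=> n; under eq_fun do rewrite expr2; exact: measurable_funM.
  - by move=> n x; exact: sqr_ge0.
  - move=> x; have -> : w x ^+ 4 = w x ^+ 2 * w x ^+ 2 by ring.
    by under eq_fun do rewrite expr2; apply: cvgM.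
split => // xi K Gxi xiK; split.
  apply: (weighted0 G w xi K) => // A GA.
  have [] := @Ex_dominated _ T R P (fun n x => \1_A x * (sin (theta n * w x) / theta n))
    (fun x => \1_A x * w x) (fun x => `|w x|) 0.
  - move=> n; apply: measurable_funM; first by apply: measurable_indic; exact: Gm.
    by apply: measurable_funM => //; exact: measurable_cst.
  - exact: itg_norm.
  - move=> n x; rewrite normrM -[leRHS]mul1r; apply: ler_pM => //.
    rewrite normrM normfV (gtr0_norm (t0 n)) ler_pdivrMr//.
    by apply: (le_trans (sin_le_norm _ _)); rewrite normrM (gtr0_norm (t0 n)) mulrC.
  - by move=> x; apply: cvgMr; exact: sin_theta_cvg.
  - rewrite (_ : (fun n => Ex _) = fun=> 0); first exact: cvg_cst.
    apply/funext => n; rewrite -[RHS](mulr0 (theta n)^-1) -(Es A (theta n) GA) -ExZ; last exact: iM.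
    by apply: eq_Ex => x; ring.
  by [].
have vi : itg (fun x => xi x * w x ^+ 2).
  by apply: (itgM _ _ _ _ _ _ K) => //; exact: sub_meas_meas Gxi.
have mxi : itg xi by apply: (itg_bd _ _ _ _ _ K) => //; exact: sub_meas_meas Gxi.
have iZ : itg (fun x => w x ^+ 2 - v) by apply: itgB => //; exact: itg_cst.
have : Ex (fun x => xi x * (w x ^+ 2 - v)) = 0.
  apply: (weighted0 G _ xi K) => // A GA.
  have [||||i2A E2A] := @Ex_dominated _ T R P (fun n x => \1_A x * f n x)
    (fun x => \1_A x * w x ^+ 2) (fun x => w x ^+ 2) (Ex (\1_A : T -> R) * v) _ i2 _ _ _.
  - by move=> n; apply: measurable_funM => //; apply: measurable_indic; exact: Gm.
  - move=> n x; have /andP[f0 f1] := fb n x; rewrite normrM -[leRHS]mul1r; apply: ler_pM => //.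
    by rewrite ger0_norm.
  - by move=> x; apply: cvgMr; exact: fcv.
  - under eq_fun => n do rewrite Ef//.
    apply: cvgMr.
    apply: (@squeeze_cvgr _ _ _ _ (fun n => v / (1 + a n)) (fun=> v)).
    + apply: nearW => n; apply/andP; split; last by have := Ef_le n; rewrite EfT.
      rewrite ler_pdivlMr ?exprn_gt0//.
      have a1 : 0 < 1 + a n by have := a0 n; lra.
      have -> : v / (1 + a n) * theta n ^+ 2 = 2 * (1 - (1 + a n)^-1).
        by rewrite /a; field; move: a1; rewrite /a => a1; apply/eqP; lra.
      by have := ev2 n; lra.
    + rewrite -[X in _ --> X]mulr1; apply: cvgMr; rewrite -[X in _ --> X]invr1; apply: cvgV => //.
      rewrite -[X in _ --> X]addr0; apply: cvgD; first exact: cvg_cst.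
      rewrite /a; rewrite -[X in _ --> X](mul0r 2^-1); apply: cvgMl.
      rewrite -[X in _ --> X](mulr0 v); apply: cvgMr.
      by rewrite -[X in _ --> X](mulr0 (0:R)); under eq_fun do rewrite expr2; apply: cvgM; exact: theta_cvg.
    + exact: cvg_cst.
  rewrite (@eq_Ex _ _ _ _ _ (fun x => \1_A x * w x ^+ 2 - v * \1_A x)); last by move=> x; ring.
  rewrite ExB//; last by apply: itgZ; exact: iind.
  rewrite ExZ ?E2A; [ring|exact: iind].
rewrite (@eq_Ex _ _ _ _ _ (fun x => xi x * w x ^+ 2 - v * xi x)); last by move=> x; ring.
by rewrite ExB// ?ExZ//; [move/eqP; rewrite subr_eq0 => /eqP|exact: itgZ].
Qed.

End moments.

(** * One step of the Euler scheme in expectation *)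

Lemma measurable_phi (R : realType) (N : R) : measurable_fun setT (phi N).
Proof.
apply: measurableT_comp; first exact: measurable_inv.
by apply: measurable_maxr => //; exact: measurable_cst.
Qed.

Section sub_meas.
Context (d : measure_display) (T : measurableType d) (R : realType).
Implicit Types (X Y : T -> R) (G : set (set T)).

(** Reads [sub_meas] as ordinary measurability on the type carrying G, so that the usual closure
    properties apply. *)
Lemma sub_measP G X : sigma_algebra setT G ->
  sub_meas G X <-> measurable_fun setT (X : g_sigma_algebraType G -> R).
Proof.
move=> sG; have GE A : @measurable _ (g_sigma_algebraType G) A = G A.
  by rewrite /measurable/= smallest_id.
split=> [H _ A mA|H A mA]; first by rewrite setTI GE; exact: H.
by have := H measurableT A mA; rewrite setTI GE.
Qed.

Lemma sub_meas_comp G X (g : R -> R) : measurable_fun setT g -> sub_meas G X ->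
  sub_meas G (fun w => g (X w)).
Proof. by move=> mg GX A mA; have := mg measurableT A mA; rewrite setTI => /GX. Qed.

Lemma sub_meas_cst G (k : R) : sigma_algebra setT G -> sub_meas G (fun=> k).
Proof. by move=> sG; apply/sub_measP => //; exact: measurable_cst. Qed.

Lemma sub_measD G X Y : sigma_algebra setT G -> sub_meas G X -> sub_meas G Y ->
  sub_meas G (fun w => X w + Y w).
Proof.
move=> sG /(sub_measP _ _ sG) mX /(sub_measP _ _ sG) mY; apply/sub_measP => //.
exact: measurable_funD.
Qed.

Lemma sub_measM G X Y : sigma_algebra setT G -> sub_meas G X -> sub_meas G Y ->
  sub_meas G (fun w => X w * Y w).
Proof.
move=> sG /(sub_measP _ _ sG) mX /(sub_measP _ _ sG) mY; apply/sub_measP => //.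
exact: measurable_funM.
Qed.

Lemma sub_measZ G X (k : R) : sigma_algebra setT G -> sub_meas G X -> sub_meas G (fun w => k * X w).
Proof. by move=> sG GX; apply: sub_measM => //; exact: sub_meas_cst. Qed.

Lemma sub_measB G X Y : sigma_algebra setT G -> sub_meas G X -> sub_meas G Y ->
  sub_meas G (fun w => X w - Y w).
Proof.
move=> sG /(sub_measP _ _ sG) mX /(sub_measP _ _ sG) mY; apply/sub_measP => //.
exact: measurable_funB.
Qed.

Lemma sub_meas_ge G X (k : R) : sigma_algebra setT G -> sub_meas G X ->
  sub_meas G (fun w => (k <= X w)%R%:R : R).
Proof.
move=> sG GX; apply: (@sub_meas_comp G X (fun x : R => (k <= x)%R%:R : R)) => //.
rewrite (_ : (fun x : R => _) = \1_(`[k, +oo[%classic)); first exact: measurable_indic.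
apply/funext => x; rewrite indicE; congr (nat_of_bool _)%:R.
by apply/idP/idP; rewrite inE/= in_itv/= andbT.
Qed.

Lemma sub_meas_cvg G (X_ : nat -> T -> R) X : sigma_algebra setT G -> (forall n, sub_meas G (X_ n)) ->
  (forall w, X_ n w @[n --> \oo] --> X w) -> sub_meas G X.
Proof.
move=> sG GX cX; apply/sub_measP => //.
apply: (@measurable_fun_cvg _ (g_sigma_algebraType G) R setT X_ X) => [n|w _]; last exact: cX.
exact/sub_measP.
Qed.

End sub_meas.

Section ito_step.
Context (d : measure_display) (T : measurableType d) (R : realType) (P : probability T R).
Local Notation itg := (itg P).
Local Notation Ex := (Ex P).
Local Notation meas := (measurable_fun [set: T]).

(** Here s is the square root of the mesh and q s^2 the variance of the noise. K^3 s^4 / 2 comes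
    from the squared drift in the second-order term; the rest bounds the cubic remainder by the
    second and fourth moments. *)
Definition ito_err (K L q s : R) : R :=
  K ^+ 3 * s ^+ 4 / 2 + 4 * L * ((q + 3 * q ^+ 2) * s ^+ 3 / 2 + K ^+ 3 * s ^+ 6).

(** Convexity splits the cube, and |x|^3 <= (s x^2 + x^4 / s) / 2 trades the third absolute moment
    for the second and the fourth. *)
Lemma cube_le (x y K s : R) : 0 < s -> `|y| <= K ->
  `|x + y| ^+ 3 <= 4 * ((s * x ^+ 2 + x ^+ 4 / s) / 2 + K ^+ 3).
Proof.
move=> s0 yK; have K0 : 0 <= K by exact: le_trans yK.
have h1 : `|x + y| ^+ 3 <= 4 * (`|x| ^+ 3 + K ^+ 3).
  apply: (@le_trans _ _ ((`|x| + K) ^+ 3)).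
    rewrite lerXn2r ?nnegrE ?addr_ge0//; apply: le_trans (ler_normD _ _) _; lra.
  set z := `|x|; have z0 : 0 <= z by exact: normr_ge0.
  have -> : 4 * (z ^+ 3 + K ^+ 3) = (z + K) ^+ 3 + 3 * ((z + K) * (z - K) ^+ 2) by ring.
  by rewrite lerDl; apply: mulr_ge0 => //; apply: mulr_ge0; [exact: addr_ge0|exact: sqr_ge0].
apply: (le_trans h1); apply: ler_wpM2l => //; rewrite lerD2r.
have -> : x ^+ 2 = `|x| ^+ 2 by rewrite real_normK ?num_real.
have -> : x ^+ 4 = `|x| ^+ 4.
  have -> : x ^+ 4 = (x ^+ 2) ^+ 2 by ring.
  by rewrite -[x ^+ 2]real_normK ?num_real// -exprM.
set z := `|x|; have z0 : 0 <= z by exact: normr_ge0.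
have -> : (s * z ^+ 2 + z ^+ 4 / s) / 2 = z ^+ 3 + (z ^+ 2 / s) * (s - z) ^+ 2 / 2.
  by field; rewrite gt_eqF.
by rewrite lerDl divr_ge0// mulr_ge0 ?sqr_ge0// divr_ge0 ?sqr_ge0// ltW.
Qed.

(** A discrete Ito inequality: xi, r1, r2 and g are known before the increment w, so terms linear in
    w average to 0 and w^2 to its variance. Bounds on r1 and r2 are asked only where xi is nonzero,
    so xi can stop the scheme before the test function becomes singular. *)
Lemma ito_step (G : set (set T)) (q s K L : R) (w xi r1 r2 g dF : T -> R) :
  sigma_algebra setT G -> G `<=` measurable -> meas w -> 0 <= q -> 0 < s -> 0 <= K -> 0 <= L ->
  centered_gauss _ _ _ P G (s ^+ 2 * q) w ->
  sub_meas G xi -> sub_meas G r1 -> sub_meas G r2 -> sub_meas G g ->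
  (forall x, 0 <= xi x <= 1) -> (forall x, xi x != 0 -> `|r1 x| <= K) ->
  (forall x, xi x != 0 -> `|r2 x| <= K) ->
  (forall x, `|g x| <= K) -> itg (fun x => xi x * dF x) ->
  (forall x, xi x * dF x <= xi x * (r1 x * (w x + g x * s ^+ 2)
     + r2 x * (w x + g x * s ^+ 2) ^+ 2 / 2 + L * `|w x + g x * s ^+ 2| ^+ 3)) ->
  Ex (fun x => xi x * dF x) <= s ^+ 2 * Ex (fun x => xi x * (r1 x * g x + r2 x * q / 2))
    + ito_err K L q s.
Proof.
move=> sG Gm mw q0 s0 K0 L0 gw Gxi Gr1 Gr2 Gg xi01 r1K r2K gK idF hdF.
have GT : G setT by case: sG => g0 gC _; rewrite -(setD0 setT); exact: gC.
have v0 : 0 <= s ^+ 2 * q by rewrite mulr_ge0// sqr_ge0.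
have [i1 i2 i4 E4 Hw] := gauss_moments _ _ _ _ _ _ _ Gm GT mw v0 gw.
have xi1 x : `|xi x| <= 1 by have /andP[h1 h2] := xi01 x; rewrite ger0_norm.
pose k1 x := xi x * r1 x; pose k2 x := xi x * r2 x; pose k3 x := xi x * r2 x * g x.
have kb r : (forall x, xi x != 0 -> `|r x| <= K) -> forall x, `|xi x * r x| <= K.
  move=> rK x; rewrite normrM; have [->|nz] := eqVneq (xi x) 0; first by rewrite normr0 mul0r.
  by rewrite -[leRHS]mul1r; apply: ler_pM => //; exact: rK.
have k1K := kb _ r1K; have k2K := kb _ r2K.
have k3K x : `|k3 x| <= K * K by rewrite normrM; apply: ler_pM => //; exact: k2K.
have Gk1 : sub_meas G k1 by exact: sub_measM.
have Gk2 : sub_meas G k2 by exact: sub_measM.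
have Gk3 : sub_meas G k3 by exact: sub_measM.
have me X : sub_meas G X -> meas X by exact: sub_meas_meas.
have [E1 _] := Hw k1 K Gk1 k1K; have [_ E2] := Hw k2 K Gk2 k2K; have [E3 _] := Hw k3 _ Gk3 k3K.
have [_ E5] := Hw (fun=> 1) 1 (sub_meas_cst _ _ _ _ 1 sG) (fun x => eq_ind_r (fun z => z <= 1) (lexx 1) (normr1 R)).
have {}E5 : Ex (fun x => w x ^+ 2) = s ^+ 2 * q.
  move: E5; rewrite Ex_cst mulr1 => <-; by apply: eq_Ex => x; rewrite mul1r.
have ik1 : itg (fun x => k1 x * w x) by apply: (itgM _ _ _ _ _ _ K) => //; exact: me.
have ik1g : itg (fun x => k1 x * g x).
  apply: (itg_bd _ _ _ _ _ (K * K)); first by apply: measurable_funM; exact: me.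
  by move=> x; rewrite normrM; apply: ler_pM => //; exact: k1K.
have ik2 : itg (fun x => k2 x * w x ^+ 2) by apply: (itgM _ _ _ _ _ _ K) => //; exact: me.
have ik2' : itg k2 by apply: (itg_bd _ _ _ _ _ K) => //; exact: me.
have ik3 : itg (fun x => k3 x * w x) by apply: (itgM _ _ _ _ _ _ (K * K)) => //; exact: me.
pose c := K ^+ 3 * s ^+ 4 / 2 + 4 * L * (K ^+ 3 * s ^+ 6).
pose U x := k1 x * w x + (s ^+ 2 * (k1 x * g x) + (2^-1 * (k2 x * w x ^+ 2)
  + (s ^+ 2 * (k3 x * w x) + (c + (2 * L * s * w x ^+ 2 + 2 * L / s * w x ^+ 4))))).
have j6 : itg (fun x => 2 * L * s * w x ^+ 2 + 2 * L / s * w x ^+ 4) by apply: itgD; exact: itgZ.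
have j5 : itg (fun x => c + (2 * L * s * w x ^+ 2 + 2 * L / s * w x ^+ 4)).
  by apply: itgD => //; exact: itg_cst.
have j4 : itg (fun x => s ^+ 2 * (k3 x * w x) + (c + (2 * L * s * w x ^+ 2 + 2 * L / s * w x ^+ 4))).
  by apply: itgD => //; exact: itgZ.
have j3 : itg (fun x => 2^-1 * (k2 x * w x ^+ 2) + (s ^+ 2 * (k3 x * w x) + (c + (2 * L * s * w x ^+ 2 + 2 * L / s * w x ^+ 4)))).
  by apply: itgD => //; exact: itgZ.
have j2 : itg (fun x => s ^+ 2 * (k1 x * g x) + (2^-1 * (k2 x * w x ^+ 2) + (s ^+ 2 * (k3 x * w x) + (c + (2 * L * s * w x ^+ 2 + 2 * L / s * w x ^+ 4))))).
  by apply: itgD => //; exact: itgZ.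
have iU : itg U by apply: itgD.
have EU : Ex U = s ^+ 2 * Ex (fun x => k1 x * g x) + 2^-1 * (s ^+ 2 * q * Ex k2)
   + c + 2 * L * s * (s ^+ 2 * q) + 2 * L / s * Ex (fun x => w x ^+ 4).
  rewrite /U ExD// ExD//; last exact: itgZ.
  rewrite ExD//; last exact: itgZ.
  rewrite ExD//; last exact: itgZ.
  rewrite ExD//; last exact: itg_cst.
  have -> : Ex (fun x => 2 * L * s * w x ^+ 2 + 2 * L / s * w x ^+ 4) = 2 * L * s * Ex (fun x => w x ^+ 2) + 2 * L / s * Ex (fun x => w x ^+ 4).
    by rewrite -!ExZ// -ExD//; exact: itgZ.
  by rewrite !ExZ// E1 E2 E3 E5 Ex_cst; ring.
apply: (@le_trans _ _ (Ex U)).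
  apply: Ex_le => // x; apply: (le_trans (hdF x)).
  have /andP[x0 x1] := xi01 x.
  have cub := cube_le (w x) (g x * s ^+ 2) (K * s ^+ 2) s s0.
  have gs : `|g x * s ^+ 2| <= K * s ^+ 2.
    by rewrite normrM [`|s ^+ 2|]ger0_norm ?sqr_ge0// ler_wpM2r ?sqr_ge0.
  have {cub gs} cub := cub gs.
  have t1 : xi x * (L * `|w x + g x * s ^+ 2| ^+ 3) <= L * (4 * ((s * w x ^+ 2 + w x ^+ 4 / s) / 2 + (K * s ^+ 2) ^+ 3)).
    apply: (@le_trans _ _ (1 * (L * `|w x + g x * s ^+ 2| ^+ 3))).
      by apply: ler_wpM2r => //; rewrite mulr_ge0// exprn_ge0.
    by rewrite mul1r ler_wpM2l.
  have t2 : k3 x * g x * (s ^+ 4 / 2) <= K ^+ 3 * (s ^+ 4 / 2).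
    apply: ler_wpM2r; first by rewrite divr_ge0// exprn_ge0// ltW.
    apply: (le_trans (ler_norm _)); rewrite normrM.
    have -> : K ^+ 3 = K * K * K by ring.
    by apply: ler_pM.
  have -> : xi x * (r1 x * (w x + g x * s ^+ 2) + r2 x * (w x + g x * s ^+ 2) ^+ 2 / 2 + L * `|w x + g x * s ^+ 2| ^+ 3)
    = k1 x * w x + s ^+ 2 * (k1 x * g x) + 2^-1 * (k2 x * w x ^+ 2) + s ^+ 2 * (k3 x * w x)
      + k3 x * g x * (s ^+ 4 / 2) + xi x * (L * `|w x + g x * s ^+ 2| ^+ 3).
    by rewrite /k1 /k2 /k3; field.
  apply: (@le_trans _ _ (k1 x * w x + s ^+ 2 * (k1 x * g x) + 2^-1 * (k2 x * w x ^+ 2) + s ^+ 2 * (k3 x * w x)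
      + K ^+ 3 * (s ^+ 4 / 2) + L * (4 * ((s * w x ^+ 2 + w x ^+ 4 / s) / 2 + (K * s ^+ 2) ^+ 3)))).
    by apply: lerD => //; rewrite lerD2l.
  by rewrite /U /c le_eqVlt; apply/orP; left; apply/eqP; field; rewrite gt_eqF.
have -> : Ex (fun x => xi x * (r1 x * g x + r2 x * q / 2)) = Ex (fun x => k1 x * g x) + q / 2 * Ex k2.
  rewrite -ExZ// -ExD//; last exact: itgZ.
  by apply: eq_Ex => x; rewrite /k1 /k2; ring.
rewrite EU.
have t3 : 2 * L / s * Ex (fun x => w x ^+ 4) <= 2 * L / s * (3 * (s ^+ 2 * q) ^+ 2).
  by apply: ler_wpM2l E4; rewrite divr_ge0 ?mulr_ge0// ltW.
have -> : ito_err K L q s = c + 2 * L * s * (s ^+ 2 * q) + 2 * L / s * (3 * (s ^+ 2 * q) ^+ 2).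
  by rewrite /ito_err /c; field; rewrite gt_eqF.
move: t3; set a1 := Ex _; set a2 := Ex _; set a3 := Ex _; set a4 := 2 * L / s * _; set a5 := 2 * L / s * _.
move=> t3; lra.
Qed.

End ito_step.

(** * Adaptedness of the schemes *)

Section adapted.
Context (d : measure_display) (T : measurableType d) (R : realType) (P : probability T R).
Variables (al be ga de : R) (B C : R -> T -> R) (X0 Y0 : T -> R).

Definition plev (w : T) (k : nat) : nat -> R * R :=
  lev al be ga de (B ^~ w) (C ^~ w) (X0 w) (Y0 w) k.

(** Kept abstract so that one argument serves the given filtration and the one generated by the
    data. *)
Definition adapted_data (F : R -> set (set T)) : Prop :=
  [/\ (forall t, 0 <= t -> sigma_algebra setT (F t)),
      (forall s t, 0 <= s -> s <= t -> F s `<=` F t),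
      sub_meas (F 0) X0 /\ sub_meas (F 0) Y0 &
      forall t, 0 <= t -> sub_meas (F t) (B t) /\ sub_meas (F t) (C t)].

Lemma sub_measS (G G' : set (set T)) (X : T -> R) : G `<=` G' -> sub_meas G X -> sub_meas G' X.
Proof. by move=> GG GX A mA; apply: GG; exact: GX. Qed.

Lemma plev_adapted F k i : adapted_data F ->
  sub_meas (F (i%:R * hlev k)) (fun w => (plev w k i).1) /\
  sub_meas (F (i%:R * hlev k)) (fun w => (plev w k i).2).
Proof.
move=> [sF mF [GX GY] GBC]; have h0 := @hlev_gt0 R k.
elim: i => [|i [IH1 IH2]]; first by rewrite mul0r.
have ih : 0 <= i%:R * hlev k :> R by rewrite mulr_ge0// ltW.
have iS : i%:R * hlev k <= i.+1%:R * hlev k :> R by rewrite ler_wpM2r ?(ltW h0)// ler_nat.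
have ih' := le_trans ih iS.
have FF := mF _ _ ih iS; have sG := sF _ ih'.
have g1 := sub_measS _ _ _ FF IH1; have g2 := sub_measS _ _ _ FF IH2.
have [b1 c1] := GBC _ ih'; have [b0 c0] := GBC _ ih.
have b2 := sub_measS _ _ _ FF b0; have c2 := sub_measS _ _ _ FF c0.
have p1 : sub_meas (F (i.+1%:R * hlev k)) (fun w => phi (nlev k) (plev w k i).1).
  by apply: (sub_meas_comp _ _ _ _ _ (phi (nlev k))) => //; exact: measurable_phi.
have p2 : sub_meas (F (i.+1%:R * hlev k)) (fun w => phi (nlev k) (plev w k i).2).
  by apply: (sub_meas_comp _ _ _ _ _ (phi (nlev k))) => //; exact: measurable_phi.
split.
- apply: (sub_measD _ _ _ _ (fun w => (plev w k i).1 + (B (i.+1%:R * hlev k) w - B (i%:R * hlev k) w))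
    (fun w => hlev k * (al * phi (nlev k) (plev w k i).1 + be * phi (nlev k) (plev w k i).2))) => //.
    by apply: sub_measD => //; exact: sub_measB.
  by apply: sub_measZ => //; apply: sub_measD => //; exact: sub_measZ.
- apply: (sub_measD _ _ _ _ (fun w => (plev w k i).2 + (C (i.+1%:R * hlev k) w - C (i%:R * hlev k) w))
    (fun w => hlev k * (ga * phi (nlev k) (plev w k i).1 + de * phi (nlev k) (plev w k i).2))) => //.
    by apply: sub_measD => //; exact: sub_measB.
  by apply: sub_measZ => //; apply: sub_measD => //; exact: sub_measZ.
Qed.

Lemma app_adapted F k t : 0 <= t -> adapted_data F ->
  sub_meas (F t) (fun w => app1 (plev w) (B ^~ w) k t) /\
  sub_meas (F t) (fun w => app2 (plev w) (C ^~ w) k t).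
Proof.
move=> t0 aF; have [sF mF _ GBC] := aF.
set i := Num.truncn (t * (msh k)%:R).
have [/andP[s0 st] _] := @grid_dist R k t t0.
have FF := mF _ _ s0 st; have sG := sF _ t0.
have [e1 e2] := plev_adapted F k i aF.
have [b1 c1] := GBC _ t0; have [b0 c0] := GBC _ s0.
split.
- apply: (sub_measD _ _ _ _ (fun w => (plev w k i).1) (fun w => B t w - B (i%:R * hlev k) w)) => //.
    exact: sub_measS FF e1.
  by apply: sub_measB => //; exact: sub_measS FF b0.
- apply: (sub_measD _ _ _ _ (fun w => (plev w k i).2) (fun w => C t w - C (i%:R * hlev k) w)) => //.
    exact: sub_measS FF e2.
  by apply: sub_measB => //; exact: sub_measS FF c0.
Qed.

Lemma goodlS (la mu eta : R) E i :
  goodl la mu eta E i.+1 = goodl la mu eta E i && (eta <= la * (E i.+1).1 + mu * (E i.+1).2).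
Proof. by rewrite /goodl -[i.+2]addn1 iotaD all_cat/= andbT. Qed.

Lemma Z_adapted F (la mu : R) k i : adapted_data F ->
  sub_meas (F (i%:R * hlev k)) (fun w => la * (plev w k i).1 + mu * (plev w k i).2).
Proof.
move=> aF; have [g1 g2] := plev_adapted F k i aF; have [sF _ _ _] := aF.
have sG := sF (i%:R * hlev k) (mulr_ge0 (ler0n _ _) (ltW (hlev_gt0 _ _))).
by apply: sub_measD => //; exact: sub_measZ.
Qed.

Lemma goodl_adapted F (la mu eta : R) k i : adapted_data F ->
  sub_meas (F (i%:R * hlev k)) (fun w => (goodl la mu eta (plev w k) i)%:R : R).
Proof.
move=> aF; have [sF mF _ _] := aF; have h0 := @hlev_gt0 R k.
elim: i => [|i IH].
  rewrite mul0r; have := Z_adapted F la mu k 0 aF; rewrite mul0r => GZ.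
  have := sub_meas_ge _ _ _ _ _ eta (sF _ (lexx 0)) GZ.
  by congr sub_meas; apply/funext => w; rewrite /goodl/= andbT.
have ih : 0 <= i%:R * hlev k :> R by rewrite mulr_ge0// ltW.
have iS : i%:R * hlev k <= i.+1%:R * hlev k :> R by rewrite ler_wpM2r ?(ltW h0)// ler_nat.
have sG := sF _ (le_trans ih iS).
have := sub_measM _ _ _ _ _ _ sG (sub_measS _ _ _ (mF _ _ ih iS) IH)
  (sub_meas_ge _ _ _ _ _ eta sG (Z_adapted F la mu k i.+1 aF)).
by congr sub_meas; apply/funext => w; rewrite goodlS -natrM mulnb.
Qed.

End adapted.

Section bm.
Context (d : measure_display) (T : measurableType d) (R : realType) (P : probability T R).
Variables (F : R -> set (set T)) (rho : R) (B C : R -> T -> R).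

Lemma corr_BM_swap : corr_BM P F rho B C -> corr_BM P F rho C B.
Proof.
move=> [h1 h2 h3 h4]; split.
- by move=> w; have [] := h1 w.
- by move=> w; have [] := h2 w.
- by move=> t t0; have [] := h3 t t0.
- move=> s t s0 st A FA u v; have [e1 e2] := h4 s t s0 st A FA v u; split.
    rewrite -[LHS]/(_) (_ : u ^+ 2 + 2 * rho * u * v + v ^+ 2 = v ^+ 2 + 2 * rho * v * u + u ^+ 2); last ring.
    by rewrite -e1; apply: eq_integral => w _; rewrite addrC.
  by rewrite -e2; apply: eq_integral => w _; rewrite addrC.
Qed.

Lemma bm_gauss (s t u v : R) : corr_BM P F rho B C -> 0 <= s -> s <= t ->
  centered_gauss _ _ _ P (F s) ((t - s) * (u ^+ 2 + 2 * rho * u * v + v ^+ 2))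
    (fun w => u * (B t w - B s w) + v * (C t w - C s w)).
Proof.
move=> [_ _ _ H] s0 st A FA th; have [h1 h2] := H s t s0 st A FA (th * u) (th * v); split.
  transitivity (P A * (expR (- ((t - s) * ((th * u) ^+ 2 + 2 * rho * (th * u) * (th * v) + (th * v) ^+ 2)) / 2))%:E)%E.
    by rewrite -h1; apply: eq_integral => w _; congr (cos _)%:E; ring.
  by congr (_ * (expR _)%:E)%E; ring.
by rewrite -h2; apply: eq_integral => w _; congr (sin _)%:E; ring.
Qed.

Lemma q_ge0 (u v : R) : -1 <= rho <= 1 -> 0 <= u ^+ 2 + 2 * rho * u * v + v ^+ 2.
Proof.
move=> /andP[r1 r2].
have -> : u ^+ 2 + 2 * rho * u * v + v ^+ 2 = (u + rho * v) ^+ 2 + (1 - rho) * (1 + rho) * v ^+ 2 by ring.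
by rewrite addr_ge0 ?sqr_ge0// mulr_ge0 ?sqr_ge0// mulr_ge0//; lra.
Qed.

End bm.

Definition slev {R : realType} (k : nat) : R := nlev k ^- 4.

Section err.
Variable R : realType.

Lemma slev_gt0 k : 0 < @slev R k. Proof. by rewrite invr_gt0 exprn_gt0// nlev_gt0. Qed.
Lemma slev2 k : @slev R k ^+ 2 = hlev k.
Proof. by rewrite /slev hlevE exprVn -exprM. Qed.

(** For K = c n, L = c n^2 and s = n^-4 the terms of [ito_err] are of order n^-13, n^-10 and n^-19,
    all below the mesh n^-8 for large n. *)
Lemma err_small (c q : R) : 0 <= c -> 0 <= q -> exists k0, forall k, (k0 <= k)%N ->
  ito_err R (c * nlev k) (c * nlev k ^+ 2) q (slev k) <= hlev k.
Proof.
move=> c0 q0; pose D := c ^+ 3 / 2 + 4 * c * ((q + 3 * q ^+ 2) / 2 + c ^+ 3).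
have D0 : 0 <= D.
  by rewrite /D !(addr_ge0, mulr_ge0, divr_ge0, exprn_ge0)// ?exprn_ge0.
have [k0 Hk0] := nlev_big R D; exists k0 => k /Hk0 Dk.
have n0 := @nlev_gt0 R k; have n1 := @nlev_ge1 R k.
set n := nlev k in Dk n0 n1 *.
have -> : hlev k = n ^- 8 by rewrite hlevE.
rewrite /ito_err /slev -/n.
pose m := n^-1; have m0 : 0 < m by rewrite invr_gt0.
have m1 : m <= 1 by rewrite invf_le1.
have nm : n * m = 1 by rewrite mulfV ?gt_eqF.
have -> : n ^- 4 = m ^+ 4 by rewrite exprVn.
have -> : n ^- 8 = m ^+ 8 by rewrite exprVn.
have e1 : (c * n) ^+ 3 * (m ^+ 4) ^+ 4 / 2 = c ^+ 3 / 2 * m ^+ 13 * (n * m) ^+ 3 by ring.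
have e2 : 4 * (c * n ^+ 2) * ((q + 3 * q ^+ 2) * (m ^+ 4) ^+ 3 / 2 + (c * n) ^+ 3 * (m ^+ 4) ^+ 6) =
  4 * c * ((q + 3 * q ^+ 2) / 2 * m ^+ 10 * (n * m) ^+ 2 + c ^+ 3 * m ^+ 19 * (n * m) ^+ 5) by ring.
rewrite e1 e2 nm !expr1n !mulr1.
have mp j : (9 <= j)%N -> m ^+ j <= m ^+ 9 by move=> j9; apply: ler_wiXn2l => //; exact: ltW.
have h1 : c ^+ 3 / 2 * m ^+ 13 <= c ^+ 3 / 2 * m ^+ 9.
  by apply: ler_wpM2l; [rewrite divr_ge0// exprn_ge0|exact: mp].
have h2 : (q + 3 * q ^+ 2) / 2 * m ^+ 10 <= (q + 3 * q ^+ 2) / 2 * m ^+ 9.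
  by apply: ler_wpM2l; [rewrite divr_ge0// addr_ge0// mulr_ge0// exprn_ge0|exact: mp].
have h3 : c ^+ 3 * m ^+ 19 <= c ^+ 3 * m ^+ 9.
  by apply: ler_wpM2l; [rewrite exprn_ge0|exact: mp].
have h4 : 4 * c * ((q + 3 * q ^+ 2) / 2 * m ^+ 10 + c ^+ 3 * m ^+ 19) <=
  4 * c * ((q + 3 * q ^+ 2) / 2 * m ^+ 9 + c ^+ 3 * m ^+ 9).
  by apply: ler_wpM2l; [rewrite mulr_ge0|exact: lerD].
have h5 : D * m <= 1 by rewrite -nm ler_wpM2r// ltW.
have h6 : D * m ^+ 9 <= m ^+ 8.
  have -> : D * m ^+ 9 = (D * m) * m ^+ 8 by ring.
  by rewrite ler_piMl// exprn_ge0// ltW.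
apply: le_trans h6; rewrite /D; move: h1 h4; clear; lra.
Qed.

End err.

(** * Avoiding the corner *)

Section ln_taylor.
Variable R : realType.

Lemma ln_taylor (x : R) : `|x| <= 1/2 -> `|ln (1 + x) - (x - x ^+ 2 / 2)| <= 2 * `|x| ^+ 3.
Proof.
move=> hx; move: (hx); rewrite ler_norml => /andP[x1 x2].
pose g := (fun u : R => ln u + (u ^+ 2 / 2 - 2 * u)).
have dg (u : R) : 0 < u -> is_derive u 1 g (u^-1 + (u - 2)).
  move=> u0; have dl := is_derive1_ln u0.
  have dp : is_derive u 1 (fun u : R => u ^+ 2 / 2 - 2 * u) (u - 2).
    apply: is_derive_eq.
    by rewrite !scaler0 add0r /GRing.scale/= !mulr1; field.
  exact: is_deriveD.
have gmvt (a b : R) : 0 < a -> a <= b -> exists2 c, a <= c <= b & g b - g a = (c^-1 + (c - 2)) * (b - a).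
  move=> a0 ab; have [||c] := @MVT_segment R g (fun u => u^-1 + (u - 2)) a b ab.
  - by move=> u; rewrite in_itv/= => /andP[au _]; apply: dg; exact: lt_trans au.
  - apply: derivable_within_continuous => u; rewrite in_itv/= => /andP[au _].
    by have [] := dg u (lt_le_trans a0 au).
  by rewrite in_itv/= => cab e; exists c.
have g1 : g 1 = 1 / 2 - 2 by rewrite /g ln1 expr1n; ring.
have gx : g (1 + x) = ln (1 + x) + (x ^+ 2 / 2 - x) - 3 / 2 by rewrite /g; field.
have x10 : 0 < 1 + x by move: x1; clear; lra.
have key (c : R) : 1 / 2 <= c -> `|c - 1| <= `|x| -> 0 <= c^-1 + (c - 2) <= 2 * x ^+ 2.
  move=> c2 cx; have c0 : 0 < c by move: c2; clear; lra.
  have -> : c^-1 + (c - 2) = c^-1 * (c - 1) ^+ 2 by field; rewrite gt_eqF.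
  have ci : c^-1 <= 2.
    by rewrite -[leRHS]invrK lef_pV2 ?posrE ?invr_gt0//; move: c2; clear; lra.
  have c3 : (c - 1) ^+ 2 <= x ^+ 2.
    by rewrite -[(c - 1) ^+ 2]real_normK ?num_real// -[x ^+ 2]real_normK ?num_real// lerXn2r ?nnegrE.
  apply/andP; split; first by rewrite mulr_ge0 ?sqr_ge0// invr_ge0 ltW.
  by apply: ler_pM => //; rewrite ?sqr_ge0// invr_ge0 ltW.
have -> : ln (1 + x) - (x - x ^+ 2 / 2) = g (1 + x) - g 1 by rewrite gx g1; field.
have n3 : 2 * `|x| ^+ 3 = 2 * x ^+ 2 * `|x|.
  by rewrite -[x ^+ 2]real_normK ?num_real//; ring.
rewrite n3; have [x0|x0] := leP 0 x.
  have [|c /andP[c1 c2] ->] := gmvt 1 (1 + x) ltr01; first by rewrite lerDl.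
  have -> : 1 + x - 1 = x by ring.
  rewrite normrM ler_wpM2r//.
  have /andP[k1 k2] : 0 <= c^-1 + (c - 2) <= 2 * x ^+ 2.
    apply: key; first by move: c1; clear; lra.
    by rewrite !ger0_norm ?subr_ge0//; move: c2; clear; lra.
  by rewrite ger0_norm.
have [|c /andP[c1 c2] e] := gmvt (1 + x) 1 x10; first by move: x0; clear; lra.
rewrite distrC e (_ : 1 - (1 + x) = - x); last ring.
rewrite normrM normrN ler_wpM2r//.
have /andP[k1 k2] : 0 <= c^-1 + (c - 2) <= 2 * x ^+ 2.
  apply: key; first by move: c1 x1; clear; lra.
  rewrite distrC ger0_norm ?subr_ge0// ltr0_norm//; move: c1; clear; lra.
by rewrite ger0_norm.
Qed.

(** For z > 0 this is half of ln (1 + z^-2), and [V1], [V2] are its first two derivatives. The term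
    ln (1 + z^2) / 2 keeps it nonnegative at infinity and leaves the singularity - ln z at 0. *)
Definition Vf (z : R) : R := ln (1 + z ^+ 2) / 2 - ln z.
Definition V1 (z : R) : R := z / (1 + z ^+ 2) - z^-1.
Definition V2 (z : R) : R := (1 - z ^+ 2) / (1 + z ^+ 2) ^+ 2 + z ^- 2.

Lemma VfE z : 0 < z -> Vf z = ln (1 + z ^- 2) / 2.
Proof.
move=> z0; have z20 : 0 < z ^+ 2 by rewrite exprn_gt0.
have -> : 1 + z ^- 2 = (1 + z ^+ 2) / z ^+ 2 by field; rewrite gt_eqF.
rewrite ln_div ?posrE//; last by rewrite addr_gt0.
by rewrite lnXn// /Vf mulrBl; congr (_ - _); rewrite -mulr_natr; field.
Qed.

Lemma Vf_ge0 z : 0 < z -> 0 <= Vf z.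
Proof.
by move=> z0; rewrite VfE// divr_ge0// ln_ge0// lerDl invr_ge0 exprn_ge0// ltW.
Qed.

Lemma Vf_gt0 z : 0 < z -> 0 < Vf z.
Proof.
move=> z0; rewrite VfE// divr_gt0// ln_gt0// ltrDl invr_gt0 exprn_gt0//.
Qed.

Lemma Vf_dec z z' : 0 < z -> z <= z' -> Vf z' <= Vf z.
Proof.
move=> z0 zz; have z'0 := lt_le_trans z0 zz; rewrite !VfE// ler_wpM2r// ?invr_ge0//.
rewrite ler_ln ?posrE ?addr_gt0 ?invr_gt0 ?exprn_gt0//.
by rewrite lerD2l lef_pV2 ?posrE ?exprn_gt0// lerXn2r// nnegrE ltW.
Qed.

Lemma Vf_big z : 0 < z -> - ln z <= Vf z.
Proof.
move=> z0; rewrite /Vf lerDr divr_ge0// ln_ge0// lerDl sqr_ge0//.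
Qed.

Lemma V2_ge0 z : 0 < z -> 0 <= V2 z.
Proof.
move=> z0; have z20 : 0 < z ^+ 2 by rewrite exprn_gt0.
have -> : V2 z = (1 + 3 * z ^+ 2) / (z ^+ 2 * (1 + z ^+ 2) ^+ 2).
  by rewrite /V2; field; rewrite !gt_eqF// addr_gt0.
by rewrite divr_ge0 ?addr_ge0 ?mulr_ge0 ?exprn_ge0 ?addr_ge0// ltW.
Qed.

Lemma V1_bound z eta : 0 < eta -> eta <= z -> `|V1 z| <= eta^-1.
Proof.
move=> e0 ez; have z0 := lt_le_trans e0 ez; have z20 : 0 < z ^+ 2 by rewrite exprn_gt0.
have -> : V1 z = - (z * (1 + z ^+ 2))^-1 by rewrite /V1; field; rewrite !gt_eqF// addr_gt0.
rewrite normrN ger0_norm ?invr_ge0 ?mulr_ge0 ?addr_ge0 ?(ltW z0) ?(ltW z20)//.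
rewrite lef_pV2 ?posrE ?mulr_gt0 ?addr_gt0//; apply: (le_trans ez).
by apply: ler_peMr; [exact: ltW|rewrite lerDl ltW].
Qed.

Lemma V2_bound z eta : 0 < eta -> eta <= z -> `|V2 z| <= 1 + eta ^- 2.
Proof.
move=> e0 ez; have z0 := lt_le_trans e0 ez; have z20 : 0 < z ^+ 2 by rewrite exprn_gt0.
rewrite /V2; apply: le_trans (ler_normD _ _) _; apply: lerD.
  rewrite normrM normfV [`|(1 + z ^+ 2) ^+ 2|]ger0_norm ?sqr_ge0// ler_pdivrMr ?exprn_gt0 ?addr_gt0// mul1r.
  rewrite ler_norml expr2; apply/andP; split; nra.
rewrite ger0_norm ?invr_ge0 ?exprn_ge0 ?(ltW z0)// lef_pV2 ?posrE ?exprn_gt0//.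
by rewrite lerXn2r// nnegrE ltW.
Qed.

(** A Gaussian step can leave the domain of the logarithm, hence the clamp at eta / 2. Steps longer
    than eta / 4 are paid for by the cubic term; shorter ones do not reach the clamp and are treated
    by expanding both logarithms. *)
Lemma V_taylor (eta : R) : 0 < eta -> eta <= 1 -> exists2 L : R, 0 <= L & forall z w, eta <= z ->
  Vf (Num.max (z + w) (eta / 2)) <= Vf z + V1 z * w + V2 z * w ^+ 2 / 2 + L * `|w| ^+ 3.
Proof.
move=> e0 e1; pose ie := eta^-1; have ie0 : 0 < ie by rewrite invr_gt0.
pose V0 := Vf (eta / 2); have e20 : 0 < eta / 2 by rewrite divr_gt0.
have V00 : 0 <= V0 by exact: Vf_ge0.
(* The first two summands serve the long steps, the bracket the short ones. *)
pose L := 64 * ie ^+ 3 * V0 + 16 * ie ^+ 3 + (3 + 2 * ie ^+ 3).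
have p2 : 0 <= ie ^+ 3 by rewrite exprn_ge0// ltW.
have p1 : 0 <= 64 * ie ^+ 3 * V0 by apply: mulr_ge0 => //; exact: mulr_ge0.
have L0 : 0 <= L by rewrite /L; move: p1 p2; clear; lra.
exists L => // z w ez; have z0 := lt_le_trans e0 ez.
have z20 : 0 < z ^+ 2 by rewrite exprn_gt0.
set W := `|w|; have W0 : 0 <= W by exact: normr_ge0.
have W3 : 0 <= W ^+ 3 by rewrite exprn_ge0.
have [big|small] := ltP (eta / 4) W.
  have h1 : Vf (Num.max (z + w) (eta / 2)) <= V0 by apply: Vf_dec => //; rewrite le_max lexx orbT.
  have h2 : - (ie * W) <= V1 z * w.
    have := V1_bound z eta e0 ez => b1; have : `|V1 z * w| <= ie * W by rewrite normrM ler_wpM2r.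
    by rewrite ler_norml => /andP[].
  have h3 : 0 <= V2 z * w ^+ 2 / 2 by rewrite divr_ge0// mulr_ge0 ?V2_ge0// sqr_ge0.
  have t1 : 1 <= 4 * ie * W.
    rewrite [leLHS](_ : 1 = 4 * ie * (eta / 4)); last by rewrite /ie; field; rewrite gt_eqF.
    by rewrite ler_wpM2l ?(ltW big)// mulr_ge0// ltW.
  have t2 : 1 <= (4 * ie * W) ^+ 2 by rewrite exprn_ege1.
  have t3 : 1 <= (4 * ie * W) ^+ 3 by rewrite exprn_ege1.
  have h4 : V0 <= 64 * ie ^+ 3 * V0 * W ^+ 3.
    have -> : 64 * ie ^+ 3 * V0 * W ^+ 3 = (4 * ie * W) ^+ 3 * V0 by ring.
    by rewrite ler_peMl.
  have h5 : ie * W <= 16 * ie ^+ 3 * W ^+ 3.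
    have -> : 16 * ie ^+ 3 * W ^+ 3 = (4 * ie * W) ^+ 2 * (ie * W) by ring.
    by rewrite ler_peMl// mulr_ge0// ltW.
  have h6 : 0 <= (3 + 2 * ie ^+ 3) * W ^+ 3 by rewrite mulr_ge0//; move: p2; clear; lra.
  have h7 := Vf_ge0 z z0.
  rewrite /L; move: h1 h2 h3 h4 h5 h6 h7; clear.
  set a := Vf _; set b := Vf _; set c := V1 z * w; set e := V2 z * _ / 2; lra.
have wb : - (eta / 4) <= w <= eta / 4 by rewrite -ler_norml.
have zw : eta / 2 <= z + w by move: wb ez e0; clear; lra.
have zw0 : 0 < z + w by exact: lt_le_trans zw.
rewrite max_l//.
pose x := w / z; pose y := (2 * z * w + w ^+ 2) / (1 + z ^+ 2).
have z21 : 0 < 1 + z ^+ 2 by rewrite addr_gt0.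
have xW : `|x| <= ie * W.
  rewrite normrM normfV (gtr0_norm z0) mulrC ler_wpM2r// lef_pV2 ?posrE//.
have x12 : `|x| <= 1 / 2.
  apply: (le_trans xW); apply: (@le_trans _ _ (ie * (eta / 4))); first by rewrite ler_wpM2l// ltW.
  by rewrite mulrA mulVf ?gt_eqF//; clear; lra.
have W14 : W <= 1 / 4 by apply: (le_trans small); move: e1; clear; lra.
have yW : `|y| <= 5 / 4 * W.
  rewrite normrM normfV (gtr0_norm z21) ler_pdivrMr//.
  apply: le_trans (ler_normD _ _) _; rewrite normrX !normrM (gtr0_norm z0) -/W (ger0_norm (ler0n _ 2)).
  have k1 : 2 * z <= 1 + z ^+ 2 by have := sqr_ge0 (z - 1); rewrite !expr2; clear; lra.
  have k2 : 2 * z * W <= (1 + z ^+ 2) * W by rewrite ler_wpM2r.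
  have k3 : W ^+ 2 <= 1 / 4 * W by rewrite expr2 ler_wpM2r.
  have k4 : 0 <= W * z ^+ 2 by rewrite mulr_ge0// ltW.
  by move: k2 k3 k4; clear; lra.
have y12 : `|y| <= 1 / 2 by apply: (le_trans yW); move: W14; clear; lra.
have Tx := ln_taylor x x12; have Ty := ln_taylor y y12.
have lnE : Vf (z + w) - Vf z = ln (1 + y) / 2 - ln (1 + x).
  have -> : 1 + y = (1 + (z + w) ^+ 2) / (1 + z ^+ 2) by rewrite /y; field; rewrite gt_eqF.
  have -> : 1 + x = (z + w) / z by rewrite /x; field; rewrite gt_eqF.
  rewrite !ln_div ?posrE//; last by rewrite addr_gt0// exprn_gt0.
  by rewrite /Vf; field.
have x3 : `|x| ^+ 3 <= ie ^+ 3 * W ^+ 3.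
  by rewrite -exprMn lerXn2r ?nnegrE// mulr_ge0// ltW.
have y3 : `|y| ^+ 3 <= 2 * W ^+ 3.
  apply: (@le_trans _ _ ((5 / 4 * W) ^+ 3)); first by rewrite lerXn2r ?nnegrE// mulr_ge0.
  rewrite exprMn ler_wpM2r//; clear; by rewrite !exprS expr0; lra.
have res : - ((4 * z * w ^+ 3 + w ^+ 4) / (4 * (1 + z ^+ 2) ^+ 2)) <= W ^+ 3.
  have w4 : 0 <= w ^+ 4 by have -> : w ^+ 4 = (w ^+ 2) ^+ 2; [ring|rewrite sqr_ge0].
  have w3 : - W ^+ 3 <= w ^+ 3.
    have : `|w ^+ 3| <= W ^+ 3 by rewrite normrX.
    by rewrite ler_norml => /andP[].
  have d0 : 0 < 4 * (1 + z ^+ 2) ^+ 2 by rewrite mulr_gt0// exprn_gt0.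
  rewrite -mulNr ler_pdivrMr//.
  have k1 : z <= (1 + z ^+ 2) ^+ 2.
    have a1 : z <= 1 + z ^+ 2 by have := sqr_ge0 (z - 1); have := ltW z20; rewrite !expr2; clear; lra.
    by apply: (le_trans a1); rewrite expr2; apply: ler_peMr; [exact: ltW|rewrite lerDl ltW].
  have k2 : z * (- W ^+ 3) <= z * w ^+ 3 by rewrite ler_wpM2l// ltW.
  have k3 : z * W ^+ 3 <= (1 + z ^+ 2) ^+ 2 * W ^+ 3 by rewrite ler_wpM2r.
  by move: k2 k3 w4; clear; set q := (1 + z ^+ 2) ^+ 2; lra.
have yE : y / 2 - y ^+ 2 / 4 = z / (1 + z ^+ 2) * w + (1 - z ^+ 2) / (1 + z ^+ 2) ^+ 2 * w ^+ 2 / 2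
   - (4 * z * w ^+ 3 + w ^+ 4) / (4 * (1 + z ^+ 2) ^+ 2).
  by rewrite /y; field; rewrite gt_eqF.
have xE : - x + x ^+ 2 / 2 = - z^-1 * w + z ^- 2 * w ^+ 2 / 2 by rewrite /x; field; rewrite gt_eqF.
move: Tx Ty; rewrite !ler_norml => /andP[Tx _] /andP[_ Ty].
have q1 : 0 <= (64 * ie ^+ 3 * V0 + 16 * ie ^+ 3) * W ^+ 3 by rewrite mulr_ge0//; move: p1 p2; clear; lra.
have -> : V1 z * w = z / (1 + z ^+ 2) * w - z^-1 * w by rewrite /V1 mulrBl.
have -> : V2 z * w ^+ 2 / 2 = (1 - z ^+ 2) / (1 + z ^+ 2) ^+ 2 * w ^+ 2 / 2 + z ^- 2 * w ^+ 2 / 2.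
  by rewrite /V2 !mulrDl.
rewrite /L; move: lnE Tx Ty x3 y3 res yE xE q1; clear.
set a1 := ln (1 + x); set a2 := ln (1 + y); set a3 := Vf _; set a4 := Vf _.
set b1 := z / _ * w; set b2 := (1 - z ^+ 2) / _ * _ / 2; set b3 := z ^- 2 * _ / 2.
set b4 := (4 * z * _ + _) / _; set b5 := `|x| ^+ 3; set b6 := `|y| ^+ 3; set b7 := W ^+ 3; set b8 := ie ^+ 3 * b7.
have -> : (64 * ie ^+ 3 * V0 + 16 * ie ^+ 3 + (3 + 2 * ie ^+ 3)) * b7 = (64 * ie ^+ 3 * V0 + 16 * ie ^+ 3) * b7 + 3 * b7 + 2 * b8.
  by rewrite /b8; ring.
set b9 := (_ + 16 * _) * b7; set b10 := z^-1 * w; rewrite mulNr -/b10.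
set b11 := x ^+ 2; set b12 := y ^+ 2; lra.
Qed.

(** The singular part of V2 q / 2 is q / 2 divided by z^2 (1 + z^2), and V1 g is - z g over the same
    denominator; so they cancel when z g >= q / 2, and the remainder is at most q. *)
Lemma V_drift (z g q : R) : 0 < z -> 0 <= q -> q / 2 <= z * g -> V1 z * g + V2 z * q / 2 <= q.
Proof.
move=> z0 q0 zg; have z20 : 0 < z ^+ 2 by rewrite exprn_gt0.
have z21 : 0 < 1 + z ^+ 2 by rewrite addr_gt0.
have -> : V1 z * g = - ((z * g) / (z ^+ 2 * (1 + z ^+ 2))) by rewrite /V1; field; rewrite !gt_eqF.
have d0 : 0 < z ^+ 2 * (1 + z ^+ 2) by rewrite mulr_gt0.
have h : q / 2 / (z ^+ 2 * (1 + z ^+ 2)) <= (z * g) / (z ^+ 2 * (1 + z ^+ 2)).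
  by rewrite ler_wpM2r// invr_ge0 ltW.
have e : V2 z * q / 2 = q / 2 / (z ^+ 2 * (1 + z ^+ 2)) + q / (1 + z ^+ 2) ^+ 2.
  by rewrite /V2; field; rewrite !gt_eqF.
have k : q / (1 + z ^+ 2) ^+ 2 <= q.
  by rewrite ler_pdivrMr ?exprn_gt0// ler_peMr// exprn_ege1// lerDl ltW.
by rewrite e; move: h k; clear; lra.
Qed.

Lemma measurable_V1 : measurable_fun setT V1.
Proof.
have m2 : measurable_fun setT (fun z : R => 1 + z ^+ 2).
  by apply: measurable_funD; [exact: measurable_cst|under eq_fun do rewrite expr2; exact: measurable_funM].
apply: measurable_funB; last exact: measurable_inv.
by apply: measurable_funM => //; apply: measurableT_comp m2; exact: measurable_inv.
Qed.

Lemma measurable_V2 : measurable_fun setT V2.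
Proof.
have m2 : measurable_fun setT (fun z : R => z ^+ 2).
  by under eq_fun do rewrite expr2; exact: measurable_funM.
have m3 : measurable_fun setT (fun z : R => 1 + z ^+ 2) by apply: measurable_funD => //; exact: measurable_cst.
apply: measurable_funD; last by apply: measurableT_comp m2; exact: measurable_inv.
apply: measurable_funM; first by apply: measurable_funB => //; exact: measurable_cst.
apply: measurableT_comp; first exact: measurable_inv.
by under eq_fun do rewrite expr2; exact: measurable_funM.
Qed.

Lemma measurable_Vf : measurable_fun setT Vf.
Proof.
have m2 : measurable_fun setT (fun z : R => 1 + z ^+ 2).
  by apply: measurable_funD; [exact: measurable_cst|under eq_fun do rewrite expr2; exact: measurable_funM].
apply: measurable_funB; last exact: measurable_ln.
by apply: measurable_funM; [apply: measurableT_comp m2; exact: measurable_ln|exact: measurable_cst].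
Qed.

End ln_taylor.

Section euler_ito.
Context (d : measure_display) (T : measurableType d) (R : realType) (P : probability T R).
Variables (F : R -> set (set T)) (rho : R) (B C : R -> T -> R) (al be ga de : R) (X0 Y0 : T -> R).
Hypothesis uF : usual_filtration P F.
Hypothesis rho1 : -1 <= rho <= 1.
Hypothesis BM : corr_BM P F rho B C.
Hypothesis FX0 : sub_meas (F 0) X0.
Hypothesis FY0 : sub_meas (F 0) Y0.
Local Notation itg := (itg P).
Local Notation Ex := (Ex P).
Local Notation E := (plev _ _ _ al be ga de B C X0 Y0).

Lemma F_adapted : adapted_data _ _ _ B C X0 Y0 F.
Proof. by case: uF => sF _ mF _ _; case: BM => _ _ aBC _; split. Qed.

Lemma grid_ge0 k i : 0 <= i%:R * hlev k :> R.
Proof. by rewrite mulr_ge0// ltW// hlev_gt0. Qed.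

Lemma grid_sigma k i : sigma_algebra setT (F (i%:R * hlev k)).
Proof. by case: uF => sF _ _ _ _; apply: sF; exact: grid_ge0. Qed.

Lemma grid_measurable k i : F (i%:R * hlev k) `<=` measurable.
Proof. by case: uF => _ Fm _ _ _; apply: Fm; exact: grid_ge0. Qed.

Lemma plev_measurable k i : measurable_fun setT (fun w => (E w k i).1) /\
  measurable_fun setT (fun w => (E w k i).2).
Proof.
have [h1 h2] := plev_adapted _ _ _ al be ga de B C X0 Y0 F k i F_adapted.
by split; apply: sub_meas_meas (grid_measurable k i) _.
Qed.

(** [ito_step] for one step of u X + v Y. It is used with (la, mu) against the corner and with (1,
    0) against the axis. *)
Lemma euler_ito k i (u v K L : R) (xi r1 r2 dF : T -> R) :
  let D w := u * ((E w k i.+1).1 - (E w k i).1) + v * ((E w k i.+1).2 - (E w k i).2) in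
  let g w := (u * al + v * ga) * phi (nlev k) (E w k i).1
           + (u * be + v * de) * phi (nlev k) (E w k i).2 in
  let q := u ^+ 2 + 2 * rho * u * v + v ^+ 2 in
  0 <= L -> (`|u * al + v * ga| + `|u * be + v * de|) * nlev k <= K ->
  sub_meas (F (i%:R * hlev k)) xi -> sub_meas (F (i%:R * hlev k)) r1 ->
  sub_meas (F (i%:R * hlev k)) r2 ->
  (forall w, 0 <= xi w <= 1) -> (forall w, xi w != 0 -> `|r1 w| <= K) ->
  (forall w, xi w != 0 -> `|r2 w| <= K) -> itg (fun w => xi w * dF w) ->
  (forall w, xi w * dF w <= xi w * (r1 w * D w + r2 w * D w ^+ 2 / 2 + L * `|D w| ^+ 3)) ->
  Ex (fun w => xi w * dF w) <= hlev k * Ex (fun w => xi w * (r1 w * g w + r2 w * q / 2))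
    + ito_err R K L q (slev k).
Proof.
move=> D g q L0 gK Gxi Gr1 Gr2 xi01 r1K r2K idF hdF.
have n0 := @nlev_gt0 R k; have h0 := @hlev_gt0 R k.
have K0 : 0 <= K by apply: le_trans gK; rewrite mulr_ge0 ?addr_ge0// ltW.
have s0 := grid_ge0 k i.
have iS : i%:R * hlev k <= i.+1%:R * hlev k :> R by rewrite ler_wpM2r ?(ltW h0)// ler_nat.
have sG := grid_sigma k i; have Gm := grid_measurable k i.
have [e1 e2] := plev_adapted _ _ _ al be ga de B C X0 Y0 F k i F_adapted.
set w := fun x => u * (B (i.+1%:R * hlev k) x - B (i%:R * hlev k) x)
   + v * (C (i.+1%:R * hlev k) x - C (i%:R * hlev k) x).
have gw : centered_gauss _ _ _ P (F (i%:R * hlev k)) (slev k ^+ 2 * q) w.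
  have := bm_gauss _ _ _ P F rho B C _ _ u v BM s0 iS.
  by rewrite -mulrBl -natrB// subSnn mul1r slev2.
have [_ _ aBC _] := BM.
have mB t : 0 <= t -> measurable_fun setT (B t) /\ measurable_fun setT (C t).
  move=> t0; have [b c] := aBC _ t0; case: uF => _ Fm _ _ _.
  by split; apply: (sub_meas_meas _ _ _ (F t)) => //; exact: Fm.
have mw : measurable_fun setT w.
  have [b1 c1] := mB _ s0; have [b2 c2] := mB _ (le_trans s0 iS).
  by apply: measurable_funD; apply: measurable_funM; (try exact: measurable_cst); apply: measurable_funB.
have Gg : sub_meas (F (i%:R * hlev k)) g.
  apply: sub_measD => //; apply: sub_measZ => //.
    by apply: (sub_meas_comp _ _ _ _ _ (phi (nlev k))) => //; exact: measurable_phi.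
  by apply: (sub_meas_comp _ _ _ _ _ (phi (nlev k))) => //; exact: measurable_phi.
have DE x : w x + g x * slev k ^+ 2 = D x.
  rewrite slev2 /D /w /g /plev /lev/= -!/(plev _ _ _ al be ga de B C X0 Y0 x k i).
  by ring.
have gKx x : `|g x| <= K.
  apply: le_trans gK; apply: (le_trans (ler_normD _ _)); rewrite [leRHS]mulrDl !normrM.
  by apply: lerD; apply: ler_wpM2l => //; rewrite gtr0_norm ?phi_gt0// phi_le.
rewrite -slev2.
apply: (ito_step _ _ _ P (F (i%:R * hlev k)) q (slev k) K L w xi r1 r2 g dF) => //.
- exact: q_ge0.
- exact: slev_gt0.
- by move=> x; rewrite DE.
Qed.

End euler_ito.

Section corner_hit.
Context (d : measure_display) (T : measurableType d) (R : realType) (P : probability T R).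
Variables (F : R -> set (set T)) (rho : R) (al be ga de : R) (B C : R -> T -> R) (X0 Y0 : T -> R).
Hypothesis uF : usual_filtration P F.
Hypothesis rho1 : -1 <= rho <= 1.
Hypothesis BM : corr_BM P F rho B C.
Hypothesis FX0 : sub_meas (F 0) X0.
Hypothesis FY0 : sub_meas (F 0) Y0.
Local Notation itg := (itg P).
Local Notation Ex := (Ex P).
Local Notation E := (plev _ _ _ al be ga de B C X0 Y0).

(** The restriction to starting values of at least a0 bounds the initial value of the test function,
    which is unbounded otherwise. *)
Definition hitw (la mu a0 eta : R) (k i : nat) (w : T) : R :=
  (a0 <= la * X0 w + mu * Y0 w)%R%:R * (goodl la mu eta (E w k) i)%:R.

Lemma hitw_adapted la mu a0 eta k i : sub_meas (F (i%:R * hlev k)) (hitw la mu a0 eta k i).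
Proof.
have aF := F_adapted _ _ _ P F rho B C X0 Y0 uF BM FX0 FY0.
have [sF mF _ _] := aF.
have sG := grid_sigma _ _ _ _ _ uF k i.
apply: sub_measM => //; last exact: goodl_adapted.
have h : sub_meas (F 0) (fun w => (a0 <= la * X0 w + mu * Y0 w)%R%:R : R).
  apply: sub_meas_ge; first exact: sF.
  by apply: sub_measD; [exact: sF| |]; apply: sub_measZ => //; exact: sF.
by apply: sub_measS h; apply: mF => //; exact: grid_ge0.
Qed.

Lemma hitw01 la mu a0 eta k i w : 0 <= hitw la mu a0 eta k i w <= 1.
Proof.
rewrite /hitw; case: (a0 <= _); case: (goodl _ _ _ _ _); rewrite ?mulr1 ?mulr0 ?mul0r ?lexx ?ler01//.
Qed.

Lemma hitw_le la mu a0 eta k i w : hitw la mu a0 eta k i.+1 w <= hitw la mu a0 eta k i w.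
Proof.
rewrite /hitw goodlS; case: (a0 <= _); rewrite ?mul0r// !mul1r.
by case: (goodl _ _ _ _ _); case: (eta <= _) => //=; rewrite ?ler01.
Qed.

End corner_hit.

Arguments hitw {d T R}.
Arguments plev {d T R}.

(** Markov's inequality for the test function stopped at the first step below eta: it starts below
    [Vf a0], increases in mean by at most q + 1 per unit of time (q from the drift, 1 from the
    discretisation), and is at least [Vf eta] at the exit. The left side is the probability of such
    an exit. *)
Lemma corner_hit (d : measure_display) (T : measurableType d) (R : realType) (P : probability T R)
    (F : R -> set (set T)) (rho : R) (B C : R -> T -> R) (al be ga de : R) (X0 Y0 : T -> R)
    (la mu a0 eta : R) (Tn : nat) :
  usual_filtration P F -> -1 <= rho <= 1 -> corr_BM P F rho B C ->
  sub_meas (F 0) X0 -> sub_meas (F 0) Y0 -> corner_cond rho al be ga de la mu ->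
  0 < a0 -> 0 < eta -> eta <= 1 ->
  let q := la ^+ 2 + 2 * rho * la * mu + mu ^+ 2 in
  exists k0, forall k, (k0 <= k)%N ->
  Ex P (fun w => hitw al be ga de B C X0 Y0 la mu a0 eta k 0 w
      - hitw al be ga de B C X0 Y0 la mu a0 eta k (Tn * msh k) w)
    <= (Vf R a0 + Tn%:R * (q + 1)) / Vf R eta.
Proof.
move=> uF rho1 BM FX0 FY0 cc a00 e0 e1 q.
set E := plev al be ga de B C X0 Y0.
have [la0 mu0 a1 b1 hcc] := cc.
have q0 : 0 <= q by exact: q_ge0.
set a := la * al + mu * ga in a1 hcc; set b := la * be + mu * de in b1 hcc.
have [L0 L00 VT] := V_taylor R eta e0 e1.
pose c := eta^-1 + (1 + eta ^- 2) + (a + b) + L0.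
have ie0 : 0 < eta^-1 by rewrite invr_gt0.
have ie20 : 0 < eta ^- 2 by rewrite invr_gt0 exprn_gt0.
have c0 : 0 <= c by rewrite /c; move: ie0 ie20 a1 b1 L00; clear; lra.
have [k1 Hk1] := err_small R c q c0 q0.
have [k2 Hk2] := nlev_big R (q / (2 * (eta * a)) + q / (2 * (eta * b))).
exists (maxn k1 k2) => k; rewrite geq_max => /andP[/Hk1 {Hk1} Hk1 /Hk2 {Hk2} Hk2].
have n0 := @nlev_gt0 R k; have n1 := @nlev_ge1 R k; have h0 := @hlev_gt0 R k.
set N : R := nlev k in Hk1 Hk2 n0 n1 *.
have cN : c <= c * N by rewrite ler_peMr.
have cN2 : c <= c * N ^+ 2 by rewrite ler_peMr// exprn_ege1.
pose Z i w := la * (E w k i).1 + mu * (E w k i).2.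
pose Fi i w := Vf R (Num.max (Z i w) (eta / 2)).
pose xi := hitw al be ga de B C X0 Y0 la mu a0 eta k.
have e20 : 0 < eta / 2 by rewrite divr_gt0.
have Fib i w : 0 <= Fi i w <= Vf R (eta / 2).
  apply/andP; split; first by apply: Vf_ge0; rewrite lt_max e20 orbT.
  by apply: Vf_dec => //; rewrite le_max lexx orbT.
have xi01 i w : 0 <= xi i w <= 1 by exact: hitw01.
have xiN i w : xi i w != 0 -> xi i w = 1 /\ eta <= Z i w.
  rewrite /xi /hitw; case: (a0 <= _); rewrite ?mul0r ?eqxx// mul1r.
  case: (boolP (goodl _ _ _ _ _)) => [/goodlP g _|]; last by rewrite eqxx.
  by split => //; exact: g.
have aF := F_adapted _ _ _ P F rho B C X0 Y0 uF BM FX0 FY0.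
have GZ i : sub_meas (F (i%:R * hlev k)) (Z i) by exact: Z_adapted.
have Gxi i : sub_meas (F (i%:R * hlev k)) (xi i) by apply: (hitw_adapted _ _ _ P F rho).
have me i f : sub_meas (F (i%:R * hlev k)) f -> measurable_fun setT f.
  by apply: sub_meas_meas; exact: grid_measurable uF k i.
have mZ i : measurable_fun setT (Z i) by exact: me (GZ i).
have mxi i : measurable_fun setT (xi i) by exact: me (Gxi i).
have mFi i : measurable_fun setT (Fi i).
  apply: measurableT_comp; first exact: measurable_Vf.
  by apply: measurable_maxr => //; exact: measurable_cst.
have idF i : itg P (fun w => xi i w * (Fi i.+1 w - Fi i w)).
  apply: (itg_bd _ _ _ _ _ (Vf R (eta / 2))).
    by apply: measurable_funM => //; apply: measurable_funB.
  move=> w; rewrite normrM; have /andP[x0 x1] := xi01 i w.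
  have /andP[f0 f1] := Fib i w; have /andP[f0' f1'] := Fib i.+1 w.
  rewrite (ger0_norm x0) -[leRHS]mul1r; apply: ler_pM => //.
  by rewrite ler_norml; apply/andP; split; move: f0 f1 f0' f1'; clear; lra.
have step i : Ex P (fun w => xi i w * (Fi i.+1 w - Fi i w)) <= hlev k * (q + 1).
  have := euler_ito _ _ _ P F rho B C al be ga de X0 Y0 uF rho1 BM FX0 FY0 k i la mu (c * N) (c * N ^+ 2)
    (xi i) (fun w => V1 R (Z i w)) (fun w => V2 R (Z i w)) (fun w => Fi i.+1 w - Fi i w).
  cbv zeta; rewrite -/E -/a -/b -/q -/N => /(_ _ _ _ _ _ _ _ _ _ _)/Wrap[].
  - by rewrite mulr_ge0// exprn_ge0// ltW.
  - rewrite ler_wpM2r ?(ltW n0)// !gtr0_norm// /c; move: ie0 ie20 L00; clear; lra.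
  - exact: Gxi.
  - by apply: (sub_meas_comp _ _ _ _ _ (V1 R)) => //; exact: measurable_V1.
  - by apply: (sub_meas_comp _ _ _ _ _ (V2 R)) => //; exact: measurable_V2.
  - exact: xi01.
  - move=> w /xiN[_ zw]; apply: le_trans cN; apply: le_trans (V1_bound _ _ _ e0 zw) _.
    by rewrite /c; move: ie20 a1 b1 L00; clear; lra.
  - move=> w /xiN[_ zw]; apply: le_trans cN; apply: le_trans (V2_bound _ _ _ e0 zw) _.
    by rewrite /c; move: ie0 a1 b1 L00; clear; lra.
  - exact: idF.
  - move=> w; have [->|/xiN[-> zw]] := eqVneq (xi i w) 0; first by rewrite !mul0r.
    rewrite !mul1r; set D := _ + mu * _.
    have DE : Z i.+1 w = Z i w + D by rewrite /Z /D; ring.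
    have mx : Num.max (Z i w) (eta / 2) = Z i w.
      by rewrite max_l//; move: zw e0; clear; lra.
    have := VT (Z i w) D zw; rewrite /Fi DE mx.
    have : L0 * `|D| ^+ 3 <= c * N ^+ 2 * `|D| ^+ 3.
      apply: ler_wpM2r; first by rewrite exprn_ge0.
      by apply: le_trans cN2; rewrite /c; move: ie0 ie20 a1 b1; clear; lra.
    set t1 := _ * `|D| ^+ 3; set t2 := _ * `|D| ^+ 3; set t3 := V1 _ _ * D; set t4 := V2 _ _ * _ / 2.
    by clear; lra.
  move=> h; apply: (le_trans h); rewrite mulrDr mulr1; apply: lerD => //.
  rewrite ler_wpM2l ?(ltW h0)// -[leRHS](Ex_cst _ _ _ P q).
  have mp1 j : measurable_fun setT (fun w => phi N (E w k j).1).
    by have [p1 _] := plev_measurable _ _ _ P F rho B C al be ga de X0 Y0 uF BM FX0 FY0 k j; apply: measurableT_comp p1; exact: measurable_phi.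
  have mp2 j : measurable_fun setT (fun w => phi N (E w k j).2).
    by have [_ p1] := plev_measurable _ _ _ P F rho B C al be ga de X0 Y0 uF BM FX0 FY0 k j; apply: measurableT_comp p1; exact: measurable_phi.
  have pb x : 0 <= phi N x <= N by rewrite phi_le// ltW// phi_gt0.
  apply: Ex_le.
  - apply: (itg_bd _ _ _ _ _ (c * ((a + b) * N) + c * q)).
      apply: measurable_funM => //; apply: measurable_funD.
        apply: measurable_funM; first by apply: measurableT_comp (mZ i); exact: measurable_V1.
        by apply: measurable_funD; apply: measurable_funM => //; exact: measurable_cst.
      apply: measurable_funM; last exact: measurable_cst.
      apply: measurable_funM; last exact: measurable_cst.
      by apply: measurableT_comp (mZ i); exact: measurable_V2.
    move=> w; have [->|/xiN[-> zw]] := eqVneq (xi i w) 0.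
      have ab0 : 0 <= (a + b) * N by rewrite mulr_ge0 ?(ltW n0)// ltW// addr_gt0.
      by rewrite mul0r normr0; apply: addr_ge0; apply: mulr_ge0.
    rewrite mul1r; apply: le_trans (ler_normD _ _) _; apply: lerD.
      rewrite normrM; apply: ler_pM => //.
        by apply: le_trans (V1_bound _ _ _ e0 zw) _; rewrite /c; move: ie20 a1 b1 L00; clear; lra.
      have /andP[p1 p2] := pb (E w k i).1; have /andP[p3 p4] := pb (E w k i).2.
      rewrite ger0_norm; last by rewrite addr_ge0// mulr_ge0// ltW.
      by rewrite [leRHS]mulrDl; apply: lerD; apply: ler_wpM2l => //; exact: ltW.
    rewrite -mulrA normrM; apply: ler_pM => //.
      by apply: le_trans (V2_bound _ _ _ e0 zw) _; rewrite /c; move: ie0 a1 b1 L00; clear; lra.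
    by rewrite ger0_norm; move: q0; clear; lra.
  - exact: itg_cst.
  move=> w; have [->|/xiN[-> zw]] := eqVneq (xi i w) 0; first by rewrite mul0r.
  rewrite mul1r; apply: V_drift => //; first exact: lt_le_trans zw.
  have /andP[p1 p2] := pb (E w k i).1; have /andP[p3 p4] := pb (E w k i).2.
  have ea0 : 0 < eta * a by rewrite mulr_gt0.
  have eb0 : 0 < eta * b by rewrite mulr_gt0.
  have qa0 : 0 <= q / (2 * (eta * a)) by rewrite divr_ge0// mulr_ge0// ltW.
  have qb0 : 0 <= q / (2 * (eta * b)) by rewrite divr_ge0// mulr_ge0// ltW.
  (* A coordinate below 1 / N, possibly negative, has truncated reciprocal N, and for large N this
     alone gives the required drift. Otherwise no truncation is active and [corner_cond] applies. *)
  have [xs|xs] := ltP (E w k i).1 N^-1.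
    rewrite (phi_eqN _ _ _ (ltW xs)).
    apply: (@le_trans _ _ (eta * (a * N))).
      rewrite mulrA -ler_pdivrMl//; apply: le_trans Hk2; rewrite (_ : _ * (q / 2) = q / (2 * (eta * a))); first by rewrite lerDl.
      by field; rewrite !gt_eqF.
    apply: ler_pM => //; rewrite ?(ltW e0) ?mulr_ge0// ?(ltW a1) ?(ltW n0)//.
    by rewrite lerDl mulr_ge0// ltW.
  have [ys|ys] := ltP (E w k i).2 N^-1.
    rewrite (phi_eqN _ _ _ (ltW ys)).
    apply: (@le_trans _ _ (eta * (b * N))).
      rewrite mulrA -ler_pdivrMl//; apply: le_trans Hk2; rewrite (_ : _ * (q / 2) = q / (2 * (eta * b))); first by rewrite lerDr.
      by field; rewrite !gt_eqF.
    apply: ler_pM => //; rewrite ?(ltW e0) ?mulr_ge0// ?(ltW b1) ?(ltW n0)//.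
    by rewrite lerDr mulr_ge0// ltW.
  have iN0 : 0 < N^-1 by rewrite invr_gt0.
  rewrite !phi_eq//.
  have := hcc (E w k i).1 (E w k i).2 (lt_le_trans iN0 xs) (lt_le_trans iN0 ys).
  by rewrite (_ : la ^+ 2 + mu ^+ 2 + 2 * rho * la * mu = q)//; rewrite /q; ring.
(* Summation by parts with the decreasing weight xi: at the exit step Z is below eta, so the clamped
   test function is at least [Vf eta]. *)
have tele w (I : nat) : (xi 0%N w - xi I w) * Vf R eta - xi 0%N w * Fi 0%N w + xi I w * Fi I w
    <= \sum_(i < I) xi i w * (Fi i.+1 w - Fi i w).
  elim: I => [|I IH]; first by rewrite big_ord0 subrr mul0r add0r addNr.
  rewrite big_ord_recr/=; apply: le_trans (lerD IH (lexx _)).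
  have : (xi I w - xi I.+1 w) * Vf R eta <= (xi I w - xi I.+1 w) * Fi I.+1 w.
    have [->|ne] := eqVneq (xi I w) (xi I.+1 w); first by rewrite subrr !mul0r.
    apply: ler_wpM2l; first by rewrite subr_ge0; exact: hitw_le.
    apply: Vf_dec; first by rewrite lt_max e20 orbT.
    rewrite ge_max; apply/andP; split; last by move: e0; clear; lra.
    move: ne; rewrite /xi /hitw goodlS; case: (a0 <= _); rewrite ?mul0r ?eqxx// !mul1r.
    case: (goodl _ _ _ _ _); rewrite /= ?eqxx//; rewrite -/(Z I.+1 w).
    by case: (leP eta (Z I.+1 w)) => [_|/ltW//]; rewrite eqxx.
  set A1 := Vf R eta; set A2 := xi 0%N w * _; rewrite !mulrBl mulrBr; clear; lra.
pose I := (Tn * msh k)%N.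
have ExS : Ex P (fun w => \sum_(i < I) xi i w * (Fi i.+1 w - Fi i w)) <= Tn%:R * (q + 1).
  rewrite (Ex_sum _ _ _ P _ _ (fun i : 'I_I => fun w => xi i w * (Fi i.+1 w - Fi i w)))//.
  apply: (@le_trans _ _ (\sum_(i < I) hlev k * (q + 1))); first by apply: ler_sum => i _; exact: step.
  by rewrite sumr_const card_ord -[leLHS]mulr_natl mulrA /I natrM -mulrA -(mulrA Tn%:R) [_ * (hlev k * _)]mulrA hlev_msh mul1r.
have Ve0 := Vf_gt0 R eta e0.
have ix : itg P (fun w => xi 0%N w - xi I w).
  apply: (itg_bd _ _ _ _ _ 1); first exact: measurable_funB.
  move=> w; have := xi01 0%N w; have := xi01 I w; rewrite ler_norml; clear; lra.
rewrite ler_pdivlMr// mulrC -ExZ//.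
have iS : itg P (fun w => \sum_(i < I) xi i w * (Fi i.+1 w - Fi i w)).
  exact: (itg_sum _ _ _ P _ _ (fun i : 'I_I => fun w => xi i w * (Fi i.+1 w - Fi i w))).
apply: (@le_trans _ _ (Ex P (fun w => Vf R a0 + \sum_(i < I) xi i w * (Fi i.+1 w - Fi i w)))).
  apply: Ex_le; first exact: itgZ.
    by apply: itgD => //; exact: itg_cst.
  move=> w; have := tele w I.
  have h1 : xi 0%N w * Fi 0%N w <= Vf R a0.
    have [->|ne] := eqVneq (xi 0%N w) 0; first by rewrite mul0r Vf_ge0.
    have [-> _] := xiN _ _ ne; rewrite mul1r; apply: Vf_dec => //.
    move: ne; rewrite /xi /hitw /Z/=; case: (leP a0) => [h _|_]; last by rewrite mul0r eqxx.
    by rewrite le_max h.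
  have h2 : 0 <= xi I w * Fi I w.
    by have /andP[x0 _] := xi01 I w; have /andP[f0 _] := Fib I w; exact: mulr_ge0.
  rewrite -/xi -/I (mulrC (Vf R eta)); move: h1 h2; clear.
  by set A1 := xi 0%N w * _; set A2 := xi I w * _; set A3 := _ * Vf R eta; lra.
by rewrite ExD//; [rewrite Ex_cst lerD2l|exact: itg_cst].
Qed.

(** * Time spent near the axes *)

Section log_test.
Variable R : realType.
Implicit Types N kap x u v : R.

Definition lclamp N kap x : R := Num.min (Num.max x N^-1) kap.
Definition llog N kap x : R := ln (kap / lclamp N kap x).
(** The primitive of [llog] that vanishes from kap on: x ln (kap / x) + x - kap between 1 / N and
    kap, affine below. It is a concave, continuously differentiable version of x ln (1 / x). *)
Definition ltest N kap x : R := x * llog N kap x + lclamp N kap x - kap.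

Lemma ln_le_sub1 x : 0 < x -> ln x <= x - 1.
Proof.
move=> x0; have := @le_ln1Dx R (x - 1); rewrite (_ : 1 + (x - 1) = x); last ring.
by apply; move: x0; clear; lra.
Qed.

Lemma ln_ge_inv x : 0 < x -> 1 - x^-1 <= ln x.
Proof.
move=> x0; have := ln_le_sub1 x^-1; rewrite invr_gt0 => /(_ x0); rewrite lnV ?posrE//.
by lra.
Qed.

Lemma lclamp_bd N kap x : 0 < N -> N^-1 <= kap -> N^-1 <= lclamp N kap x <= kap.
Proof.
move=> N0 Nk; rewrite /lclamp le_min Nk le_max lexx orbT/=.
by rewrite ge_min lexx orbT.
Qed.

Lemma llog_ge0 N kap x : 0 < N -> N^-1 <= kap -> 0 <= llog N kap x.
Proof.
move=> N0 Nk; have /andP[c1 c2] := lclamp_bd N kap x N0 Nk.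
have i0 : 0 < N^-1 by rewrite invr_gt0.
by apply: ln_ge0; rewrite ler_pdivlMr ?mul1r//; exact: lt_le_trans c1.
Qed.

Lemma llog_le N kap x : 0 < N -> N^-1 <= kap -> llog N kap x <= kap * N.
Proof.
move=> N0 Nk; have /andP[c1 c2] := lclamp_bd N kap x N0 Nk.
have i0 : 0 < N^-1 by rewrite invr_gt0.
have c0 := lt_le_trans i0 c1; have k0 := lt_le_trans i0 Nk.
apply: (le_trans (ln_le_sub1 _ _)); first by rewrite divr_gt0.
have : kap / lclamp N kap x <= kap * N.
  by rewrite ler_wpM2l ?(ltW k0)// -[leRHS]invrK lef_pV2 ?posrE.
by lra.
Qed.

Lemma ltest_le0 N kap x : 0 < N -> N^-1 <= kap -> ltest N kap x <= 0.
Proof.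
move=> N0 Nk; have /andP[c1 c2] := lclamp_bd N kap x N0 Nk; have l0 := llog_ge0 N kap x N0 Nk.
have i0 : 0 < N^-1 by rewrite invr_gt0.
have c0 := lt_le_trans i0 c1; have k0 := lt_le_trans i0 Nk.
rewrite /ltest; have [xk|xk] := leP kap x.
  have e : lclamp N kap x = kap by rewrite /lclamp min_r// le_max xk.
  by rewrite /llog e mulfV ?gt_eqF// ln1 mulr0 add0r subrr.
have xc : x <= lclamp N kap x by rewrite le_min (ltW xk) le_max lexx.
have h1 : x * llog N kap x <= lclamp N kap x * llog N kap x by exact: ler_wpM2r.
have h2 : lclamp N kap x * llog N kap x <= lclamp N kap x * (kap / lclamp N kap x - 1).
  by rewrite ler_wpM2l ?(ltW c0)// ln_le_sub1// divr_gt0.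
have h3 : lclamp N kap x * (kap / lclamp N kap x - 1) = kap - lclamp N kap x.
  by field; rewrite gt_eqF.
move: h1 h2 h3; clear; lra.
Qed.

Lemma ltest_ge N kap x : 0 < N -> N^-1 <= kap -> 0 <= x -> - kap <= ltest N kap x.
Proof.
move=> N0 Nk x0; have /andP[c1 c2] := lclamp_bd N kap x N0 Nk; have l0 := llog_ge0 N kap x N0 Nk.
have i0 : 0 < N^-1 by rewrite invr_gt0.
have := mulr_ge0 x0 l0; rewrite /ltest; move: c1 i0; clear; lra.
Qed.

(** A lower bound valid for all u and v. For v >= 0 the quadratic term suffices; a jump from above 1
    / N to a negative v is longer than 1 / N, and there the cubic term pays. *)
Lemma ltest_taylor N kap u v : 0 < N -> N^-1 <= kap ->
  llog N kap u * (v - u) - (lclamp N kap u)^-1 * (v - u) ^+ 2 - N ^+ 2 * `|v - u| ^+ 3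
  <= ltest N kap v - ltest N kap u.
Proof.
move=> N0 Nk.
have i0 : 0 < N^-1 by rewrite invr_gt0.
have /andP[u1 u2] := lclamp_bd N kap u N0 Nk; have /andP[v1 v2] := lclamp_bd N kap v N0 Nk.
have u0 := lt_le_trans i0 u1; have v0 := lt_le_trans i0 v1; have k0 := lt_le_trans i0 Nk.
have idn : ltest N kap v - ltest N kap u - llog N kap u * (v - u) =
   v * (llog N kap v - llog N kap u) + lclamp N kap v - lclamp N kap u by rewrite /ltest; ring.
have lE : llog N kap v - llog N kap u = ln (lclamp N kap u / lclamp N kap v).
  by rewrite /llog !ln_div ?posrE//; ring.
rewrite lE in idn.
have cuE : lclamp N kap u = Num.min (Num.max u N^-1) kap by [].
have cvE : lclamp N kap v = Num.min (Num.max v N^-1) kap by [].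
move: idn; set A := ltest _ _ _; set A' := ltest _ _ _; set l := llog _ _ _.
move: cuE cvE u1 u2 v1 v2 u0 v0; set cu := lclamp _ _ u; set cv := lclamp _ _ v.
move=> cuE cvE u1 u2 v1 v2 u0 v0 idn; set W := `|v - u|.
have W0 : 0 <= W by exact: normr_ge0.
have NW : 0 <= N ^+ 2 * W ^+ 3 by rewrite mulr_ge0 ?exprn_ge0// ltW.
suff key : - (cu^-1 * (v - u) ^+ 2) - N ^+ 2 * W ^+ 3 <= v * ln (cu / cv) + cv - cu.
  by move: key idn; clear; set a := ln _; lra.
set m := N^-1 in i0 Nk cuE cvE u1 v1.
have cuP : [\/ u <= m /\ cu = m, m <= u <= kap /\ cu = u | kap <= u /\ cu = kap].
  rewrite cuE; have [um|um] := leP u m; first by apply: Or31; rewrite (min_idPl Nk).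
  have [uk|uk] := leP u kap; first by apply: Or32; rewrite (ltW um).
  by apply: Or33; rewrite (ltW uk).
have cvP : [\/ v <= m /\ cv = m, m <= v <= kap /\ cv = v | kap <= v /\ cv = kap].
  rewrite cvE; have [um|um] := leP v m; first by apply: Or31; rewrite (min_idPl Nk).
  have [uk|uk] := leP v kap; first by apply: Or32; rewrite (ltW um).
  by apply: Or33; rewrite (ltW uk).
have [vp|vn] := leP 0 v.
  have h1 : v * (1 - cv / cu) <= v * ln (cu / cv).
    rewrite ler_wpM2l// -[cv / cu]invrK invf_div; apply: ln_ge_inv; exact: divr_gt0.
  (* The logarithm has been removed by ln t >= 1 - 1 / t. After multiplication by the clamp of u a
     quadratic inequality is left, one for each position of u and v. *)
  suff h2 : - (v - u) ^+ 2 <= (cv - cu) * (cu - v).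
    have h3 : - (v - u) ^+ 2 * cu^-1 <= (cv - cu) * (cu - v) * cu^-1.
      by rewrite ler_wpM2r// invr_ge0 ltW.
    have h4 : (cv - cu) * (cu - v) * cu^-1 = v * (1 - cv / cu) + cv - cu by field; rewrite gt_eqF.
    move: h1 h3 h4 NW; clear; lra.
  move: cuP cvP i0 Nk; clear => cuP cvP i0 Nk.
  have aux (p r e : R) : 0 <= p -> p <= e -> 0 <= r -> r <= e -> p * r <= e ^+ 2.
    by move=> p0 pe r0 re; rewrite expr2; exact: ler_pM.
  case: cuP => [[h1 ->]|[/andP[h1 h2] ->]|[h1 ->]]; case: cvP => [[g1 ->]|[/andP[g1 g2] ->]|[g1 ->]].
  - by rewrite subrr mul0r oppr_le0 sqr_ge0.
  - by have := aux (v - m) (v - m) (v - u); lra.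
  - by have := aux (kap - m) (v - m) (v - u); lra.
  - by have := aux (u - m) (u - v) (u - v); lra.
  - by rewrite -(opprB v u) mulrN -expr2.
  - by have := aux (kap - u) (v - u) (v - u); lra.
  - by have := aux (kap - m) (kap - v) (u - v); lra.
  - by have := aux (kap - v) (kap - v) (u - v); lra.
  - by rewrite subrr mul0r oppr_le0 sqr_ge0.
have cvm : cv = m.
  case: cvP => [[]//|[/andP[h _] _]|[h _]]; exfalso; move: h vn i0 Nk; clear; lra.
rewrite cvm; have h1 : v * (cu / m - 1) <= v * ln (cu / m).
  rewrite ler_wnM2l ?(ltW vn)//; apply: ln_le_sub1; exact: divr_gt0.
have [um|um] := leP u m.
  have -> : cu = m by rewrite cuE (max_idPr um) (min_idPl Nk).
  rewrite mulfV ?gt_eqF// ln1 mulr0 add0r subrr -opprD oppr_le0 addr_ge0// mulr_ge0 ?sqr_ge0// invr_ge0 ltW//.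
have cuu : cu <= u by case: cuP => [[h ->]|[_ ->]|[h ->]]//; move: um h; clear; lra.
have Wu : W = u - v by rewrite /W distrC gtr0_norm//; move: vn um i0; clear; lra.
have h2 : v * (cu / m - 1) + m - cu = - ((cu - m) * (m - v) * N).
  rewrite /m invrK; field; exact: lt0r_neq0.
have h3 : (cu - m) * (m - v) <= W ^+ 2.
  rewrite expr2; apply: ler_pM; rewrite ?subr_ge0//; first by move: vn i0; clear; lra.
    by rewrite Wu; move: cuu vn i0; clear; lra.
  by rewrite Wu; move: um; clear; lra.
have h4 : (cu - m) * (m - v) * N <= W ^+ 2 * N by rewrite ler_wpM2r// ltW.
have h5 : W ^+ 2 * N <= N ^+ 2 * W ^+ 3.
  have -> : N ^+ 2 * W ^+ 3 = W ^+ 2 * N * (N * W) by ring.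
  rewrite ler_peMr ?mulr_ge0 ?exprn_ge0 ?(ltW N0)//.
  by rewrite -ler_pdivrMl// mulr1 Wu -/m; move: um vn; clear; lra.
have h6 : 0 <= cu^-1 * (v - u) ^+ 2 by rewrite mulr_ge0 ?sqr_ge0// invr_ge0 ltW.
move: h1 h2 h4 h5 h6; clear; set a := v * ln _; lra.
Qed.

Lemma measurable_lclamp N kap : measurable_fun setT (lclamp N kap).
Proof.
by apply: measurable_minr; [apply: measurable_maxr => //|]; exact: measurable_cst.
Qed.

Lemma measurable_inv_lclamp N kap : measurable_fun setT (fun x => (lclamp N kap x)^-1).
Proof. apply: measurableT_comp; [exact: measurable_inv|exact: measurable_lclamp]. Qed.

Lemma measurable_llog N kap : measurable_fun setT (llog N kap).
Proof.
apply: measurableT_comp; first exact: measurable_ln.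
by apply: measurable_funM; [exact: measurable_cst|exact: measurable_inv_lclamp].
Qed.

Lemma measurable_ltest N kap : measurable_fun setT (ltest N kap).
Proof.
apply: measurable_funB; last exact: measurable_cst.
apply: measurable_funD; last exact: measurable_lclamp.
by apply: measurable_funM => //; exact: measurable_llog.
Qed.

(** Where x < kap, the lower bound on la x + mu y forces y >= 2 kap, so the [be] term is at most a
    multiple of [llog]. For small x half of the [al] term outweighs both this and the reciprocal of
    the clamp; elsewhere all terms are bounded. *)
Lemma log_drift (al be la mu eta kap : R) : 0 < al -> 0 < la -> 0 < mu -> 0 < eta ->
  kap = eta / (2 * (la + mu)) -> exists2 D : R, 0 <= D & forall N x y, 0 < N -> N^-1 <= kap ->
  eta <= la * x + mu * y ->
  al / 2 * (phi N x * llog N kap x) - D <=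
  llog N kap x * (al * phi N x + be * phi N y) - (lclamp N kap x)^-1.
Proof.
move=> al0 la0 mu0 e0 kE; have lm0 : 0 < la + mu by rewrite addr_gt0.
have k0 : 0 < kap by rewrite kE divr_gt0// mulr_gt0.
have eE : eta = 2 * kap * (la + mu) by rewrite kE; field; rewrite gt_eqF.
(* For t = kap / [lclamp N kap x] above t0, ln t >= 4 / al absorbs the reciprocal of the clamp and
   al t / 4 >= |be| / 2 absorbs the [be] term. *)
pose t0 := expR (4 / al) + 2 * `|be| / al.
have b0 : 0 <= 2 * `|be| / al by rewrite divr_ge0 ?mulr_ge0// ltW.
have t00 : 0 < t0 by rewrite /t0; have := expR_gt0 (4 / al); move: b0; clear; lra.
have ik0 : 0 < kap^-1 by rewrite invr_gt0.
pose D := kap^-1 + t0 * (1 + `|be|) / kap.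
have D1 : 0 <= t0 * (1 + `|be|) / kap by rewrite divr_ge0 ?mulr_ge0 ?addr_ge0// ltW.
exists D; first by rewrite /D addr_ge0// ltW.
move=> N x y N0 Nk Zxy; have i0 : 0 < N^-1 by rewrite invr_gt0.
have [xk|xk] := leP kap x.
  have e : lclamp N kap x = kap by rewrite /lclamp min_r// le_max xk.
  rewrite /llog e mulfV ?gt_eqF// ln1 !mulr0 mul0r !sub0r /D lerN2 lerDl//.
have yk : 2 * kap <= y.
  rewrite -(ler_pM2l mu0); move: Zxy; rewrite eE.
  have : la * x <= la * kap by rewrite ler_wpM2l ?ltW.
  have : 0 <= la * kap by rewrite mulr_ge0 ?ltW.
  by clear; lra.
have /andP[c1 c2] := lclamp_bd N kap x N0 Nk; have L0 := llog_ge0 N kap x N0 Nk.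
have c0 := lt_le_trans i0 c1.
have phE : phi N x = (lclamp N kap x)^-1 by rewrite /phi /lclamp min_l// ge_max (ltW xk) Nk.
have y0 : 0 < 2 * kap by rewrite mulr_gt0.
have phy : phi N y <= (2 * kap)^-1.
  apply: le_trans (phi_le_inv _ _ _ N0 (lt_le_trans y0 yk)) _.
  by rewrite lef_pV2 ?posrE//; exact: lt_le_trans yk.
have phy0 := phi_gt0 R N y N0.
rewrite phE; set c := lclamp N kap x in c0 c1 c2 *; set L := llog N kap x in L0 *.
have hb : - (`|be| * (2 * kap)^-1 * L) <= L * (be * phi N y).
  have : `|L * (be * phi N y)| <= `|be| * (2 * kap)^-1 * L.
    rewrite !normrM (ger0_norm L0) (gtr0_norm phy0) mulrC ler_wpM2r// ler_wpM2l//.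
  by rewrite ler_norml => /andP[].
pose t := kap / c; have tt0 : 0 < t by rewrite divr_gt0.
have LE : L = ln t by [].
have cE : c^-1 = t / kap by rewrite /t; field; rewrite !gt_eqF.
have kE2 : (2 * kap)^-1 = kap^-1 / 2 by rewrite invfM mulrC.
have Lt : L <= t by rewrite LE; apply: (le_trans (ln_le_sub1 _ tt0)); clear; lra.
rewrite mulrDr; suff : - D <= al / 2 * (c^-1 * L) - `|be| * (2 * kap)^-1 * L - c^-1.
  by move: hb; clear; set z := L * (be * _); set z' := `|be| * _ * L; set z'' := c^-1; nra.
rewrite cE kE2.
have [tt|tt] := leP t t0.
  have h1 : t / kap * (1 + `|be|) <= t0 * (1 + `|be|) / kap.
    rewrite mulrAC ler_wpM2r ?(ltW ik0)// ler_wpM2r ?addr_ge0//.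
  have h2 : 0 <= al / 2 * (t / kap * L).
    by apply: mulr_ge0; [rewrite divr_ge0// ltW|apply: mulr_ge0 => //; rewrite divr_ge0// ltW].
  have h3 : `|be| * (kap^-1 / 2) * L <= t / kap * `|be|.
    have -> : t / kap * `|be| = `|be| * kap^-1 * t by ring.
    apply: ler_pM => //; rewrite ?mulr_ge0 ?divr_ge0 ?(ltW ik0)//.
    by rewrite ler_wpM2l//; move: ik0; clear; lra.
  rewrite /D; move: h1 h2 h3 ik0; clear; lra.
have La : 4 / al <= L.
  rewrite LE -[leLHS]expRK ler_ln ?posrE ?expR_gt0//; apply: le_trans (ltW tt).
  by rewrite /t0; move: b0; clear; lra.
have h1 : 1 <= al / 4 * L.
  by rewrite -ler_pdivrMl ?divr_gt0// mulr1 invf_div.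
have h2 : `|be| / 2 <= al / 4 * t.
  rewrite -ler_pdivrMl ?divr_gt0// invf_div; apply: le_trans (ltW tt).
  have -> : 4 / al * (`|be| / 2) = 2 * `|be| / al by field; rewrite gt_eqF.
  by rewrite /t0; have := expR_gt0 (4 / al); clear; lra.
have h3 : t / kap <= al / 4 * L * (t / kap) by rewrite ler_peMl// divr_ge0// ltW.
have h4 : `|be| / 2 * (L / kap) <= al / 4 * t * (L / kap) by rewrite ler_wpM2r// divr_ge0// ltW.
have D0 : 0 <= D by rewrite /D addr_ge0// ltW.
have e1 : al / 2 * (t / kap * L) = al / 4 * L * (t / kap) + al / 4 * t * (L / kap) by field; rewrite gt_eqF.
have e2 : `|be| * (kap^-1 / 2) * L = `|be| / 2 * (L / kap) by field; rewrite gt_eqF.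
rewrite e1 e2; move: h3 h4 D0; clear; lra.
Qed.

End log_test.

(** The test function is nonpositive and starts at no less than - kap, so its stopped mean increase
    is at most kap. By [log_drift] this increase exceeds al / 2 times the quantity wanted, up to a
    bounded drift, which gives a bound uniform in k. *)
Lemma log_bound (d : measure_display) (T : measurableType d) (R : realType) (P : probability T R)
    (F : R -> set (set T)) (rho : R) (B C : R -> T -> R) (al be ga de : R) (X0 Y0 : T -> R)
    (la mu eta kap : R) (Tn : nat) :
  usual_filtration P F -> -1 <= rho <= 1 -> corr_BM P F rho B C ->
  sub_meas (F 0) X0 -> sub_meas (F 0) Y0 -> (forall w, 0 <= X0 w) ->
  0 < al -> 0 < la -> 0 < mu -> 0 < eta -> kap = eta / (2 * (la + mu)) ->
  let E := plev al be ga de B C X0 Y0 in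
  exists2 D : R, 0 <= D & exists k0, forall k, (k0 <= k)%N ->
  Ex P (fun w => \sum_(i < Tn * msh k) hlev k * ((goodl la mu eta (E w k) i)%:R
    * (phi (nlev k) (E w k i).1 * llog R (nlev k) kap (E w k i).1))) <= D.
Proof.
move=> uF rho1 BM FX0 FY0 X00 al0 la0 mu0 e0 kE E.
have k0 : 0 < kap by rewrite kE divr_gt0// mulr_gt0// addr_gt0.
have [D0 D00 drift] := log_drift R al be la mu eta kap al0 la0 mu0 e0 kE.
pose c := kap + 2 + al + `|be|.
have nb : 0 <= `|be| by [].
have c0 : 0 <= c by rewrite /c; move: k0 al0 nb; clear; lra.
have [k1 Hk1] := err_small R c 1 c0 ler01.
have [k2 Hk2] := nlev_big R kap^-1.
pose D := (2 / al) * (kap + Tn%:R * (D0 + 1)).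
exists D.
  by rewrite /D mulr_ge0 ?divr_ge0 ?(ltW al0)// addr_ge0 ?(ltW k0)// mulr_ge0// addr_ge0.
exists (maxn k1 k2) => k; rewrite geq_max => /andP[/Hk1 {Hk1} Hk1 /Hk2 {Hk2} Hk2].
have n0 := @nlev_gt0 R k; have n1 := @nlev_ge1 R k; have h0 := @hlev_gt0 R k.
set N : R := nlev k in Hk1 Hk2 n0 n1 *.
have Nk : N^-1 <= kap by rewrite -[leRHS]invrK lef_pV2 ?posrE ?invr_gt0.
have i0 : 0 < N^-1 by rewrite invr_gt0.
have c1 : 1 <= c by rewrite /c; move: k0 al0 nb; clear; lra.
pose X i w := (E w k i).1.
pose xi i w : R := (goodl la mu eta (E w k) i)%:R.
pose f i w := ltest R N kap (X i w).
have aF := F_adapted _ _ _ P F rho B C X0 Y0 uF BM FX0 FY0.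
have GX i : sub_meas (F (i%:R * hlev k)) (X i).
  by have [] := plev_adapted _ _ _ al be ga de B C X0 Y0 F k i aF.
have Gxi i : sub_meas (F (i%:R * hlev k)) (xi i) by exact: goodl_adapted.
have me i g : sub_meas (F (i%:R * hlev k)) g -> measurable_fun setT g.
  by apply: sub_meas_meas; exact: grid_measurable uF k i.
have mX i : measurable_fun setT (X i) by exact: me (GX i).
have mY i : measurable_fun setT (fun w => (E w k i).2).
  by have [] := plev_measurable _ _ _ P F rho B C al be ga de X0 Y0 uF BM FX0 FY0 k i.
have mxi i : measurable_fun setT (xi i) by exact: me (Gxi i).
have mf i : measurable_fun setT (f i).
  by apply: measurableT_comp (mX i); exact: measurable_ltest.
have xi01 i w : 0 <= xi i w <= 1.
  by rewrite /xi; case: (goodl _ _ _ _ _); rewrite ?lexx ?ler01.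
have xiN i w : xi i w != 0 -> xi i w = 1 /\ eta <= la * (E w k i).1 + mu * (E w k i).2.
  rewrite /xi; case: (boolP (goodl _ _ _ _ _)) => [/goodlP g _|]; last by rewrite eqxx.
  by split => //; exact: g.
have pb x : 0 <= phi N x <= N by rewrite phi_le// ltW// phi_gt0.
have icb x : 0 <= (lclamp R N kap x)^-1 <= N.
  have /andP[b1 b2] := lclamp_bd R N kap x n0 Nk; have b0 := lt_le_trans i0 b1.
  by rewrite invr_ge0 ltW//= -[leRHS]invrK lef_pV2 ?posrE.
have lb x : 0 <= llog R N kap x <= c * N.
  rewrite llog_ge0//=; apply: le_trans (llog_le _ _ _ _ n0 Nk) _; rewrite ler_wpM2r ?(ltW n0)//.
  by rewrite /c; move: al0 nb; clear; lra.
pose g i w := al * phi N (X i w) + be * phi N (E w k i).2.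
have gb i w : `|g i w| <= c * N.
  have /andP[p1 p2] := pb (X i w); have /andP[p3 p4] := pb (E w k i).2.
  apply: le_trans (ler_normD _ _) _; rewrite !normrM (gtr0_norm al0) !(ger0_norm p1) !(ger0_norm p3).
  apply: (@le_trans _ _ (al * N + `|be| * N)); first by apply: lerD; apply: ler_wpM2l => //; exact: ltW.
  by rewrite -mulrDl ler_wpM2r ?(ltW n0)// /c; move: k0; clear; lra.
pose dl i w := X i.+1 w - X i w.
have dlE i w : dl i w = (B (i.+1%:R * hlev k) w - B (i%:R * hlev k) w) + hlev k * g i w.
  by rewrite /dl /X /E /plev /lev/= /g /X /E /plev /lev; ring.
have mB t : 0 <= t -> measurable_fun setT (B t).
  by move=> t0; have [_ _ aBC _] := BM; have [b _] := aBC _ t0; case: uF => _ Fm _ _ _; apply: (sub_meas_meas _ _ _ (F t)) => //; exact: Fm.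
have mdl i : measurable_fun setT (dl i) by exact: measurable_funB.
(* Increments of the test function are unbounded; the fourth power of the step provides an
   integrable majorant for them. *)
have i4 i : itg P (fun w => dl i w ^+ 4).
  have s0 := grid_ge0 R k i.
  have iS : i%:R * hlev k <= i.+1%:R * hlev k :> R by rewrite ler_wpM2r ?(ltW h0)// ler_nat.
  have := bm_gauss _ _ _ P F rho B C _ _ 1 0 BM s0 iS.
  set w := (fun _ : T => _) => gw.
  have wE x : w x = B (i.+1%:R * hlev k) x - B (i%:R * hlev k) x by rewrite /w mul1r mul0r addr0.
  have sG := grid_sigma _ _ _ _ _ uF k i.
  have GT : F (i%:R * hlev k) setT by case: sG => g0 gC _; rewrite -(setD0 setT); exact: gC.
  have mw : measurable_fun setT w.
    rewrite (_ : w = fun x => B (i.+1%:R * hlev k) x - B (i%:R * hlev k) x); last exact/funext.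
    by apply: measurable_funB; apply: mB => //; exact: le_trans iS.
  have v0 : 0 <= (i.+1%:R * hlev k - i%:R * hlev k) * (1 ^+ 2 + 2 * rho * 1 * 0 + 0 ^+ 2) :> R.
    by rewrite mulr_ge0 ?subr_ge0// q_ge0.
  have [_ _ w4 _ _] := gauss_moments _ _ _ P _ _ _ (grid_measurable _ _ _ _ _ uF k i) GT mw v0 gw.
  apply: (itg_le _ _ _ _ _ (fun x => 8 * (w x ^+ 4) + 8 * (hlev k * (c * N)) ^+ 4)).
  - rewrite (_ : (fun x => dl i x ^+ 4) = fun x => dl i x * dl i x * (dl i x * dl i x)).
      by apply: measurable_funM; apply: measurable_funM.
    by apply/funext => x; ring.
  - by apply: itgD; [exact: itgZ|exact: itg_cst].
  move=> x; rewrite dlE -wE; set a := w x; set b := hlev k * g i x.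
  have b4 : b ^+ 4 <= (hlev k * (c * N)) ^+ 4.
    rewrite -[b ^+ 4]ger0_norm; last by rewrite (_ : b ^+ 4 = (b ^+ 2) ^+ 2) ?sqr_ge0//; ring.
    rewrite normrX lerXn2r ?nnegrE// ?mulr_ge0 ?(ltW h0) ?(ltW n0)//.
    by rewrite /b normrM (gtr0_norm h0) ler_wpM2l// ltW.
  have ab : (a + b) ^+ 4 <= 8 * a ^+ 4 + 8 * b ^+ 4.
    have e1 : 2 * (a ^+ 2 + b ^+ 2) - (a + b) ^+ 2 = (a - b) ^+ 2 by ring.
    have e2 : (a + b) ^+ 2 <= 2 * (a ^+ 2 + b ^+ 2) by rewrite -subr_ge0 e1 sqr_ge0.
    have e3 : ((a + b) ^+ 2) ^+ 2 <= (2 * (a ^+ 2 + b ^+ 2)) ^+ 2.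
      by rewrite lerXn2r ?nnegrE ?sqr_ge0//; exact: le_trans (sqr_ge0 _) e2.
    have -> : (a + b) ^+ 4 = ((a + b) ^+ 2) ^+ 2 by ring.
    apply: (le_trans e3); rewrite -subr_ge0.
    have -> : 8 * a ^+ 4 + 8 * b ^+ 4 - (2 * (a ^+ 2 + b ^+ 2)) ^+ 2 = (2 * (a ^+ 2 - b ^+ 2)) ^+ 2 by ring.
    exact: sqr_ge0.
  rewrite ger0_norm; last by rewrite (_ : (a + b) ^+ 4 = ((a + b) ^+ 2) ^+ 2) ?sqr_ge0//; ring.
  by apply: (le_trans ab); rewrite lerD2l ler_wpM2l.
have taylor u v : llog R N kap u * (v - u) - (lclamp R N kap u)^-1 * (v - u) ^+ 2 - N ^+ 2 * `|v - u| ^+ 3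
  <= ltest R N kap v - ltest R N kap u by exact: ltest_taylor.
have idf i : itg P (fun w => xi i w * - (f i.+1 w - f i w)).
  apply: (itg_le _ _ _ _ _ (fun w => (c * N + N + N ^+ 2) + (c * N + N + N ^+ 2) * dl i w ^+ 4)).
  - apply: measurable_funM => //; apply: measurableT_comp => //; exact: measurable_funB.
  - by apply: itgD; [exact: itg_cst|exact: itgZ].
  move=> w; set dd := dl i w.
  have d4 : 0 <= dd ^+ 4 by rewrite (_ : dd ^+ 4 = (dd ^+ 2) ^+ 2) ?sqr_ge0//; ring.
  have n4 : dd ^+ 4 = `|dd| ^+ 4.
    by rewrite -normrX ger0_norm.
  set a := `|dd|; have a0 : 0 <= a by exact: normr_ge0.
  have pw j : (j <= 4)%N -> a ^+ j <= 1 + dd ^+ 4.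
    move=> j4; rewrite n4; have [a1|a1] := leP a 1.
      by apply: le_trans (exprn_ile1 _ a0 a1) _; rewrite lerDl exprn_ge0.
    by apply: le_trans (_ : a ^+ 4 <= _); [rewrite ler_weXn2l// ltW|rewrite lerDr].
  have n2 : dd ^+ 2 = a ^+ 2 by rewrite /a -normrX ger0_norm// sqr_ge0.
  have bnd u v : v - u = dd \/ v - u = - dd -> - ((c * N + N + N ^+ 2) * (1 + dd ^+ 4)) <= ltest R N kap v - ltest R N kap u.
    move=> e; apply: le_trans (taylor u v).
    have nn : `|v - u| = a by case: e => ->; rewrite ?normrN.
    have ss : (v - u) ^+ 2 = a ^+ 2 by case: e => ->; rewrite ?sqrrN.
    rewrite nn ss (mulrDl (c * N + N)) (mulrDl (c * N)).
    have /andP[l1 l2] := lb u; have /andP[q1 q2] := icb u.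
    have t1 : - (c * N * (1 + dd ^+ 4)) <= llog R N kap u * (v - u).
      have : `|llog R N kap u * (v - u)| <= c * N * (1 + dd ^+ 4).
        rewrite normrM nn (ger0_norm l1); apply: ler_pM => //; exact: (pw 1%N).
      by rewrite ler_norml => /andP[].
    have t2 : (lclamp R N kap u)^-1 * a ^+ 2 <= N * (1 + dd ^+ 4).
      by apply: ler_pM => //; [exact: exprn_ge0|exact: pw].
    have t3 : N ^+ 2 * a ^+ 3 <= N ^+ 2 * (1 + dd ^+ 4).
      by apply: ler_wpM2l; [rewrite exprn_ge0// ltW|exact: pw].
    move: t1 t2 t3; clear; lra.
  rewrite normrM; have /andP[x0 x1] := xi01 i w; rewrite (ger0_norm x0) normrN.
  apply: (@le_trans _ _ `|f i.+1 w - f i w|); first by rewrite ler_piMl.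
  have := bnd (X i w) (X i.+1 w) (or_introl erefl).
  have := bnd (X i.+1 w) (X i w) _; rewrite -/(f i w) -/(f i.+1 w) => h2 h1.
  have {}h2 := h2 (or_intror (esym (opprB _ _))).
  rewrite ler_norml; move: h1 h2; clear; set K := c * N + N + N ^+ 2; set z := dd ^+ 4.
  by rewrite mulrDr mulr1 => *; apply/andP; split; lra.
have ibd i (r : T -> R) : measurable_fun setT r -> (forall w, `|r w| <= c * N) ->
   itg P (fun w => xi i w * r w).
  move=> mr rK; apply: (itg_bd _ _ _ _ _ (c * N)); first exact: measurable_funM.
  move=> w; rewrite normrM; have /andP[x0 x1] := xi01 i w; rewrite (ger0_norm x0).
  by apply: le_trans (rK w); rewrite ler_piMl.
(* [euler_ito] bounds from above, so it is applied to minus the test function. The factor 2 in [r2]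
   offsets the 1 / 2 of its second-order term. *)
pose r1 i w := - llog R N kap (X i w).
pose r2 i w := 2 * (lclamp R N kap (X i w))^-1.
have Gr1 i : sub_meas (F (i%:R * hlev k)) (r1 i).
  apply: (sub_meas_comp _ _ _ _ _ (fun x => - llog R N kap x)) => //.
  by apply: measurableT_comp => //; exact: measurable_llog.
have Gr2 i : sub_meas (F (i%:R * hlev k)) (r2 i).
  apply: (sub_meas_comp _ _ _ _ _ (fun x => 2 * (lclamp R N kap x)^-1)) => //.
  by apply: measurable_funM; [exact: measurable_cst|exact: measurable_inv_lclamp].
have mr1 i : measurable_fun setT (r1 i) by exact: me (Gr1 i).
have mr2 i : measurable_fun setT (r2 i) by exact: me (Gr2 i).
have mph1 i : measurable_fun setT (fun w => phi N (X i w)).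
  by apply: measurableT_comp (mX i); exact: measurable_phi.
have mph2 i : measurable_fun setT (fun w => phi N (E w k i).2).
  by apply: measurableT_comp (mY i); exact: measurable_phi.
have mg i : measurable_fun setT (g i).
  by apply: measurable_funD; apply: measurable_funM => //; exact: measurable_cst.
pose G i w := xi i w * (phi N (X i w) * llog R N kap (X i w)).
have iG i : itg P (G i).
  apply: (itg_bd _ _ _ _ _ (N * (c * N))).
    apply: measurable_funM => //; apply: measurable_funM => //.
    by apply: measurableT_comp (mX i); exact: measurable_llog.
  move=> w; rewrite normrM; have /andP[x0 x1] := xi01 i w; rewrite (ger0_norm x0).
  have /andP[p1 p2] := pb (X i w); have /andP[l1 l2] := lb (X i w).
  apply: (@le_trans _ _ `|phi N (X i w) * llog R N kap (X i w)|); first by rewrite ler_piMl.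
  by rewrite normrM !ger0_norm//; apply: ler_pM.
have step i : hlev k * Ex P (G i) * (al / 2) <= Ex P (fun w => xi i w * (f i.+1 w - f i w)) + hlev k * (D0 + 1).
  have := euler_ito _ _ _ P F rho B C al be ga de X0 Y0 uF rho1 BM FX0 FY0 k i 1 0 (c * N) (c * N ^+ 2)
    (xi i) (r1 i) (r2 i) (fun w => - (f i.+1 w - f i w)).
  cbv zeta; rewrite -/E -/N.
  rewrite (_ : 1 ^+ 2 + 2 * rho * 1 * 0 + 0 ^+ 2 = 1); last ring.
  rewrite (_ : 1 * al + 0 * ga = al); last ring.
  rewrite (_ : 1 * be + 0 * de = be); last ring.
  move=> /(_ _ _ _ _ _ _ _ _ _ _)/Wrap[].
  - by rewrite mulr_ge0// exprn_ge0// ltW.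
  - rewrite ler_wpM2r ?(ltW n0)// (gtr0_norm al0) /c; move: k0; clear; lra.
  - exact: Gxi.
  - exact: Gr1.
  - exact: Gr2.
  - exact: xi01.
  - by move=> w _; rewrite normrN; have /andP[l1 l2] := lb (X i w); rewrite ger0_norm.
  - move=> w _; rewrite normrM; have /andP[l1 l2] := icb (X i w); rewrite !ger0_norm//.
    apply: ler_pM => //; rewrite /c; move: k0 al0 nb; clear; lra.
  - exact: idf.
  - move=> w; have /andP[x0 _] := xi01 i w; apply: ler_wpM2l => //.
    rewrite mul1r mul0r addr0 -/(X i w) -/(X i.+1 w).
    have := taylor (X i w) (X i.+1 w); rewrite -/(f i w) -/(f i.+1 w).
    have : N ^+ 2 * `|X i.+1 w - X i w| ^+ 3 <= c * N ^+ 2 * `|X i.+1 w - X i w| ^+ 3.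
      by apply: ler_wpM2r; [exact: exprn_ge0|rewrite ler_peMl// exprn_ge0// ltW].
    rewrite /r1 /r2; set z := X i.+1 w - X i w.
    set z3 := _ * `|z| ^+ 3; set z4 := c * _ * `|z| ^+ 3; set z1 := llog _ _ _ _; set z2 := (lclamp _ _ _ _)^-1.
    have -> : 2 * z2 * z ^+ 2 / 2 = z2 * z ^+ 2 by field.
    by set z5 := z2 * _; rewrite mulNr; set z6 := z1 * _; clear; lra.
  rewrite -/(g i).
  have i1 : itg P (fun w => xi i w * (r1 i w * g i w + r2 i w * 1 / 2)).
    apply: (itg_bd _ _ _ _ _ (c * N * (c * N) + N)).
      apply: measurable_funM => //; apply: measurable_funD; first exact: measurable_funM.
      by apply: measurable_funM; [apply: measurable_funM => //|]; exact: measurable_cst.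
    move=> w; rewrite normrM; have /andP[x0 x1] := xi01 i w; rewrite (ger0_norm x0).
    apply: (@le_trans _ _ `|r1 i w * g i w + r2 i w * 1 / 2|); first by rewrite ler_piMl.
    apply: le_trans (ler_normD _ _) _; apply: lerD.
      rewrite normrM; apply: ler_pM => //; rewrite normrN.
      by have /andP[l1 l2] := lb (X i w); rewrite ger0_norm.
    have -> : r2 i w * 1 / 2 = (lclamp R N kap (X i w))^-1 by rewrite /r2; set z := (lclamp _ _ _ _)^-1; field.
    by have /andP[l1 l2] := icb (X i w); rewrite ger0_norm.
  have ixf : itg P (fun w => xi i w * (f i.+1 w - f i w)).
    rewrite (_ : (fun w => _) = fun w => (-1) * (xi i w * - (f i.+1 w - f i w))); first exact: itgZ (idf i).
    by apply/funext => w; rewrite mulN1r mulrN opprK.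
  have -> : Ex P (fun w => xi i w * - (f i.+1 w - f i w)) = - Ex P (fun w => xi i w * (f i.+1 w - f i w)).
    rewrite -[RHS]mulN1r -ExZ//; apply: eq_Ex => w; by rewrite mulN1r mulrN.
  set S := Ex P (fun w => xi i w * (f i.+1 w - f i w)); set Q := Ex P (fun w => xi i w * (r1 i w * _ + _)).
  move=> h.
  have h1 : Ex P (G i) * (al / 2) <= D0 - Q.
    rewrite mulrC -ExZ// -[X in X - Q](Ex_cst _ _ _ P D0) -ExB//; last exact: itg_cst.
    apply: Ex_le; first exact: itgZ.
      by apply: itgB => //; exact: itg_cst.
    move=> w; rewrite /G; have [->|/xiN[-> zw]] := eqVneq (xi i w) 0.
      by rewrite !mul0r mulr0 subr0.
    rewrite !mul1r; have := drift N _ _ n0 Nk zw; rewrite -/(X i w) -/(g i w) /r1 /r2.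
    set z1 := llog _ _ _ _; set z2 := (lclamp _ _ _ _)^-1; have -> : 2 * z2 * 1 / 2 = z2 by field.
    by rewrite mulNr; set z3 := z1 * g i w; set z4 := phi _ _ * _; clear; lra.
  have h2 : hlev k * (Ex P (G i) * (al / 2)) <= hlev k * (D0 - Q) by rewrite ler_wpM2l// ltW.
  rewrite -mulrA; move: h h2 Hk1; clear; set z1 := hlev k * (_ * _); set z2 := ito_err _ _ _ _ _.
  by rewrite mulrBr mulrDr mulr1; lra.
pose I := (Tn * msh k)%N.
(* The weight decreases and f is nonpositive, so stopping can only lower the sum; the initial term
   is at least - kap because X0 is nonnegative. *)
have tele w (J : nat) : \sum_(i < J) xi i w * (f i.+1 w - f i w) <= xi J w * f J w + kap.
  elim: J => [|J IH].
    rewrite big_ord0; have := ltest_ge R N kap (X 0%N w) n0 Nk (X00 w); rewrite -/(f 0%N w) => fk.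
    by have /andP[] := xi01 0%N w; move: fk (ltest_le0 R N kap (X 0%N w) n0 Nk); rewrite -/(f 0%N w); clear; nra.
  rewrite big_ord_recr/=; apply: le_trans (lerD IH (lexx _)) _.
  have : (xi J w - xi J.+1 w) * f J.+1 w <= 0.
    apply: mulr_ge0_le0; last exact: ltest_le0.
    by rewrite subr_ge0 /xi goodlS; case: (goodl _ _ _ _ _); case: (eta <= _); rewrite /= ?lexx ?ler01.
  by clear; lra.
have ixf i : itg P (fun w => xi i w * (f i.+1 w - f i w)).
  rewrite (_ : (fun w => _) = fun w => (-1) * (xi i w * - (f i.+1 w - f i w))); first exact: itgZ (idf i).
  by apply/funext => w; rewrite mulN1r mulrN opprK.
rewrite (Ex_sum _ _ _ P _ _ (fun i : 'I_I => fun w => hlev k * G i w)); last first.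
  by move=> i; apply: itgZ.
rewrite (_ : \sum_(i < I) Ex P (fun w => hlev k * G i w) = (2 / al) * \sum_(i < I) hlev k * Ex P (G i) * (al / 2)); last first.
  rewrite mulr_sumr; apply: eq_bigr => i _; rewrite ExZ//; by field; rewrite gt_eqF.
rewrite /D ler_wpM2l ?divr_ge0 ?(ltW al0)//.
apply: (@le_trans _ _ (\sum_(i < I) (Ex P (fun w => xi i w * (f i.+1 w - f i w)) + hlev k * (D0 + 1)))).
  by apply: ler_sum => i _; exact: step.
rewrite big_split/=; apply: lerD.
  rewrite -(Ex_sum _ _ _ P _ _ (fun i : 'I_I => fun w => xi i w * (f i.+1 w - f i w)))// -[leRHS](Ex_cst _ _ _ P kap).
  apply: Ex_le; [exact: (itg_sum _ _ _ P _ _ (fun i : 'I_I => fun w => xi i w * (f i.+1 w - f i w)))|exact: itg_cst|].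
  move=> w; apply: (le_trans (tele w I)).
  have : xi I w * f I w <= 0 by apply: mulr_ge0_le0; [have /andP[] := xi01 I w|exact: ltest_le0].
  by clear; lra.
by rewrite sumr_const card_ord -[leLHS]mulr_natl mulrA /I natrM -mulrA -(mulrA Tn%:R) [_ * (hlev k * _)]mulrA hlev_msh mul1r.
Qed.

Lemma ltr_indE (R : realType) (x c : R) : (x < c)%R%:R = 1 - (c <= x)%R%:R :> R.
Proof. by have [h|h] := leP c x; rewrite ?subrr// subr0. Qed.

Lemma measurable_ltr_ind (R : realType) (c : R) : measurable_fun setT (fun x : R => (x < c)%R%:R : R).
Proof.
under eq_fun do rewrite ltr_indE.
apply: measurable_funB; first exact: measurable_cst.
rewrite (_ : (fun x : R => _) = \1_(`[c, +oo[%classic)); first exact: measurable_indic.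
apply/funext => x; rewrite indicE; congr (nat_of_bool _)%:R.
by apply/idP/idP; rewrite inE/= in_itv/= andbT.
Qed.

Lemma bm_abs (d : measure_display) (T : measurableType d) (R : realType) (P : probability T R)
    (F : R -> set (set T)) (rho : R) (B C : R -> T -> R) (s t e : R) :
  usual_filtration P F -> corr_BM P F rho B C -> 0 <= s -> s <= t -> 0 < e -> -1 <= rho <= 1 ->
  itg P (fun w => `|B t w - B s w|) /\ Ex P (fun w => `|B t w - B s w|) <= ((t - s) / e + e) / 2.
Proof.
move=> uF BM s0 st e0 rho1; have [sF Fm _ _ _] := uF; have [_ _ aBC _] := BM.
have gw := bm_gauss _ _ _ P F rho B C _ _ 1 0 BM s0 st.
set w := (fun _ : T => _) in gw.
have wE x : w x = B t x - B s x by rewrite /w mul1r mul0r addr0.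
have t0 := le_trans s0 st.
have mB r : 0 <= r -> measurable_fun setT (B r).
  by move=> r0; have [b _] := aBC _ r0; apply: (sub_meas_meas _ _ _ (F r)) => //; exact: Fm.
have mw : measurable_fun setT w.
  rewrite (_ : w = fun x => B t x - B s x); last exact/funext.
  by apply: measurable_funB; exact: mB.
have GT : F s setT by case: (sF _ s0) => g0 gC _; rewrite -(setD0 setT); exact: gC.
have v0 : 0 <= (t - s) * (1 ^+ 2 + 2 * rho * 1 * 0 + 0 ^+ 2).
  by rewrite mulr_ge0 ?subr_ge0// q_ge0.
have [i1 i2 _ _ H] := gauss_moments _ _ _ P _ _ _ (Fm _ s0) GT mw v0 gw.
have [_ E2] := H (fun=> 1) 1 (sub_meas_cst _ _ _ _ 1 (sF _ s0)) (fun x => eq_ind_r (fun z => z <= 1) (lexx 1) (normr1 R)).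
have {}E2 : Ex P (fun x => w x ^+ 2) = t - s.
  rewrite Ex_cst in E2; rewrite (_ : t - s = (t - s) * (1 ^+ 2 + 2 * rho * 1 * 0 + 0 ^+ 2) * 1); last ring.
  by rewrite -E2; apply: eq_Ex => x; rewrite mul1r.
have ia : itg P (fun x => `|B t x - B s x|).
  rewrite (_ : (fun x => _) = fun x => `|w x|); first exact: itg_norm.
  by apply/funext => x; rewrite wE.
split => //.
have -> : ((t - s) / e + e) / 2 = Ex P (fun x => (2 * e)^-1 * w x ^+ 2 + e / 2).
  rewrite ExD; [|exact: itgZ|exact: itg_cst].
  by rewrite Ex_cst ExZ// E2; field; rewrite gt_eqF.
apply: Ex_le => //; first by apply: itgD; [exact: itgZ|exact: itg_cst].
move=> x; rewrite -wE; set a := `|w x|.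
have -> : w x ^+ 2 = a ^+ 2 by rewrite /a -normrX ger0_norm// sqr_ge0.
rewrite -subr_ge0; have -> : (2 * e)^-1 * a ^+ 2 + e / 2 - a = (2 * e)^-1 * (a - e) ^+ 2.
  by field; rewrite gt_eqF.
by rewrite mulr_ge0 ?sqr_ge0// invr_ge0 mulr_ge0// ltW.
Qed.

(** Below 1 / n_k the logarithm of level k + 1 is at least ln (kap n_k) = 2^k ln 2 + ln kap, hence
    at least 2^k / 4 for large k. The growth of the levels turns a logarithmic gain into a geometric
    one. *)
Lemma singular_term (R : realType) (kap : R) : 0 < kap -> exists k0, forall k (x : R), (k0 <= k)%N ->
  phi (nlev k.+1) x * (x < (nlev k)^-1)%R%:R <=
  4 * 2^-1 ^+ k * (phi (nlev k.+1) x * llog R (nlev k.+1) kap x).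
Proof.
move=> kap0; have [k1 Hk1] := nlev_big R (kap^-1).
pose k2 := Num.Def.truncn (4 / kap).
exists (maxn k1 k2.+1) => k x; rewrite geq_max => /andP[/Hk1 {Hk1} Hk1 kk2].
have n0 := @nlev_gt0 R k; have n0' := @nlev_gt0 R k.+1; have nn := @nlev_le R k.
have i0 : 0 < (nlev k)^-1 :> R by rewrite invr_gt0.
have Nk : (nlev k)^-1 <= kap :> R by rewrite -[leRHS]invrK lef_pV2 ?posrE ?invr_gt0.
have ni : (nlev k.+1)^-1 <= (nlev k)^-1 :> R by rewrite lef_pV2 ?posrE.
have Nk' := le_trans ni Nk.
have p0 := phi_gt0 R (nlev k.+1) x n0'; have l0 := llog_ge0 R (nlev k.+1) kap x n0' Nk'.
have g0 : 0 <= 4 * 2^-1 ^+ k :> R by rewrite mulr_ge0// exprn_ge0// invr_ge0.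
have [xk|xk] := ltP x (nlev k)^-1; last by rewrite mulr0 mulr_ge0// mulr_ge0// ltW.
rewrite mulr1 mulrCA ler_peMr ?(ltW p0)//.
have lg : 2 ^+ k / 4 <= llog R (nlev k.+1) kap x.
  have c1 : lclamp R (nlev k.+1) kap x <= (nlev k)^-1.
    by rewrite /lclamp ge_min ge_max (ltW xk) ni.
  have /andP[c2 _] := lclamp_bd R (nlev k.+1) kap x n0' Nk'.
  have c0 : 0 < lclamp R (nlev k.+1) kap x by apply: lt_le_trans c2; rewrite invr_gt0.
  apply: (@le_trans _ _ (ln (kap * nlev k))); last first.
    rewrite /llog ler_ln ?posrE ?mulr_gt0 ?invr_gt0// ler_wpM2l ?(ltW kap0)//.
    by rewrite -[leLHS]invrK lef_pV2 ?posrE.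
  rewrite lnM ?posrE// /nlev natrX lnXn// -[ln _ *+ _]mulr_natl natrX.
  have l2 : 1 / 2 <= ln 2 :> R by have := ln_ge_inv R 2 (ltr0n _ 2); clear; lra.
  have lk : 1 - kap^-1 <= ln kap by exact: ln_ge_inv.
  have k4 : kap^-1 <= 2 ^+ k / 4 :> R.
    rewrite ler_pdivlMr// mulrC; apply: (@le_trans _ _ k%:R).
      by apply: le_trans (ltW (truncnS_gt _)) _; rewrite ler_nat.
    by rewrite -natrX ler_nat ltnW// ltn_expl.
  have : 2 ^+ k * (1 / 2) <= 2 ^+ k * ln 2 :> R by rewrite ler_wpM2l// exprn_ge0.
  move: lk k4; clear; set z := 2 ^+ k; set z1 := z * ln 2; set z2 := ln kap; lra.
have h : 4 * 2^-1 ^+ k * (2 ^+ k / 4) <= 4 * 2^-1 ^+ k * llog R (nlev k.+1) kap x by rewrite ler_wpM2l.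
apply: le_trans h; rewrite exprVn le_eqVlt; apply/orP; left; apply/eqP; field.
by rewrite gt_eqF// exprn_gt0.
Qed.

Lemma singular_bound (d : measure_display) (T : measurableType d) (R : realType) (P : probability T R)
    (F : R -> set (set T)) (rho : R) (B C : R -> T -> R) (al be ga de : R) (X0 Y0 : T -> R)
    (la mu eta : R) (Tn : nat) :
  usual_filtration P F -> -1 <= rho <= 1 -> corr_BM P F rho B C ->
  sub_meas (F 0) X0 -> sub_meas (F 0) Y0 -> (forall w, 0 <= X0 w) ->
  0 < al -> 0 < la -> 0 < mu -> 0 < eta ->
  let E := plev al be ga de B C X0 Y0 in
  let S k i w : R := (goodl la mu eta (E w k.+1) i)%:R
    * (phi (nlev k.+1) (E w k.+1 i).1 * ((E w k.+1 i).1 < (nlev k)^-1)%R%:R) in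
  (forall k i, itg P (S k i)) /\
  exists2 D : R, 0 <= D & exists k0, forall k, (k0 <= k)%N ->
  Ex P (fun w => \sum_(i < Tn * msh k.+1) hlev k.+1 * S k i w) <= D * 2^-1 ^+ k.
Proof.
move=> uF rho1 BM FX0 FY0 X00 al0 la0 mu0 e0 E S.
set kap := eta / (2 * (la + mu)).
have kap0 : 0 < kap by rewrite divr_gt0// mulr_gt0// addr_gt0.
have aF := F_adapted _ _ _ P F rho B C X0 Y0 uF BM FX0 FY0.
have me k i g : sub_meas (F (i%:R * hlev k)) g -> measurable_fun setT g.
  by apply: sub_meas_meas; exact: grid_measurable uF k i.
have mX k i : measurable_fun setT (fun w => (E w k i).1).
  by have [] := plev_measurable _ _ _ P F rho B C al be ga de X0 Y0 uF BM FX0 FY0 k i.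
have mg k i : measurable_fun setT (fun w => (goodl la mu eta (E w k) i)%:R : R).
  exact: me (goodl_adapted _ _ _ al be ga de B C X0 Y0 F la mu eta k i aF).
have g01 k i w : `|(goodl la mu eta (E w k) i)%:R : R| <= 1.
  by case: (goodl _ _ _ _ _); rewrite ?normr1 ?normr0.
have pN k x : `|phi (nlev k) x| <= nlev k :> R.
  by rewrite gtr0_norm ?phi_gt0 ?nlev_gt0// phi_le// nlev_gt0.
have mphi k i : measurable_fun setT (fun w => phi (nlev k) (E w k i).1).
  by apply: measurableT_comp (mX k i); exact: measurable_phi.
have iS k i : itg P (S k i).
  apply: (itgM _ _ _ _ _ _ 1) => //; apply: (itgM _ _ _ _ _ _ (nlev k.+1)) => //.
  apply: (itg_bd _ _ _ _ _ 1).
    by apply: (measurableT_comp (measurable_ltr_ind R (nlev k)^-1)); exact: mX.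
  by move=> w; case: (_ < _); rewrite ?normr1 ?normr0.
split => //.
have [D D0 [k1 Hk1]] := log_bound _ _ _ P F rho B C al be ga de X0 Y0 la mu eta kap Tn uF rho1 BM FX0 FY0
  X00 al0 la0 mu0 e0 erefl.
have [k2 Hk2] := singular_term R kap kap0.
have [k3 Hk3] := nlev_big R kap^-1.
exists (4 * D); first by rewrite mulr_ge0.
exists (maxn k1 (maxn k2 k3)) => k; rewrite !geq_max => /and3P[kk1 kk2 kk3].
have {}Hk1 := Hk1 _ (leqW kk1); rewrite -/E in Hk1; have {}Hk3 := Hk3 _ (leqW kk3).
have n0 := @nlev_gt0 R k.+1; have h0 := @hlev_gt0 R k.+1.
have Nk : (nlev k.+1)^-1 <= kap by rewrite -[leRHS]invrK lef_pV2 ?posrE ?invr_gt0.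
set G := (fun w => \sum_(i < _) _) in Hk1.
have iG : itg P G.
  apply: itg_sum => i; apply: itgZ; apply: (itgM _ _ _ _ _ _ 1) => //.
  apply: (itgM _ _ _ _ _ _ (nlev k.+1)) => //.
  apply: (itg_bd _ _ _ _ _ (kap * nlev k.+1)).
    by apply: (measurableT_comp (measurable_llog R _ _)); exact: mX.
  by move=> w; rewrite ger0_norm ?llog_ge0// llog_le.
have g0 : 0 <= 4 * 2^-1 ^+ k :> R by rewrite mulr_ge0// exprn_ge0// invr_ge0.
apply: (@le_trans _ _ (4 * 2^-1 ^+ k * Ex P G)); last first.
  by rewrite [leRHS](_ : _ = 4 * 2^-1 ^+ k * D); [rewrite ler_wpM2l|ring].
rewrite -ExZ//; apply: Ex_le; [|exact: itgZ|].
  by apply: itg_sum => i; apply: itgZ.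
move=> w; rewrite /G mulr_sumr; apply: ler_sum => i _; rewrite [leRHS]mulrCA ler_wpM2l ?(ltW h0)//.
rewrite /S [leRHS]mulrCA ler_wpM2l//; exact: Hk2.
Qed.

(** The singular part comes from [singular_bound], applied also with exchanged coordinates. The
    freezing part is n_k^2 times increments of mean size at most n_k^-4 and a drift of order n_k^-7,
    so it is O(1 / n_k). *)
Lemma ErrW_expect (d : measure_display) (T : measurableType d) (R : realType) (P : probability T R)
    (F : R -> set (set T)) (rho : R) (B C : R -> T -> R) (al be ga de : R) (X0 Y0 : T -> R)
    (la mu eta : R) (Tn : nat) :
  usual_filtration P F -> -1 <= rho <= 1 -> corr_BM P F rho B C ->
  sub_meas (F 0) X0 -> sub_meas (F 0) Y0 -> (forall w, 0 <= X0 w /\ 0 <= Y0 w) ->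
  0 < al -> 0 < de -> 0 < la -> 0 < mu -> 0 < eta ->
  let Er k w := ErrW al be ga de la mu eta (B ^~ w) (C ^~ w) (X0 w) (Y0 w) Tn k in
  (forall k, itg P (Er k)) /\
  exists2 D : R, 0 <= D & exists k0, forall k, (k0 <= k)%N -> Ex P (Er k) <= D * 2^-1 ^+ k.
Proof.
move=> uF rho1 BM FX0 FY0 XY0 al0 de0 la0 mu0 e0 Er.
have [iS1 [D1 D10 [k1 Hk1]]] := singular_bound _ _ _ P F rho B C al be ga de X0 Y0 la mu eta Tn uF rho1 BM FX0 FY0
  (fun w => proj1 (XY0 w)) al0 la0 mu0 e0.
have BM' := corr_BM_swap _ _ _ _ _ _ _ _ BM.
have [iS2 [D2 D20 [k2 Hk2]]] := singular_bound _ _ _ P F rho C B de ga be al Y0 X0 mu la eta Tn uF rho1 BM' FY0 FX0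
  (fun w => proj2 (XY0 w)) de0 mu0 la0 e0.
set E := plev al be ga de B C X0 Y0.
have sw w k i : plev de ga be al C B Y0 X0 w k i = ((E w k i).2, (E w k i).1).
  exact: euler_swap.
have gsw w k i : goodl mu la eta (plev de ga be al C B Y0 X0 w k) i = goodl la mu eta (E w k) i.
  apply/goodlP/goodlP => H j /H; by rewrite sw/= addrC.
pose S1 k i w : R := (goodl la mu eta (E w k.+1) i)%:R
    * (phi (nlev k.+1) (E w k.+1 i).1 * ((E w k.+1 i).1 < (nlev k)^-1)%R%:R).
pose S2 k i w : R := (goodl la mu eta (E w k.+1) i)%:R
    * (phi (nlev k.+1) (E w k.+1 i).2 * ((E w k.+1 i).2 < (nlev k)^-1)%R%:R).
have {}iS2 k i : itg P (S2 k i).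
  rewrite (_ : S2 k i = fun w => (goodl mu la eta (plev de ga be al C B Y0 X0 w k.+1) i)%:R
    * (phi (nlev k.+1) (plev de ga be al C B Y0 X0 w k.+1 i).1 * ((plev de ga be al C B Y0 X0 w k.+1 i).1 < (nlev k)^-1)%R%:R)); first exact: iS2.
  by apply/funext => w; rewrite gsw sw.
have {}iS1 k i : itg P (S1 k i) by exact: iS1.
have {}Hk2 k : (k2 <= k)%N -> Ex P (fun w => \sum_(i < Tn * msh k.+1) hlev k.+1 * S2 k i w) <= D2 * 2^-1 ^+ k.
  move=> /Hk2; rewrite (@eq_Ex _ _ _ P _ (fun w => \sum_(i < Tn * msh k.+1) hlev k.+1 * S2 k i w))//.
  by move=> w; apply: eq_bigr => i _; rewrite gsw sw.
have {}Hk1 k : (k1 <= k)%N -> Ex P (fun w => \sum_(i < Tn * msh k.+1) hlev k.+1 * S1 k i w) <= D1 * 2^-1 ^+ k.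
  by move=> /Hk1.
set Ka := coefK al be ga de; have Ka0 : 0 <= Ka by rewrite /Ka /coefK !addr_ge0.
pose eB k i w := errB Ka (nlev k) (hlev k.+1) (msh k) (B ^~ w) (C ^~ w) i.
have eBH k i : itg P (eB k i) /\ Ex P (eB k i) <= 2 * (1 + Ka) * 2^-1 ^+ k.
  have n0 := @nlev_gt0 R k; have n1 := @nlev_ge1 R k; have h0 := @hlev_gt0 R k; have h0' := @hlev_gt0 R k.+1.
  set s : R := (i %/ msh k)%:R * ((msh k)%:R * hlev k.+1); set t : R := i%:R * hlev k.+1.
  have s0 : 0 <= s by rewrite !mulr_ge0// ltW.
  have st : s <= t by rewrite /s mulrA -natrM ler_wpM2r ?(ltW h0')// ler_nat leq_divM.
  have ts : t - s <= hlev k.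
    rewrite /t /s mulrA -natrM -mulrBl -natrB ?leq_divM// -(hlevS R k) ler_wpM2r ?(ltW h0')// ler_nat.
    by rewrite leq_subLR addnC -mulSn ltnW// ltn_ceil// msh_gt0.
  have [ib Eb] := bm_abs _ _ _ P F rho B C s t (slev k) uF BM s0 st (slev_gt0 _ _) rho1.
  have [ic Ec] := bm_abs _ _ _ P F rho C B s t (slev k) uF BM' s0 st (slev_gt0 _ _) rho1.
  have sl : ((t - s) / slev k + slev k) / 2 <= slev k.
    have h : (t - s) / slev k <= slev k.
      by rewrite ler_pdivrMr ?slev_gt0// -expr2 slev2.
    by move: h; clear; lra.
  have i1 : itg P (fun w => `|B t w - B s w| + `|C t w - C s w|) by exact: itgD.
  have i2 : itg P (fun w => `|B t w - B s w| + `|C t w - C s w| + 2 * ((msh k)%:R * hlev k.+1 * (Ka * nlev k))).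
    by apply: itgD => //; exact: itg_cst.
  split; first exact: itgZ.
  rewrite /eB /errB ExZ// ExD//; last exact: itg_cst.
  rewrite Ex_cst ExD// hlevS.
  have h1 := le_trans Eb sl; have h2 := le_trans Ec sl.
  apply: (@le_trans _ _ (nlev k ^+ 2 * (slev k + slev k + 2 * (hlev k * (Ka * nlev k))))).
    by apply: ler_wpM2l; [rewrite exprn_ge0// ltW|rewrite lerD2r; move: h1 h2; rewrite /s hlevS => h1 h2; apply: lerD; [exact: h1|exact: h2]].
  apply: (@le_trans _ _ (2 * (1 + Ka) * (nlev k)^-1)); last first.
    by rewrite ler_wpM2l ?nlev_inv_geo// mulr_ge0// addr_ge0.
  have hp := @hlev_pow R k 3 isT.
  have sp : nlev k ^+ 2 * slev k <= (nlev k)^-1 :> R.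
    rewrite /slev ler_pdivrMr ?exprn_gt0//.
    have -> : nlev k ^+ 4 = nlev k * nlev k ^+ 3 :> R by rewrite -exprS.
    by rewrite mulKf ?gt_eqF// ler_weXn2l.
  have hp' : Ka * (hlev k * nlev k ^+ 3) <= Ka * (nlev k)^-1 by rewrite ler_wpM2l.
  rewrite (_ : nlev k ^+ 2 * (slev k + slev k + 2 * (hlev k * (Ka * nlev k))) =
     2 * (nlev k ^+ 2 * slev k) + 2 * (Ka * (hlev k * nlev k ^+ 3))); last ring.
  by move: hp' sp; clear; lra.
have ErE k w : Er k w = \sum_(i < Tn * msh k.+1) hlev k.+1 * eB k i w
    + (\sum_(i < Tn * msh k.+1) hlev k.+1 * S1 k i w + \sum_(i < Tn * msh k.+1) hlev k.+1 * S2 k i w).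
  rewrite -!big_split/=; apply: eq_bigr => i _; rewrite -!mulrDr; congr (_ * (_ + _)).
have i1 k : itg P (fun w => \sum_(i < Tn * msh k.+1) hlev k.+1 * eB k i w).
  apply: (itg_sum _ _ _ P _ _ (fun i : 'I_(Tn * msh k.+1) => fun w => hlev k.+1 * eB k i w)) => i.
  by apply: itgZ; have [] := eBH k i.
have i2 k : itg P (fun w => \sum_(i < Tn * msh k.+1) hlev k.+1 * S1 k i w).
  by apply: (itg_sum _ _ _ P _ _ (fun i : 'I_(Tn * msh k.+1) => fun w => hlev k.+1 * S1 k i w)) => i; exact: itgZ.
have i3 k : itg P (fun w => \sum_(i < Tn * msh k.+1) hlev k.+1 * S2 k i w).
  by apply: (itg_sum _ _ _ P _ _ (fun i : 'I_(Tn * msh k.+1) => fun w => hlev k.+1 * S2 k i w)) => i; exact: itgZ.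
have EE k : Er k = fun w => \sum_(i < Tn * msh k.+1) hlev k.+1 * eB k i w
    + (\sum_(i < Tn * msh k.+1) hlev k.+1 * S1 k i w + \sum_(i < Tn * msh k.+1) hlev k.+1 * S2 k i w).
  by apply/funext => w; exact: ErE.
split; first by move=> k; rewrite EE; apply: itgD => //; exact: itgD.
exists (Tn%:R * (2 * (1 + Ka)) + (D1 + D2)); first by rewrite !addr_ge0// !mulr_ge0// addr_ge0.
exists (maxn k1 k2) => k; rewrite geq_max => /andP[kk1 kk2].
rewrite EE ExD//; last exact: itgD.
rewrite ExD// [leRHS]mulrDl (mulrDl D1); apply: lerD; last by apply: lerD; [exact: Hk1|exact: Hk2].
rewrite (Ex_sum _ _ _ P _ _ (fun i : 'I_(Tn * msh k.+1) => fun w => hlev k.+1 * eB k i w)); last first.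
  by move=> i; apply: itgZ; have [] := eBH k i.
apply: (@le_trans _ _ (\sum_(i < Tn * msh k.+1) hlev k.+1 * (2 * (1 + Ka) * 2^-1 ^+ k))).
  apply: ler_sum => i _; have [ie Ee] := eBH k i; rewrite ExZ// ler_wpM2l// ltW// hlev_gt0//.
by rewrite sumr_const card_ord -[leLHS]mulr_natl mulrA natrM -mulrA -(mulrA Tn%:R) [_ * (hlev k.+1 * _)]mulrA hlev_msh mul1r mulrA.
Qed.

(** * Almost sure behaviour *)

Section almost_surely.
Context (d : measure_display) (T : measurableType d) (R : realType) (P : probability T R).

(** Summable expectations make the sum of the series integrable, hence almost surely finite, and its
    tails tend to 0. *)
Lemma ae_tail (f : nat -> T -> R) (D : R) (k0 : nat) :
  (forall k, itg P (f k)) -> (forall k w, 0 <= f k w) -> 0 <= D ->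
  (forall k, (k0 <= k)%N -> Ex P (f k) <= D * 2^-1 ^+ k) ->
  {ae P, forall w, forall e : R, 0 < e -> exists k1, forall n, \sum_(k1 <= k < n) f k w <= e}.
Proof.
move=> fi f0 D0 fD.
pose u k w := (f (k + k0)%N w)%:E.
pose S w := (\sum_(k <oo) u k w)%E.
have mf k : measurable_fun setT (f k) by apply: itg_meas; exact: fi.
have mu_ k : measurable_fun setT (u k) by exact/measurable_EFinP.
have u0 k w : (0 <= u k w)%E by rewrite lee_fin.
have mS : measurable_fun setT S by apply: ge0_emeasurable_sum => // k x _ _; exact: u0.
have S0 w : (0 <= S w)%E by apply: nneseries_ge0.
have iS : P.-integrable setT S.
  apply/integrableP; split => //.
  have -> : (\int[P]_w `|S w| = \int[P]_w S w)%E.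
    by apply: eq_integral => x _; rewrite gee0_abs.
  rewrite integral_nneseries//.
  apply: (@le_lt_trans _ _ (D * 2)%:E); last exact: ltry.
  apply: lime_le; first by apply: is_cvg_nneseries => *; exact: integral_ge0.
  apply: nearW => n; rewrite (eq_bigr (fun k => (Ex P (f (k + k0)%N))%:E)); last by move=> k _; rewrite Ex_EFin.
  rewrite sumEFin lee_fin.
  apply: (@le_trans _ _ (\sum_(0 <= k < n) D * 2^-1 ^+ k)).
    apply: ler_sum => k _; apply: le_trans (fD _ (leq_addl _ _)) _; rewrite ler_wpM2l//.
    by apply: ler_wiXn2l; [rewrite invr_ge0|rewrite invf_le1// ler1n|exact: leq_addr].
  rewrite -mulr_sumr ler_wpM2l//; have := sum_geo_le R 0 n; by rewrite expr0 mulr1.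
apply: (ae_imp _ _ _ _ _ _ (@integrable_ae _ _ _ P setT measurableT S iS)) => w /(_ I) fin e e0.
have Sx : S w = (fine (S w))%:E by rewrite fineK.
pose a n := \sum_(0 <= k < n) f (k + k0)%N w.
have part n : a n <= fine (S w).
  rewrite -lee_fin -Sx -sumEFin; apply: nneseries_lim_ge => k _ _; exact: u0.
have nd : nondecreasing_seq a.
  move=> n n' nn'; rewrite /a (@big_cat_nat _ _ _ n 0%N n')//= lerDl; exact: sumr_ge0.
have cv : cvgn a.
  by apply: nondecreasing_is_cvgn => //; exists (fine (S w)) => _ [n _ <-]; exact: part.
have le n : a n <= limn a by exact: nondecreasing_cvgn_le.
move/cvgrPdist_lt: cv => /(_ e e0)[n1 _ Hn1].
have {Hn1}n1e : limn a - a n1 < e.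
  have := Hn1 n1 (leqnn _); rewrite ger0_norm// subr_ge0//; exact: le.
exists (n1 + k0)%N => n.
have [nn|nn] := leqP n (n1 + k0); first by rewrite big_geq// ltW.
have nE : n = (n - k0 + k0)%N by rewrite subnK//; apply: leq_trans (ltnW nn); exact: leq_addl.
have -> : \sum_(n1 + k0 <= k < n) f k w = a (n - k0)%N - a n1.
  rewrite nE big_addn addnK /a (@big_cat_nat _ _ _ n1 0%N (n - k0)) //=; last by rewrite leq_subRL; [rewrite addnC ltnW|apply: leq_trans (ltnW nn); exact: leq_addl].
  by rewrite [RHS]addrC addKr.
by apply: ltW; apply: le_lt_trans n1e; rewrite lerD2r; exact: le.
Qed.

(** Lying in [A j k] for all large k has probability at most c j, by continuity from below; so doing
    this for every j is a null event. *)
Lemma io_ae (A : nat -> nat -> set T) (c : nat -> R) :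
  (forall j k, measurable (A j k)) ->
  (forall j, exists k0, forall k, (k0 <= k)%N -> (P (A j k) <= (c j)%:E)%E) ->
  (forall e : R, 0 < e -> exists j, c j <= e) ->
  {ae P, forall w, exists j, forall k0, exists2 k, (k0 <= k)%N & ~ A j k w}.
Proof.
move=> mA HA Hc.
pose M j n := \bigcap_(k in [set k | (n <= k)%N]) A j k.
have mM j n : measurable (M j n) by apply: bigcap_measurableType => k _; exact: mA.
have mU j : measurable (\bigcup_n M j n) by exact: bigcupT_measurable.
pose S := \bigcap_j (\bigcup_n M j n).
have mS : measurable S by exact: bigcapT_measurable.
have PU j : (P (\bigcup_n M j n) <= (c j)%:E)%E.
  have nd : nondecreasing_seq (M j).
    apply/nondecreasing_seqP => n; apply/subsetPset => w H k /= nk; apply: H => /=; exact: ltnW.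
  have cv := nondecreasing_cvg_mu (mu := P) (mM j) (mU j) nd.
  have -> : P (\bigcup_n M j n) = limn (P \o M j) by apply/esym/cvg_lim.
  apply: lime_le; first by apply/cvg_ex; exists (P (\bigcup_n M j n)).
  apply: nearW => n; have [k0 Hk0] := HA j.
  apply: le_trans (Hk0 (maxn k0 n) (leq_maxl _ _)).
  by apply: le_measure; rewrite ?inE//; move=> w; apply => /=; exact: leq_maxr.
have PS : P S = 0%E.
  apply/eqP; rewrite eq_le measure_ge0 andbT; apply/lee_addgt0Pr => e e0; rewrite add0e.
  have [j Hj] := Hc e e0.
  apply: (@le_trans _ _ (P (\bigcup_n M j n))).
    by apply: le_measure; rewrite ?inE//; move=> w; apply.
  by apply: le_trans (PU j) _; rewrite lee_fin.
exists S; split => // w /= H j _; apply: contrapT => nj.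
apply: H; exists j => k0; apply: contrapT => nk; apply: nj; exists k0 => // k /= kk.
by apply: contrapT => nA; apply: nk; exists k.
Qed.

End almost_surely.

(** All that the deterministic part asks of a path. The threshold eta may depend on path and
    horizon; the errors are taken at eta / 2 because that is the threshold left after the descent in
    [levels_summable]. *)
Definition good_path {R : realType} (al be ga de la mu : R) (b c : R -> R) (x0 y0 : R) : Prop :=
  forall Tn : nat, exists2 eta : R, 0 < eta &
    (forall k0, exists2 k, (k0 <= k)%N & goodl la mu eta (lev al be ga de b c x0 y0 k) (Tn * msh k)) /\
    (forall e : R, 0 < e -> exists k0, forall n,
       \sum_(k0 <= k < n) ErrW al be ga de la mu (eta / 2) b c x0 y0 Tn k <= e).

(** Thresholds run through reciprocals of integers, so only countably many null sets occur. The
    bound of [corner_hit] tends to 0 with eta because [Vf] is unbounded at 0, and [io_ae] converts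
    it into infinitely many good levels. *)
Lemma good_path_ae (d : measure_display) (T : measurableType d) (R : realType) (P : probability T R)
    (F : R -> set (set T)) (rho : R) (B C : R -> T -> R) (al be ga de : R) (X0 Y0 : T -> R)
    (la mu : R) :
  usual_filtration P F -> -1 <= rho <= 1 -> corr_BM P F rho B C ->
  sub_meas (F 0) X0 -> sub_meas (F 0) Y0 -> (forall w, 0 <= X0 w /\ 0 <= Y0 w) ->
  P [set w | X0 w = 0 /\ Y0 w = 0] = 0%E ->
  0 < al -> 0 < de -> corner_cond rho al be ga de la mu ->
  {ae P, forall w, good_path al be ga de la mu (B ^~ w) (C ^~ w) (X0 w) (Y0 w)}.
Proof.
move=> uF rho1 BM FX0 FY0 XY0 P0 al0 de0 cc; have [la0 mu0 _ _ _] := cc.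
set E := plev al be ga de B C X0 Y0.
pose q := la ^+ 2 + 2 * rho * la * mu + mu ^+ 2.
have q0 : 0 <= q by exact: q_ge0.
have Fm : F 0 `<=` measurable by case: uF => _ Fm _ _ _; exact: Fm.
have mX0 : measurable_fun setT X0 by exact: sub_meas_meas FX0.
have mY0 : measurable_fun setT Y0 by exact: sub_meas_meas FY0.
have e0 (n : nat) : 0 < n.+1%:R^-1 :> R by rewrite invr_gt0 ltr0n.
have zpos : {ae P, forall w, ~ (X0 w = 0 /\ Y0 w = 0)}.
  exists [set w | X0 w = 0 /\ Y0 w = 0]; split => //.
    rewrite (_ : [set w | _] = (X0 @^-1` [set 0]) `&` (Y0 @^-1` [set 0]))//.
    by apply: measurableI; rewrite -[X in measurable X]setTI; [apply: mX0|apply: mY0].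
  by move=> w /= /contrapT.
have tails : {ae P, forall w, forall Tn j (e : R), 0 < e -> exists k0, forall n,
     \sum_(k0 <= k < n) ErrW al be ga de la mu (j.+1%:R^-1 / 2) (B ^~ w) (C ^~ w) (X0 w) (Y0 w) Tn k <= e}.
  apply: ae_foralln => Tn; apply: ae_foralln => j.
  have [iE [D D0 [k0 HD]]] := ErrW_expect _ _ _ P F rho B C al be ga de X0 Y0 la mu (j.+1%:R^-1 / 2) Tn
     uF rho1 BM FX0 FY0 XY0 al0 de0 la0 mu0 (divr_gt0 (e0 j) (ltr0n _ 2)).
  exact: (ae_tail _ _ _ P _ D k0 iE (fun k w => ErrW_ge0 _ _ _ _ _ _ _ _ _ _ _ _ _ _) D0 HD).
(* The shift by i keeps the threshold below 1 / (i + 1), the lower bound of the start, so the scheme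
   is good at time 0. *)
pose et (i j : nat) : R := (j + i).+1%:R^-1.
have hits : {ae P, forall w, forall Tn i, exists j, forall k0, exists2 k, (k0 <= k)%N &
    ~ (1 <= hitw al be ga de B C X0 Y0 la mu i.+1%:R^-1 (et i j) k 0 w
       - hitw al be ga de B C X0 Y0 la mu i.+1%:R^-1 (et i j) k (Tn * msh k) w)}.
  apply: ae_foralln => Tn; apply: ae_foralln => i.
  set D := fun j k w => hitw al be ga de B C X0 Y0 la mu i.+1%:R^-1 (et i j) k 0 w
       - hitw al be ga de B C X0 Y0 la mu i.+1%:R^-1 (et i j) k (Tn * msh k) w.
  have mh j k l : measurable_fun setT (hitw al be ga de B C X0 Y0 la mu i.+1%:R^-1 (et i j) k l).
    apply: (sub_meas_meas _ _ _ (F (l%:R * hlev k))); first exact: grid_measurable uF k l.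
    exact: (hitw_adapted _ _ _ P F rho).
  have mD j k : measurable_fun setT (D j k) by exact: measurable_funB.
  have hle j k l w : hitw al be ga de B C X0 Y0 la mu i.+1%:R^-1 (et i j) k l w
      <= hitw al be ga de B C X0 Y0 la mu i.+1%:R^-1 (et i j) k 0 w.
    by elim: l => // l; apply: le_trans; exact: hitw_le.
  have D01 j k w : 0 <= D j k w <= 1.
    have := hle j k (Tn * msh k)%N w.
    have /andP[_] := hitw01 _ _ _ al be ga de B C X0 Y0 la mu i.+1%:R^-1 (et i j) k 0 w.
    have /andP[] := hitw01 _ _ _ al be ga de B C X0 Y0 la mu i.+1%:R^-1 (et i j) k (Tn * msh k) w.
    by rewrite /D; clear; lra.
  apply: (io_ae _ _ _ P (fun j k => [set w | 1 <= D j k w])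
    (fun j => (Vf R i.+1%:R^-1 + Tn%:R * (q + 1)) / Vf R (et i j))).
  - move=> j k; have := mD j k measurableT `[1, +oo[%classic (measurable_itv _).
    rewrite setTI (_ : _ @^-1` _ = [set w | 1 <= D j k w])//.
    by apply/seteqP; split => w /=; rewrite in_itv/= andbT.
  - move=> j; have et1 : et i j <= 1 by rewrite /et invf_le1 ?ler1n.
    have [k0 Hk0] := corner_hit _ _ _ P F rho B C al be ga de X0 Y0 la mu i.+1%:R^-1 (et i j) Tn
      uF rho1 BM FX0 FY0 cc (e0 i) (e0 _) et1.
    exists k0 => k /Hk0; rewrite -/(D j k) -/q => h.
    have mA : measurable [set w | 1 <= D j k w].
      have := mD j k measurableT `[1, +oo[%classic (measurable_itv _).
      rewrite setTI (_ : _ @^-1` _ = [set w | 1 <= D j k w])//.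
      by apply/seteqP; split => w /=; rewrite in_itv/= andbT.
    have i1 : itg P (\1_([set w | 1 <= D j k w])).
      apply: (itg_bd _ _ _ _ _ 1); first exact: measurable_indic.
      by move=> w; rewrite indicE; case: (w \in _); rewrite ?normr1 ?normr0.
    have -> : P [set w | 1 <= D j k w] = (Ex P (\1_([set w | 1 <= D j k w]) : T -> R))%:E.
      by rewrite -Ex_EFin// integral_indic ?setIT.
    rewrite lee_fin; apply: le_trans h; apply: Ex_le => //.
      by apply: (itg_bd _ _ _ _ _ 1) => // w; have /andP[h1 h2] := D01 j k w; rewrite ger0_norm.
    move=> w; rewrite indicE; case: (boolP (w \in _)); first by rewrite inE.
    by move=> _; have /andP[] := D01 j k w.
  - move=> e e1; pose K := (Vf R i.+1%:R^-1 + Tn%:R * (q + 1)) / e.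
    have K0 : 0 <= K by rewrite divr_ge0 ?(ltW e1)// addr_ge0 ?Vf_ge0// mulr_ge0// addr_ge0.
    (* From [Vf z >= - ln z]: once j + i + 1 exceeds exp K, the bound is at most e. *)
    exists (Num.truncn (expR K)); set j := Num.truncn _.
    have ej : 0 < et i j by exact: e0.
    rewrite ler_pdivrMr ?Vf_gt0// [leRHS]mulrC -ler_pdivrMr// -/K.
    apply: le_trans (Vf_big _ _ ej); rewrite /et lnV ?posrE ?ltr0n// opprK.
    rewrite -[leLHS]expRK ler_ln ?posrE ?expR_gt0 ?ltr0n//.
    apply: le_trans (ltW (truncnS_gt _)) _; by rewrite -/j ler_nat ltnS leq_addr.
apply: (@filterS3 _ _ (ae_filter_ringOfSetsType P) _ _ _ _ _ zpos tails hits) => w z t h Tn.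
have [x0 y0] := XY0 w.
have zw : 0 < la * X0 w + mu * Y0 w.
  rewrite lt_def addr_ge0 ?mulr_ge0 ?(ltW la0) ?(ltW mu0)// andbT.
  apply/negP => /eqP e; apply: z.
  have p1 : 0 <= la * X0 w by rewrite mulr_ge0 ?(ltW la0).
  have p2 : 0 <= mu * Y0 w by rewrite mulr_ge0 ?(ltW mu0).
  have z1 : la * X0 w = 0 by apply/eqP; rewrite eq_le p1 andbT; move: e p2; clear; lra.
  have z2 : mu * Y0 w = 0 by apply/eqP; rewrite eq_le p2 andbT; move: e p1; clear; lra.
  split; apply/eqP; [move/eqP: z1|move/eqP: z2]; rewrite mulf_eq0 gt_eqF//.
pose i := Num.truncn (la * X0 w + mu * Y0 w)^-1.
have iz : i.+1%:R^-1 <= la * X0 w + mu * Y0 w.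
  by rewrite -[leRHS]invrK lef_pV2 ?posrE ?invr_gt0 ?ltr0n// ltW// truncnS_gt.
have [j Hj] := h Tn i; exists (et i j); first exact: e0.
split; last by move=> e; exact: t.
move=> k0; have [k kk nh] := Hj k0; exists k => //.
apply: contrapT => ng; apply: nh; rewrite /hitw iz !mul1r.
rewrite (_ : goodl la mu (et i j) (E w k) (Tn * msh k) = false); last exact/negP.
rewrite (_ : goodl la mu (et i j) (E w k) 0 = true) ?subr0//.
apply/goodlP => l; rewrite leqn0 => /eqP ->.
by apply: le_trans iz; rewrite lef_pV2 ?posrE ?ltr0n// ler_nat ltnS leq_addl.
Qed.

Section good_path_limit.
Variable R : realType.
Local Notation hcont f := ({within `[0, +oo[%classic, continuous (f : R -> R)}).

Lemma hlev_small (r : R) : 0 < r -> exists k0, forall k, (k0 <= k)%N -> hlev k < r.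
Proof.
move=> r0; have [k0 Hk0] := nlev_big R (2 / r); exists k0 => k /Hk0 h.
have := @hlev_pow R k 0 isT; rewrite expr0 mulr1 => /le_lt_trans; apply.
rewrite -[ltRHS]invrK ltf_pV2 ?posrE ?invr_gt0 ?nlev_gt0//; apply: lt_le_trans h.
by rewrite -[ltLHS]mul1r ltr_pM2r ?invr_gt0// ltr1n.
Qed.

(** The limit is independent of the horizon, so the results on each [0, Tn] fit together. The corner
    is excluded since at all large levels la X + mu Y >= eta / 2 on the grid. *)
Lemma good_path_limit (al be ga de la mu : R) (b c : R -> R) (x0 y0 : R) :
  0 < al -> 0 < de -> 0 <= be \/ 0 <= ga -> 0 < la -> 0 < mu ->
  hcont b -> hcont c -> b 0 = 0 -> c 0 = 0 ->
  good_path al be ga de la mu b c x0 y0 ->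
  let E := lev al be ga de b c x0 y0 in
  let X t := limn (app1 E b ^~ t) in let Y t := limn (app2 E c ^~ t) in
  [/\ (forall t, 0 <= t -> app1 E b k t @[k --> \oo] --> X t /\ app2 E c k t @[k --> \oo] --> Y t),
      (forall t, 0 <= t -> 0 <= X t /\ 0 <= Y t),
      (hcont X /\ hcont Y) /\ (X 0 = x0 /\ Y 0 = y0),
      path_sol R al be ga de b c X Y &
      forall t, 0 <= t -> ~ (X t = 0 /\ Y t = 0)].
Proof.
move=> al0 de0 bega la0 mu0 cb cc b0 c0 gp E X Y.
have mb (Tn : nat) : modulus Tn%:R b by exact: within_modulus.
have mc (Tn : nat) : modulus Tn%:R c by exact: within_modulus.
have X0E : X 0 = x0.
  rewrite /X (_ : (app1 E b ^~ 0) = fun=> x0); first exact: lim_cst.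
  by apply/funext => k; rewrite /app1 mul0r truncn0 mul0r subrr addr0.
have Y0E : Y 0 = y0.
  rewrite /Y (_ : (app2 E c ^~ 0) = fun=> y0); first exact: lim_cst.
  by apply/funext => k; rewrite /app2 mul0r truncn0 mul0r subrr addr0.
have key (Tn : nat) : (0 < Tn)%N ->
   [/\ (forall t, 0 <= t <= Tn%:R -> app1 E b k t @[k --> \oo] --> X t /\ app2 E c k t @[k --> \oo] --> Y t),
    (forall t, 0 <= t <= Tn%:R -> 0 <= X t /\ 0 <= Y t),
    modulus Tn%:R X /\ modulus Tn%:R Y,
    (forall t, 0 <= t <= Tn%:R ->
      [/\ (@lebesgue_measure R) (`[0, t]%classic `&` [set s | X s = 0]) = 0%E,
        (@lebesgue_measure R) (`[0, t]%classic `&` [set s | Y s = 0]) = 0%E,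
        (inv_int X t < +oo)%E /\ (inv_int Y t < +oo)%E,
        X t = x0 + (b t - b 0) + al * fine (inv_int X t) + be * fine (inv_int Y t) &
        Y t = y0 + (c t - c 0) + ga * fine (inv_int X t) + de * fine (inv_int Y t)]) &
    forall t, 0 <= t <= Tn%:R -> ~ (X t = 0 /\ Y t = 0)].
  move=> T0; have [eta e0 [inf tail]] := gp Tn.
  have [K [K0 [k1 Hk1]]] := @levels_summable R al be ga de la mu eta b c x0 y0 Tn
    al0 de0 bega la0 mu0 e0 (mb Tn) (mc Tn) inf tail.
  rewrite -/E in Hk1.
  have [k2 Hk2] := tail 1 ltr01.
  have HM n : \sum_(maxn k1 k2 <= k < n) \sum_(i < Tn * msh k.+1) hlev k.+1 * dphi (E k) (E k.+1) k i <= K.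
    apply: (@le_trans _ _ (\sum_(maxn k1 k2 <= k < n) K * ErrW al be ga de la mu (eta / 2) b c x0 y0 Tn k)).
      rewrite big_nat_cond [leRHS]big_nat_cond; apply: ler_sum => k /andP[/andP[kk _] _].
      by have [] := Hk1 k (leq_trans (leq_maxl _ _) kk).
    rewrite -mulr_sumr -[leRHS]mulr1 ler_wpM2l//.
    have [nn|nn] := leqP (maxn k1 k2) n; last by rewrite big_geq// ltnW.
    apply: le_trans (Hk2 n); rewrite (@big_cat_nat _ _ _ (maxn k1 k2) k2 n)//= ?leq_maxr//.
    by rewrite lerDr; apply: sumr_ge0 => k _; exact: ErrW_ge0.
  have [p1 p2 p3 p4] := path_limit R al be ga de b c x0 y0 K Tn (maxn k1 k2) T0 (mb Tn) (mc Tn) HM.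
  split => // t tT [Xt Yt]; have [/andP[t0 tT']] := (tT, tT) => _.
  have [cX cY] := p1 t tT; move: cX cY; rewrite -/(X t) -/(Y t) Xt Yt.
  (* Both coordinates below 4 e would give la X + mu Y < eta / 2. *)
  pose e := eta / (8 * (la + mu)).
  have lm0 : 0 < la + mu by rewrite addr_gt0.
  have ee0 : 0 < e by rewrite divr_gt0// mulr_gt0.
  move=> /cvgrPdist_lt/(_ e ee0)[n1 _ H1] /cvgrPdist_lt/(_ e ee0)[n2 _ H2].
  have [r1 r10 Hr1] := mb Tn e ee0; have [r2 r20 Hr2] := mc Tn e ee0.
  have [m1 Hm1] := hlev_small r1 r10; have [m2 Hm2] := hlev_small r2 r20.
  pose k := maxn (maxn n1 n2) (maxn (maxn m1 m2) k1).
  have kn1 : (n1 <= k)%N by rewrite /k !leq_max leqnn.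
  have kn2 : (n2 <= k)%N by rewrite /k !leq_max leqnn !orbT.
  have km1 : (m1 <= k)%N by rewrite /k !leq_max leqnn !orbT.
  have km2 : (m2 <= k)%N by rewrite /k !leq_max leqnn !orbT.
  have kk1 : (k1 <= k)%N by rewrite /k !leq_max leqnn !orbT.
  have := H1 k kn1; have := H2 k kn2; rewrite !sub0r !normrN.
  have [g _] := Hk1 k kk1.
  have [/andP[s0 st] ts] := @grid_dist R k t t0.
  rewrite /app1 /app2; set i := Num.truncn (t * (msh k)%:R) in s0 st ts *.
  have iT : (i <= Tn * msh k)%N.
    rewrite -(ler_nat R) natrM; have m0 : 0 <= (msh k)%:R :> R by [].
    apply: (@le_trans _ _ (t * (msh k)%:R)); last by rewrite ler_wpM2r.
    by rewrite truncn_le// mulr_ge0.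
  move/goodlP: g => /(_ i iT).
  have B1 := Hr1 _ _ s0 st tT' (le_lt_trans ts (Hm1 k km1)).
  have C1 := Hr2 _ _ s0 st tT' (le_lt_trans ts (Hm2 k km2)).
  move: B1 C1; set bb := b t - _; set cd := c t - _; set x := (E k i).1; set y := (E k i).2.
  rewrite !ltr_norml => /andP[_ B1] /andP[_ C1] Z /andP[_ h2] /andP[_ h1].
  have eE : eta / 2 = la * (4 * e) + mu * (4 * e) by rewrite /e; field; rewrite gt_eqF.
  have k1' : la * (4 * e - x) <= la * (4 * e) - la * x by rewrite mulrBr.
  have bb1 : - bb < e by move: (Hr1 _ _ s0 st tT' (le_lt_trans ts (Hm1 k km1))); rewrite ltr_norml -/bb => /andP[]; clear; lra.
  have cd1 : - cd < e by move: (Hr2 _ _ s0 st tT' (le_lt_trans ts (Hm2 k km2))); rewrite ltr_norml -/cd => /andP[]; clear; lra.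
  have x2 : x < 4 * e by move: h1 bb1 ee0; clear; lra.
  have y2 : y < 4 * e by move: h2 cd1 ee0; clear; lra.
  have l1 : la * x < la * (4 * e) by rewrite ltr_pM2l.
  have l2 : mu * y < mu * (4 * e) by rewrite ltr_pM2l.
  by move: Z l1 l2; rewrite eE; clear; lra.
pose up (t : R) := (Num.truncn t).+1.
have upT (t : R) : 0 <= t -> 0 <= t <= (up t)%:R by move=> t0; rewrite t0 ltW// truncnS_gt.
split.
- by move=> t t0; have [h _ _ _ _] := key (up t) isT; exact: h (upT t t0).
- by move=> t t0; have [_ h _ _ _] := key (up t) isT; exact: h (upT t t0).
- split => //; split; apply: modulus_within => -[|Tn].
  + have [_ _ [h _] _ _] := key 1%N isT; move=> e e0; have [r r0 H] := h e e0; exists r => // s t s0 st t0.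
    by apply: H => //; exact: le_trans t0 _.
  + by have [_ _ [h _] _ _] := key Tn.+1 isT.
  + have [_ _ [_ h] _ _] := key 1%N isT; move=> e e0; have [r r0 H] := h e e0; exists r => // s t s0 st t0.
    by apply: H => //; exact: le_trans t0 _.
  + by have [_ _ [_ h] _ _] := key Tn.+1 isT.
- move=> t t0; have [_ _ _ h _] := key (up t) isT; have [h1 h2 h3 h4 h5] := h t (upT t t0).
  by split => //; [rewrite {1}h4 X0E b0 subr0|rewrite {1}h5 Y0E c0 subr0].
- by move=> t t0; have [_ _ _ _ h] := key (up t) isT; exact: h (upT t t0).
Qed.

End good_path_limit.

Section filtrations.
Context (d : measure_display) (T : measurableType d) (R : realType) (P : probability T R).
Variables (B C : R -> T -> R) (X0 Y0 : T -> R).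

(** H contains all negligible sets, hence the complement of G and each part of it, so redefining a
    function there cannot be seen by H. *)
Lemma sub_meas_modif (H : set (set T)) (G : set T) (f g : T -> R) :
  sigma_algebra setT H -> (forall M, P.-negligible M -> H M) -> P.-negligible (~` G) ->
  sub_meas H f -> sub_meas H (fun w => if pselect (G w) then f w else g w).
Proof.
move=> sH HN NG Hf A mA.
have hE D : @measurable _ (g_sigma_algebraType H) D = H D by rewrite /measurable/= smallest_id.
rewrite -hE.
rewrite (_ : _ @^-1` A = (f @^-1` A `\` ~` G) `|` (~` G `&` (g @^-1` A))).
  apply: measurableU; last by rewrite hE; apply: HN; apply: negligibleS NG => w [].
  by apply: measurableD; rewrite hE; [exact: Hf|exact: HN].
apply/seteqP; split => w /=; case: pselect => Gw.
- by move=> h; left; split => //; exact.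
- by move=> h; right.
- by case => [[]//|[]//].
- by case => [[_ /(_ Gw)]//|[]//].
Qed.

Lemma strong_adapted : adapted_data _ _ _ B C X0 Y0 (strong_filtration P X0 Y0 B C).
Proof.
split.
- by move=> t _; exact: smallest_sigma_algebra.
- move=> s t s0 st; apply: smallest_sub; first exact: smallest_sigma_algebra.
  move=> A; case => [[D [mD H]]|H]; last by apply: sub_sigma_algebra; right.
  apply: sub_sigma_algebra; left; exists D; split => //.
  case: H => [->|[->|[r [/andP[r0 rs] H]]]]; [by left|by right; left|right; right].
  by exists r; rewrite r0 (le_trans rs st).
- by split => A mA; apply: sub_sigma_algebra; left; exists A; split => //; [left|right; left].
- move=> t t0; split => A mA; apply: sub_sigma_algebra; left; exists A; split => //; right; right;
    exists t; rewrite t0 lexx; split => //; [left|right]; exact: erefl.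
Qed.

Lemma strong_negligible t N : P.-negligible N -> strong_filtration P X0 Y0 B C t N.
Proof. by move=> nN; apply: sub_sigma_algebra; right. Qed.

End filtrations.

Theorem mainTheorem9 (d : measure_display) (T : measurableType d) (R : realType)
  (P : probability T R) (F : R -> set (set T)) (rho : R) (B C : R -> T -> R)
  (alpha beta gamma delta : R) :
  complete_space P -> usual_filtration P F ->
  -1 <= rho <= 1 -> corr_BM P F rho B C ->
  0 < alpha -> 0 < delta ->
  beta * gamma < 0 ->
  cond_C2a alpha beta \/ cond_C3 rho alpha beta gamma delta ->
  forall X0 Y0 : T -> R,
    sub_meas (F 0) X0 -> sub_meas (F 0) Y0 ->
    (forall w, 0 <= X0 w /\ 0 <= Y0 w) ->
    P [set w | X0 w = 0 /\ Y0 w = 0] = 0%E ->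
  (exists X Y : R -> T -> R,
     [/\ O2BP P F B C alpha beta gamma delta X Y,
         (forall w, X 0 w = X0 w /\ Y 0 w = Y0 w),
         (forall t : R, 0 <= t ->
            sub_meas (strong_filtration P X0 Y0 B C t) (X t) /\
            sub_meas (strong_filtration P X0 Y0 B C t) (Y t)),
         {ae P, forall w, forall t : R, 0 <= t -> ~ (X t w = 0 /\ Y t w = 0)}
       & forall X' Y' : R -> T -> R,
           O2BP P F B C alpha beta gamma delta X' Y' ->
           (forall w, X' 0 w = X0 w /\ Y' 0 w = Y0 w) ->
           {ae P, forall w, forall t : R, 0 <= t ->
              X t w = X' t w /\ Y t w = Y' t w}]).
Proof.
move=> _ uF rho1 BM al0 de0 bega cond X0 Y0 FX0 FY0 XY0 P0.
have [la [mu cc]] := corner_cond_ex R rho alpha beta gamma delta rho1 al0 de0 bega cond.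
have [la0 mu0 _ _ _] := cc.
have bg : 0 <= beta \/ 0 <= gamma.
  have [b0|b0] := leP 0 beta; first by left.
  right; rewrite leNgt; apply/negP => g0; move: bega; rewrite ltNge => /negP; apply.
  by rewrite mulr_le0// ltW.
pose gp w := good_path alpha beta gamma delta la mu (B ^~ w) (C ^~ w) (X0 w) (Y0 w).
have gp_ae : {ae P, forall w, gp w} by exact: (good_path_ae _ _ _ P F rho).
have gpN : P.-negligible (~` [set w | gp w]) by exact: gp_ae.
pose E w := plev alpha beta gamma delta B C X0 Y0 w.
(* Off the good set the paths stay at their initial value, so continuity, nonnegativity and the
   initial condition hold for every w. *)
pose X t w := if pselect (gp w) then limn (app1 (E w) (B ^~ w) ^~ t) else X0 w.
pose Y t w := if pselect (gp w) then limn (app2 (E w) (C ^~ w) ^~ t) else Y0 w.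
have [BC0 cBC aBC _] := BM.
have lim w : gp w -> _ := good_path_limit R alpha beta gamma delta la mu (B ^~ w) (C ^~ w) (X0 w) (Y0 w)
  al0 de0 bg la0 mu0 (proj1 (cBC w)) (proj2 (cBC w)) (proj1 (BC0 w)) (proj2 (BC0 w)).
(* H is used below both for [F] and for the filtration generated by the data, which yields the
   strong solution from the same limit. *)
have adap H t : 0 <= t -> adapted_data _ _ _ B C X0 Y0 H -> (forall M, P.-negligible M -> H t M) ->
    sub_meas (H t) (X t) /\ sub_meas (H t) (Y t).
  move=> t0 aH HN; have [sH _ _ _] := aH; have sHt := sH t t0; split.
  - apply: (sub_meas_cvg _ _ _ _ (fun k w => if pselect (gp w) then app1 (E w) (B ^~ w) k t else X0 w)) => //.
      move=> k; apply: (sub_meas_modif _ _ _ P (H t) [set w | gp w]) => //.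
      by have [] := app_adapted _ _ _ alpha beta gamma delta B C X0 Y0 H k t t0 aH.
    move=> w; rewrite /X; case: pselect => gw; last exact: cvg_cst.
    by have [h _ _ _ _] := lim w gw; have [] := h t t0.
  - apply: (sub_meas_cvg _ _ _ _ (fun k w => if pselect (gp w) then app2 (E w) (C ^~ w) k t else Y0 w)) => //.
      move=> k; apply: (sub_meas_modif _ _ _ P (H t) [set w | gp w]) => //.
      by have [] := app_adapted _ _ _ alpha beta gamma delta B C X0 Y0 H k t t0 aH.
    move=> w; rewrite /Y; case: pselect => gw; last exact: cvg_cst.
    by have [h _ _ _ _] := lim w gw; have [] := h t t0.
have XE w : gp w -> X ^~ w = fun t => limn (app1 (E w) (B ^~ w) ^~ t).
  by move=> gw; apply/funext => t; rewrite /X; case: pselect.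
have YE w : gp w -> Y ^~ w = fun t => limn (app2 (E w) (C ^~ w) ^~ t).
  by move=> gw; apply/funext => t; rewrite /Y; case: pselect.
have XY00 w : X 0 w = X0 w /\ Y 0 w = Y0 w.
  rewrite /X /Y; case: pselect => gw //.
  by have [_ _ [_ [h1 h2]] _ _] := lim w gw.
have pos t w : 0 <= t -> 0 <= X t w /\ 0 <= Y t w.
  move=> t0; rewrite /X /Y; case: pselect => gw; last exact: XY0.
  by have [_ h _ _ _] := lim w gw; exact: h.
have cont w : {within `[0, +oo[%classic, continuous (fun t => X t w)} /\
              {within `[0, +oo[%classic, continuous (fun t => Y t w)}.
  have [gw|gw] := pselect (gp w).
    by have [_ _ [h _] _ _] := lim w gw; rewrite XE// YE.
  have -> : (fun t => X t w) = fun=> X0 w by apply/funext => t; rewrite /X; case: pselect.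
  have -> : (fun t => Y t w) = fun=> Y0 w by apply/funext => t; rewrite /Y; case: pselect.
  by split; apply: continuous_subspaceT => x; exact: cvg_cst.
have sol w : gp w -> path_sol R alpha beta gamma delta (B ^~ w) (C ^~ w) (X ^~ w) (Y ^~ w).
  by move=> gw; have [_ _ _ h _] := lim w gw; rewrite XE// YE.
have nz w : gp w -> forall t, 0 <= t -> ~ (X t w = 0 /\ Y t w = 0).
  move=> gw t t0; have [_ _ _ _ h] := lim w gw; have := h t t0.
  by rewrite /X /Y; case: pselect.
exists X, Y; split => //.
- split => //.
    move=> t t0; apply: adap => //; first exact: F_adapted uF BM FX0 FY0.
    move=> M NM; case: uF => _ _ mF _ F0; apply: (mF 0 t) => //; exact: F0.
  by apply: (ae_imp _ _ _ _ _ _ gp_ae) => w /sol.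
- move=> t t0; apply: (adap (strong_filtration P X0 Y0 B C)) => //; first exact: strong_adapted.
  exact: strong_negligible.
- by apply: (ae_imp _ _ _ _ _ _ gp_ae) => w /nz.
- move=> X' Y' [pos' cont' _ sol'] XY'0.
  apply: (@filterS2 _ _ (ae_filter_ringOfSetsType P) _ _ _ _ gp_ae sol') => w gw s'.
  have [c1 c2] := cont w; have [c1' c2'] := cont' w.
  have [e1 e2] := XY00 w; have [e1' e2'] := XY'0 w.
  apply: (path_uniq R alpha beta gamma delta (B ^~ w) (C ^~ w) (X ^~ w) (Y ^~ w) (X' ^~ w) (Y' ^~ w)) => //.
  + by move=> s s0; have [] := pos s w s0.
  + by move=> s s0; have [] := pos s w s0.
  + by move=> s s0; have [] := pos' s w s0.
  + by move=> s s0; have [] := pos' s w s0.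
  + exact: sol.
  + by rewrite e1 e1'.
  + by rewrite e2 e2'.
  + exact: nz.
Qed.
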